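(* Let $k\ge2$ be an integer. With $q=e^{-s}$, as $s\to0^+$, $$g_k(q)\sim\frac{2}{k+1}\sqrt{\frac{2\pi}{s}}\;e^{-\frac{\pi^2}{3k(k+1)s}+\frac{s}{24}}\;\mathrm{Re}\left(\phi\left(\frac{k}{k+1},1;\frac{(k+1)^{\frac{k}{k+1}}}{k}\,e^{\frac{\pi i k}{k+1}}\,s^{-\frac{1}{k+1}}\right)\right).$$
   Context: Definition of $g_k$. Let $0<s<1$, $q:=e^{-s}$, and let $\mathcal{C}_1,\mathcal{C}_2,\ldots$ be independent events with $\mathbf{P}_s(\mathcal{C}_n)=1-e^{-ns}$ under a probability measure $\mathbf{P}_s$. Let $$A_k:=\bigcap_{j=1}^\infty\left(\mathcal{C}_j\cup\mathcal{C}_{j+1}\cup\cdots\cup\mathcal{C}_{j+k-1}\right)$$ be the event that there is no sequence of $k$ consecutive $\mathcal{C}_j$ that do not occur, and set $g_k(q):=\mathbf{P}_s(A_k)$. Wright function: for $\rho<1$ and $\beta\in\mathbb{C}$, $$\phi(\rho,\beta;z):=\sum_{n=0}^\infty\frac{z^n}{n!\,\Gamma(\beta-\rho n)},$$ where $1/\Gamma$ is the entire reciprocal Gamma function (equal to $0$ at non-positive integers). The notation $F\sim G$ means $F/G\to1$. *)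

(* Defs.v *)
From HB Require Import structures.
From mathcomp Require Import all_boot all_order all_algebra.
From mathcomp Require Import all_classical all_reals all_analysis.
From mathcomp Require Import complex.
Set Implicit Arguments.
Unset Strict Implicit.
Unset Printing Implicit Defensive.
Import Order.TTheory GRing.Theory Num.Theory.
Import numFieldNormedType.Exports.
Local Open Scope classical_set_scope.
Local Open Scope ring_scope.
Local Open Scope complex_scope.

(* Mutual independence of the measurable events E n, n \in I: the product rule
   holds for every finite subfamily, listed without repetition by s. *)
Definition independent_events (R : realType) (d : measure_display)
    (T : measurableType d) (P : probability T R) (I : set nat)
    (E : nat -> set T) : Prop :=
  (forall n, I n -> measurable (E n)) /\
  (forall s : seq nat, uniq s -> (forall n, n \in s -> I n) ->
    P (\bigcap_(n in [set` s]) E n) = (\prod_(n <- s) P (E n))%E).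

(* The event A_k.  Events are indexed from 1; E 0 plays no role. *)
Definition no_gap (T : Type) (k : nat) (E : nat -> set T) : set T :=
  \bigcap_(j in [set j | (1 <= j)%N])
    \bigcup_(i in [set i | (j <= i <= j + k - 1)%N]) E i.

Definition cexp (R : realType) (z : R[i]) : R[i] :=
  (expR (complex.Re z))%:C * (cos (complex.Im z) +i* sin (complex.Im z)).

(* The entire function 1/Gamma, by the Euler-Gauss product
     1/Gamma(z) = lim_n z (z + 1) ... (z + n) / (n! n^z),
   valid for every complex z; at z = -m the factor z + m makes the terms with
   n >= m vanish.  Here n^z = exp (z ln n), and R[i]^o
   is R[i] with the topology of the modulus. *)
Definition rGamma (R : realType) (z : R[i]) : R[i] :=
  limn (fun n : nat => (\prod_(0 <= j < n.+1) (z + j%:R)) /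
                 (n`!%:R * cexp (z * (ln n%:R)%:C)) : R[i]^o).

Definition wright (R : realType) (rho : R) (beta z : R[i]) : R[i] :=
  limn (series (fun n : nat =>
    z ^+ n / n`!%:R * rGamma (beta - (rho * n%:R)%:C) : R[i]^o)).

(* F ~ G along the filter L *)
Definition asymp (R : realType) (L : set_system R) (F G : R -> R) : Prop :=
  (F s / G s) @[s --> L] --> (1 : R).

(* Main.v *)
From HB Require Import structures.
From mathcomp Require Import all_boot all_order all_algebra.
From mathcomp Require Import all_classical all_reals all_analysis.
From mathcomp Require Import complex finmap ring lra zify.
Require Import Defs.
Set Implicit Arguments.
Unset Strict Implicit.
Unset Printing Implicit Defensive.
Import Order.TTheory GRing.Theory Num.Theory.
Import numFieldNormedType.Exports.
Local Open Scope classical_set_scope.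
Local Open Scope ring_scope.
Local Open Scope complex_scope.

(* Put p = q^k, p' = q^(k+1), A = k(k+1)s and kap = (p;p)/(p';p') (infinite q-products).
   Conditioning on the first events gives a q-difference equation whose solution is
     g_k(q) = G(0),  G(m) = sum_n c_n e^{-(A/2)(n-m)^2},  sum_n c_n z^n = (-p'z;p')/(-z;p).

   Averaging over the circle |z| = e^{-ks/2}, where (-p'z;p')/(-z;p) is by Jacobi's triple
   product a quotient of theta functions times a slowly varying factor, the dual theta series
   give G(m) = (-1)^m kap^2 E0 (1 + O(X_m)), with X_m of order (s^{-1/(k+1)} e^{-ksm})^{-1/2}.
   At m = 0 this is g_k(q) ~ (1/k) sqrt(2 pi/s) e^{s/24 - pi^2/(3A)}.

   It remains to see that the real part of the Wright function tends to (k+1)/(2k).  Expanding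
   c_n by Euler's identities and dualising the inner theta series turns (-1)^m G(m) into a
   series whose j-th term tends, when m = m(s) keeps c s^{-1/(k+1)} e^{-ksm} close to x and
   s -> 0, to that of 2 Re phi(k/(k+1), 1; x e^{i pi k/(k+1)}).  Comparing the two evaluations
   of G(m(s)) gives |2 Re phi - (k+1)/k|^2 = O(1/x), without any asymptotics of phi itself.

   Poisson summation for theta functions is proved by Polya's method: count lattice points with
   binomial coefficients, sum over roots of unity, and pass to the limit termwise. *)

(** The radius e^{-ks/2} makes the theta function of parameter ks, the one in the denominator, have
    imaginary argument; its dual series then has positive terms and is at least 1, so no zero has to
    be located. The Gaussian factors of the three Poisson summations cancel because 1/A + 1/((k+1)s)
    = 1/(ks), which leaves a constant. The main term is a residue at z = -1 in disguise: 1/(1 + z)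
    is expanded geometrically and the mean value evaluates the rest at -1. The obstacle lies near z
    = -e^{-ks/2}, where the dual series are not close to 1. With v = (pi - |arg z|)/A their error
    decays like e^{-2 pi v}, while the slow factor grows at most like e^{7v/2} from its value at the
    negative point. As 7/2 < 2 pi, only that value enters the error; it is a q-Gamma quotient whose
    square behaves like 1/x. Letting m depend on s holds x fixed while s -> 0, so that the termwise
    limit makes sense; at m = 0 it does not. The reciprocal Gamma function is reached from q-Gamma
    functions by a convexity sandwich that yields Gauss's product at the same time. *)

Definition nc (R : realType) (z : R[i]) : R := Normc.normc z.

Arguments nc {R} z : simpl never.

(** * The modulus of complex numbers as a real number *)

Section Modulus.
Variable R : realType.
Local Notation C := R[i].
Implicit Types (z w : C) (x y : R).

Lemma nc_ge0 z : 0 <= nc z.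
Proof. by case: z => a b; exact: sqrtr_ge0. Qed.

Lemma nc0 : nc (0 : C) = 0. Proof. exact: Normc.normc0. Qed.
Lemma nc1 : nc (1 : C) = 1. Proof. exact: Normc.normc1. Qed.
Lemma nc0_eq z : nc z = 0 -> z = 0. Proof. exact: Normc.eq0_normc. Qed.
Lemma ncM z w : nc (z * w) = nc z * nc w. Proof. exact: Normc.normcM. Qed.
Lemma ncV z : nc z^-1 = (nc z)^-1. Proof. exact: Normc.normcV. Qed.
Lemma ncN z : nc (- z) = nc z. Proof. exact: normcN. Qed.
Lemma ncD z w : nc (z + w) <= nc z + nc w. Proof. exact: le_normcD. Qed.
Lemma nc_eq0 z : (nc z == 0) = (z == 0).
Proof. by apply/eqP/eqP => [/nc0_eq //|->]; rewrite nc0. Qed.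
Lemma nc_gt0 z : (0 < nc z) = (z != 0).
Proof. by rewrite lt_def nc_eq0 nc_ge0 andbT. Qed.
Lemma ncB z w : nc (z - w) = nc (w - z).
Proof. by rewrite -ncN opprB. Qed.
Lemma ncX z n : nc (z ^+ n) = nc z ^+ n.
Proof. by elim: n => [|n IH]; rewrite ?expr0 ?nc1 // !exprS ncM IH. Qed.
Lemma nc_real x : nc x%:C = `|x|.
Proof. by rewrite /nc /= expr0n /= addr0 sqrtr_sqr. Qed.
Lemma nc_pos x : 0 <= x -> nc x%:C = x.
Proof. by move=> x0; rewrite nc_real ger0_norm. Qed.
Lemma nc_sum (I : Type) (s : seq I) (P : pred I) (f : I -> C) :
  nc (\sum_(i <- s | P i) f i) <= \sum_(i <- s | P i) nc (f i).
Proof.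
elim/big_rec2: _ => [|i a b _ h]; first by rewrite nc0.
by apply: le_trans (ncD _ _) _; rewrite lerD2l.
Qed.
Lemma nc_prod (I : Type) (s : seq I) (P : pred I) (f : I -> C) :
  nc (\prod_(i <- s | P i) f i) = \prod_(i <- s | P i) nc (f i).
Proof. by elim/big_rec2: _ => [|i a b _ <-]; rewrite ?nc1 ?ncM. Qed.
Lemma normRe z : `|complex.Re z| <= nc z.
Proof.
case: z => a b; rewrite /nc /= -sqrtr_sqr; apply: ler_wsqrtr.
by rewrite lerDl sqr_ge0.
Qed.
Lemma normIm z : `|complex.Im z| <= nc z.
Proof.
case: z => a b; rewrite /nc /= -sqrtr_sqr; apply: ler_wsqrtr.
by rewrite lerDr sqr_ge0.
Qed.
Lemma nc_triB z w v : nc (z - w) <= nc (z - v) + nc (v - w).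
Proof. by apply: le_trans (ncD _ _); rewrite addrA subrK. Qed.
Lemma nc_le_B z w : nc z - nc w <= nc (z - w).
Proof. by rewrite lerBlDr; apply: le_trans (ncD _ _); rewrite subrK. Qed.
Lemma ReD z w : complex.Re (z + w) = complex.Re z + complex.Re w.
Proof. by case: z; case: w. Qed.
Lemma ReN z : complex.Re (- z) = - complex.Re z.
Proof. by case: z. Qed.
Lemma ReB z w : complex.Re (z - w) = complex.Re z - complex.Re w.
Proof. by rewrite ReD ReN. Qed.
Lemma ReZ x z : complex.Re (x%:C * z) = x * complex.Re z.
Proof. by case: z => a b /=; rewrite mul0r subr0. Qed.
Lemma Re_sum (I : Type) (s : seq I) (P : pred I) (f : I -> C) :
  complex.Re (\sum_(i <- s | P i) f i) = \sum_(i <- s | P i) complex.Re (f i).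
Proof. by elim/big_rec2: _ => [|i a b _ <-] //; rewrite ReD. Qed.
Lemma rcD x y : (x + y)%:C = x%:C + y%:C :> C. Proof. exact: rmorphD. Qed.
Lemma rcB x y : (x - y)%:C = x%:C - y%:C :> C. Proof. exact: rmorphB. Qed.
Lemma rcN x : (- x)%:C = - x%:C :> C. Proof. exact: rmorphN. Qed.
Lemma rcM x y : (x * y)%:C = x%:C * y%:C :> C. Proof. exact: rmorphM. Qed.
Lemma rcX x n : (x ^+ n)%:C = x%:C ^+ n :> C. Proof. exact: rmorphXn. Qed.
Lemma rcV x : (x^-1)%:C = x%:C^-1 :> C. Proof. exact: fmorphV. Qed.
Lemma rc_nat n : (n%:R)%:C = n%:R :> C. Proof. exact: rmorph_nat. Qed.
Lemma rc_sum (I : Type) (s : seq I) (P : pred I) (f : I -> R) :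
  (\sum_(i <- s | P i) f i)%:C = \sum_(i <- s | P i) (f i)%:C :> C.
Proof. exact: rmorph_sum. Qed.
Lemma rc_prod (I : Type) (s : seq I) (P : pred I) (f : I -> R) :
  (\prod_(i <- s | P i) f i)%:C = \prod_(i <- s | P i) (f i)%:C :> C.
Proof. exact: rmorph_prod. Qed.
End Modulus.

(** * Unconditional summation *)

Section Sums.
Variable R : realType.
Local Notation C := R[i].

(* Convergence along the net of finite subsets. *)
Definition is_sum (I : choiceType) (f : I -> C) (l : C) : Prop :=
  forall e : R, 0 < e -> exists A : {fset I}, forall B : {fset I},
    (A `<=` B)%fset -> nc (\sum_(i <- B) f i - l) < e.

(** Absolute summability is carried with an explicit bound on all finite partial sums, because
    several estimates use the bound itself and not only its existence. *)
Definition abs_le (I : choiceType) (f : I -> C) (K : R) : Prop :=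
  forall A : {fset I}, \sum_(i <- A) nc (f i) <= K.

Definition cvgc (T : Type) (F : set_system T) (u : T -> C) (l : C) : Prop :=
  forall e : R, 0 < e -> \forall t \near F, nc (u t - l) < e.

Lemma nc_small z w : (forall e : R, 0 < e -> nc (z - w) < e) -> z = w.
Proof.
move=> h; apply/eqP; rewrite -subr_eq0 -nc_eq0; apply/eqP.
apply/eqP; rewrite eq_le nc_ge0 andbT; apply/ler_addgt0Pr => e e0.
by rewrite add0r ltW// h.
Qed.

Lemma sum_const_lt (I : choiceType) (A : {fset I}) (e : R) : 0 < e ->
  \sum_(i <- A) (e / (#|` A|.+1)%:R) < e.
Proof.
move=> e0; rewrite big_const_seq count_predT iter_addr_0 -[X in X < _]mulr_natr -mulrA.
rewrite gtr_pMr// mulrC ltr_pdivrMr ?ltr0Sn// mul1r ltr_nat.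
by rewrite cardfE.
Qed.

Section Basic.
Variable I : choiceType.
Implicit Types (f g : I -> C) (A B : {fset I}).

Lemma is_sum_uniq f a b : is_sum f a -> is_sum f b -> a = b.
Proof.
move=> fa fb; apply: nc_small => e e0.
have e2 : 0 < e / 2 by rewrite divr_gt0.
have [A hA] := fa _ e2; have [B hB] := fb _ e2.
have := hA (A `|` B)%fset (fsubsetUl _ _).
have := hB (A `|` B)%fset (fsubsetUr _ _).
set S := \sum_(i <- _) _ => h1 h2.
apply: le_lt_trans (nc_triB _ _ S) _; rewrite (ncB a).
by rewrite [e in _ < e]splitr ltrD.
Qed.

Lemma eq_is_sum f g l : f =1 g -> is_sum f l -> is_sum g l.
Proof.
move=> fg fl e /fl[A hA]; exists A => B /hA.
by under eq_bigr do rewrite fg.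
Qed.

Lemma is_sumD f g a b : is_sum f a -> is_sum g b ->
  is_sum (fun i => f i + g i) (a + b).
Proof.
move=> fa gb e e0; have e2 : 0 < e / 2 by rewrite divr_gt0.
have [A hA] := fa _ e2; have [B hB] := gb _ e2.
exists (A `|` B)%fset => D /fsubUsetP[AD BD].
rewrite big_split /= opprD addrACA; apply: le_lt_trans (ncD _ _) _.
by rewrite [e in _ < e]splitr ltrD ?hA ?hB.
Qed.

Lemma is_sumZ f a c : is_sum f a -> is_sum (fun i => c * f i) (c * a).
Proof.
move=> fa e e0.
have d0 : 0 < e / (nc c + 1) by rewrite divr_gt0// ltr_wpDl// nc_ge0.
have [A hA] := fa _ d0; exists A => B /hA h.
rewrite -mulr_sumr -mulrBr ncM.
have c1 : 0 < nc c + 1 by rewrite ltr_wpDl// nc_ge0.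
apply: le_lt_trans (_ : (nc c + 1) * nc (\sum_(i <- B) f i - a) < e).
  by rewrite ler_wpM2r ?nc_ge0// lerDl.
by rewrite mulrC -ltr_pdivlMr.
Qed.

Lemma is_sumN f a : is_sum f a -> is_sum (fun i => - f i) (- a).
Proof.
move=> /(is_sumZ (-1)); rewrite mulN1r; apply: eq_is_sum => i.
by rewrite mulN1r.
Qed.

Lemma is_sumB f g a b : is_sum f a -> is_sum g b ->
  is_sum (fun i => f i - g i) (a - b).
Proof. by move=> fa /is_sumN; exact: is_sumD. Qed.

Lemma is_sum0 : is_sum (fun _ : I => 0) 0.
Proof.
move=> e e0; exists fset0 => B _; by rewrite big1 ?subr0 ?nc0.
Qed.

Lemma abs_le_ge0 f K : abs_le f K -> 0 <= K.
Proof. by move=> /(_ fset0); rewrite big_seq_fset0. Qed.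

Lemma sub_sum_le (m : I -> R) A B : (forall i, 0 <= m i) -> (A `<=` B)%fset ->
  \sum_(i <- A) m i <= \sum_(i <- B) m i.
Proof.
move=> m0 AB; rewrite (big_fsetID _ (mem A) B) /=.
have -> : [fset x in B | x \in A]%fset = A.
  by apply/fsetP => x; rewrite !inE /= andbC; apply/andb_idr/(fsubsetP AB).
by rewrite lerDl sumr_ge0.
Qed.

Lemma pos_is_sum (m : I -> R) K : (forall i, 0 <= m i) ->
  (forall A, \sum_(i <- A) m i <= K) ->
  exists l : R, is_sum (fun i => (m i)%:C) l%:C.
Proof.
move=> m0 mK.
pose S := [set x : R | exists A : {fset I}, x = \sum_(i <- A) m i].
have hS : has_sup S.
  split; first by exists 0; exists fset0; rewrite big_seq_fset0.
  by exists K => _ [A ->].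
exists (sup S) => e e0.
have [_ [A ->] hA] := sup_adherent e0 hS.
exists A => B AB; rewrite -rc_sum -rcB nc_real.
have h1 : \sum_(i <- B) m i <= sup S by apply: ub_le_sup; [case: hS|exists B].
have h2 := sub_sum_le m0 AB.
by rewrite ler0_norm ?subr_le0//; lra.
Qed.

Lemma max_subN (x : R) : Num.max x 0 - Num.max (- x) 0 = x.
Proof.
case: (lerP 0 x) => h; first by rewrite (max_r (x := - x)) ?subr0 ?oppr_le0.
by rewrite max_l ?opprK ?add0r// oppr_ge0 ltW.
Qed.

(** Real and imaginary parts are split into positive and negative parts, four nonnegative families
    whose sums are suprema. *)
Lemma abs_le_is_sum f K : abs_le f K -> exists l, is_sum f l.
Proof.
move=> fK.
have aux (m : I -> R) : (forall i, 0 <= m i <= nc (f i)) ->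
    exists l : R, is_sum (fun i => (m i)%:C) l%:C.
  move=> hm; apply: (@pos_is_sum _ K) => [i|A]; first by case/andP: (hm i).
  by apply: le_trans (fK A); apply: ler_sum => i _; case/andP: (hm i).
have [|a ha] := aux (fun i => Num.max (complex.Re (f i)) 0).
  move=> i; rewrite le_max lexx orbT /= ge_max nc_ge0 andbT.
  exact: le_trans (ler_norm _) (normRe _).
have [|b hb] := aux (fun i => Num.max (- complex.Re (f i)) 0).
  move=> i; rewrite le_max lexx orbT /= ge_max nc_ge0 andbT.
  by apply: le_trans (normRe _); rewrite -normrN ler_norm.
have [|c hc] := aux (fun i => Num.max (complex.Im (f i)) 0).
  move=> i; rewrite le_max lexx orbT /= ge_max nc_ge0 andbT.
  exact: le_trans (ler_norm _) (normIm _).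
have [|d hd] := aux (fun i => Num.max (- complex.Im (f i)) 0).
  move=> i; rewrite le_max lexx orbT /= ge_max nc_ge0 andbT.
  by apply: le_trans (normIm _); rewrite -normrN ler_norm.
exists (a%:C - b%:C + 'i%C * (c%:C - d%:C)).
apply: eq_is_sum (is_sumD (is_sumB ha hb) (is_sumZ 'i%C (is_sumB hc hd))) => i.
rewrite [RHS]complexE -!rcB; congr (_%:C + 'i%C * _%:C).
  exact: max_subN.
exact: max_subN.
Qed.

Lemma is_sum_nc_le f l K : is_sum f l -> abs_le f K -> nc l <= K.
Proof.
move=> fl fK; apply/ler_addgt0Pr => e e0.
have [A /(_ A (fsubset_refl _)) hA] := fl _ e0.
have := nc_le_B l (\sum_(i <- A) f i); rewrite ncB => h.
have := nc_sum A xpredT f; have := fK A; lra.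
Qed.

Lemma abs_leS f g K : (forall i, nc (f i) <= nc (g i)) -> abs_le g K -> abs_le f K.
Proof.
by move=> fg gK A; apply: le_trans (gK A); apply: ler_sum => i _.
Qed.

Lemma abs_leZ f c K : abs_le f K -> abs_le (fun i => c * f i) (nc c * K).
Proof.
move=> fK A; under eq_bigr do rewrite ncM.
by rewrite -mulr_sumr ler_wpM2l ?nc_ge0.
Qed.

Lemma le_abs_le f K K' : K <= K' -> abs_le f K -> abs_le f K'.
Proof. by move=> KK fK A; apply: le_trans (fK A) KK. Qed.

Lemma summable_tail (m : I -> R) K : (forall i, 0 <= m i) ->
  (forall A, \sum_(i <- A) m i <= K) -> forall e, 0 < e ->
  exists A, forall B, (A `<=` B)%fset ->
   \sum_(i <- (B `\` A)%fset) m i < e.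
Proof.
move=> m0 mK e e0; have [l hl] := pos_is_sum m0 mK.
have e2 : 0 < e / 2 by rewrite divr_gt0.
have [A hA] := hl _ e2; exists A => B AB.
have := hA _ AB; have := hA _ (fsubset_refl A).
rewrite -!rc_sum -!rcB !nc_real.
rewrite (big_fsetID _ (mem A) B) /=.
have -> : [fset x in B | x \in A]%fset = A.
  by apply/fsetP => x; rewrite !inE /= andbC; apply/andb_idr/(fsubsetP AB).
have -> : [fset x in B | x \notin A]%fset = (B `\` A)%fset.
  by apply/fsetP => x; rewrite !inE andbC.
rewrite !ltr_norml => /andP[h1 h2] /andP[h3 h4]; lra.
Qed.

(** Dominated convergence for series along an arbitrary proper filter. One finite set controls the
    tails of the dominating family and of the limit series; what remains is a finite sum, handled
    termwise. It serves Poisson summation, the mean values on the circle and the limit s -> 0. *)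
Lemma tannery (T : Type) (F : set_system T) (FF : ProperFilter F)
    (f : T -> I -> C) g (m : I -> R) K (L : T -> C) (l : C) :
  (forall A, \sum_(i <- A) m i <= K) ->
  (\forall t \near F, forall i, nc (f t i) <= m i) ->
  (forall i, cvgc F (fun t => f t i) (g i)) ->
  (\forall t \near F, is_sum (f t) (L t)) -> is_sum g l -> cvgc F L l.
Proof.
move=> mK fm fg fL gl e e0.
have m0 i : 0 <= m i.
  by have [t /(_ i)] := filter_ex fm; apply: le_trans (nc_ge0 _).
have e4 : 0 < e / 4 by rewrite divr_gt0.
have [A1 hA1] := summable_tail m0 mK e4; have [A2 hA2] := gl _ e4.
pose A := (A1 `|` A2)%fset.
have gA : nc (\sum_(i <- A) g i - l) < e / 4 by apply: hA2; exact: fsubsetUr.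
have fA (t : T) : (forall i, nc (f t i) <= m i) -> is_sum (f t) (L t) ->
    nc (\sum_(i <- A) f t i - L t) < e / 2.
  move=> ftm ftL; have [B hB] := ftL _ e4.
  have h1 := hB (A `|` B)%fset (fsubsetUr _ _).
  have h2 : \sum_(i <- ((A `|` B) `\` A1)%fset) m i < e / 4.
    by apply: hA1; rewrite -fsetUA fsubsetUl.
  have h3 : nc (\sum_(i <- (A `|` B)%fset) f t i - \sum_(i <- A) f t i) < e / 4.
    rewrite (big_fsetID _ (mem A) (A `|` B)%fset) /=.
    have -> : [fset x in (A `|` B)%fset | x \in A]%fset = A.
      by apply/fsetP => x; rewrite !inE /=; case: (x \in A1); case: (x \in A2);
         case: (x \in B).
    rewrite addrC addrK; apply: le_lt_trans h2.
    apply: le_trans (nc_sum _ _ _) _.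
    apply: le_trans (_ : \sum_(i <- [fset x in (A `|` B)%fset | x \notin A]%fset) m i <= _).
      by apply: ler_sum.
    apply: sub_sum_le => //; apply/fsubsetP => x; rewrite !inE /= negb_or.
    by move=> /andP[-> /andP[-> _]].
  apply: le_lt_trans (nc_triB _ _ (\sum_(i <- (A `|` B)%fset) f t i)) _.
  rewrite ncB; lra.
have fgA : \forall t \near F, nc (\sum_(i <- A) f t i - \sum_(i <- A) g i) < e / 4.
  have : \forall t \near F, forall i, i \in A ->
      nc (f t i - g i) < e / 4 / (#|` A|.+1)%:R.
    have : forall s : seq I, \forall t \near F, forall i, i \in s ->
        nc (f t i - g i) < e / 4 / (#|` A|.+1)%:R.
      elim => [|i s IH]; first by near=> t.
      have hi := fg i _ (divr_gt0 e4 (ltr0Sn _ #|` A|)).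
      near=> t => j; rewrite inE => /orP[/eqP->|]; first by near: t.
      by move: j; near: t.
    exact.
  apply: filterS => t h; rewrite -sumrB.
  apply: le_lt_trans (nc_sum _ _ _) _.
  apply: le_lt_trans (_ : \sum_(i <- A) (e / 4 / (#|` A|.+1)%:R) < e / 4).
    by rewrite !big_seq; apply: ler_sum => i iA; rewrite ltW// h.
  exact: sum_const_lt.
near=> t.
apply: le_lt_trans (nc_triB _ _ (\sum_(i <- A) f t i)) _.
have h1 : nc (\sum_(i <- A) f t i - L t) < e / 2.
  by apply: fA; near: t.
have h2 : nc (\sum_(i <- A) f t i - \sum_(i <- A) g i) < e / 4 by near: t.
have := nc_triB (\sum_(i <- A) f t i) l (\sum_(i <- A) g i).
rewrite (ncB (L t)); lra.
Unshelve. all: by end_near. Qed.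

End Basic.

Lemma is_sum_reindex (I J : choiceType) (h : I -> J) (h' : J -> I)
    (f : J -> C) l : cancel h h' -> cancel h' h -> is_sum f l ->
  is_sum (fun i => f (h i)) l.
Proof.
move=> hK h'K fl e /fl[A hA].
exists [fset h' x | x in A]%fset => B AB.
have -> : \sum_(i <- B) f (h i) = \sum_(j <- [fset h x | x in B]%fset) f j.
  by rewrite big_imfset//= => x y _ _; exact: can_inj.
apply: hA; apply/fsubsetP => x xA; rewrite -(h'K x); apply: in_imfset => /=.
by apply: (fsubsetP AB); exact: in_imfset.
Qed.

Lemma abs_le_reindex (I J : choiceType) (h : I -> J) (f : J -> C) K :
  injective h -> abs_le f K -> abs_le (fun i => f (h i)) K.
Proof.
move=> hI fK A; apply: le_trans (fK [fset h x | x in A]%fset).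
by rewrite big_imfset//= => x y _ _; exact: hI.
Qed.

Section Pairs.
Variables I J : choiceType.

Lemma sum_fset_pair (V : nmodType) (B : {fset I}) (t : I -> {fset J}) (f : I * J -> V) :
  \sum_(p <- [fset ((i, j) : I * J) | i in B, j in t i]%fset) f p =
  \sum_(i <- B) \sum_(j <- t i) f (i, j).
Proof. by rewrite big_imfset2//= => -[a b] [c d] _ _ /= [-> ->]. Qed.

(** Each row over the finite set [B] gets its own finite approximation, enlarged by the second
    coordinates of [A]. The resulting set of pairs contains [A], while every row is close to its own
    sum. *)
Lemma fubini (f : I * J -> C) l r : is_sum f l ->
  (forall i, is_sum (fun j => f (i, j)) (r i)) -> is_sum r l.
Proof.
move=> fl fr e e0; have e2 : 0 < e / 2 by rewrite divr_gt0.
have [A hA] := fl _ e2; exists [fset p.1 | p in A]%fset => B AB.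
pose d := e / 2 / (#|` B|.+1)%:R.
have d0 : 0 < d by rewrite divr_gt0.
have [t ht] : exists t : I -> {fset J}, forall i, forall D, (t i `<=` D)%fset ->
    nc (\sum_(j <- D) f (i, j) - r i) < d.
  suff /choice[t ht] : forall i, exists ti : {fset J}, forall D, (ti `<=` D)%fset ->
      nc (\sum_(j <- D) f (i, j) - r i) < d by exists t.
  by move=> i; have [D hD] := fr i _ d0; exists D.
pose A2 := [fset p.2 | p in A]%fset.
pose t2 i := (t i `|` A2)%fset.
pose P := [fset ((i, j) : I * J) | i in B, j in t2 i]%fset.
have AP : (A `<=` P)%fset.
  apply/fsubsetP => -[i j] ijA; apply/imfset2P; exists i => /=.
    by apply: (fsubsetP AB); apply/imfsetP; exists (i, j).
  by exists j => //=; rewrite inE; apply/orP; right; apply/imfsetP; exists (i, j).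
have := hA P AP; rewrite /P sum_fset_pair => h1.
have h2 : nc (\sum_(i <- B) r i - \sum_(i <- B) \sum_(j <- t2 i) f (i, j)) < e / 2.
  rewrite -sumrB; apply: le_lt_trans (nc_sum _ _ _) _.
  apply: le_lt_trans (_ : \sum_(i <- B) d < _).
    by apply: ler_sum => i _; rewrite ncB ltW// ht// fsubsetUl.
  exact: sum_const_lt.
apply: le_lt_trans (nc_triB _ _ (\sum_(i <- B) \sum_(j <- t2 i) f (i, j))) _.
lra.
Qed.

Lemma abs_le_pair (f : I * J -> C) (a : I -> R) K :
  (forall i, abs_le (fun j => f (i, j)) (a i)) ->
  (forall A : {fset I}, \sum_(i <- A) a i <= K) -> abs_le f K.
Proof.
move=> fa aK A; rewrite (partition_big_imfset _ (@fst I J)) /=.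
apply: le_trans (aK [fset x.1 | x in A]%fset); apply: ler_sum => i _.
apply: le_trans (fa i [fset p.2 | p in A & p.1 == i]%fset).
rewrite big_imfset//=; last first.
  by move=> [a1 b1] [a2 b2] /andP[_ /eqP /= ->] /andP[_ /eqP /= ->] ->.
rewrite big_filter le_eqVlt; apply/orP; left; apply/eqP.
by apply: eq_bigr => -[a1 b1] /= /eqP ->.
Qed.

Lemma abs_le_prod (f : I -> C) (g : J -> C) a b : abs_le f a -> abs_le g b ->
  abs_le (fun p : I * J => f p.1 * g p.2) (a * b).
Proof.
move=> fa gb; apply: (@abs_le_pair _ (fun i => nc (f i) * b)) => [i A|A] /=.
  under eq_bigr do rewrite ncM.
  by rewrite -mulr_sumr ler_wpM2l ?nc_ge0.
by rewrite -mulr_suml ler_wpM2r// (abs_le_ge0 gb).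
Qed.

Lemma is_sum_prod (f : I -> C) (g : J -> C) a b l l' :
  abs_le f a -> abs_le g b -> is_sum f l -> is_sum g l' ->
  is_sum (fun p : I * J => f p.1 * g p.2) (l * l').
Proof.
move=> fa gb fl gl; have [x hx] := abs_le_is_sum (abs_le_prod fa gb).
suff <- : x = l * l' by [].
apply: is_sum_uniq (fubini hx (fun i => is_sumZ (f i) gl)) _.
by rewrite mulrC; apply: eq_is_sum (is_sumZ l' fl) => i; rewrite mulrC.
Qed.
End Pairs.

Lemma fubini_r (I J : choiceType) (f : I * J -> C) l r : is_sum f l ->
  (forall j, is_sum (fun i => f (i, j)) (r j)) -> is_sum r l.
Proof.
move=> fl; apply: (@fubini J I (fun p => f (p.2, p.1))).
by apply: (is_sum_reindex (h' := fun p : I * J => (p.2, p.1))) fl; case.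
Qed.

Definition iota_fset n : {fset nat} := seq_fset tt (iota 0 n).

Lemma big_iota_fset (V : nmodType) (f : nat -> V) n :
  \sum_(i <- iota_fset n) f i = \sum_(i < n) f i.
Proof.
rewrite -(big_mkord xpredT f) /index_iota subn0.
by rewrite (perm_big _ (seq_fset_perm tt _)) undup_id ?iota_uniq.
Qed.

Lemma fset_nat_sub (A : {fset nat}) : exists n, (A `<=` iota_fset n)%fset.
Proof.
exists (\max_(i <- A) i).+1; apply/fsubsetP => i iA.
rewrite seq_fsetE mem_iota /= add0n ltnS.
by rewrite (bigD1_seq i)//= leq_maxl.
Qed.

Lemma abs_le_nat (f : nat -> C) K :
  (forall n, \sum_(i < n) nc (f i) <= K) -> abs_le f K.
Proof.
move=> h A; have [n An] := fset_nat_sub A.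
apply: le_trans (h n); rewrite -(big_iota_fset (fun i => nc (f i))).
by apply: sub_sum_le An => i; exact: nc_ge0.
Qed.

Lemma fsum_nat_le (m : nat -> R) K : (forall i, 0 <= m i) ->
  (forall n, \sum_(i < n) m i <= K) -> forall A : {fset nat}, \sum_(i <- A) m i <= K.
Proof.
move=> m0 h A; have [n An] := fset_nat_sub A.
apply: le_trans (h n); rewrite -(big_iota_fset m).
exact: sub_sum_le An.
Qed.

Lemma is_sum_nat (f : nat -> C) l : is_sum f l ->
  cvgc \oo (fun n => \sum_(i < n) f i) l.
Proof.
move=> fl e /fl[A hA]; have [n An] := fset_nat_sub A.
exists n => // m /= nm; rewrite -(big_iota_fset f); apply: hA.
apply: fsubset_trans An _; apply/fsubsetP => i.
by rewrite !seq_fsetE !mem_iota !add0n /= => /leq_trans; apply.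
Qed.

Lemma geo_sum_le (x : R) n : 0 <= x < 1 -> \sum_(i < n) x ^+ i <= (1 - x)^-1.
Proof.
move=> /andP[x0 x1]; have h : 0 < 1 - x by rewrite subr_gt0.
rewrite -(ler_pM2l h) mulfV ?gt_eqF//.
have -> : (1 - x) * (\sum_(i < n) x ^+ i) = 1 - x ^+ n.
  by rewrite -[RHS]opprB subrX1; ring.
by rewrite gerBl exprn_ge0.
Qed.

(** The index 0 is counted in both halves, which is harmless for an upper bound. *)
Lemma fsum_int_le (m : int -> R) a b : (forall i, 0 <= m i) ->
  (forall A : {fset nat}, \sum_(i <- A) m i%:Z <= a) ->
  (forall A : {fset nat}, \sum_(i <- A) m (- i%:Z) <= b) ->
  forall A : {fset int}, \sum_(i <- A) m i <= a + b.
Proof.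
move=> m0 ma mb A; rewrite (big_fsetID _ (fun i : int => 0 <= i) A) /=.
apply: lerD.
  apply: le_trans (ma [fset `|x|%N | x in A & 0 <= x]%fset).
  rewrite big_imfset//= [leRHS]big_imfset/=; last first.
    by move=> x y /andP[_ /= x0] /andP[_ /= y0]; lia.
  rewrite !big_filter le_eqVlt; apply/orP; left; apply/eqP.
  by apply: eq_bigr => i /= i0; rewrite gez0_abs.
apply: le_trans (mb [fset `|x|%N | x in A & ~~ (0 <= x)]%fset).
rewrite big_imfset//= [leRHS]big_imfset/=; last first.
  by move=> x y /andP[_ /= x0] /andP[_ /= y0]; lia.
rewrite !big_filter le_eqVlt; apply/orP; left; apply/eqP.
by apply: eq_bigr => i /= i0; congr m; lia.
Qed.

Lemma fsum_geo_le (x : R) : 0 <= x < 1 ->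
  forall A : {fset nat}, \sum_(i <- A) x ^+ i <= (1 - x)^-1.
Proof.
move=> x01; apply: fsum_nat_le => [i|n]; last exact: geo_sum_le.
by rewrite exprn_ge0//; case/andP: x01.
Qed.

Lemma is_sum_fin (I : choiceType) (A : {fset I}) (f : I -> C) :
  (forall i, i \notin A -> f i = 0) -> is_sum f (\sum_(i <- A) f i).
Proof.
move=> f0 e e0; exists A => B AB; rewrite (big_fset_incl _ AB) ?subrr ?nc0//.
by move=> i _ /f0.
Qed.

(** Vanishing terms may be added to the index set; [g] inverts [h] on both sides only where [f] is
    nonzero. Shifted series, series over naturals seen over the integers, and diagonals of product
    families all arise in this way. *)
Lemma is_sum_extend (I J : choiceType) (h : I -> J) (g : J -> I)
    (f : J -> C) l : cancel h g -> (forall j, f j != 0 -> h (g j) = j) ->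
  is_sum (fun i => f (h i)) l -> is_sum f l.
Proof.
move=> hg fg fl e /fl[A hA]; exists [fset h x | x in A]%fset => B AB.
have -> : \sum_(j <- B) f j =
    \sum_(i <- [fset g j | j in B & h (g j) == j]%fset) f (h i).
  rewrite big_imfset//=; last first.
    move=> x y /andP[_ /eqP hx] /andP[_ /eqP hy] gxy.
    by rewrite -hx -hy gxy.
  rewrite (big_fsetID _ (fun j => h (g j) == j) B) /= [X in _ + X]big1_fset ?addr0; last first.
    move=> i; rewrite !inE /= => /andP[_ hi] _; apply/eqP; apply: contraNT hi.
    by move=> /fg ->.
  rewrite big_imfset//= !big_filter.
  by apply: eq_bigr => i /= /eqP ->.
apply: hA; apply/fsubsetP => x xA; apply/imfsetP; exists (h x) => //=.
by rewrite !inE /= hg eqxx andbT; apply: (fsubsetP AB); exact: in_imfset.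
Qed.
End Sums.

(** * Limits of complex functions and theta series *)

Section Limits.
Variable R : realType.
Local Notation C := R[i].
Implicit Types (z w : C) (x y : R).

Definition csum (I : choiceType) (f : I -> C) : C := xget 0 [set l | is_sum f l].

Lemma csumP (I : choiceType) (f : I -> C) K : abs_le f K -> is_sum f (csum f).
Proof. by move=> /abs_le_is_sum[l fl]; rewrite /csum; case: xgetP => // /(_ l). Qed.

Lemma csumE (I : choiceType) (f : I -> C) l : is_sum f l -> csum f = l.
Proof.
move=> fl; rewrite /csum; case: xgetP => [x _ fx|/(_ l)//]; exact: is_sum_uniq fx fl.
Qed.

Section Filter.
Variables (T : Type) (F : set_system T).
Context {FF : ProperFilter F}.
Implicit Types (u v : T -> C) (a b c l : C).

Lemma cvgcP u l : cvgc F u l <-> (nc (u t - l) @[t --> F] --> (0 : R)).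
Proof.
split=> [h|h e e0].
  apply/cvgrPdist_lt => e /h; apply: filterS => t.
  by rewrite sub0r normrN ger0_norm ?nc_ge0.
move/cvgrPdist_lt : h => /(_ _ e0); apply: filterS => t.
by rewrite sub0r normrN ger0_norm ?nc_ge0.
Qed.

Lemma cvgc_uniq u l l' : cvgc F u l -> cvgc F u l' -> l = l'.
Proof.
move=> h h'; apply: nc_small => e e0; have e2 : 0 < e / 2 by rewrite divr_gt0.
have [t [h1 h2]] := filter_ex (filterI (h _ e2) (h' _ e2)).
by apply: le_lt_trans (nc_triB _ _ (u t)) _; rewrite ncB; lra.
Qed.

Lemma cvgc_cst l : cvgc F (fun=> l) l.
Proof. by move=> e e0; near=> t; rewrite subrr nc0. Unshelve. all: by end_near. Qed.

Lemma cvgcD u v a b : cvgc F u a -> cvgc F v b -> cvgc F (fun t => u t + v t) (a + b).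
Proof.
move=> h h' e e0; have e2 : 0 < e / 2 by rewrite divr_gt0.
apply: filterS (filterI (h _ e2) (h' _ e2)) => t [h1 h2].
by rewrite opprD addrACA; apply: le_lt_trans (ncD _ _) _; lra.
Qed.

Lemma cvgcM u v a b : cvgc F u a -> cvgc F v b -> cvgc F (fun t => u t * v t) (a * b).
Proof.
move=> h h'; apply/cvgcP.
have hb : nc (u t - a) * nc (v t - b) + nc (u t - a) * nc b + nc a * nc (v t - b)
    @[t --> F] --> (0 * 0 + 0 * nc b + nc a * 0 : R).
  move/cvgcP in h; move/cvgcP in h'.
  by apply: cvgD; [apply: cvgD; [exact: cvgM|apply: cvgM => //; exact: cvg_cst]
    |apply: cvgM => //; exact: cvg_cst].
rewrite !mul0r mulr0 !addr0 in hb.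
apply: (squeeze_cvgr _ (cvg_cst 0) hb); near=> t.
rewrite nc_ge0 /= -!ncM.
have -> : u t * v t - a * b =
  (u t - a) * (v t - b) + (u t - a) * b + a * (v t - b) by ring.
by apply: le_trans (ncD _ _) _; rewrite lerD2r; exact: ncD.
Unshelve. all: by end_near. Qed.

Lemma cvgcZ u a c : cvgc F u a -> cvgc F (fun t => c * u t) (c * a).
Proof. by apply: cvgcM; exact: cvgc_cst. Qed.

Lemma cvgcN u a : cvgc F u a -> cvgc F (fun t => - u t) (- a).
Proof.
by move=> h e /h; apply: filterS => t; rewrite -opprD ncN.
Qed.

Lemma cvgcB u v a b : cvgc F u a -> cvgc F v b -> cvgc F (fun t => u t - v t) (a - b).
Proof. by move=> h /cvgcN; exact: cvgcD. Qed.

Lemma near_cvgc u v l : (\forall t \near F, u t = v t) -> cvgc F u l -> cvgc F v l.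
Proof. by move=> h hu e /hu hue; apply: filterS (filterI h hue) => t [->]. Qed.

Lemma cvgc_real (u : T -> R) (l : R) :
  u t @[t --> F] --> l -> cvgc F (fun t => (u t)%:C) l%:C.
Proof.
move=> /cvgrPdist_lt h e /h; apply: filterS => t.
by rewrite -rcB nc_real distrC.
Qed.

Lemma cvgc_Re u l : cvgc F u l -> complex.Re (u t) @[t --> F] --> complex.Re l.
Proof.
move=> h; apply/cvgrPdist_lt => e /h; apply: filterS => t.
by rewrite -ReB ncB; apply: le_lt_trans (normRe _).
Qed.

Lemma cvgc_nc u l : cvgc F u l -> nc (u t) @[t --> F] --> nc l.
Proof.
move=> h; apply/cvgrPdist_lt => e /h; apply: filterS => t.
apply: le_lt_trans; rewrite ler_norml; have := nc_le_B l (u t).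
by have := nc_le_B (u t) l; rewrite (ncB l); lra.
Qed.

Lemma cvgcV u a : a != 0 -> cvgc F u a -> cvgc F (fun t => (u t)^-1) a^-1.
Proof.
move=> a0 h; apply/cvgcP.
have hn := cvgc_nc h; have na : nc a != 0 by rewrite nc_eq0.
have hq : nc (u t - a) / (nc (u t) * nc a) @[t --> F] --> (0 / (nc a * nc a) : R).
  apply: cvgM; first exact/cvgcP.
  by apply: cvgV; [rewrite mulf_neq0|apply: cvgM => //; exact: cvg_cst].
rewrite mul0r in hq; apply: cvg_trans hq; apply: near_eq_cvg.
have ev : \forall t \near F, u t != 0.
  have : 0 < nc a by rewrite nc_gt0.
  move=> /h; apply: filterS => t; apply: contraTneq => ->.
  by rewrite sub0r ncN ltxx.
apply: filterS ev => t u0; rewrite -ncM -ncV -ncM -ncN; congr nc.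
by field; rewrite ?u0 ?a0.
Qed.
End Filter.

Lemma cvgc_comp (T U : Type) (F : set_system T) (G : set_system U) (h : T -> U)
    (u : U -> C) l : h @ F --> G -> cvgc G u l -> cvgc F (fun t => u (h t)) l.
Proof. by move=> hFG hu e /hu /hFG. Qed.

Lemma cexpD z w : cexp (z + w) = cexp z * cexp w.
Proof.
case: z w => a b [c d]; rewrite /cexp /= expRD rcM cosD sinD.
rewrite mulrACA; congr (_ * _); apply/eqP; rewrite eq_complex /=.
by rewrite eqxx addrC eqxx.
Qed.

Lemma nc_cexp z : nc (cexp z) = expR (complex.Re z).
Proof.
rewrite /cexp ncM nc_pos ?expR_ge0//.
by rewrite /nc /= cos2Dsin2 sqrtr1 mulr1.
Qed.

Lemma cexp0 : cexp (0 : C) = 1.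
Proof. by rewrite /cexp /= expR0 cos0 sin0 mul1r. Qed.

Lemma cexp_neq0 z : cexp z != 0.
Proof. by rewrite -nc_gt0 nc_cexp expR_gt0. Qed.

Lemma cexpN z : cexp (- z) = (cexp z)^-1.
Proof.
by apply: (mulfI (cexp_neq0 z)); rewrite -cexpD subrr cexp0 divff// cexp_neq0.
Qed.

Lemma cexp_real x : cexp x%:C = (expR x)%:C.
Proof. by rewrite /cexp /= cos0 sin0 mulr1. Qed.

Lemma cexp_i x : cexp (0 +i* x) = cos x +i* sin x.
Proof. by rewrite /cexp /= expR0 mul1r. Qed.

Lemma cexpMn z n : cexp (z *+ n) = cexp z ^+ n.
Proof. by elim: n => [|n IH]; rewrite ?mulr0n ?cexp0// mulrS exprS cexpD IH. Qed.

Lemma cexpM_nat z n : cexp (n%:R * z) = cexp z ^+ n.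
Proof. by rewrite mulr_natl cexpMn. Qed.

Lemma intC (n : int) : (n%:~R : C) = (n%:~R : R)%:C.
Proof. by rewrite rmorph_int. Qed.

Lemma cexp_2pi : cexp (0 +i* (2 * pi) : C) = 1.
Proof. by rewrite cexp_i mulr_natl cos2pi sin2pi. Qed.

Lemma cexp_pi : cexp (0 +i* pi : C) = -1.
Proof. by rewrite cexp_i cospi sinpi; apply/eqP; rewrite eq_complex /= oppr0 !eqxx. Qed.

Lemma cexpM_int z (n : int) : cexp z = 1 -> cexp (n%:~R * z) = 1.
Proof.
move=> z1; case: n => n; first by rewrite cexpM_nat z1 expr1n.
by rewrite NegzE rmorphN mulNr cexpN cexpM_nat z1 expr1n invr1.
Qed.

Lemma Re_intM (n : int) z : complex.Re (n%:~R * z) = n%:~R * complex.Re z.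
Proof. by rewrite intC ReZ. Qed.

Lemma fsum_shift_int (m : int -> R) (K : R) (n0 : int) :
  (forall A : {fset int}, \sum_(i <- A) m i <= K) ->
  forall A : {fset int}, \sum_(i <- A) m (i + n0) <= K.
Proof.
move=> mK A; apply: le_trans (mK [fset (i + n0)%R | i in A]%fset).
by rewrite big_imfset//= => x y _ _ /addIr.
Qed.

Definition gbound (a : R) : R := expR (2 * a) * (2 / (1 - expR (- a))).

(** With d = n - floor b one has (n - b)^2 >= |d| - 2, so the Gaussian is at most e^{2a} e^{-a|d|}
    and two geometric series suffice. The bound does not depend on the centre [b]. *)
Lemma gauss_fsum_le (a b : R) : 0 < a -> forall A : {fset int},
  \sum_(n <- A) expR (- a * (n%:~R - b) ^+ 2) <= gbound a.
Proof.
move=> a0 A.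
have x01 : 0 <= expR (- a) < 1 by rewrite expR_ge0 expR_lt1 oppr_lt0.
pose m (d : int) : R := expR (2 * a) * expR (- a) ^+ `|d|%N.
have mK (B : {fset int}) : \sum_(d <- B) m d <= gbound a.
  rewrite -mulr_sumr /gbound ler_pM2l ?expR_gt0//.
  have -> : 2 / (1 - expR (- a)) = (1 - expR (- a))^-1 + (1 - expR (- a))^-1 by ring.
  apply: fsum_int_le => [i|D|D]; first by rewrite exprn_ge0 ?expR_ge0.
    exact: fsum_geo_le.
  under eq_bigr do rewrite abszN.
  exact: fsum_geo_le.
apply: le_trans (fsum_shift_int (- Num.floor b) mK A); apply: ler_sum => n _.
rewrite /m -expRM_natl -expRD ler_expR.
have hfl := Num.Theory.floor_le b; have hfu := Num.Theory.floorD1_gt b.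
set d := n - Num.floor b.
have -> : n%:~R - b = d%:~R - (b - (Num.floor b)%:~R) by rewrite /d rmorphB /=; ring.
set f := b - _.
have f0 : 0 <= f by rewrite subr_ge0.
have f1 : f <= 1.
  by rewrite lerBlDr addrC; apply: ltW; move: hfu; rewrite rmorphD.
have hd : (`|d|%N)%:R - 2 <= (d%:~R - f) ^+ 2 :> R.
  case: (lerP 1 d) => hd.
    have -> : (`|d|%N)%:R = d%:~R :> R by rewrite pmulrn gez0_abs//; lia.
    have : 1 <= d%:~R :> R by rewrite -(ler_int R) in hd.
    move: (d%:~R : R) => D; have := sqr_ge0 (D - f - 1); rewrite !expr2; lra.
  have hd0 : d <= 0 by lia.
  have -> : (`|d|%N)%:R = - d%:~R :> R by rewrite pmulrn -rmorphN /=; congr (_%:~R); lia.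
  have h1 : d%:~R <= 0 :> R by rewrite -(ler_int R) in hd0.
  have h2 : - d%:~R <= d%:~R ^+ 2 :> R.
    case: (eqVneq d 0) => [->|dn0]; first by rewrite expr2 mul0r oppr0.
    have h3 : d <= - 1 by lia.
    have : d%:~R <= - 1 :> R by rewrite -(ler_int R) in h3; move: h3; rewrite rmorphN.
    move: (d%:~R : R) => D; rewrite expr2; nra.
  move: h1 h2; move: (d%:~R : R) => D h1 h2.
  have h3 : 0 <= - D * f by rewrite mulr_ge0// oppr_ge0.
  have := sqr_ge0 f; rewrite !expr2 in h2 *; nra.
have := ler_wpM2l (ltW a0) hd; lra.
Qed.

Definition th (t : R) (w : C) (n : int) : C :=
  cexp (- (t / 2)%:C * n%:~R ^+ 2 + n%:~R * w).

Lemma nc_th t w n :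
  nc (th t w n) = expR (- (t / 2) * n%:~R ^+ 2 + n%:~R * complex.Re w).
Proof.
by rewrite /th nc_cexp ReD Re_intM intC -rcX -rcN -rcM.
Qed.

Definition thbound (t : R) (w : C) := 
  expR (complex.Re w ^+ 2 / (2 * t)) * gbound (t / 2).

Lemma abs_le_th t w : 0 < t -> abs_le (th t w) (thbound t w).
Proof.
move=> t0 A; have t2 : 0 < t / 2 by rewrite divr_gt0.
rewrite -(ler_pM2l (expR_gt0 (- (complex.Re w ^+ 2 / (2 * t))))) mulr_sumr.
rewrite /thbound mulrA expRN mulVf ?mul1r ?expR_eq0// -expRN.
apply: le_trans (gauss_fsum_le (complex.Re w / t) t2 A).
apply: ler_sum => n _; rewrite nc_th -expRD ler_expR le_eqVlt; apply/orP; left.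
by apply/eqP; field; rewrite gt_eqF.
Qed.

Definition Th t w := csum (th t w).

Lemma ThP t w : 0 < t -> is_sum (th t w) (Th t w).
Proof. by move=> /(abs_le_th w)/csumP. Qed.

End Limits.

(** * Euler products and the Jacobi triple product *)

Section PowerSeries.
Variable R : realType.
Local Notation C := R[i].
Implicit Types (z w : C) (x y : R) (a : nat -> R).

Definition pterm a z (i : nat) : C := (a i)%:C * z ^+ i.
Definition pser a z : C := csum (pterm a z).

Lemma abs_le_pterm_le a z w K : nc z <= nc w -> abs_le (pterm a w) K -> abs_le (pterm a z) K.
Proof.
move=> zw; apply: abs_leS => i; rewrite !ncM !ncX.
by rewrite ler_wpM2l ?nc_ge0// lerXn2r// ?nnegrE ?nc_ge0.
Qed.

Lemma pser_near1 a z K (c : R) : a 0%N = 1 -> abs_le (pterm a z) K -> 0 <= c <= 1 ->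
  nc (pser a (z * c%:C) - 1) <= c * K.
Proof.
move=> a0 hK /andP[c0 c1].
have hc : abs_le (pterm a (z * c%:C)) K.
  by apply: abs_le_pterm_le hK; rewrite ncM nc_pos// ler_piMr ?nc_ge0.
pose d (i : nat) : C := (i == 0%N)%:R.
have hd : is_sum d 1.
  have := @is_sum_fin R nat (fset1 0%N) d; rewrite big_seq_fset1 /d eqxx; apply=> i.
  by rewrite inE => /negPf ->.
apply: is_sum_nc_le (is_sumB (csumP hc) hd) _.
have := abs_leZ c%:C hK; rewrite nc_pos//; apply: abs_leS => i.
rewrite /d; case: i => [|i].
  by rewrite /pterm a0 !expr0 mulr1 subrr nc0 nc_ge0.
rewrite subr0 /pterm !ncM !ncX ncM !(nc_pos c0) exprMn.
rewrite [leLHS]mulrA [leLHS]mulrC ler_wpM2r//.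
  by rewrite mulr_ge0 ?nc_ge0 ?exprn_ge0 ?nc_ge0.
by rewrite exprS ler_piMr// exprn_ile1.
Qed.

Lemma is_sum_real_Re (I : choiceType) (r : I -> R) (l : C) :
  is_sum (fun i => (r i)%:C) l -> l = (complex.Re l)%:C.
Proof.
move=> h; apply/eqP; rewrite eq_complex /= eqxx /=; apply/eqP.
apply/eqP; rewrite -normr_le0; apply/ler_addgt0Pr => e e0; rewrite add0r.
have [A /(_ A (fsubset_refl _))] := h _ e0; rewrite -rc_sum => hA.
apply/ltW/(le_lt_trans _ hA); have := normIm ((\sum_(i <- A) r i)%:C - l).
by case: (l) => u v /=; rewrite add0r normrN.
Qed.

Lemma cvgn_expR (t : R) : 0 < t -> expR (- t) ^+ n @[n --> \oo] --> (0 : R).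
Proof.
move=> t0; apply: cvg_expr.
by rewrite ger0_norm ?expR_ge0// expR_lt1 oppr_lt0.
Qed.

Lemma pser_scale_cvg a z K (t : R) : 0 < t -> a 0%N = 1 -> abs_le (pterm a z) K ->
  cvgc \oo (fun n => pser a (z * (expR (- t) ^+ n)%:C)) 1.
Proof.
move=> t0 a0 hK; apply/cvgcP.
have h : expR (- t) ^+ n * K @[n --> \oo] --> (0 * K : R).
  by apply: cvgM; [exact: cvgn_expR|exact: cvg_cst].
rewrite mul0r in h; apply: (squeeze_cvgr _ (cvg_cst 0) h); near=> n.
rewrite nc_ge0 /= pser_near1// exprn_ge0 ?expR_ge0//=.
by rewrite exprn_ile1 ?expR_ge0// expR_le1 oppr_le0 ltW.
Unshelve. all: by end_near. Qed.

Lemma is_sum_shift (f : nat -> C) l : is_sum f l ->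
  is_sum (fun i => if i is j.+1 then f j else 0) l.
Proof.
move=> fl; apply: (@is_sum_extend R nat nat succn predn) => //=.
by case=> //=; rewrite eqxx.
Qed.

End PowerSeries.

Section Euler.
Variable R : realType.
Local Notation C := R[i].
Variable t : R.
Hypothesis t0 : 0 < t.
Implicit Types (z w : C) (x y : R).
Local Notation p := (expR (- t)).

(* (p;p)_n, where p = e^{-t}; [qinf] below is (p;p)_oo *)
Definition qf (n : nat) : R := \prod_(i < n) (1 - p ^+ i.+1).

Lemma p01 : 0 < p < 1. Proof. by rewrite expR_gt0 expR_lt1 oppr_lt0 t0. Qed.

Lemma pX_lt1 i : p ^+ i.+1 < 1.
Proof. by case/andP: p01 => a b; rewrite exprn_ilt1// ltW. Qed.

Lemma qf_gt0 n : 0 < qf n.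
Proof. by apply: prodr_gt0 => i _; rewrite subr_gt0 pX_lt1. Qed.

Lemma qfS n : qf n.+1 = qf n * (1 - p ^+ n.+1).
Proof. by rewrite /qf big_ord_recr. Qed.

Definition qlow : R := expR (- (1 - p) ^- 2).

Lemma expR_le_1B x : 0 <= x < 1 -> expR (- (x / (1 - x))) <= 1 - x.
Proof.
move=> /andP[x0 x1]; have h : 0 < 1 - x by rewrite subr_gt0.
rewrite expRN -[leRHS]invrK lef_pV2 ?posrE ?expR_gt0 ?invr_gt0//.
apply: le_trans (expR_ge1Dx _); rewrite le_eqVlt; apply/orP; left; apply/eqP.
by field; rewrite gt_eqF.
Qed.

(** Each factor satisfies 1 - p^i >= e^{-p^i/(1-p)}, and the geometric series produces the exponent
    of [qlow]. Uniformity in [n] makes both Euler series absolutely summable. *)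
Lemma qf_ge n : qlow <= qf n.
Proof.
case/andP: p01 => p0 p1; have h1 : 0 < 1 - p by rewrite subr_gt0.
apply: (@le_trans _ _ (\prod_(i < n) expR (- (p ^+ i.+1 / (1 - p))))).
  rewrite -expR_sum ler_expR sumrN lerN2 -mulr_suml expr2 invfM ler_wpM2r ?invr_ge0 ?(ltW h1)//.
  apply: le_trans (@geo_sum_le R p n _); last by rewrite p1 (ltW p0).
  by apply: ler_sum => i _; rewrite exprS ler_piMl ?exprn_ge0 ?ltW.
apply: ler_prod => i _; rewrite expR_ge0 /=.
have h2 : 0 < 1 - p ^+ i.+1 by rewrite subr_gt0 pX_lt1.
apply: le_trans (expR_le_1B _); last by rewrite exprn_ge0 ?pX_lt1// ltW.
rewrite ler_expR lerN2 ler_wpM2l ?exprn_ge0 ?(ltW p0)// lef_pV2 ?posrE//.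
by rewrite lerB// exprS ler_piMr ?(ltW p0)// exprn_ile1// ltW.
Qed.

Definition ecoef (i : nat) : R := p ^+ 'C(i, 2) / qf i.
Definition lcoef (i : nat) : R := (qf i)^-1.

(* With p = e^{-t}: Ep z = (-z;p)_oo and Lp z = 1/(z;p)_oo, the latter for |z| < 1 only. *)
Definition Ep z := pser ecoef z.
Definition Lp z := pser lcoef z.

Lemma ecoef0 : ecoef 0 = 1. Proof. by rewrite /ecoef /qf big_ord0 invr1 mulr1. Qed.
Lemma lcoef0 : lcoef 0 = 1. Proof. by rewrite /lcoef /qf big_ord0 invr1. Qed.

Lemma bin2R (n : nat) : ('C(n, 2))%:R * 2 = n%:R * (n%:R - 1) :> R.
Proof.
elim: n => [|n IH]; first by rewrite bin0n /= !mul0r.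
rewrite binS bin1 natrD mulrDl IH -natr1; ring.
Qed.

Lemma th_nat w (n : nat) : th t (w + (t / 2)%:C) n = (p ^+ 'C(n, 2))%:C * cexp w ^+ n.
Proof.
rewrite /th -cexpMn -expRM_natl -cexp_real -cexpD; congr cexp.
rewrite -[w *+ n]mulr_natl.
have -> : (n : int)%:~R = (n%:R : R)%:C :> C by rewrite rc_nat.
have -> : ('C(n, 2))%:R * - t = n%:R * (n%:R - 1) * (- (t / 2)).
  by rewrite -bin2R; field.
rewrite -(rc_nat _ n) !(rcM, rcN, rcB, rcV); ring.
Qed.

Lemma Ep_abs z : exists K, abs_le (pterm ecoef z) K.
Proof.
pose r := Num.max 1 (nc z); have r0 : 0 < r by rewrite lt_max ltr01.
exists (qlow^-1 * thbound t ((ln r)%:C + (t / 2)%:C)).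
apply: (@abs_le_pterm_le _ _ _ r%:C).
  by rewrite (nc_pos (ltW r0)) le_max lexx orbT.
apply: (@abs_leS R nat _ (fun n => (qlow^-1)%:C * th t ((ln r)%:C + (t / 2)%:C) n)) => [i|].
  rewrite th_nat cexp_real lnK ?posrE// !ncM /ecoef !nc_real.
  rewrite normrM !ger0_norm ?exprn_ge0 ?expR_ge0 ?invr_ge0 ?expR_ge0 ?(ltW (qf_gt0 _))//.
  rewrite mulrA ler_wpM2r ?nc_ge0// mulrC ler_wpM2r ?exprn_ge0 ?expR_ge0//.
  by rewrite lef_pV2 ?posrE ?qf_gt0 ?expR_gt0// qf_ge.
have := @abs_leZ R nat (fun n : nat => th t ((ln r)%:C + (t / 2)%:C) n) (qlow^-1)%:C
   (thbound t ((ln r)%:C + (t / 2)%:C)).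
rewrite nc_pos ?invr_ge0 ?expR_ge0//; apply.
apply: (@abs_le_reindex R nat int Posz (th t _)) => [a b []//|].
exact: abs_le_th.
Qed.

Lemma Lp_abs z : nc z < 1 -> exists K, abs_le (pterm lcoef z) K.
Proof.
move=> z1; exists (qlow^-1 * (1 - nc z)^-1).
apply: abs_le_nat => n.
apply: le_trans (_ : \sum_(i < n) qlow^-1 * nc z ^+ i <= _).
  apply: ler_sum => i _; rewrite ncM ncX nc_pos ?invr_ge0 ?(ltW (qf_gt0 _))//.
  rewrite ler_wpM2r ?exprn_ge0 ?nc_ge0// lef_pV2 ?posrE ?qf_gt0 ?expR_gt0//.
  exact: qf_ge.
rewrite -mulr_sumr ler_wpM2l ?invr_ge0 ?expR_ge0//.
by apply: geo_sum_le; rewrite nc_ge0.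
Qed.

Lemma EpP z : is_sum (pterm ecoef z) (Ep z).
Proof. by have [K /csumP] := Ep_abs z. Qed.

Lemma LpP z : nc z < 1 -> is_sum (pterm lcoef z) (Lp z).
Proof. by move=> /Lp_abs[K /csumP]. Qed.

Lemma Ep_funE z : Ep z = (1 + z) * Ep (z * p%:C).
Proof.
apply: is_sum_uniq (EpP z) _; rewrite mulrDl mul1r.
apply: eq_is_sum (is_sumD (EpP _) (is_sum_shift (is_sumZ z (EpP (z * p%:C))))).
case=> [|i]; first by rewrite /pterm !expr0 addr0.
rewrite /pterm [z ^+ _ in RHS]exprS !exprMn -!rcX.
have E : ecoef i.+1 = ecoef i.+1 * p ^+ i.+1 + ecoef i * p ^+ i.
  rewrite /ecoef qfS binS bin1 exprD.
  have h1 : qf i != 0 by rewrite gt_eqF ?qf_gt0.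
  have h2 : 1 - p ^+ i.+1 != 0 by rewrite gt_eqF// subr_gt0 pX_lt1.
  by field; rewrite h1 h2.
rewrite [in RHS]E rcD !rcM exprS; ring.
Qed.

Lemma Lp_funE z : nc z < 1 -> Lp (z * p%:C) = (1 - z) * Lp z.
Proof.
move=> z1; have zp1 : nc (z * p%:C) < 1.
  rewrite ncM nc_pos ?expR_ge0//; apply: le_lt_trans z1.
  by rewrite ler_piMr ?nc_ge0// ltW//; case/andP: p01.
apply: is_sum_uniq (LpP zp1) _; rewrite mulrBl mul1r.
apply: eq_is_sum (is_sumB (LpP z1) (is_sum_shift (is_sumZ z (LpP z1)))).
case=> [|i]; first by rewrite /pterm !expr0 subr0.
rewrite /pterm exprMn -rcX [z ^+ i.+1]exprS.
have -> : lcoef i = lcoef i.+1 * (1 - p ^+ i.+1).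
  rewrite /lcoef qfS.
  have h1 : qf i != 0 by rewrite gt_eqF ?qf_gt0.
  have h2 : 1 - p ^+ i.+1 != 0 by rewrite gt_eqF// subr_gt0 pX_lt1.
  by field; rewrite h1 h2.
rewrite rcM rcB; ring.
Qed.

Lemma Ep_prod z n : Ep z = \prod_(i < n) (1 + z * (p ^+ i)%:C) * Ep (z * (p ^+ n)%:C).
Proof.
elim: n => [|n IH]; first by rewrite big_ord0 mul1r expr0 mulr1.
rewrite IH big_ord_recr /= -mulrA; congr (_ * _).
by rewrite Ep_funE -mulrA -rcM -exprSr.
Qed.

Lemma Lp_prod z n : nc z < 1 ->
  Lp (z * (p ^+ n)%:C) = \prod_(i < n) (1 - z * (p ^+ i)%:C) * Lp z.
Proof.
move=> z1; elim: n => [|n IH]; first by rewrite big_ord0 mul1r expr0 mulr1.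
rewrite exprSr rcM mulrA Lp_funE; first by rewrite IH big_ord_recr /=; ring.
rewrite ncM nc_pos ?exprn_ge0 ?expR_ge0//; apply: le_lt_trans z1.
rewrite ler_piMr ?nc_ge0// exprn_ile1 ?expR_ge0// ltW//; by case/andP: p01.
Qed.

Lemma Ep_scale z : cvgc \oo (fun n => Ep (z * (p ^+ n)%:C)) 1.
Proof. by have [K hK] := Ep_abs z; apply: pser_scale_cvg hK => //; exact: ecoef0. Qed.

(** The series is the definition and the product is derived: the functional equation peels off n
    factors, and the remaining value at z p^n tends to 1. *)
Lemma Ep_cvg z : cvgc \oo (fun n => \prod_(i < n) (1 + z * (p ^+ i)%:C)) (Ep z).
Proof.
have h : cvgc \oo (fun n => Ep z / Ep (z * (p ^+ n)%:C)) (Ep z * 1^-1).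
  exact: cvgcZ (cvgcV (oner_neq0 _) (Ep_scale z)).
rewrite invr1 mulr1 in h; apply: near_cvgc h.
have : \forall n \near \oo, Ep (z * (p ^+ n)%:C) != 0.
  have := Ep_scale z ltr01; apply: filterS => n; apply: contraTneq => ->.
  by rewrite sub0r ncN nc1 ltxx.
by apply: filterS => n h; rewrite (Ep_prod z n) mulfK.
Qed.

(** The values of [Lp] at z p^n tend to 1, and by the functional equation they are also the partial
    products of [Ep (- z)] times [Lp z]. *)
Lemma Lp_Ep z : nc z < 1 -> Lp z * Ep (- z) = 1.
Proof.
move=> z1; have [K hK] := Lp_abs z1.
apply: (@cvgc_uniq R nat \oo _ (fun n => Lp (z * (p ^+ n)%:C))); last first.
  by apply: pser_scale_cvg hK => //; exact: lcoef0.
apply: near_cvgc (cvgcZ (Lp z) (Ep_cvg (- z))).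
by near=> n; rewrite Lp_prod// mulrC; under eq_bigr do rewrite mulNr.
Unshelve. all: by end_near. Qed.

Definition qinf : R := complex.Re (Ep (- p%:C)).

Lemma qinfE : Ep (- p%:C) = qinf%:C.
Proof.
apply: (@is_sum_real_Re _ _ (fun i => ecoef i * (- p) ^+ i)).
by apply: eq_is_sum (EpP _) => i; rewrite /pterm -rcN -rcX -rcM.
Qed.

Lemma qf_cvg : qf n @[n --> \oo] --> qinf.
Proof.
apply: cvg_trans (cvgc_Re (Ep_cvg (- p%:C))).
apply: near_eq_cvg; near=> n; rewrite /qf.
rewrite (_ : \prod_(i < n) _ = (\prod_(i < n) (1 - p ^+ i.+1))%:C)//.
rewrite rc_prod; apply: eq_bigr => i _.
by rewrite rcB exprS rcM mulNr.
Unshelve. all: by end_near. Qed.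

Lemma qinf_gt0 : 0 < qinf.
Proof.
apply: (@lt_le_trans _ _ qlow); first exact: expR_gt0.
rewrite -(cvg_lim _ qf_cvg)//; apply: limr_ge; first exact: cvgP qf_cvg.
by near=> n; exact: qf_ge.
Unshelve. all: by end_near. Qed.

Lemma Ep_qf m : Ep (- (p ^+ m.+1)%:C) = (qinf / qf m)%:C.
Proof.
have := Ep_prod (- p%:C) m; rewrite qinfE.
have -> : \prod_(i < m) (1 + - p%:C * (p ^+ i)%:C) = (qf m)%:C :> C.
  by rewrite rc_prod; apply: eq_bigr => i _; rewrite rcB exprS rcM mulNr.
rewrite mulNr -rcM -exprS rcM rcV => ->; rewrite mulrAC mulfV ?mul1r//.
by rewrite -nc_eq0 nc_real normr_eq0 gt_eqF ?qf_gt0.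
Qed.

(** This vanishing is what lets sums over naturals be read as sums over all integers, here in the
    triple product and later in [lint]. *)
Lemma Ep_root m : Ep (- (p ^- m)%:C) = 0.
Proof.
rewrite (Ep_prod _ m.+1) big_ord_recr /= mulNr -rcM mulVf ?subrr ?mulr0 ?mul0r//.
by rewrite expf_neq0// gt_eqF ?expR_gt0.
Qed.

(** The theta series is multiplied by the series of [Lp] at x = -p e^{-W}, and the double sum is
    regrouped. At fixed n the inner sum is Euler's series at -p^{n+1}, which vanishes for n < 0 and
    equals [qinf / qf n] for n >= 0; what is left is Euler's series at e^W. The condition on the
    real part of [W] says that |x| < 1. *)
Lemma jacobi (W : C) : - t < complex.Re W ->
  Th t (W + (t / 2)%:C) = qinf%:C * (Ep (cexp W) * Ep (p%:C * cexp (- W))).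
Proof.
move=> tW; set w := W + _; pose x : C := - (p%:C * cexp (- W)).
have x1 : nc x < 1.
  rewrite ncN ncM nc_cexp nc_pos ?expR_ge0// -expRD ReN expR_lt1; lra.
have [Kl hKl] := Lp_abs x1.
have hS := is_sum_prod (abs_le_th w t0) hKl (ThP w t0) (LpP x1).
(* The shear n -> n + j turns the factor p^{n^2/2} into p^{C(j,2)} times a power that is geometric
   in j. *)
pose h (c : int * nat) : int * nat := (c.1 + c.2%:Z, c.2).
pose h' (c : int * nat) : int * nat := (c.1 - c.2%:Z, c.2).
have hK : cancel h h' by case=> a b; rewrite /h /h' /= addrK.
have h'K : cancel h' h by case=> a b; rewrite /h /h' /= subrK.
have {hS}hS := is_sum_reindex hK h'K hS.
have hr n : is_sum (fun j => th t w (h (n, j)).1 * pterm lcoef x (h (n, j)).2)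
    (th t w n * Ep (- (expR (- t * (n%:~R + 1)))%:C)).
  apply: eq_is_sum (is_sumZ (th t w n) (EpP _)) => j /=.
  have key : th t w (n + j%:Z) =
      th t w n * (p ^+ 'C(j, 2))%:C * ((expR (- t * n%:~R))%:C * cexp W) ^+ j.
    rewrite -expRM_natl -!cexp_real -cexpD -cexpM_nat /th -!cexpD; congr cexp.
    have -> : ('C(j, 2))%:R * - t = j%:R * (j%:R - 1) * (- (t / 2)).
      by rewrite -bin2R; field.
    rewrite /w !intC rmorphD /= -!pmulrn -!rc_nat.
    by rewrite !(rcM, rcN, rcB, rcD, rcV, rc_nat); field.
  rewrite key /pterm /ecoef /lcoef rcM.
  have -> : - (expR (- t * (n%:~R + 1)))%:C =
      (expR (- t * n%:~R))%:C * cexp W * x :> C.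
    rewrite /x mulrDr mulr1 expRD rcM cexpN; field; exact: cexp_neq0.
  rewrite [(_ * x) ^+ j]exprMn; ring.
have hs := fubini hS hr.
have hE : is_sum (fun n : int => th t w n * Ep (- (expR (- t * (n%:~R + 1)))%:C))
    (qinf%:C * Ep (cexp W)).
  apply: (@is_sum_extend R nat int Posz absz); [by []|case=> [//|m]|].
    rewrite NegzE.
    have -> : expR (- t * ((- m.+1%:Z)%:~R + 1)) = p ^- m :> R.
      by rewrite -exprVn -expRN opprK -expRM_natl rmorphN /= -pmulrn -natr1; congr expR; ring.
    by rewrite Ep_root mulr0 eqxx.
  apply: eq_is_sum (is_sumZ qinf%:C (EpP (cexp W))) => m.
  have -> : expR (- t * ((Posz m)%:~R + 1)) = p ^+ m.+1 :> R.
    by rewrite -expRM_natl -pmulrn natr1 mulrC.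
  rewrite Ep_qf /w th_nat /pterm /ecoef !rcM; ring.
have := is_sum_uniq hs hE => H.
have hL := Lp_Ep x1; rewrite opprK in hL.
by rewrite mulrA -H -mulrA hL mulr1.
Qed.

End Euler.

(** * Poisson summation *)

Section TrigBounds.
Variable R : realType.
Implicit Types (x u : R).

Lemma sin_le_id u : 0 <= u -> sin u <= u.
Proof.
move=> u0; have [|c _ h] := @MVT_segment R sin cos 0 u u0.
  exact/continuous_subspaceT/continuous_sin.
move: h; rewrite sin0 !subr0 => ->.
by rewrite ler_piMl// cos_le1.
Qed.

Lemma sin_ge_cos u : 0 <= u <= pi -> u * cos u <= sin u.
Proof.
move=> /andP[u0 upi]; have [|c /itvP cu h] := @MVT_segment R sin cos 0 u u0.
  exact/continuous_subspaceT/continuous_sin.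
move: h; rewrite sin0 !subr0 => ->; rewrite mulrC ler_wpM2r//.
have h1 : c <= u by rewrite cu.
have h2 : 0 <= c by rewrite cu.
by rewrite leNgt ltr_cos ?in_itv /= ?u0 ?upi ?h2 ?(le_trans h1)// -leNgt.
Qed.

Lemma cos_pi4_ge : 1 / 2 <= cos (pi / 4) ^+ 2 :> R.
Proof.
have := @cos_pihalf R; have -> : pi / 2 = (pi / 4) *+ 2 :> R by rewrite -mulr_natl; field.
by rewrite cos_mulr2n -mulr_natl => h; lra.
Qed.

Lemma sin_ge_half u : 0 <= u <= pi / 2 -> u / 2 <= sin u.
Proof.
move=> /andP[u0 u1]; have hpi := pi_gt0 R.
pose v := u / 2; have v0 : 0 <= v by rewrite divr_ge0.
have v1 : v <= pi / 4 by rewrite /v; lra.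
have -> : sin u = 2 * (cos v * sin v).
  by rewrite mulr_natl -sin_mulr2n; congr sin; rewrite -mulr_natl /v; field.
have -> : u = 2 * v by rewrite /v; field.
have s1 : v * cos v <= sin v by apply: sin_ge_cos; rewrite v0 /=; lra.
have c0 : 0 <= cos v by apply: cos_ge0_pihalf; apply/andP; split; lra.
have c1 : cos (pi / 4) <= cos v.
  rewrite leNgt ltr_cos -?leNgt// in_itv /=; apply/andP; split; lra.
have c2 : 0 <= cos (pi / 4) :> R by apply: cos_ge0_pihalf; apply/andP; split; lra.
have h := cos_pi4_ge.
have : 1 / 2 <= cos v ^+ 2 by apply: (le_trans h); rewrite lerXn2r.
rewrite expr2; nra.
Qed.

Lemma sin_ge_half_norm u : `|u| <= pi / 2 -> u ^+ 2 / 4 <= sin u ^+ 2.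
Proof.
move=> hu.
have h : `|u| / 2 <= sin `|u| by apply: sin_ge_half; rewrite normr_ge0 hu.
have -> : sin u ^+ 2 = sin `|u| ^+ 2 by rewrite !sin2cos2 cos_norm.
have -> : u ^+ 2 = `|u| ^+ 2 by rewrite real_normK ?num_real.
have -> : `|u| ^+ 2 / 4 = (`|u| / 2) ^+ 2 by field.
by rewrite lerXn2r// nnegrE ?(le_trans _ h)// divr_ge0.
Qed.

(* The sandwich exp(-tan^2) <= cos^2 <= exp(-sin^2). *)
Lemma cos2_upper u : cos u ^+ 2 <= expR (- sin u ^+ 2).
Proof. by rewrite cos2sin2; apply: expR_ge1Dx. Qed.

Lemma cos2_lower u : cos u != 0 -> expR (- (sin u ^+ 2 / cos u ^+ 2)) <= cos u ^+ 2.
Proof.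
move=> c0; have h : 0 < cos u ^+ 2 by rewrite exprn_even_gt0.
have := @expR_le_1B R (sin u ^+ 2); rewrite -cos2sin2; apply.
by rewrite sqr_ge0 /= -subr_gt0 -cos2sin2.
Qed.
End TrigBounds.

Section Binomials.
Variable R : realType.
Local Notation C := R[i].

Definition rb (M j : nat) : R := 'C(M.*2, M + j)%:R / 'C(M.*2, M)%:R.

Lemma binC_gt0 M : 0 < 'C(M.*2, M)%:R :> R.
Proof. by rewrite ltr0n bin_gt0 -addnn leq_addr. Qed.

Lemma rb0 M : rb M 0 = 1.
Proof. by rewrite /rb addn0 divff// gt_eqF// binC_gt0. Qed.

Lemma rb_ge0 M j : 0 <= rb M j. Proof. by rewrite divr_ge0. Qed.

Lemma rb_big M j : (M < j)%N -> rb M j = 0.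
Proof. by move=> h; rewrite /rb bin_small ?mul0r// -addnn ltn_add2l. Qed.

Lemma rbS M j : (j < M)%N -> rb M j.+1 = rb M j * ((M - j)%:R / (M + j.+1)%:R).
Proof.
move=> h; rewrite /rb.
have := mul_bin_left (M.*2) (M + j).
rewrite -addnS (_ : M.*2 - (M + j) = M - j)%N; last by rewrite -addnn subnDl.
move/(congr1 (fun n => n%:R : R)); rewrite !natrM => e.
have h1 : (M + j.+1)%:R != 0 :> R by rewrite pnatr_eq0 addnS.
have -> : 'C(M.*2, M + j.+1)%:R = (M - j)%:R * 'C(M.*2, M + j)%:R / (M + j.+1)%:R :> R.
  by rewrite -e mulrAC mulfV ?mul1r.
by rewrite mulrAC; ring.
Qed.

Lemma sum_odd_sq j : \sum_(i < j) ((i.*2.+1)%:R : R) = j%:R ^+ 2.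
Proof.
elim: j => [|j IH]; first by rewrite big_ord0 expr2 mul0r.
by rewrite big_ord_recr /= IH -addnn -!natr1 natrD; ring.
Qed.

(** The ratio of consecutive values is 1 - (2i+1)/(M+i+1), at most e^{-(2i+1)/(M+j)}, and the odd
    numbers add up to j^2. The lower bound uses the same ratio with 1 - x >= e^{-x/(1-x)}. *)
Lemma rb_upper M j : (0 < M)%N -> (j <= M)%N -> rb M j <= expR (- (j%:R ^+ 2 / (M + j)%:R)).
Proof.
move=> M0 jM.
have hk : forall k, (k <= j)%N ->
    rb M k <= expR (- ((\sum_(i < k) (i.*2.+1)%:R) / (M + j)%:R)).
  elim=> [_|k IH kj]; first by rewrite rb0 big_ord0 mul0r oppr0 expR0.
  have kM : (k < M)%N by apply: leq_trans jM.
  rewrite rbS// big_ord_recr /= mulrDl opprD expRD.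
  apply: ler_pM; rewrite ?rb_ge0 ?divr_ge0// ?IH ?(ltnW kj)//.
  have -> : (M - k)%:R / (M + k.+1)%:R = 1 - (k.*2.+1)%:R / (M + k.+1)%:R :> R.
    have h1 : (M + k.+1)%:R != 0 :> R by rewrite pnatr_eq0 addnS.
    apply: (mulIf h1); rewrite mulrBl !divfK// mul1r natrB ?(ltnW kM)//.
    by rewrite natrD -addnn -!natr1 natrD; ring.
  apply: le_trans (expR_ge1Dx _) _; rewrite ler_expR lerN2 ler_wpM2l//.
  by rewrite lef_pV2 ?posrE ?ltr0n ?addn_gt0 ?M0// ler_nat leq_add2l.
by have := hk j (leqnn j); rewrite sum_odd_sq.
Qed.

Lemma rb_lower M j : (j < M)%N -> expR (- (j%:R ^+ 2 / (M - j)%:R)) <= rb M j.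
Proof.
move=> jM.
have hk : forall k, (k <= j)%N ->
    expR (- ((\sum_(i < k) (i.*2.+1)%:R) / (M - j)%:R)) <= rb M k.
  elim=> [_|k IH kj]; first by rewrite rb0 big_ord0 mul0r oppr0 expR0.
  have kM : (k < M)%N by apply: leq_trans (ltnW jM).
  rewrite rbS// big_ord_recr /= mulrDl opprD expRD.
  apply: ler_pM; rewrite ?expR_ge0 ?IH ?(ltnW kj)//.
  have h1 : (M + k.+1)%:R != 0 :> R by rewrite pnatr_eq0 addnS.
  have h2 : (M - k)%:R != 0 :> R by rewrite pnatr_eq0 subn_eq0 -ltnNge.
  have e : (M - k)%:R / (M + k.+1)%:R = 1 - (k.*2.+1)%:R / (M + k.+1)%:R :> R.
    apply: (mulIf h1); rewrite mulrBl !divfK// mul1r natrB ?(ltnW kM)//.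
    by rewrite natrD -addnn -!natr1 natrD; ring.
  rewrite e; apply: le_trans (expR_le_1B _); last first.
    rewrite divr_ge0//= ltr_pdivrMr ?ltr0n ?addn_gt0 ?orbT// mul1r ltr_nat.
    by rewrite -addnn -addnS ltn_add2r.
  rewrite ler_expR lerN2 -e -mulrA ler_wpM2l// invf_div.
  rewrite mulrA mulVf// mul1r lef_pV2 ?posrE ?ltr0n ?subn_gt0//.
  by rewrite ler_nat leq_sub2l// ltnW.
by have := hk j (leqnn j); rewrite sum_odd_sq.
Qed.

Definition cb (M : nat) : R := 4 ^+ M / ('C(M.*2, M)%:R * Num.sqrt M%:R).

Lemma cb_gt0 M : (0 < M)%N -> 0 < cb M.
Proof.
by move=> M0; rewrite divr_gt0 ?exprn_gt0// mulr_gt0 ?binC_gt0 ?sqrtr_gt0 ?ltr0n.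
Qed.

Lemma binC_S M : M.+1%:R * 'C(M.+1.*2, M.+1)%:R = 2 * (M.*2.+1)%:R * 'C(M.*2, M)%:R :> R.
Proof.
rewrite -!natrM; congr (_%:R).
have h1 : (M.+1.*2 * 'C(M.*2.+1, M) = M.+1 * 'C(M.+1.*2, M.+1))%N.
  exact: mul_bin_diag.
have h3 : (M.*2.+1 * 'C(M.*2, M) = M.+1 * 'C(M.*2.+1, M))%N.
  have := mul_bin_down (M.*2.+1) M; rewrite -pred_Sn => ->; congr (_ * _)%N.
  by rewrite subSn -addnn ?addnK ?leq_addr.
rewrite -h1 -mulnA h3 -[M.+1.*2]mul2n; lia.
Qed.

(** Only the existence of the limit of the Wallis ratio is obtained here, by monotonicity. Its value
    is read off from Poisson summation itself in [cb_lim_pi]. *)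
Lemma cb_cvg : exists2 W : R, 0 <= W & cb M.+1 @[M --> \oo] --> W.
Proof.
have dec : nonincreasing_seq (fun M => cb M.+1).
  apply/nonincreasing_seqP => M; rewrite -(@ler_pXn2r _ 2%N) ?nnegrE ?(ltW (cb_gt0 _))//.
  have e4 : 4 ^+ M.+2 = 4 * 4 ^+ M.+1 :> R by rewrite exprS.
  rewrite /cb e4; move: (4 ^+ M.+1 : R) => X {e4}.
  rewrite !expr_div_n !exprMn !sqr_sqrtr ?ler0n//.
  have hB := binC_S M.+1; have b1 := binC_gt0 M.+1.
  have m1 : 0 < M.+1%:R :> R by rewrite ltr0n.
  have e : (M.+2)%:R = M.+1%:R + 1 :> R by rewrite natr1.
  have e2 : (M.+1.*2.+1)%:R = 2 * M.+1%:R + 1 :> R by rewrite -natr1 -addnn natrD; ring.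
  rewrite e e2 in hB; rewrite e.
  have -> : 'C(M.+2.*2, M.+2)%:R =
     2 * (2 * M.+1%:R + 1) * 'C(M.+1.*2, M.+1)%:R / (M.+1%:R + 1) :> R.
    by rewrite -hB mulrAC mulfV ?mul1r// gt_eqF// addr_gt0.
  move: (M.+1%:R : R) m1 ('C(M.+1.*2, M.+1)%:R : R) b1 {hB e e2}.
  move=> m m1 b b1; rewrite -subr_ge0.
  have -> : X ^+ 2 / (b ^+ 2 * m) - 4 ^+ 2 * X ^+ 2 /
     ((2 * (2 * m + 1) * b / (m + 1)) ^+ 2 * (m + 1)) =
     X ^+ 2 / (b ^+ 2 * m * (2 * m + 1) ^+ 2) :> R.
    field; rewrite !gt_eqF//; lra.
  by rewrite divr_ge0 ?sqr_ge0// mulr_ge0 ?sqr_ge0// mulr_ge0 ?sqr_ge0// ltW.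
have bnd : has_lbound (range (fun M => cb M.+1)).
  by exists 0 => _ [M _ <-]; rewrite ltW// cb_gt0.
have h := nonincreasing_is_cvgn dec bnd; exists (limn (fun M => cb M.+1)) => //.
by apply: limr_ge => //; near=> M; rewrite ltW// cb_gt0.
Unshelve. all: by end_near. Qed.

End Binomials.

Section Polya.
Variable R : realType.
Local Notation C := R[i].
Implicit Types (x y : R).

Definition ei x : C := cexp (0 +i* x).

Lemma ImiD x y : (0 +i* (x + y) : C) = 0 +i* x + 0 +i* y.
Proof. by apply/eqP; rewrite eq_complex /= addr0 !eqxx. Qed.
Lemma ImiM x y : (0 +i* (x * y) : C) = x%:C * (0 +i* y).
Proof. by apply/eqP; rewrite eq_complex /= !mul0r mulr0 subr0 addr0 !eqxx. Qed.
Lemma eiD x y : ei (x + y) = ei x * ei y.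
Proof. by rewrite /ei ImiD cexpD. Qed.
Lemma ei0 : ei 0 = 1. Proof. exact: cexp0. Qed.
Lemma nc_ei x : nc (ei x) = 1. Proof. by rewrite nc_cexp expR0. Qed.
Lemma ei_nat x n : ei (x * n%:R) = ei x ^+ n.
Proof. by rewrite /ei -cexpM_nat [x * _]mulrC ImiM rc_nat. Qed.
Lemma ei_int2pi (n : int) : ei (2 * pi * n%:~R) = 1.
Proof.
rewrite /ei -[RHS](cexpM_int n (@cexp_2pi R)); congr cexp.
have -> : 2 * pi * n%:~R = n%:~R * (2 * pi) :> R by rewrite mulrC.
by rewrite (ImiM n%:~R) intC.
Qed.
Lemma eiE x : ei x = cos x +i* sin x. Proof. exact: cexp_i. Qed.

Lemma ei_neq1 x : 0 < x < 2 * pi -> ei x != 1.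
Proof.
move=> /andP[x0 x1]; apply/negP => /eqP h.
have : cos x = 1 by move: h; rewrite eiE => -[].
have -> : x = (x / 2) *+ 2 by rewrite -mulr_natl; field.
rewrite cos_mulr2n cos2sin2 -mulr_natl => h2.
have : 0 < sin (x / 2) by apply: sin_gt0_pi; apply/andP; split; lra.
have : sin (x / 2) ^+ 2 = 0 by lra.
by move/eqP; rewrite sqrf_eq0 => /eqP ->; rewrite ltxx.
Qed.

Lemma root_sum (N : nat) y (d : int) : (0 < N)%N ->
  \sum_(l < N) ei ((y + 2 * pi * l%:R) * d%:~R / N%:R) =
  (if (N %| d)%Z then N%:R * ei (y * d%:~R / N%:R) else 0).
Proof.
move=> N0; have N1 : N%:R != 0 :> R by rewrite pnatr_eq0 -lt0n.
transitivity (\sum_(l < N) ei (y * d%:~R / N%:R) * ei (2 * pi * d%:~R / N%:R) ^+ l).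
  by apply: eq_bigr => l _; rewrite -ei_nat -eiD; congr ei; ring.
rewrite -mulr_sumr; case: ifPn => hd.
  have -> : ei (2 * pi * d%:~R / N%:R) = 1.
    case/dvdzP: hd => c ->; rewrite -[RHS](ei_int2pi c); congr ei.
    by rewrite rmorphM /= -pmulrn; field.
  under eq_bigr do rewrite expr1n.
  by rewrite sumr_const card_ord mulr_natr mulr_natl.
set r := ei (2 * pi * d%:~R / N%:R); have rN : r ^+ N = 1.
  by rewrite /r -ei_nat -[RHS](ei_int2pi d); congr ei; field.
have r1 : r != 1.
  have hr : r = ei (2 * pi * (d %% N)%Z%:~R / N%:R).
    rewrite /r {1}(divz_eq d N) rmorphD rmorphM /= -pmulrn.
    have -> : 2 * pi * ((d %/ N)%Z%:~R * N%:R + (d %% N)%Z%:~R) / N%:R =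
      2 * pi * (d %/ N)%Z%:~R + 2 * pi * (d %% N)%Z%:~R / N%:R :> R by field.
    by rewrite eiD ei_int2pi mul1r.
  rewrite hr; apply: ei_neq1.
  have Np : 0 < N%:R :> R by rewrite ltr0n.
  have m0 : 0 < (d %% N)%Z.
    rewrite lt_def modz_ge0 ?andbT; last by rewrite eqz_nat -lt0n.
    by apply: contraNneq hd => h; apply/dvdz_mod0P.
  have m1 : (d %% N)%Z < N by apply: ltz_pmod.
  have hpi := pi_gt0 R.
  have e0 : 0 < (d %% N)%Z%:~R :> R by rewrite ltr0z.
  have e1 : (d %% N)%Z%:~R < N%:R :> R by rewrite pmulrn ltr_int.
  rewrite divr_gt0 ?mulr_gt0//= ltr_pdivrMr//; nra.
have : (r - 1) * (\sum_(i < N) r ^+ i) = 0 by rewrite -subrX1 rN subrr.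
by move/eqP; rewrite mulf_eq0 subr_eq0 (negPf r1) => /eqP ->; rewrite mulr0.
Qed.

Lemma cos_pow_sum x (M : nat) : (4 ^+ M * cos x ^+ M.*2)%:C =
  \sum_(h < M.*2.+1) ('C(M.*2, h))%:R * ei (2 * x * (M%:R - h%:R)).
Proof.
have -> : (4 ^+ M * cos x ^+ M.*2)%:C = (ei x + ei (- x)) ^+ M.*2.
  have -> : ei x + ei (- x) = (2 * cos x)%:C.
    rewrite !eiE cosN sinN; apply/eqP; rewrite eq_complex /= subrr eqxx andbT.
    by apply/eqP; ring.
  rewrite -rcX exprMn; congr ((_ * _)%:C).
  by rewrite -mul2n exprM; congr (_ ^+ _); ring.
rewrite exprDn; apply: eq_bigr => h _.
rewrite -mulr_natl -!ei_nat -eiD; congr (_ * ei _).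
have hM : (h <= M.*2)%N by rewrite -ltnS.
have eM : (M.*2)%:R = M%:R + M%:R :> R by rewrite -addnn natrD.
by rewrite natrB// eM; ring.
Qed.

Lemma is_sum_natint (f : int -> C) l : (forall n : nat, f (- n.+1%:Z) = 0) ->
  is_sum (fun n : nat => f n) l -> is_sum f l.
Proof.
move=> f0; apply: (@is_sum_extend R nat int Posz absz); first by [].
case=> [n _|n]; first by [].
by rewrite NegzE f0 eqxx.
Qed.

Lemma is_sum_ordint (n : nat) (f : int -> C) :
  (forall i : int, ~~ (0 <= i < n%:Z) -> f i = 0) -> is_sum f (\sum_(i < n) f i).
Proof.
move=> f0; apply: is_sum_natint => [m|]; first by apply: f0; lia.
rewrite -(big_iota_fset (fun i : nat => f i)).
apply: is_sum_fin => i; rewrite seq_fsetE mem_iota add0n /= => h.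
by apply: f0; lia.
Qed.

Definition bz (M : nat) (j : int) : R := if 0 <= j then 'C(M.*2, `|j|%N)%:R else 0.

Lemma bz_rb M (j : int) : bz M (M%:Z - j) = 'C(M.*2, M)%:R * rb R M `|j|%N.
Proof.
rewrite /rb mulrC divfK ?gt_eqF ?binC_gt0// /bz.
case: ifPn => h.
  congr (_%:R); case: (lerP 0 j) => j0.
    rewrite -bin_sub; last by lia.
    by congr ('C(_, _)); lia.
  by congr ('C(_, _)); lia.
by rewrite bin_small//; lia.
Qed.

(** The finite form of Poisson summation: (2 cos)^{2M} is expanded by the binomial theorem, and the
    sum over the N sample points keeps the lattice points congruent to [a] modulo N. Since N = 2L +
    1 is odd, the frequencies l - L are symmetric about 0. *)
Lemma polya (M L : nat) (a : int) y : let N := L.*2.+1 in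
  is_sum (fun n : int => (rb R M (absz (a + N%:Z * n)))%:C * ei (y * n%:~R))
   ((4 ^+ M / 'C(M.*2, M)%:R / N%:R)%:C *
    \sum_(l < N) ei (- a%:~R * ((y + 2 * pi * (l%:R - L%:R)) / N%:R)) *
       (cos ((y + 2 * pi * (l%:R - L%:R)) / (2 * N%:R)) ^+ M.*2)%:C).
Proof.
move=> N; pose b : R := 'C(M.*2, M)%:R; have b0 : b != 0 by rewrite gt_eqF ?binC_gt0.
have N0 : N%:R != 0 :> R by rewrite pnatr_eq0.
have bC0 : b%:C != 0 :> C by rewrite -nc_eq0 nc_real normr_eq0.
have NC0 : N%:R != 0 :> C by rewrite pnatr_eq0.
pose phi (d : int) : C := if (N %| d)%Z then ei (y * d%:~R / N%:R) else 0.
pose T : C := \sum_(h < M.*2.+1) ('C(M.*2, h))%:R * phi (M%:Z - h%:Z - a).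
have hsum : (4 ^+ M / b / N%:R)%:C *
    (\sum_(l < N) ei (- a%:~R * ((y + 2 * pi * (l%:R - L%:R)) / N%:R)) *
       (cos ((y + 2 * pi * (l%:R - L%:R)) / (2 * N%:R)) ^+ M.*2)%:C) = b%:C^-1 * T.
  have e1 : N%:R * T = \sum_(l < N) ei (- a%:~R * ((y + 2 * pi * (l%:R - L%:R)) / N%:R)) *
       (4 ^+ M * cos ((y + 2 * pi * (l%:R - L%:R)) / (2 * N%:R)) ^+ M.*2)%:C.
    under [RHS]eq_bigr do rewrite cos_pow_sum mulr_sumr.
    rewrite exchange_big /= /T mulr_sumr; apply: eq_bigr => h _.
    rewrite mulrCA /phi.
    have := @root_sum N (y - 2 * pi * L%:R) (M%:Z - h%:Z - a) isT.
    have -> : (if (N %| M%:Z - h%:Z - a)%Z then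
       N%:R * ei ((y - 2 * pi * L%:R) * (M%:Z - h%:Z - a)%:~R / N%:R) else 0) =
       N%:R * (if (N %| M%:Z - h%:Z - a)%Z then
       ei (y * (M%:Z - h%:Z - a)%:~R / N%:R) else 0).
      case: ifP => hd; last by rewrite mulr0.
      congr (_ * _); case/dvdzP: hd => c ->; rewrite rmorphM /= -pmulrn.
      have -> : (y - 2 * pi * L%:R) * (c%:~R * N%:R) / N%:R =
        y * (c%:~R * N%:R) / N%:R + 2 * pi * (- (c * L%:Z))%:~R :> R.
        by rewrite rmorphN rmorphM /= -pmulrn; field.
      by rewrite eiD ei_int2pi mulr1.
    move=> <-; rewrite mulr_sumr; apply: eq_bigr => l _.
    rewrite [RHS]mulrCA -eiD; congr (_ * ei _).
    by rewrite !rmorphB /= -!pmulrn; field.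
  have -> : T = N%:R^-1 * (N%:R * T) by rewrite mulKf.
  rewrite e1; under [in RHS]eq_bigr do rewrite rcM mulrCA.
  rewrite -mulr_sumr; set S := \sum_(l < N) _; move: (4 ^+ M : R) => X.
  rewrite (rcM _ N%:R^-1) (rcM X) (rcV b) (rcV N%:R) (rc_nat R N).
  by move: (b%:C^-1) (N%:R^-1 : C) S (X%:C) => u v S' x; ring.
rewrite hsum.
have h1 : is_sum (fun h : int => (bz M h)%:C * phi (M%:Z - h - a)) T.
  have -> : T = \sum_(h < M.*2.+1) (bz M h%:Z)%:C * phi (M%:Z - h%:Z - a).
    by apply: eq_bigr => h _; rewrite /bz /= rc_nat.
  apply: (@is_sum_ordint _ (fun h : int => (bz M h)%:C * phi (M%:Z - h - a))) => h hh.
  rewrite /bz; case: ifP => h0; last by rewrite mul0r.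
  by rewrite bin_small ?mul0r//; lia.
pose s (d : int) : int := M%:Z - a - d.
have sK : cancel s s by move=> d; rewrite /s; lia.
have h2 := is_sum_reindex sK sK h1.
have f_abs : abs_le (fun n : int => b%:C * ((rb R M (absz (a + N%:Z * n)))%:C * ei (y * n%:~R)))
    (\sum_(h < M.*2.+1) ('C(M.*2, h))%:R).
  have hb (j : int) : 0 <= bz M j by rewrite /bz; case: ifP.
  have hA (A : {fset int}) : \sum_(j <- A) bz M j <= \sum_(h < M.*2.+1) ('C(M.*2, h))%:R.
    have hj : is_sum (fun j : int => (bz M j)%:C) (\sum_(h < M.*2.+1) (bz M h%:Z)%:C).
      apply: (@is_sum_ordint _ (fun j : int => (bz M j)%:C)) => h hh.
      rewrite /bz; case: ifP => h0 //.
      by rewrite bin_small//; lia.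
    apply/ler_addgt0Pr => e e0; have [B hB] := hj e e0.
    have := hB (A `|` B)%fset (fsubsetUr _ _); rewrite -!rc_sum -rcB nc_real.
    have := sub_sum_le hb (fsubsetUl A B); rewrite ltr_norml => k1 /andP[_ k2].
    have -> : \sum_(h < M.*2.+1) 'C(M.*2, h)%:R = \sum_(h < M.*2.+1) bz M h by [].
    lra.
  have hi : injective (fun n : int => M%:Z - (a + N%:Z * n)).
    by move=> u v /= /addrI /oppr_inj /addrI; apply: mulfI.
  move=> A; apply: le_trans (hA [fset (M%:Z - (a + N%:Z * n))%R | n in A]%fset).
  rewrite big_imfset//=; last by move=> u v _ _; exact: hi.
  apply: ler_sum => n _; rewrite bz_rb mulrA -rcM ncM nc_ei mulr1.
  by rewrite nc_pos// mulr_ge0 ?rb_ge0 ?ltW ?binC_gt0.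
have h3 := csumP f_abs; set S := csum _ in h3.
have h4 : is_sum (fun i : int => (bz M (s i))%:C * phi (M%:Z - s i - a)) S.
  apply: (@is_sum_extend R int int (fun n => N%:Z * n) (fun d => (d %/ N)%Z)).
  - by move=> n; rewrite mulrC mulzK.
  - move=> d; rewrite /s /phi.
    have -> : M%:Z - (M%:Z - a - d) - a = d by lia.
    case: ifP => hd; last by rewrite mulr0 eqxx.
    by move=> _; rewrite mulrC divzK.
  apply: eq_is_sum h3 => n; rewrite /s /phi.
  have -> : M%:Z - (M%:Z - a - N%:Z * n) - a = N%:Z * n by lia.
  have -> : M%:Z - a - N%:Z * n = M%:Z - (a + N%:Z * n) by lia.
  rewrite dvdz_mulr ?dvdzz// bz_rb rcM mulrA; congr (_ * ei _).
  by rewrite rmorphM /= -pmulrn; field.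
rewrite (is_sum_uniq h2 h4).
by apply: eq_is_sum (is_sumZ b%:C^-1 h3) => n; rewrite mulKf.
Qed.

End Polya.

Section RealLimits.
Variable R : realType.
Variables (T : Type) (F : set_system T).
Context {FF : ProperFilter F}.
Implicit Types (u v : T -> R) (a b : R).

Lemma lim_expR u a : u t @[t --> F] --> a -> expR (u t) @[t --> F] --> expR a.
Proof. by move=> h; apply: continuous_cvg => //; exact: continuous_expR. Qed.
Lemma lim_cos u a : u t @[t --> F] --> a -> cos (u t) @[t --> F] --> cos a.
Proof. by move=> h; apply: continuous_cvg => //; exact: continuous_cos. Qed.
Lemma lim_sin u a : u t @[t --> F] --> a -> sin (u t) @[t --> F] --> sin a.
Proof. by move=> h; apply: continuous_cvg => //; exact: continuous_sin. Qed.
Lemma lim_sqrt u a : u t @[t --> F] --> a -> Num.sqrt (u t) @[t --> F] --> Num.sqrt a.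
Proof. by move=> h; apply: continuous_cvg => //; exact: sqrt_continuous. Qed.
Lemma lim_sq u a : u t @[t --> F] --> a -> (u t) ^+ 2 @[t --> F] --> a ^+ 2.
Proof. by move=> h; apply: cvgM. Qed.
Lemma lim_M u v a b : u t @[t --> F] --> a -> v t @[t --> F] --> b ->
  u t * v t @[t --> F] --> a * b.
Proof. exact: cvgM. Qed.
Lemma lim_Z u a b : u t @[t --> F] --> a -> b * u t @[t --> F] --> b * a.
Proof. by apply: cvgM; exact: cvg_cst. Qed.
Lemma lim_D u v a b : u t @[t --> F] --> a -> v t @[t --> F] --> b ->
  u t + v t @[t --> F] --> a + b.
Proof. exact: cvgD. Qed.
Lemma lim_V u a : a != 0 -> u t @[t --> F] --> a -> (u t)^-1 @[t --> F] --> a^-1.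
Proof. exact: cvgV. Qed.
Lemma lim_div u v a b : b != 0 -> u t @[t --> F] --> a -> v t @[t --> F] --> b ->
  u t / v t @[t --> F] --> a / b.
Proof. by move=> b0 h h'; apply: lim_M => //; exact: lim_V. Qed.
Lemma lim_near u v a : (\forall t \near F, u t = v t) -> u t @[t --> F] --> a ->
  v t @[t --> F] --> a.
Proof. by move=> h; apply: cvg_trans; exact: near_eq_cvg. Qed.
Lemma lim_ei u a : u t @[t --> F] --> a -> cvgc F (fun t => ei (u t)) (ei a).
Proof.
move=> h; rewrite eiE.
have e z w : z +i* w = z%:C + 'i%C * w%:C :> R[i].
  by rewrite [LHS]complexE.
rewrite e; apply: near_cvgc (cvgcD (cvgc_real (lim_cos h)) (cvgcZ 'i%C (cvgc_real (lim_sin h)))).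
by near=> t; rewrite eiE -e.
Unshelve. all: by end_near. Qed.
End RealLimits.
Arguments lim_Z {R T F FF u a} b _.

Section Poisson.
Variable R : realType.
Local Notation C := R[i].
Variables (t alpha : R).
Hypothesis t0 : 0 < t.

Definition NL (L : nat) : R := (L.*2.+1)%:R.
(** The scaling M ~ 2N^2/t makes j^2/M tend to b^2 t/2 when j ~ bN, and M sin^2(x/(2N)) tend to
    x^2/(2t): both Gaussians of the Poisson formula at once. *)
Definition ML (L : nat) : nat := Num.truncn (2 * NL L ^+ 2 / t).
Definition aL (L : nat) : int := Num.floor (alpha * NL L).

Lemma NL_gt0 L : 0 < NL L. Proof. by rewrite ltr0n. Qed.
Lemma NL_ge1 L : 1 <= NL L. Proof. by rewrite ler1n. Qed.

Lemma NL_inv : (NL L)^-1 @[L --> \oo] --> (0 : R).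
Proof.
apply: (squeeze_cvgr _ (cvg_cst 0) cvg_harmonic); near=> L.
rewrite invr_ge0 (ltW (NL_gt0 _)) /= lef_pV2 ?posrE ?NL_gt0 ?ltr0n//.
by rewrite ler_nat ltnS -addnn leq_addr.
Unshelve. all: by end_near. Qed.

Lemma ML_itv L : (ML L)%:R <= 2 * NL L ^+ 2 / t < (ML L)%:R + 1.
Proof.
rewrite natr1; apply: truncn_itv.
by rewrite divr_ge0 ?(ltW t0)// mulr_ge0 ?sqr_ge0.
Qed.

Lemma near_close (u : nat -> R) (x : R) : (forall L, `|u L - x * NL L| <= 1) ->
  u L / NL L @[L --> \oo] --> x.
Proof.
move=> h; apply/cvgrPdist_le => e e0; move/cvgrPdist_le: NL_inv => /(_ e e0).
apply: filterS => L; rewrite sub0r normrN ger0_norm ?invr_ge0 ?(ltW (NL_gt0 _))//.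
apply: le_trans; have -> : x - u L / NL L = - ((u L - x * NL L) / NL L).
  by field; rewrite gt_eqF ?NL_gt0.
rewrite normrN normrM [X in _ * X]gtr0_norm ?invr_gt0 ?NL_gt0//.
by rewrite ler_piMl// invr_ge0 ltW ?NL_gt0.
Qed.

Lemma aL_lim : (aL L)%:~R / NL L @[L --> \oo] --> alpha.
Proof.
apply: near_close => L; have := Num.Theory.floor_le (alpha * NL L).
have := Num.Theory.floorD1_gt (alpha * NL L); rewrite -/(aL L) rmorphD /=.
by rewrite ler_norml => *; apply/andP; split; lra.
Qed.

Lemma ML_lim : (ML L)%:R / NL L ^+ 2 @[L --> \oo] --> 2 / t.
Proof.
apply/cvgrPdist_le => e e0; move/cvgrPdist_le: NL_inv => /(_ e e0).
apply: filterS => L; rewrite sub0r normrN ger0_norm ?invr_ge0 ?(ltW (NL_gt0 _))//.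
apply: le_trans; have /andP[h1 h2] := ML_itv L; have n1 := NL_ge1 L.
have n0 := NL_gt0 L; have n2 : 0 < NL L ^+ 2 by rewrite exprn_gt0.
have -> : 2 / t - (ML L)%:R / NL L ^+ 2 = (2 * NL L ^+ 2 / t - (ML L)%:R) / NL L ^+ 2.
  by field; rewrite !gt_eqF.
rewrite ger0_norm ?divr_ge0 ?subr_ge0 ?(ltW n2)//.
apply: (@le_trans _ _ (1 / NL L ^+ 2)).
  by rewrite ler_wpM2r ?invr_ge0 ?(ltW n2)//; lra.
rewrite div1r lef_pV2 ?posrE// expr2 ler_peMl// ltW//.
Qed.

Lemma ML_large (K : nat) : \forall L \near \oo, (K < ML L)%N.
Proof.
have := @nbhs_infty_ger R ((K.+1)%:R * t); apply: filterS => L hL.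
rewrite truncn_gt_nat ler_pdivlMr//; apply: le_trans hL _.
have n1 := NL_ge1 L; have : L%:R <= NL L by rewrite ler_nat -addnn; lia.
rewrite expr2; nra.
Qed.

Lemma ML_ny : ML L @[L --> \oo] --> \oo.
Proof.
by apply/cvgnyPgt => K; exact: ML_large.
Qed.

Lemma rb_lim (j : nat -> nat) (b : R) : (j L)%:R / NL L @[L --> \oo] --> b ->
  rb R (ML L) (j L) @[L --> \oo] --> expR (- (b ^+ 2 * (t / 2))).
Proof.
move=> hj; have t2 : 2 / t != 0 by rewrite mulf_neq0 ?invr_neq0 ?gt_eqF.
have tt : (2 / t)^-1 = t / 2 by rewrite invf_div.
have h1 : (j L)%:R / (ML L)%:R @[L --> \oo] --> (0 : R).
  (pose proof (lim_M (lim_M hj (lim_V t2 ML_lim)) NL_inv) as HH); move: HH.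
  rewrite mulr0; apply: lim_near; have := ML_large 0; apply: filterS => L M0.
  have m0 : (ML L)%:R != 0 :> R by rewrite pnatr_eq0 -lt0n.
  by have n0 := NL_gt0 L; field; rewrite m0 gt_eqF.
have hq : (j L)%:R ^+ 2 / (ML L)%:R @[L --> \oo] --> b ^+ 2 * (t / 2).
  (pose proof (lim_M (lim_sq hj) (lim_V t2 ML_lim)) as HH); move: HH; rewrite tt.
  apply: lim_near; have := ML_large 0; apply: filterS => L M0.
  have m0 : (ML L)%:R != 0 :> R by rewrite pnatr_eq0 -lt0n.
  by have n0 := NL_gt0 L; field; rewrite m0 gt_eqF.
have jM : \forall L \near \oo, (j L < ML L)%N.
  (pose proof (cvgr_lt _ h1 _ ltr01) as HH); move: HH; apply: filter_app; have := ML_large 0.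
  apply: filterS => L M0; rewrite ltr_pdivrMr ?ltr0n// mul1r ltr_nat.
  exact.
have up : expR (- ((j L)%:R ^+ 2 / (ML L + j L)%:R)) @[L --> \oo] -->
    expR (- (b ^+ 2 * (t / 2))).
  apply: lim_expR; apply: cvgN.
  have o1 : (1 + 0 : R) != 0 by rewrite addr0 oner_neq0.
  (pose proof (lim_div o1 hq (lim_D (cvg_cst (1 : R)) h1)) as HH); move: HH.
  rewrite addr0 divr1; apply: lim_near; have := ML_large 0; apply: filterS => L M0.
  have m0 : 0 < (ML L)%:R :> R by rewrite ltr0n.
  have m1 : 0 < (ML L)%:R + (j L)%:R :> R by rewrite ltr_wpDr.
  by rewrite natrD; field; rewrite !gt_eqF.
have lo : expR (- ((j L)%:R ^+ 2 / (ML L - j L)%:R)) @[L --> \oo] -->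
    expR (- (b ^+ 2 * (t / 2))).
  apply: lim_expR; apply: cvgN.
  have o1 : (1 - 0 : R) != 0 by rewrite subr0 oner_neq0.
  (pose proof (lim_div o1 hq (lim_D (cvg_cst (1 : R)) (cvgN h1))) as HH); move: HH.
  rewrite subr0 divr1; apply: lim_near; have := ML_large 0.
  apply: filter_app; move: jM; apply: filterS => L jM M0.
  have m0 : 0 < (ML L)%:R :> R by rewrite ltr0n.
  have m1 : 0 < (ML L)%:R - (j L)%:R :> R by rewrite subr_gt0 ltr_nat.
  by rewrite natrB ?(ltnW jM)//; field; rewrite !gt_eqF.
apply: (squeeze_cvgr _ lo up); have := ML_large 0.
apply: filter_app; move: jM; apply: filterS => L jM M0.
by rewrite rb_lower//= rb_upper// ltnW.
Qed.

Lemma cos_lim (x : R) : cos (x / (2 * NL L)) ^+ (ML L).*2 @[L --> \oo] -->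
   expR (- (x ^+ 2 / (2 * t))).
Proof.
pose th L := x / (2 * NL L).
have th0 : th L @[L --> \oo] --> (0 : R).
  (pose proof (lim_Z (x / 2) NL_inv) as HH); move: HH; rewrite mulr0; apply: lim_near.
  by near=> L; rewrite /th; field; rewrite gt_eqF ?NL_gt0.
have c1 : cos (th L) ^+ 2 @[L --> \oo] --> (1 : R).
  by (pose proof (lim_sq (lim_cos th0)) as HH); move: HH; rewrite cos0 expr1n.
have small : \forall L \near \oo, `|th L| <= pi / 2.
  have pi2 : 0 < pi / 2 :> R by rewrite divr_gt0 ?pi_gt0.
  move/cvgrPdist_le: th0 => /(_ _ pi2); apply: filterS => L.
  by rewrite sub0r normrN.
have s1 : NL L ^+ 2 * sin (th L) ^+ 2 @[L --> \oo] --> x ^+ 2 / 4.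
  (pose proof (lim_Z (x ^+ 2 / 4) c1) as lo); rewrite mulr1 in lo.
  apply: (squeeze_cvgr _ lo (cvg_cst (x ^+ 2 / 4))).
  move: small; apply: filterS => L hs; have n0 := NL_gt0 L.
  have e : x ^+ 2 / 4 = NL L ^+ 2 * th L ^+ 2 by rewrite /th; field; rewrite gt_eqF.
  rewrite e -mulrA !(ler_pM2l (exprn_gt0 2 n0)).
  have sE : sin (th L) ^+ 2 = sin `|th L| ^+ 2 by rewrite !sin2cos2 cos_norm.
  have tE : th L ^+ 2 = `|th L| ^+ 2 by rewrite real_normK ?num_real.
  rewrite sE tE -(cos_norm (th L)); set u := `|th L| in hs *.
  have u0 : 0 <= u by exact: normr_ge0.
  have hpi := pi_gt0 R.
  have c0 : 0 <= cos u by apply: cos_ge0_pihalf; apply/andP; split; lra.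
  have h1 : u * cos u <= sin u by apply: sin_ge_cos; apply/andP; split; lra.
  have h2 := sin_le_id u0; have h3 : 0 <= u * cos u by rewrite mulr_ge0.
  by rewrite -exprMn !lerXn2r ?nnegrE// (le_trans h3).
have Ms : (ML L)%:R * sin (th L) ^+ 2 @[L --> \oo] --> x ^+ 2 / (2 * t).
  (pose proof (lim_M ML_lim s1) as HH); move: HH.
  have -> : 2 / t * (x ^+ 2 / 4) = x ^+ 2 / (2 * t) by field; rewrite gt_eqF.
  by apply: lim_near; near=> L; field; rewrite gt_eqF ?NL_gt0.
have lo : expR (- ((ML L)%:R * sin (th L) ^+ 2 / cos (th L) ^+ 2)) @[L --> \oo] -->
    expR (- (x ^+ 2 / (2 * t))).
  apply: lim_expR; apply: cvgN; rewrite -[X in _ --> X]divr1.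
  by apply: lim_div => //; rewrite oner_neq0.
(pose proof (lim_expR (cvgN Ms)) as up).
apply: (squeeze_cvgr _ lo up).
have c1' : \forall L \near \oo, cos (th L) != 0.
  (pose proof (cvgr_gt _ c1 _ ltr01) as HH); move: HH; apply: filterS => L; apply: contraTneq => ->.
  by rewrite expr2 mul0r ltxx.
move: c1'; apply: filterS => L c0; rewrite -/(th L) -mul2n exprM.
have e1 : forall z : R, expR (- ((ML L)%:R * z)) = expR (- z) ^+ ML L.
  by move=> z; rewrite -expRM_natl mulrN.
rewrite -mulrA !e1 !lerXn2r ?nnegrE ?expR_ge0 ?sqr_ge0 ?cos2_upper//.
exact: cos2_lower.
Unshelve. all: by end_near. Qed.

End Poisson.

Section PoissonSum.
Variable R : realType.
Local Notation C := R[i].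

Section Fixed.
Variables (t alpha y : R).
Hypothesis t0 : 0 < t.
Local Notation M := (ML t).
Local Notation a := (aL alpha).
Local Notation NN := (@NL R).

Definition pS (n : int) : C := (expR (- (t / 2) * (n%:~R + alpha) ^+ 2))%:C * ei (y * n%:~R).
Definition pD (l : int) : C := ei (- alpha * (y + 2 * pi * l%:~R)) *
  (expR (- ((y + 2 * pi * l%:~R) ^+ 2 / (2 * t))))%:C.

Definition pf (L : nat) (n : int) : C :=
  (rb R (M L) (absz (a L + (L.*2.+1)%:Z * n)))%:C * ei (y * n%:~R).
Definition pFl (L : nat) (l : int) : C :=
  ei (- (a L)%:~R * ((y + 2 * pi * l%:~R) / NN L)) *
       (cos ((y + 2 * pi * l%:~R) / (2 * NN L)) ^+ (M L).*2)%:C.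
Definition pg (L : nat) (l : int) : C := if (- L%:Z <= l <= L%:Z) then pFl L l else 0.
Definition pK (L : nat) : R := 4 ^+ M L / 'C((M L).*2, M L)%:R / NN L.
Definition pG (L : nat) : C := \sum_(l < L.*2.+1) pFl L (l%:Z - L%:Z).

Lemma pS_abs : abs_le pS (gbound (t / 2)).
Proof.
move=> A; apply: le_trans (gauss_fsum_le (- alpha) (divr_gt0 t0 (ltr0Sn _ 1)) A).
by apply: ler_sum => n _; rewrite ncM nc_ei mulr1 nc_pos ?expR_ge0// opprK.
Qed.

Lemma gauss2pi_fsum (c : R) : 0 < c -> forall A : {fset int},
  \sum_(l <- A) expR (- ((y + 2 * pi * l%:~R) ^+ 2 / c)) <= gbound (4 * pi ^+ 2 / c).
Proof.
move=> c0 A; have hpi := pi_gt0 R.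
have h : 0 < 4 * pi ^+ 2 / c :> R by rewrite divr_gt0// mulr_gt0// exprn_gt0.
apply: le_trans (gauss_fsum_le (- (y / (2 * pi))) h A).
apply: ler_sum => l _; rewrite ler_expR le_eqVlt; apply/orP; left; apply/eqP.
by move: (@pi R) hpi => p hp; field; rewrite !gt_eqF.
Qed.

Lemma pD_abs : abs_le pD (gbound (4 * pi ^+ 2 / (2 * t))).
Proof.
move=> A; have t2 : 0 < 2 * t by rewrite mulr_gt0.
apply: le_trans (gauss2pi_fsum t2 A).
by apply: ler_sum => n _; rewrite ncM nc_ei mul1r nc_pos ?expR_ge0.
Qed.

Lemma pf_sum L : is_sum (pf L) ((pK L)%:C * pG L).
Proof.
have := @polya R (M L) L (a L) y; rewrite /pK /pG /pf /NL /=.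
set P := (_%:C * _); set Q := (_%:C * _); suff -> : P = Q by [].
rewrite /P /Q; congr (_ * _); apply: eq_bigr => l _.
by rewrite /pFl /NL rmorphB /= -!pmulrn.
Qed.

Lemma pg_sum L : is_sum (pg L) (pG L).
Proof.
pose f (i : int) := if (0 <= i < (L.*2.+1)%:Z) then pFl L (i - L%:Z) else 0.
have hf : is_sum f (\sum_(i < L.*2.+1) f i).
  by apply: is_sum_ordint => i hi; rewrite /f (negPf hi).
have -> : pG L = \sum_(i < L.*2.+1) f i.
  by apply: eq_bigr => i _; rewrite /f /= ltz_nat ltn_ord.
have hK : cancel (fun l : int => l + L%:Z) (fun l => l - L%:Z) by move=> l; rewrite addrK.
have h'K : cancel (fun l : int => l - L%:Z) (fun l => l + L%:Z) by move=> l; rewrite subrK.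
apply: eq_is_sum (is_sum_reindex hK h'K hf) => l; rewrite /pg /f addrK.
by congr (if _ then _ else _); lia.
Qed.

(** From M + j <= 2M and M <= 2N^2/t the exponent in [rb_upper] is at least (t/4)(n + u)^2, where u
    = a/N; then (n + u)^2 >= n^2/2 - u^2 and |u| <= |alpha| + 1. *)
Definition mf (n : int) : R := expR (t / 4 * (`|alpha| + 1) ^+ 2) *
   expR (- (t / 8) * (n%:~R - 0) ^+ 2).

Lemma aN_bound L : `|(a L)%:~R / NN L| <= `|alpha| + 1.
Proof.
have n1 := NL_ge1 R L; have n0 := NL_gt0 R L.
have h1 := Num.Theory.floor_le (alpha * NN L).
have := Num.Theory.floorD1_gt (alpha * NN L); rewrite -/(a L) rmorphD /= => h2.
have -> : (a L)%:~R / NN L = alpha + ((a L)%:~R - alpha * NN L) / NN L.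
  by field; rewrite gt_eqF.
apply: le_trans (ler_normD _ _) _; rewrite lerD2l normrM [X in _ * X]gtr0_norm ?invr_gt0//.
rewrite ler_pdivrMr// mul1r; apply: le_trans n1; rewrite ler_norml.
by apply/andP; split; lra.
Qed.

Lemma pf_dom : \forall L \near \oo, forall n, nc (pf L n) <= mf n.
Proof.
have := ML_large t0 0; apply: filterS => L M0 n.
rewrite ncM nc_ei mulr1 nc_pos ?rb_ge0//; set j := absz _.
have n0 := NL_gt0 R L; have m0 : 0 < (M L)%:R :> R by rewrite ltr0n.
have jR : (j%:R : R) ^+ 2 = ((a L)%:~R + NN L * n%:~R) ^+ 2.
  have -> : (j%:R : R) = `|(a L)%:~R + NN L * n%:~R|.
    rewrite /j natr_absz intr_norm; congr (`|_|).
    by rewrite rmorphD rmorphM /= -pmulrn.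
  by rewrite real_normK ?num_real.
case: (leqP j (M L)) => jM; last by rewrite rb_big// mulr_ge0 ?expR_ge0.
apply: le_trans (rb_upper R M0 jM) _; rewrite /mf -expRD ler_expR subr0.
set u := (a L)%:~R / NN L; have hu : u ^+ 2 <= (`|alpha| + 1) ^+ 2.
  by rewrite -(real_normK (num_real u)) lerXn2r ?nnegrE ?addr_ge0 ?normr_ge0 ?aN_bound.
have e : ((a L)%:~R + NN L * n%:~R) = NN L * (u + n%:~R).
  by rewrite /u; field; rewrite gt_eqF.
have h1 : t / 4 * (u + n%:~R) ^+ 2 <= j%:R ^+ 2 / (M L + j)%:R.
  rewrite jR e exprMn ler_pdivlMr ?ltr0n ?addn_gt0 ?M0//.
  have h2 : (M L + j)%:R <= 2 * (M L)%:R :> R by rewrite -natrM ler_nat; lia.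
  have /andP[h3 _] := ML_itv t0 L.
  rewrite ler_pdivlMr// in h3.
  have h4 : 0 <= t / 4 * (u + n%:~R) ^+ 2 by rewrite mulr_ge0 ?sqr_ge0// divr_ge0// ltW.
  apply: le_trans (ler_wpM2l h4 h2) _.
  have h5 : 0 <= (u + n%:~R) ^+ 2 by exact: sqr_ge0.
  have h6 := ler_wpM2r h5 h3; lra.
have h7 : 0 <= (n%:~R + 2 * u) ^+ 2 by exact: sqr_ge0.
move: h1 h7 hu; move: (j%:R ^+ 2 / _) (n%:~R : R) => z m; rewrite !expr2 => h1 h7 hu.
have h8 := ler_wpM2l (ltW t0) hu; have h9 := mulr_ge0 (ltW t0) h7.
lra.
Qed.

Lemma mf_sum (A : {fset int}) : \sum_(n <- A) mf n <=
  expR (t / 4 * (`|alpha| + 1) ^+ 2) * gbound (t / 8).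
Proof.
by rewrite -mulr_sumr ler_wpM2l ?expR_ge0// gauss_fsum_le// divr_gt0.
Qed.

Lemma pf_lim n : cvgc \oo (fun L => pf L n) (pS n).
Proof.
apply: cvgcM; last exact: cvgc_cst.
apply: cvgc_real.
have := @rb_lim R t t0 (fun L => absz (a L + (L.*2.+1)%:Z * n)) `|alpha + n%:~R|.
rewrite real_normK ?num_real//.
have -> : - ((alpha + n%:~R) ^+ 2 * (t / 2)) = - (t / 2) * (n%:~R + alpha) ^+ 2 by ring.
have h : `|(a L)%:~R / NN L + n%:~R| @[L --> \oo] --> `|alpha + n%:~R|.
  by apply: cvg_norm; apply: cvgD; [exact: aL_lim|exact: cvg_cst].
apply; apply: lim_near h.
near=> L; rewrite natr_absz intr_norm rmorphD rmorphM /= -pmulrn -/(NL R L).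
rewrite -[X in _ = _ / X]gtr0_norm ?NL_gt0// -normf_div; congr (`|_|).
by field; rewrite gt_eqF ?NL_gt0.
Unshelve. all: by end_near. Qed.

(** The condition on [y] keeps the angle x/(2N) in [-pi/2, pi/2], where |sin u| >= |u|/2. With M >
    N^2/t, eventually true, this yields x^2/(16t), weaker than the limiting exponent x^2/(2t) but
    summable. *)
Lemma pg_dom (ypi : `|y| <= pi) : \forall L \near \oo, forall l,
  nc (pg L l) <= expR (- ((y + 2 * pi * l%:~R) ^+ 2 / (16 * t))).
Proof.
have tt : 1 / t < 2 / t by rewrite ltr_pM2r ?invr_gt0// ltr1n.
pose proof (cvgr_gt _ (ML_lim t0) _ tt) as HH; move: HH; apply: filterS => L hM l.
have n0 := NL_gt0 R L; have hpi := pi_gt0 R.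
rewrite /pg; case: ifPn => [hl|_]; last by rewrite nc0 expR_ge0.
rewrite ncM nc_ei mul1r nc_real -mul2n exprM ger0_norm; last first.
  by apply: exprn_ge0; exact: sqr_ge0.
set x := y + _; set th := x / _.
have hx : `|x| <= pi * NN L.
  apply: le_trans (ler_normD _ _) _.
  have -> : pi * NN L = pi + 2 * pi * L%:R.
    by rewrite /NL -natr1 -addnn natrD; ring.
  apply: lerD => //; rewrite normrM gtr0_norm ?mulr_gt0// ler_wpM2l ?mulr_ge0 ?(ltW hpi)//.
  rewrite -intr_norm pmulrn ler_int; lia.
have hth : `|th| <= pi / 2.
  rewrite /th normrM [X in _ * X]gtr0_norm ?invr_gt0 ?mulr_gt0//.
  rewrite ler_pdivrMr ?mulr_gt0//; apply: le_trans hx _; lra.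
have h1 := sin_ge_half_norm hth.
apply: le_trans (_ : expR (- sin th ^+ 2) ^+ (M L) <= _).
  by rewrite lerXn2r ?nnegrE ?expR_ge0 ?sqr_ge0// cos2_upper.
rewrite -expRM_natl ler_expR mulrN lerN2.
have m0 : 0 <= (M L)%:R :> R by [].
apply: le_trans (ler_wpM2l m0 h1).
rewrite ltr_pdivlMr ?exprn_gt0// in hM.
have e : (M L)%:R * (th ^+ 2 / 4) = (M L)%:R * (x ^+ 2 / (16 * NN L ^+ 2)).
  by rewrite /th; field; rewrite gt_eqF.
rewrite e.
have h2 : 0 <= x ^+ 2 / (16 * NN L ^+ 2) by rewrite divr_ge0 ?sqr_ge0// mulr_ge0 ?sqr_ge0.
apply: le_trans (ler_wpM2r h2 (ltW hM)).
rewrite le_eqVlt; apply/orP; left; apply/eqP; field.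
by rewrite !gt_eqF.
Qed.

Lemma pg_lim l : cvgc \oo (fun L => pg L l) (pD l).
Proof.
apply: (@near_cvgc R _ _ _ (fun L => pFl L l)).
  exists (absz l) => // L /= hL; rewrite /pg ifT//; lia.
apply: cvgcM.
  apply: lim_ei.
  have h : - ((a L)%:~R / NN L) * (y + 2 * pi * l%:~R) @[L --> \oo] -->
      - alpha * (y + 2 * pi * l%:~R).
    by apply: cvgM; [apply: cvgN; exact: aL_lim|exact: cvg_cst].
  apply: lim_near h.
  by near=> L; field; rewrite gt_eqF ?NL_gt0.
by apply: cvgc_real; apply: cos_lim.
Unshelve. all: by end_near. Qed.

Lemma pK_lim (W : R) : cb R M' @[M' --> \oo] --> W ->
  pK L @[L --> \oo] --> W * Num.sqrt (2 / t).
Proof.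
move=> hW.
have h1 : cb R (M L) @[L --> \oo] --> W by apply: cvg_comp (ML_ny t0) hW.
apply: lim_near (lim_M h1 (lim_sqrt (ML_lim t0))).
have := ML_large t0 0; apply: filterS => L M0.
have m0 : 0 < Num.sqrt (M L)%:R :> R by rewrite sqrtr_gt0 ltr0n.
have n0 := NL_gt0 R L; have b0 := binC_gt0 R (M L).
rewrite sqrtrM ?ler0n// sqrtrV ?sqr_ge0// sqrtr_sqr gtr0_norm// /cb /pK.
by field; rewrite !gt_eqF.
Qed.

Lemma poisson_W (ypi : `|y| <= pi) (W : R) : cb R M' @[M' --> \oo] --> W ->
  csum pS = (W * Num.sqrt (2 / t))%:C * csum pD.
Proof.
move=> hW; have t16 : 0 < 16 * t by rewrite mulr_gt0.
have h1 : cvgc \oo (fun L => (pK L)%:C * pG L) (csum pS).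
  apply: (@tannery R _ _ \oo _ pf pS mf
    (expR (t / 4 * (`|alpha| + 1) ^+ 2) * gbound (t / 8))).
  - exact: mf_sum.
  - exact: pf_dom.
  - exact: pf_lim.
  - by near=> L; exact: pf_sum.
  - exact: csumP pS_abs.
have h2 : cvgc \oo pG (csum pD).
  apply: (@tannery R _ _ \oo _ pg pD
    (fun l => expR (- ((y + 2 * pi * l%:~R) ^+ 2 / (16 * t))))
    (gbound (4 * pi ^+ 2 / (16 * t)))).
  - exact: gauss2pi_fsum.
  - exact: pg_dom.
  - exact: pg_lim.
  - by near=> L; exact: pg_sum.
  - exact: csumP pD_abs.
by apply: cvgc_uniq h1 (cvgcM (cvgc_real (pK_lim hW)) h2).
Unshelve. all: by end_near. Qed.
End Fixed.

Lemma is_sum_ge (I : choiceType) (f : I -> R) (l : C) (i : I) :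
  (forall i, 0 <= f i) -> is_sum (fun i => (f i)%:C) l -> f i <= complex.Re l.
Proof.
move=> f0 hf; apply/ler_addgt0Pr => e e0; have [A hA] := hf e e0.
have := hA (i |` A)%fset (fsubsetUr _ _); rewrite -rc_sum => h.
have h1 : f i <= \sum_(j <- (i |` A)%fset) f j.
  by rewrite (big_fsetD1 i) ?fset1U1//= lerDl sumr_ge0.
have := le_lt_trans (normRe _) h; rewrite ReB /= ltr_norml; lra.
Qed.

(** At t = 2 pi, with shift and frequency 0, the two sides of the Poisson formula are the same
    nonzero series, so the constant in front must be 1. *)
Lemma cb_lim_pi : cb R M' @[M' --> \oo] --> Num.sqrt (pi : R).
Proof.
have [W W0 hW'] := @cb_cvg R.
have hW : cb R M' @[M' --> \oo] --> W by have := hW'; rewrite (cvg_shiftS (@cb R)).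
suff <- : W = Num.sqrt pi by [].
have hpi := pi_gt0 R; have t0 : 0 < 2 * pi :> R by rewrite mulr_gt0.
have y0 : `|0 : R| <= pi by rewrite normr0 ltW.
have := @poisson_W (2 * pi) 0 0 t0 y0 W hW.
have -> : pD (2 * pi) 0 0 = pS (2 * pi) 0 0 :> (int -> C).
  apply/funext => n; rewrite /pD /pS oppr0 !mul0r mulrC; congr (_%:C * _).
  by congr expR; move: (@pi R) hpi => p hp; field; rewrite gt_eqF.
have h1 := csumP (@pS_abs (2 * pi) 0 0 t0).
set S := csum _ in h1 *.
have S0 : S != 0.
  have h2 : is_sum (fun n : int => (expR (- (2 * pi / 2) * (n%:~R + 0) ^+ 2))%:C) S.
    by apply: eq_is_sum h1 => n; rewrite /pS mul0r ei0 mulr1.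
  have := @is_sum_ge int _ S 0 _ h2; rewrite addr0 expr2 mulr0 mulr0 expR0 => h3.
  apply: contraTneq (h3 _) => [->|i]; last exact: expR_ge0.
  by rewrite /= -ltNge ltr01.
move=> /esym/(canRL (mulfK S0)); rewrite divff// => /complexI h4.
have e : 2 / (2 * pi) = pi^-1 :> R by move: (@pi R) hpi => p hp; field; rewrite gt_eqF.
rewrite e sqrtrV ?(ltW hpi)// in h4.
have s0 : Num.sqrt pi != 0 :> R by rewrite gt_eqF// sqrtr_gt0.
by rewrite -[LHS](divfK s0) h4 mul1r.
Qed.

(** Completing the square turns the real part of [w] into the shift [alpha] = -Re w / t, while the
    imaginary part becomes the frequency [y] of the real-parameter formula. *)
Lemma poisson (t : R) (w : C) : 0 < t -> `|complex.Im w| <= pi ->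
  Th t w = (Num.sqrt (2 * pi / t))%:C *
    (cexp (w ^+ 2 / (2 * t)%:C) * Th (4 * pi ^+ 2 / t) ((0 +i* (2 * pi / t)) * w)).
Proof.
case: w => u y t0 /= hy; have hpi := pi_gt0 R.
have t1 : 0 < 4 * pi ^+ 2 / t by rewrite divr_gt0// mulr_gt0// exprn_gt0.
have tC : t%:C != 0 :> C by rewrite -nc_eq0 nc_real normr_eq0 gt_eqF.
set w := u +i* y; pose alpha := - u / t.
have [I [i2 wE iE]] : exists I : C, [/\ I * I = -1, w = u%:C + I * y%:C &
    forall x : R, 0 +i* x = I * x%:C].
  exists 'i%C; split; [by rewrite -expr2 sqr_i|by rewrite [LHS]complexE|].
  by move=> x; rewrite [LHS]complexE add0r.
have e1 := @poisson_W t alpha y t0 hy _ cb_lim_pi.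
have sq : Num.sqrt pi * Num.sqrt (2 / t) = Num.sqrt (2 * pi / t).
  by rewrite -sqrtrM ?(ltW hpi)//; congr Num.sqrt; ring.
rewrite sq in e1.
have hS : is_sum (th t w) (cexp (t * alpha ^+ 2 / 2)%:C * csum (pS t alpha y)).
  apply: eq_is_sum (is_sumZ _ (csumP (pS_abs alpha y t0))) => n.
  rewrite /pS /th -cexp_real /ei -!cexpD; congr cexp.
  rewrite wE iE /alpha !intC !(rc_nat, rcM, rcN, rcX, rcV, rcD); field.
  by rewrite ?tC.
have hD : is_sum (th (4 * pi ^+ 2 / t) ((0 +i* (2 * pi / t)) * w))
    (cexp (0 +i* (alpha * y) + (y ^+ 2 / (2 * t))%:C) * csum (pD t alpha y)).
  apply: eq_is_sum (is_sumZ _ (csumP (pD_abs alpha y t0))) => n; rewrite /pD /th -cexp_real /ei -!cexpD; congr cexp.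
  move: (@pi R) => pr; rewrite wE !iE /alpha !intC !(rc_nat, rcM, rcN, rcX, rcV, rcD).
  have -> : I * (2 * pr%:C * t%:C^-1) * (u%:C + I * y%:C) =
    I * (2 * pr%:C * t%:C^-1) * u%:C + (I * I) * (2 * pr%:C * t%:C^-1) * y%:C by ring.
  rewrite i2; field; by rewrite ?tC.
rewrite (is_sum_uniq (ThP w t0) hS) (is_sum_uniq (ThP _ t1) hD) e1.
rewrite [LHS]mulrCA; congr (_ * _); rewrite [RHS]mulrA -cexpD; congr (cexp _ * _).
rewrite wE !iE /alpha !(rc_nat, rcM, rcN, rcX, rcV, rcD).
have -> : (u%:C + I * y%:C) ^+ 2 = u%:C ^+ 2 + 2 * I * u%:C * y%:C +
  (I * I) * y%:C ^+ 2 by ring.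
rewrite i2; field; by rewrite ?tC.
Qed.

End PoissonSum.

Section DualTheta.
Variable R : realType.
Local Notation C := R[i].

Lemma pi_ge2 : 2 <= pi :> R.
Proof. by have := @pihalf_ge1 R; lra. Qed.

Lemma th0 (t : R) (w : C) : th t w 0 = 1.
Proof. by rewrite /th mulr0z expr2 !mulr0 mul0r addr0 cexp0. Qed.

Lemma th_real (t x : R) (n : int) :
  th t x%:C n = (expR (- (t / 2) * n%:~R ^+ 2 + n%:~R * x))%:C.
Proof. by rewrite /th -cexp_real; congr cexp; rewrite intC -rcX -rcN -!rcM -rcD. Qed.

(* Poisson summation takes the argument w at parameter t to dw t w at 4 pi^2/t. *)
Definition dw (t : R) (w : C) : C := (0 +i* (2 * pi / t)) * w.

Lemma Re_dw t w : complex.Re (dw t w) = - (2 * pi / t * complex.Im w).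
Proof. by case: w => a b; rewrite /dw /= mul0r sub0r. Qed.

(** The term of index 0 is 1. A term of index of absolute value n + 1 has exponent at most -(2
    pi/t)(D + n pi) with D = pi - |Im w|. Since t <= 1 the ratio is at most 1/2, so each half line
    contributes at most 2 e^{-2 pi D/t}. *)
Lemma dual_near1 (t : R) (w : C) : 0 < t <= 1 -> `|complex.Im w| <= pi ->
  nc (Th (4 * pi ^+ 2 / t) (dw t w) - 1) <=
    4 * expR (- (2 * pi * (pi - `|complex.Im w|) / t)).
Proof.
move=> /andP[t0 t1] hb; have p2 := pi_ge2; have hpi := pi_gt0 R.
have T0 : 0 < 4 * pi ^+ 2 / t by rewrite divr_gt0// mulr_gt0// exprn_gt0.
set b := complex.Im w in hb *; set D := pi - `|b|.
pose d (n : int) : C := (n == 0)%:R.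
have hd : is_sum d 1.
  have := @is_sum_fin R int (fset1 0) d; rewrite big_seq_fset1 /d eqxx; apply=> i.
  by rewrite inE => /negPf ->.
apply: is_sum_nc_le (is_sumB (ThP (dw t w) T0) hd) _.
pose x : R := expR (- (2 * pi ^+ 2 / t)).
have x0 : 0 <= x by exact: expR_ge0.
have x12 : x <= 1 / 2.
  rewrite /x expRN div1r lef_pV2 ?posrE ?expR_gt0//.
  apply: le_trans (expR_ge1Dx _).
  have : 1 <= 2 * pi ^+ 2 / t by rewrite ler_pdivlMr// expr2; nra.
  lra.
have term (n : nat) (m : int) : absz m = n.+1 ->
    nc (th (4 * pi ^+ 2 / t) (dw t w) m) <= expR (- (2 * pi * D / t)) * x ^+ n.
  move=> hm; rewrite nc_th Re_dw /x -expRM_natl -expRD ler_expR.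
  have m2 : (m%:~R : R) ^+ 2 = n.+1%:R ^+ 2.
    by rewrite -hm natr_absz intr_norm real_normK ?num_real.
  have mb : - (m%:~R * b) <= n.+1%:R * `|b|.
    by rewrite -hm natr_absz intr_norm -normrM -normrN ler_norm.
  have e1 : - (4 * pi ^+ 2 / t / 2) * m%:~R ^+ 2 + m%:~R * - (2 * pi / t * b) =
    2 * pi / t * (- (pi * n.+1%:R ^+ 2) - m%:~R * b).
    by rewrite m2; move: (@pi R) => p; field; rewrite gt_eqF.
  have e2 : - (2 * pi * D / t) + n%:R * - (2 * pi ^+ 2 / t) =
    2 * pi / t * (- D - n%:R * pi) by move: (@pi R) => p; field; rewrite gt_eqF.
  rewrite e1 e2 ler_wpM2l ?divr_ge0 ?mulr_ge0 ?(ltW t0) ?(ltW hpi)//.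
  have n0 : 0 <= n%:R :> R by [].
  have b0 : 0 <= `|b| by [].
  rewrite -natr1 /D in mb *; move: (n%:R : R) n0 mb => N n0 mb.
  have h1 : 0 <= N * (pi - `|b|) by rewrite mulr_ge0// subr_ge0.
  have h2 : 0 <= N * N * pi by rewrite !mulr_ge0// ltW.
  rewrite expr2; nra.
have E0 : 0 <= expR (- (2 * pi * D / t)) by exact: expR_ge0.
have -> : 4 * expR (- (2 * pi * D / t)) =
   2 * expR (- (2 * pi * D / t)) + 2 * expR (- (2 * pi * D / t)) by ring.
have half (g : nat -> int) : (forall n, absz (g n) = n) -> forall A : {fset nat},
    \sum_(i <- A) nc (th (4 * pi ^+ 2 / t) (dw t w) (g i) - d (g i)) <=
    2 * expR (- (2 * pi * D / t)).
  move=> hg; apply: fsum_nat_le => [i|n]; first exact: nc_ge0.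
  case: n => [|n]; first by rewrite big_ord0 mulr_ge0.
  rewrite big_ord_recl /=.
  have -> : g 0%N = 0 by apply/eqP; rewrite -absz_eq0 hg.
  rewrite th0 /d eqxx subrr nc0 add0r.
  apply: (@le_trans _ _ (\sum_(i < n) expR (- (2 * pi * D / t)) * x ^+ i)).
    apply: ler_sum => i _; have gi : g (bump 0 i) != 0.
      by rewrite -absz_eq0 hg.
    by rewrite (negPf gi) subr0; apply: term; rewrite hg.
  rewrite -mulr_sumr mulrC ler_wpM2r//.
  have x1 : 0 <= x < 1 by rewrite x0 /=; lra.
  apply: le_trans (geo_sum_le n x1) _.
  rewrite -[leRHS]invrK lef_pV2 ?posrE ?invr_gt0//; lra.
apply: fsum_int_le => [i|A|A]; first exact: nc_ge0.
  by apply: (half (fun n : nat => n%:Z)).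
by apply: (half (fun n : nat => - n%:Z)) => n; rewrite abszN.
Qed.

(** For imaginary argument the dual argument is real, so all terms are positive and the term of
    index 0 is 1. This keeps the denominator [N1] away from zero. *)
Lemma dual_ge1 (t y : R) : 0 < t -> 1 <= nc (Th (4 * pi ^+ 2 / t) (dw t (0 +i* y))).
Proof.
move=> t0; have hpi := pi_gt0 R.
have T0 : 0 < 4 * pi ^+ 2 / t by rewrite divr_gt0// mulr_gt0// exprn_gt0.
have := ThP (dw t (0 +i* y)) T0; set S := Th _ _ => hS.
have e : dw t (0 +i* y) = (- (2 * pi / t * y))%:C.
  by apply/eqP; rewrite eq_complex /= !mul0r mulr0 sub0r addr0 !eqxx.
rewrite e in hS.
pose f (n : int) : R := expR (- (4 * pi ^+ 2 / t / 2) * n%:~R ^+ 2 + n%:~R * - (2 * pi / t * y)).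
have h2 : is_sum (fun n => (f n)%:C) S.
  by apply: eq_is_sum hS => n; rewrite th_real.
have f0 n : 0 <= f n by exact: expR_ge0.
have := is_sum_ge 0 f0 h2; rewrite /f mulr0z expr0n mulr0 mul0r addr0 expR0 => h.
by apply: le_trans h _; apply: le_trans (normRe _); exact: ler_norm.
Qed.

End DualTheta.

(** * The main estimate on a circle *)

Section CircleMean.
Variable R : realType.
Local Notation C := R[i].

Definition yL (L : nat) (l : nat) : R := 2 * pi * (l%:R - L%:R) / (L.*2.+1)%:R.

(** An average over equidistant points stands in for the integral over the circle; letting [L] grow
    removes the aliased frequencies. *)
Definition cmean (L : nat) (F : R -> C) : C :=
  (L.*2.+1)%:R^-1 * \sum_(l < L.*2.+1) F (yL L l).

Lemma cmean_ei L (d : int) :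
  cmean L (fun y => ei (d%:~R * y)) = if ((L.*2.+1)%:Z %| d)%Z then 1 else 0.
Proof.
rewrite /cmean; set N := L.*2.+1.
have N0 : N%:R != 0 :> R by rewrite pnatr_eq0.
have NC0 : N%:R != 0 :> C by rewrite pnatr_eq0.
have := @root_sum R N (- (2 * pi * L%:R)) d isT.
have -> : \sum_(l < N) ei ((- (2 * pi * L%:R) + 2 * pi * l%:R) * d%:~R / N%:R) =
   \sum_(l < N) ei (d%:~R * yL L l).
  apply: eq_bigr => l _; congr ei; rewrite /yL -/N.
  by move: (@pi R) => p; field.
move=> ->; case: ifP => hd; last by rewrite mulr0.
rewrite mulKf//; case/dvdzP: hd => c ->; rewrite rmorphM /= -pmulrn.
have -> : - (2 * pi * L%:R) * (c%:~R * N%:R) / N%:R = 2 * pi * (- (c * L%:Z))%:~R :> R.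
  by rewrite rmorphN rmorphM /= -pmulrn; move: (@pi R) => p; field.
exact: ei_int2pi.
Qed.

(* Mean value over the roots of unity extracts the terms of frequency 0. *)
Lemma cmean_lim (I : choiceType) (f : I -> C) (d : I -> int) (F : R -> C) K :
  abs_le f K -> (forall y, is_sum (fun i => f i * ei ((d i)%:~R * y)) (F y)) ->
  cvgc \oo (fun L => cmean L F) (csum (fun i => if d i == 0 then f i else 0)).
Proof.
move=> fK hF.
have h0 : abs_le (fun i => if d i == 0 then f i else 0) K.
  by apply: abs_leS fK => i; case: ifP; rewrite ?nc0 ?nc_ge0.
apply: (@tannery R I nat \oo _ (fun L i =>
   f i * (if ((L.*2.+1)%:Z %| d i)%Z then 1 else 0))
   (fun i => if d i == 0 then f i else 0) (fun i => nc (f i)) K).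
- exact: fK.
- near=> L => i; case: ifP; rewrite ?mulr1 ?mulr0 ?nc0 ?nc_ge0//.
- move=> i; case: eqP => [->|/eqP di].
    apply: near_cvgc (cvgc_cst _); near=> L; by rewrite dvdz0 mulr1.
  apply: near_cvgc (cvgc_cst _); exists (absz (d i)) => // L /= hL.
  rewrite ifF ?mulr0//; apply/negP => /dvdzP[c hc]; move: di hL; rewrite hc.
  rewrite abszM; case: (eqVneq c 0) => [->|c0]; first by rewrite mul0r eqxx.
  move=> _; have c1 : (0 < `|c|)%N by rewrite absz_gt0.
  by rewrite leqNgt -addnn; nia.
- near=> L; rewrite /cmean mulr_sumr.
  have h (l : nat) := is_sumZ (L.*2.+1)%:R^-1 (hF (yL L l)).
  have hs (n : nat) : is_sum (fun i => \sum_(l < n) (L.*2.+1)%:R^-1 *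
      (f i * ei ((d i)%:~R * yL L l))) (\sum_(l < n) (L.*2.+1)%:R^-1 * F (yL L l)).
    elim: n => [|n IH].
      by rewrite big_ord0; apply: eq_is_sum (@is_sum0 R I) => i; rewrite big_ord0.
    rewrite big_ord_recr /=; apply: eq_is_sum (is_sumD IH (h n)) => i.
    by rewrite big_ord_recr.
  apply: eq_is_sum (hs L.*2.+1) => i; rewrite -cmean_ei /cmean mulrCA !mulr_sumr.
  by apply: eq_bigr => l _; rewrite mulrCA.
- exact: csumP h0.
Unshelve. all: by end_near. Qed.

Lemma nc_cmean_le L F (m : R -> R) : (forall l, (l < L.*2.+1)%N -> nc (F (yL L l)) <= m (yL L l)) ->
  nc (cmean L F) <= (L.*2.+1)%:R^-1 * \sum_(l < L.*2.+1) m (yL L l).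
Proof.
move=> h; rewrite /cmean ncM ncV.
have -> : nc ((L.*2.+1)%:R : C) = (L.*2.+1)%:R by rewrite -rc_nat nc_pos.
rewrite ler_wpM2l ?invr_ge0//; apply: le_trans (nc_sum _ _ _) _.
by apply: ler_sum => l _; apply: h.
Qed.

Lemma yL_bound L l : (l < L.*2.+1)%N -> `|yL L l| <= pi.
Proof.
move=> hl; have hpi := pi_gt0 R; have N0 : 0 < (L.*2.+1)%:R :> R by rewrite ltr0n.
rewrite /yL normrM [X in _ * X]gtr0_norm ?invr_gt0// ler_pdivrMr//.
rewrite normrM gtr0_norm ?mulr_gt0//.
have h : `|l%:R - L%:R| <= L%:R :> R.
  rewrite ler_norml; apply/andP; split.
    by rewrite lerBrDl subrr.
  by rewrite lerBlDr -natrD ler_nat addnn -ltnS.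
have : (L.*2.+1)%:R = 2 * L%:R + 1 :> R by rewrite -natr1 -addnn natrD; ring.
nra.
Qed.

End CircleMean.

Section ProductBound.
Variable R : realType.

Lemma bin_le2 n m : ('C(n, m) <= 2 ^ n)%N.
Proof.
elim: n m => [|n IH] [|m]; rewrite ?bin0 ?expn_gt0// ?bin0n//.
by rewrite binS expnS mul2n -addnn leq_add.
Qed.

Lemma prod_bin (m n : nat) :
  \prod_(i < n) (1 + m%:R / i.+1%:R) = 'C(m + n, n)%:R :> R.
Proof.
elim: n => [|n IH]; first by rewrite big_ord0 bin0.
rewrite big_ord_recr /= IH.
have : ((m + n).+1 * 'C(m + n, n) = n.+1 * 'C((m + n).+1, n.+1))%N by exact: mul_bin_diag.
move/(congr1 (fun x => x%:R : R)); rewrite !natrM -addnS => h.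
have n0 : n.+1%:R != 0 :> R by rewrite pnatr_eq0.
apply: (mulfI n0); rewrite -h natrD.
by move: (n.+1%:R : R) n0 => u n0; field.
Qed.

(** The infinite product is sinh(pi x)/(pi x); a crude exponential bound is enough. Put m = floor x
    + 1. The first m factors are at most (1 + m/i)^2, whose product C(2m,m)^2 is at most e^{4m}; the
    later ones telescope to at most e^{x^2/m} <= e^m. Finally m <= x + 1. *)
Lemma prod_sq_bound (x : R) n : 0 <= x ->
  \prod_(i < n) (1 + x ^+ 2 / i.+1%:R ^+ 2) <= expR (5 * (x + 1)).
Proof.
move=> x0; pose m := (Num.truncn x).+1.
have /andP[m1 m2] := truncn_itv x0.
have xm : x <= m%:R by exact: ltW.
have mx : m%:R <= x + 1 by rewrite -natr1 lerD2r.
have m0 : 0 < m%:R :> R by rewrite ltr0n.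
have tail (j : nat) : \prod_(i < j) (1 + x ^+ 2 / (m + i).+1%:R ^+ 2) <=
    expR (x ^+ 2 * (m%:R^-1 - (m + j)%:R^-1)).
  elim: j => [|j IH]; first by rewrite big_ord0 addn0 subrr mulr0 expR0.
  rewrite big_ord_recr /=.
  have d0 : 0 < (m + j)%:R :> R by rewrite ltr0n.
  have d1 : 0 < (m + j).+1%:R :> R by rewrite ltr0n.
  apply: le_trans (_ : expR (x ^+ 2 * (m%:R^-1 - (m + j)%:R^-1)) *
      expR (x ^+ 2 / (m + j).+1%:R ^+ 2) <= _).
    apply: ler_pM => //; first by apply: prodr_ge0 => i _; rewrite addr_ge0 ?divr_ge0 ?sqr_ge0.
      by rewrite addr_ge0 ?divr_ge0 ?sqr_ge0.
    exact: expR_ge1Dx.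
  rewrite -expRD ler_expR addnS -mulrDr ler_wpM2l ?sqr_ge0//.
  rewrite -addrA lerD2l -subr_ge0.
  have e : (m + j).+1%:R = (m + j)%:R + 1 :> R by rewrite natr1.
  rewrite e; rewrite e in d1; move: ((m + j)%:R : R) d0 d1 => u d0 d1.
  have -> : - (u + 1)^-1 - (- u^-1 + (u + 1) ^- 2) = (u * (u + 1) ^+ 2)^-1.
    by field; rewrite !gt_eqF.
  by rewrite invr_ge0 mulr_ge0 ?sqr_ge0// ltW.
have head : \prod_(i < m) (1 + x ^+ 2 / i.+1%:R ^+ 2) <= expR (4 * m%:R).
  apply: (@le_trans _ _ ((\prod_(i < m) (1 + m%:R / i.+1%:R)) ^+ 2)).
    rewrite -prodrXl; apply: ler_prod => i _.
    rewrite addr_ge0 ?divr_ge0 ?sqr_ge0//=.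
    have v0 : 0 <= m%:R / i.+1%:R :> R by rewrite divr_ge0.
    have hv : x ^+ 2 / i.+1%:R ^+ 2 <= (m%:R / i.+1%:R) ^+ 2.
      by rewrite expr_div_n ler_wpM2r ?invr_ge0 ?sqr_ge0// lerXn2r ?nnegrE// ltW.
    apply: (@le_trans _ _ (1 + (m%:R / i.+1%:R) ^+ 2)); first by rewrite lerD2l.
    by move: (m%:R / _) v0 => v v0; rewrite !expr2; nra.
  rewrite prod_bin.
  have h : 'C(m + m, m)%:R <= expR (2 * m%:R) :> R.
    apply: (@le_trans _ _ ((2 ^ (m + m))%N%:R)); first by rewrite ler_nat bin_le2.
    have -> : 2 * m%:R = (m + m)%:R * 1 :> R by rewrite natrD; ring.
    rewrite expRM_natl natrX lerXn2r ?nnegrE ?expR_ge0//.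
    by apply: le_trans (expR_ge1Dx _); lra.
  have -> : 4 * m%:R = (2 * m%:R) * 2 :> R by ring.
  by rewrite (expRM_natr 2) lerXn2r ?nnegrE ?expR_ge0.
have mono (j : nat) : \prod_(i < n) (1 + x ^+ 2 / i.+1%:R ^+ 2) <=
    \prod_(i < n + j) (1 + x ^+ 2 / i.+1%:R ^+ 2).
  elim: j => [|j IH]; first by rewrite addn0.
  apply: le_trans IH _; rewrite addnS big_ord_recr /= ler_peMr//.
    by apply: prodr_ge0 => i _; rewrite addr_ge0 ?divr_ge0 ?sqr_ge0.
  by rewrite lerDl divr_ge0 ?sqr_ge0.
apply: le_trans (mono m) _; rewrite addnC big_split_ord /=.
apply: le_trans (_ : expR (4 * m%:R) * expR (x ^+ 2 * (m%:R^-1 - (m + n)%:R^-1)) <= _).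
  apply: ler_pM => //; [| |exact: tail];
  by apply: prodr_ge0 => i _; rewrite addr_ge0 ?divr_ge0 ?sqr_ge0.
rewrite -expRD ler_expR.
have h1 : x ^+ 2 * (m%:R^-1 - (m + n)%:R^-1) <= m%:R.
  apply: (@le_trans _ _ (m%:R ^+ 2 * m%:R^-1)); last by rewrite expr2 mulfK ?gt_eqF.
  apply: ler_pM; rewrite ?sqr_ge0 ?subr_ge0 ?lef_pV2 ?posrE ?ltr0n// ?ler_nat ?leq_addr//.
    by rewrite lerXn2r ?nnegrE// ltW.
  by rewrite gerBl invr_ge0.
lra.
Qed.
End ProductBound.

Section Circle.
Variable R : realType.
Local Notation C := R[i].

Definition tlo (k : nat) (s : R) : R := k%:R * s.
Definition thi (k : nat) (s : R) : R := k.+1%:R * s.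
Definition tpr (k : nat) (s : R) : R := k%:R * k.+1%:R * s.

Lemma is_sum_geo (x : C) : nc x < 1 -> is_sum (fun n => x ^+ n) (1 - x)^-1.
Proof.
move=> x1; have ab : abs_le (fun n => x ^+ n) (1 - nc x)^-1.
  apply: abs_le_nat => n; under eq_bigr do rewrite ncX.
  by apply: geo_sum_le; rewrite nc_ge0.
have h := csumP ab; set S := csum _ in h.
have x0 : 1 - x != 0.
  by apply: contraTneq x1 => /eqP; rewrite subr_eq0 => /eqP <-; rewrite nc1 ltxx.
have hd : is_sum (fun n : nat => (n == 0%N)%:R : C) 1.
  have := @is_sum_fin R nat (fset1 0%N) (fun n : nat => (n == 0%N)%:R : C).
  by rewrite big_seq_fset1 eqxx; apply=> i; rewrite inE => /negPf ->.
have h2 := is_sumB h (is_sum_shift (is_sumZ x h)).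
have : S - x * S = 1.
  apply: is_sum_uniq h2 _; apply: eq_is_sum hd => -[|n]; rewrite ?expr0 ?subr0//.
  by rewrite exprS subrr.
by rewrite -{1}[S]mul1r -mulrBl => /(canRL (mulKf x0)); rewrite mulr1 => <-.
Qed.

(** The quadratic terms in v agree because 1/(K(K+1)S) + 1/((K+1)S) = 1/(KS), so the Gaussian
    factors of the three theta functions leave only the constant S/8. *)
Lemma exponent_identity (K S v : C) : K != 0 -> K + 1 != 0 -> S != 0 ->
  v + (- v) ^+ 2 / (2 * (K * (K + 1) * S)) +
  (- v + (K + 1) * S / 2) ^+ 2 / (2 * ((K + 1) * S)) =
  S / 8 + (v + K * S / 2) ^+ 2 / (2 * (K * S)).
Proof. by move=> h1 h2 h3; field; rewrite ?h1 ?h2 ?h3. Qed.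

Lemma circle_algebra (T h b q1 q2 c a l g z x : C) : b * c = 1 -> l * g = 1 -> z * x = 1 ->
  T * (h * b) * (q1 * (c * a)) * (1 + z) * q2 =
  q1 * (a * l) * (z * T * (q2 * ((1 + x) * g * h))).
Proof.
move=> bc lg zx.
transitivity (T * h * q1 * a * q2 * (1 + z) * (b * c)); first by ring.
transitivity (q1 * a * T * q2 * h * (z + z * x) * (l * g)); last by ring.
by rewrite bc lg zx; ring.
Qed.

Lemma circle_algebra' (q1 q2 B E N z T : C) : q2 != 0 -> 1 + z != 0 ->
  q1 * B * (E * N * T) = q1 / q2 * E * N * (B / (1 + z)) * T * (1 + z) * q2.
Proof. by move=> h1 h2; field; rewrite h1 h2. Qed.

Variables (k : nat) (s : R).
Hypothesis k0 : (0 < k)%N.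
Hypothesis s0 : 0 < s.

Local Notation t1 := (tlo k s).
Local Notation t2 := (thi k s).
Local Notation tA := (tpr k s).
Local Notation p1 := (expR (- t1)).
Local Notation p2 := (expR (- t2)).

Lemma kr0 : 0 < k%:R :> R. Proof. by rewrite ltr0n. Qed.
Lemma t10 : 0 < t1. Proof. by rewrite mulr_gt0 ?kr0. Qed.
Lemma t20 : 0 < t2. Proof. by rewrite mulr_gt0 ?ltr0n. Qed.
Lemma tA0 : 0 < tA. Proof. by rewrite !mulr_gt0 ?kr0 ?ltr0n. Qed.

(** A logarithm of the point of argument [y] on the circle of radius e^{-ks/2}; adding [t1 / 2], as
    Jacobi's formula does, makes it purely imaginary. *)
Definition wy (y : R) : C := (- (t1 / 2)) +i* y.
(** [Hz] is the generating function of the c_n, valid for |z| < 1. [Bz] is the slowly varying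
    factor, a function of x = 1/z, made of the halves of the triple products that [Hz] lacks. *)
Definition Hz (z : C) : C := Ep t2 (p2%:C * z) * Lp t1 (- z).
Definition Bz (x : C) : C := Ep t1 (p1%:C * x) * Lp t2 (- (p2%:C * x)).
(** The square roots of the three Poisson summations together with the exponential left over by
    [exponent_identity]. *)
Definition E0 : R := Num.sqrt (2 * pi / tA) * Num.sqrt (2 * pi / t2) /
   Num.sqrt (2 * pi / t1) * expR (s / 8).
Definition NA (y : R) := Th (4 * pi ^+ 2 / tA) (dw tA (- wy y)).
Definition N2 (y : R) := Th (4 * pi ^+ 2 / t2) (dw t2 (- wy y + (t2 / 2)%:C)).
Definition N1 (y : R) := Th (4 * pi ^+ 2 / t1) (dw t1 (0 +i* y)).

Lemma sqrt_gt0_pi (t : R) : 0 < t -> 0 < Num.sqrt (2 * pi / t).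
Proof. by move=> t0; rewrite sqrtr_gt0 divr_gt0// mulr_gt0// pi_gt0. Qed.

Lemma E0_gt0 : 0 < E0.
Proof.
by rewrite !(mulr_gt0, divr_gt0, invr_gt0) ?expR_gt0 ?sqrt_gt0_pi ?tA0 ?t10 ?t20.
Qed.

Lemma t1Dt2 : t2 = t1 + s.
Proof. by rewrite /thi /tlo -natr1; ring. Qed.

Lemma nc_cexp_wy y : nc (cexp (wy y)) = expR (- (t1 / 2)).
Proof. by rewrite nc_cexp. Qed.

Lemma expRt1 : expR (- (t1 / 2)) < 1.
Proof. by rewrite expR_lt1 oppr_lt0 divr_gt0 ?t10. Qed.

Lemma onez_neq0 y : 1 + cexp (wy y) != 0.
Proof.
rewrite addrC -[1]opprK subr_eq0; apply: contraTneq expRt1 => h.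
by rewrite -(nc_cexp_wy y) h ncN nc1 ltxx.
Qed.

Lemma N1_neq0 y : N1 y != 0.
Proof. by rewrite -nc_gt0; apply: lt_le_trans (dual_ge1 y t10). Qed.

Lemma rc_neq0 (x : R) : 0 < x -> x%:C != 0 :> C.
Proof. by move=> x0; rewrite -nc_eq0 nc_real normr_eq0 gt_eqF. Qed.

Lemma circle_identity y : `|y| <= pi ->
  Th tA (- wy y) * Hz (cexp (wy y)) =
  (qinf t1 / qinf t2 * E0)%:C * (NA y * N2 y / N1 y) *
    (Bz (cexp (- wy y)) / (1 + cexp (wy y))).
Proof.
move=> hy; have T1 := t10; have T2 := t20; have TA := tA0.
have e12 := t1Dt2.
set w := wy y; set z := cexp w; set x := cexp (- w).
have zx : z * x = 1 by rewrite -cexpD subrr cexp0.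
have J1 : Th t1 (0 +i* y) = (qinf t1)%:C * (Ep t1 z * Ep t1 (p1%:C * x)).
  have -> : 0 +i* y = w + (t1 / 2)%:C.
    by apply/eqP; rewrite eq_complex /= addrC subrr addr0 !eqxx.
  by apply: (jacobi T1); rewrite /w /=; lra.
have J2 : Th t2 (- w + (t2 / 2)%:C) = (qinf t2)%:C * (Ep t2 x * Ep t2 (p2%:C * z)).
  have := jacobi T2 (W := - w); rewrite opprK; apply.
  by rewrite /w /= opprK; lra.
have hy' : `|- y| <= pi by rewrite normrN.
have P1 := poisson (w := 0 +i* y) T1 hy.
have P2 := poisson (w := - w + (t2 / 2)%:C) T2.
have PA := poisson (w := - w) TA.
rewrite /= in P2 PA; have {P2}P2 := P2 _; have {PA}PA := PA hy'.
have hyy : `|- y + 0| <= pi by rewrite addr0.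
have {P2}P2 := P2 hyy.
have L1 : Lp t1 (- z) * Ep t1 z = 1.
  by have := Lp_Ep T1 (z := - z); rewrite opprK; apply; rewrite ncN nc_cexp_wy expRt1.
have L2 : Lp t2 (- (p2%:C * x)) * Ep t2 (p2%:C * x) = 1.
  have := Lp_Ep T2 (z := - (p2%:C * x)); rewrite opprK; apply.
  have ew : complex.Re (- w) = t1 / 2 by rewrite ReN /w /= opprK.
  rewrite ncN ncM nc_pos ?expR_ge0// /x nc_cexp ew -expRD expR_lt1.
  rewrite addrC subr_lt0; apply: (@lt_trans _ _ t1); first by lra.
  by rewrite e12 ltrDl.
have E2 : Ep t2 x = (1 + x) * Ep t2 (p2%:C * x) by rewrite (Ep_funE T2) [x * _]mulrC.
have q1 := rc_neq0 (qinf_gt0 T1); have q2 := rc_neq0 (qinf_gt0 T2).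
have Q1 : Num.sqrt (2 * pi / t1) != 0 by rewrite gt_eqF ?sqrt_gt0_pi.
have hE : z * Th tA (- w) * Th t2 (- w + (t2 / 2)%:C) =
    E0%:C * (NA y * N2 y / N1 y) * Th t1 (0 +i* y).
  rewrite P1 P2 PA -/(dw tA (- w)) -/(dw t2 (- w + (t2 / 2)%:C)) -/(dw t1 (0 +i* y)).
  rewrite -/(NA y) -/(N2 y) -/(N1 y) /E0.
  have n1 := N1_neq0 y.
  have ex : z * cexp ((- w) ^+ 2 / (2 * tA)%:C) * cexp ((- w + (t2 / 2)%:C) ^+ 2 / (2 * t2)%:C) =
      (expR (s / 8))%:C * cexp ((0 +i* y) ^+ 2 / (2 * t1)%:C).
    rewrite /z -cexp_real -!cexpD; congr cexp.
    have -> : 0 +i* y = w + (t1 / 2)%:C.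
      by apply/eqP; rewrite eq_complex /= addrC subrr addr0 !eqxx.
    have kC : k%:R != 0 :> C by rewrite pnatr_eq0 -lt0n.
    have kC1 : k.+1%:R != 0 :> C by rewrite pnatr_eq0.
    have sC : s%:C != 0 :> C by exact: rc_neq0.
    rewrite /tlo /thi /tpr !(rc_nat, rcM, rcV).
    by rewrite -natr1 in kC1 *; exact: exponent_identity.
  move: ex; set c1 := cexp (_ / (2 * tA)%:C); set c2 := cexp (_ / (2 * t2)%:C).
  set c3 := cexp (_ / (2 * t1)%:C) => ex.
  rewrite !(rcM, rcV).
  transitivity ((Num.sqrt (2 * pi / tA))%:C * (Num.sqrt (2 * pi / t2))%:C * (z * c1 * c2) * NA y * N2 y).
    by ring.
  rewrite ex; field; rewrite n1 /=; exact: rc_neq0 (sqrt_gt0_pi T1).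
have Th1n : Th t1 (0 +i* y) != 0.
  rewrite P1 -/(dw t1 (0 +i* y)) -/(N1 y).
  by rewrite mulf_neq0 ?(rc_neq0 (sqrt_gt0_pi T1))// mulf_neq0 ?cexp_neq0 ?N1_neq0.
have z1 := onez_neq0 y; rewrite -/w -/z in z1.
apply: (mulIf Th1n); apply: (mulIf z1); apply: (mulIf q2).
rewrite rcM [(qinf t1 / qinf t2)%:C]rcM rcV.
transitivity ((qinf t1)%:C * Bz x * (z * Th tA (- w) * Th t2 (- w + (t2 / 2)%:C))).
  rewrite J1 J2 E2 /Hz /Bz; exact: circle_algebra L1 L2 zx.
rewrite hE; exact: circle_algebra'.
Qed.

End Circle.

(** * Growth of the slowly varying factor away from the negative axis *)

Section Bounds.
Variable R : realType.
Local Notation C := R[i].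

Lemma expR_sinh (u : R) : 0 <= u -> 2 * u <= expR u - expR (- u).
Proof.
move=> u0; pose f (x : R) := expR x - expR (- x) - 2 * x.
pose df (x : R) := expR x + expR (- x) - 2.
have dfP (x : R) : is_derive x (1:R) f (df x).
  have h1 : is_derive x 1 (fun x : R => expR (- x)) (- expR (- x)).
    have d1 : is_derive x (1:R) -%R (- 1 : R) by exact: is_deriveN.
    have d2 : is_derive (- x) (1:R) expR (expR (- x)) by exact: is_derive_expR.
    have h := is_derive1_comp d2 d1.
    by apply: (@is_derive_eq _ _ _ _ _ _ _ _ h); rewrite ?mulrN1 ?mulN1r ?scaleN1r.
  rewrite /f /df.
  have -> : expR x + expR (- x) - 2 = expR x - (- expR (- x)) - 2 * 1.
    by rewrite opprK mulr1.
  apply: is_deriveB.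
have cf : {within `[0, u], continuous f}.
  apply: derivable_within_continuous => x _; exact: ex_derive.
have [c _ h] := MVT_segment u0 (fun x _ => dfP x) cf.
have f0 : f 0 = 0 by rewrite /f oppr0 subrr mulr0 subrr.
have dc : 0 <= df c.
  rewrite /df; have := expR_gt0 c; rewrite expRN => hc.
  have -> : expR c + (expR c)^-1 - 2 = (expR c - 1) ^+ 2 / expR c.
    by field; rewrite gt_eqF.
  by rewrite divr_ge0 ?sqr_ge0// ltW.
have : 0 <= f u by move: h; rewrite f0 !subr0 => ->; rewrite mulr_ge0.
rewrite /f; lra.
Qed.

Lemma nc_sq (a b : R) : nc (a +i* b) ^+ 2 = a ^+ 2 + b ^+ 2.
Proof. by rewrite /nc /= sqr_sqrtr// addr_ge0 ?sqr_ge0. Qed.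

Lemma nc_1Dx (x y : R) : nc (1 + x%:C * ei y) ^+ 2 = (1 - x) ^+ 2 + 2 * x * (1 + cos y).
Proof.
rewrite eiE.
have -> : 1 + x%:C * (cos y +i* sin y) = (1 + x * cos y) +i* (x * sin y).
  by apply/eqP; rewrite eq_complex /= !mul0r subr0 addr0 add0r !eqxx.
rewrite nc_sq exprMn sin2cos2; ring.
Qed.

(** Unrelated to the Wright function: this is |1 + x e^{iy}|^2 / (1 - x)^2, a factor of an Euler
    product relative to its value at argument pi. This form shows that it increases with x. *)
Definition phi (y x : R) : R := 1 + 2 * (1 + cos y) * (x / (1 - x) ^+ 2).

Lemma cos1_ge0 (y : R) : 0 <= 1 + cos y.
Proof. by have := cos_geN1 y; lra. Qed.

Lemma phi_ge1 (y x : R) : 0 <= x -> 1 <= phi y x.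
Proof.
move=> x0; rewrite /phi lerDl; apply: mulr_ge0; first by rewrite mulr_ge0 ?cos1_ge0.
by rewrite divr_ge0 ?sqr_ge0.
Qed.

Lemma phiE (y x : R) : x < 1 -> nc (1 + x%:C * ei y) ^+ 2 = (1 - x) ^+ 2 * phi y x.
Proof.
move=> x1; rewrite nc_1Dx /phi; field.
by rewrite subr_eq0 gt_eqF.
Qed.

Lemma phi_le (y x x' : R) : 0 <= x -> x <= x' -> x' < 1 -> phi y x <= phi y x'.
Proof.
move=> x0 xx x1; rewrite /phi lerD2l ler_wpM2l ?mulr_ge0 ?cos1_ge0//.
have h1 : 0 < 1 - x by lra.
have h2 : 0 < 1 - x' by lra.
apply: ler_pM => //; first by rewrite invr_ge0 sqr_ge0.
rewrite lef_pV2 ?posrE ?exprn_gt0//.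
by apply: lerXn2r; rewrite ?nnegrE ?(ltW h1) ?(ltW h2)// lerD2l lerN2.
Qed.

Lemma cosD_le (y : R) : `|y| <= pi -> 2 * (1 + cos y) <= (pi - `|y|) ^+ 2.
Proof.
move=> hy; set D := pi - `|y|; have D0 : 0 <= D by rewrite subr_ge0.
have -> : cos y = - cos D.
  rewrite -cos_norm /D; have -> : pi - `|y| = - `|y| + pi by rewrite addrC.
  by rewrite cosDpi cosN opprK.
have -> : cos D = 1 - 2 * sin (D / 2) ^+ 2.
  have e : D = (D / 2) *+ 2 by rewrite -mulr_natl; field.
  by rewrite {1}e cos_mulr2n cos2sin2 -mulr_natl; ring.
have h := @sin_le_id R (D / 2) (divr_ge0 D0 (ler0n _ 2)).
have hpi := pi_gt0 R.
have h0 : 0 <= sin (D / 2).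
  apply: sin_ge0_pi; apply/andP; split; first by rewrite divr_ge0.
  have := normr_ge0 y; rewrite /D; lra.
have : sin (D / 2) ^+ 2 <= (D / 2) ^+ 2 by rewrite lerXn2r ?nnegrE// (le_trans h0).
have -> : (D / 2) ^+ 2 = D ^+ 2 / 4 by field.
lra.
Qed.

(** At x = e^{-e} the quotient x/(1-x)^2 is 1/(2 sinh(e/2))^2, hence at most 1/e^2; and 2(1 + cos y)
    = 4 sin^2((pi - |y|)/2). *)
Lemma phi_bound (y e : R) : `|y| <= pi -> 0 < e ->
  phi y (expR (- e)) <= 1 + (pi - `|y|) ^+ 2 / e ^+ 2.
Proof.
move=> hy e0; rewrite /phi lerD2l; apply: ler_pM.
- by rewrite mulr_ge0 ?cos1_ge0.
- by rewrite divr_ge0 ?expR_ge0 ?sqr_ge0.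
- exact: cosD_le.
have h := expR_sinh (ltW (divr_gt0 e0 (ltr0Sn R 1))).
set a := expR (e / 2) in h; have a0 : 0 < a by exact: expR_gt0.
have ea : expR (- e) = (a ^+ 2)^-1.
  by rewrite expRN /a -expRM_natl; congr (expR _)^-1; field.
rewrite expRN -/a in h.
have h1 : e <= a - a^-1 by lra.
have -> : expR (- e) / (1 - expR (- e)) ^+ 2 = (a - a^-1) ^- 2.
  rewrite ea; have : a - a^-1 != 0 by rewrite gt_eqF// (lt_le_trans e0).
  have -> : a - a^-1 = (a ^+ 2 - 1) / a by field; rewrite gt_eqF.
  rewrite mulf_eq0 invr_eq0 negb_or => /andP[h2 h3].
  by field; rewrite h3 h2.
have h3 : 0 < a - a^-1 by exact: lt_le_trans e0 h1.
rewrite lef_pV2 ?posrE ?exprn_gt0//; apply: lerXn2r => //; rewrite nnegrE ltW//.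
Qed.

Variables (k : nat) (s : R).
Hypothesis k0 : (0 < k)%N.
Hypothesis s0 : 0 < s.
Local Notation t1 := (tlo k s).
Local Notation t2 := (thi k s).
Local Notation tA := (tpr k s).
Local Notation p1 := (expR (- t1)).
Local Notation p2 := (expR (- t2)).

Lemma t1_le_tA : t1 <= tA.
Proof. by apply: ler_wpM2r; [exact: ltW | rewrite ler_peMr ?ler1n]. Qed.
Lemma t2_le_tA : t2 <= tA.
Proof.
apply: ler_wpM2r; first exact: ltW.
by rewrite -[leLHS]mul1r; apply: ler_wpM2r; rewrite ?ler1n.
Qed.

(** With a, b, c the deviations of [NA], [N2], [N1] from 1, the numerator is ab + a + b - c. Each is
    at most 4q, hence 16 + 4 + 4 + 4 = 28; the denominator [N1] has modulus at least 1. *)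
Lemma dual_ratio (y : R) : tA <= 1 -> `|y| <= pi ->
  nc (NA k s y * N2 k s y / N1 k s y - 1) <= 28 * expR (- (2 * pi * (pi - `|y|) / tA)).
Proof.
move=> A1 hy; have T1 := t10 k0 s0; have T2 := t20 k s0; have TA := tA0 k0 s0.
have hpi := pi_gt0 R.
set q := expR (- (2 * pi * (pi - `|y|) / tA)).
have D0 : 0 <= 2 * pi * (pi - `|y|) by rewrite !mulr_ge0 ?subr_ge0// ltW.
have q01 : q <= 1 by rewrite expR_le1 oppr_le0 divr_ge0// ltW.
have q0 : 0 <= q by exact: expR_ge0.
have mono t : 0 < t -> t <= tA -> expR (- (2 * pi * (pi - `|y|) / t)) <= q.
  by move=> t0 tt; rewrite ler_expR lerN2 ler_wpM2l// lef_pV2 ?posrE.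
have hA : nc (NA k s y - 1) <= 4 * q.
  have := @dual_near1 R tA (- wy k s y); rewrite TA A1 /= normrN; exact.
have h2 : nc (N2 k s y - 1) <= 4 * q.
  have := @dual_near1 R t2 (- wy k s y + (t2 / 2)%:C).
  rewrite T2 (le_trans t2_le_tA A1) /= addr0 normrN => h.
  by apply: le_trans (h isT hy) _; rewrite ler_pM2l// mono// t2_le_tA.
have h1 : nc (N1 k s y - 1) <= 4 * q.
  have := @dual_near1 R t1 (0 +i* y).
  rewrite T1 (le_trans t1_le_tA A1) /= => h.
  by apply: le_trans (h isT hy) _; rewrite ler_pM2l// mono// t1_le_tA.
have n1 := N1_neq0 k0 s0 y.
have n11 : 1 <= nc (N1 k s y) by exact: dual_ge1.
have -> : NA k s y * N2 k s y / N1 k s y - 1 =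
   ((NA k s y - 1) * (N2 k s y - 1) + (NA k s y - 1) + (N2 k s y - 1) - (N1 k s y - 1)) / N1 k s y.
  by move: (NA k s y) (N2 k s y) (N1 k s y) n1 => a b c c0; field.
rewrite ncM ncV ler_pdivrMr ?(lt_le_trans ltr01)//.
apply: (@le_trans _ _ (28 * q)); last by rewrite ler_peMr// mulr_ge0.
apply: le_trans (ncD _ _) _; rewrite ncN.
have hM : nc ((NA k s y - 1) * (N2 k s y - 1)) <= 16 * q.
  rewrite ncM; apply: (@le_trans _ _ (4 * q * (4 * q))).
    by apply: ler_pM; rewrite ?nc_ge0.
  nra.
have := ncD ((NA k s y - 1) * (N2 k s y - 1) + (NA k s y - 1)) (N2 k s y - 1).
have := ncD ((NA k s y - 1) * (N2 k s y - 1)) (NA k s y - 1).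
lra.
Qed.

(** On |x| = e^{ks/2}, [xn] and [xd] are the moduli of p^{j+1} x and p'^{j+1} x, from the numerator
    and the denominator of [Bz]. *)
Definition xn (j : nat) : R := expR (- (t1 * (j%:R + 1 / 2))).
Definition xd (j : nat) : R := expR (- (t2 * (j%:R + 1) - t1 / 2)).

Lemma xn_itv j : 0 <= xn j < 1.
Proof.
by rewrite expR_ge0 expR_lt1 oppr_lt0 mulr_gt0 ?t10// ltr_wpDl// divr_gt0.
Qed.

Lemma xd_itv j : 0 <= xd j < 1.
Proof.
rewrite expR_ge0 expR_lt1 oppr_lt0 subr_gt0.
have T1 := t10 k0 s0; apply: (@lt_le_trans _ _ t1); first by lra.
apply: (@le_trans _ _ t2); first by rewrite (t1Dt2 k s) lerDl ltW.
by rewrite ler_peMr ?(ltW (t20 _ _))// lerDr.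
Qed.

(** The two sequences interlace: of every k + 1 consecutive numerator factors all but the first are
    dominated by the k denominator factors of the same block. One factor per block, of index (k+1)i,
    survives. *)
Lemma prod_phi_le (y : R) K :
  \prod_(j < k.+1 * K) phi y (xn j) <=
  \prod_(j < k * K) phi y (xd j) * \prod_(i < K) phi y (xn (k.+1 * i)).
Proof.
have ge0n j : 0 <= phi y (xn j) by apply: le_trans (phi_ge1 _ _) => //; case/andP: (xn_itv j).
have ge0d j : 0 <= phi y (xd j) by apply: le_trans (phi_ge1 _ _) => //; case/andP: (xd_itv j).
elim: K => [|K IH]; first by rewrite !muln0 !big_ord0 mul1r.
rewrite !mulnSr [X in _ <= _ * X]big_ord_recr /=.
set n1 := (k.+1 * K)%N in IH *; set n2 := (k * K)%N in IH *.
rewrite big_split_ord [X in _ <= X * _]big_split_ord /= big_ord_recl /= addn0.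
set a := \prod_(i < n1) _ in IH *; set b := \prod_(i < n2) _ in IH *.
set c := \prod_(i < K) _ in IH *; set d := phi y (xn _).
rewrite [leRHS](_ : _ = (b * c) * (d * \prod_(i < k) phi y (xd (n2 + i)))); last by ring.
apply: ler_pM => //; first by apply: prodr_ge0.
  by apply: mulr_ge0; [exact: ge0n | apply: prodr_ge0].
rewrite ler_wpM2l ?ge0n//; apply: ler_prod => c' _; rewrite ge0n /=.
have /andP[_ h1] := xd_itv (n2 + c'); apply: phi_le => //.
  by case/andP: (xn_itv (n1 + bump 0 c')).
(* The two exponents differ by (k - (c'+1)) s, which is nonnegative because c' < k. *)
rewrite ler_expR lerN2 /tlo /thi -subr_ge0.
have -> : k%:R * s * ((n1 + bump 0 c')%:R + 1 / 2) -
  (k.+1%:R * s * ((n2 + c')%:R + 1) - k%:R * s / 2) = (k%:R - (c'%:R + 1)) * s :> R.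
  by rewrite !natrD !natrM /bump /= -natr1; field.
by rewrite mulr_ge0 ?(ltW s0)// subr_ge0 natr1 ler_nat.
Qed.

(** The surviving exponents are t1/2 for i = 0 and at least [tA] i otherwise. The first gives the
    separate factor, the others the product of 1 + (D/tA)^2/i^2. *)
Lemma prod_phi_bound (y : R) K : `|y| <= pi ->
  \prod_(i < K.+1) phi y (xn (k.+1 * i)) <=
  (1 + 4 * (pi - `|y|) ^+ 2 / t1 ^+ 2) * expR (5 * ((pi - `|y|) / tA + 1)).
Proof.
move=> hy; have T1 := t10 k0 s0; have TA := tA0 k0 s0.
set D := pi - `|y|; have D0 : 0 <= D by rewrite subr_ge0.
have ge0n j : 0 <= phi y (xn j) by apply: le_trans (phi_ge1 _ _) => //; case/andP: (xn_itv j).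
rewrite big_ord_recl; apply: ler_pM => //; first by apply: prodr_ge0.
  rewrite muln0; apply: le_trans (phi_bound hy _) _; first by rewrite mulr_gt0// add0r divr_gt0.
  rewrite lerD2l add0r le_eqVlt; apply/orP; left; apply/eqP.
  by rewrite -/D; field; rewrite gt_eqF.
apply: le_trans (_ : \prod_(i < K) (1 + (D / tA) ^+ 2 / i.+1%:R ^+ 2) <= _); last first.
  by apply: prod_sq_bound; rewrite divr_ge0// ltW.
apply: ler_prod => i _; rewrite ge0n /=.
set e := t1 * ((k.+1 * (lift ord0 i))%:R + 1 / 2).
have e0 : 0 < e by rewrite mulr_gt0// ltr_wpDl// divr_gt0.
apply: le_trans (phi_bound hy e0) _; rewrite -/D lerD2l expr_div_n -[leRHS]mulrA.
apply: ler_wpM2l; first exact: sqr_ge0.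
rewrite -invfM lef_pV2 ?posrE ?mulr_gt0 ?exprn_gt0 ?ltr0n//.
rewrite -exprMn; apply: lerXn2r; rewrite ?nnegrE ?mulr_ge0 ?(ltW e0) ?(ltW TA) ?(ltW s0)//.
have -> : tA * i.+1%:R = t1 * (k.+1 * (lift ord0 i))%:R.
  by rewrite lift0 natrM /tpr /tlo; ring.
by rewrite ler_wpM2l ?(ltW T1)// lerDl divr_ge0.
Qed.

End Bounds.

(** * The q-Gamma function *)

Section QGamma.
Variable R : realType.
Local Notation C := R[i].

Lemma lim_le (T : Type) (F : set_system T) {FF : ProperFilter F} (u v : T -> R) (a b : R) :
  u t @[t --> F] --> a -> v t @[t --> F] --> b -> (\forall t \near F, u t <= v t) -> a <= b.
Proof.
move=> ha hb h; rewrite -subr_ge0; pose proof (cvgB hb ha) as hd.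
by apply: cvgr_to_ge hd _; apply: filterS h => t; rewrite subr_ge0.
Qed.

Lemma lim_comp (T U : Type) (F : set_system T) (G : set_system U) (h : T -> U) (u : U -> R) (l : R) :
  h @ F --> G -> u x @[x --> G] --> l -> u (h t) @[t --> F] --> l.
Proof. by move=> hF hG; exact: cvg_comp hF hG. Qed.

Lemma amgm_expR (x a b : R) : 0 <= x <= 1 ->
  expR ((1 - x) * a + x * b) <= (1 - x) * expR a + x * expR b.
Proof.
move=> /andP[x0 x1]; set m := _ + _ * b.
have ha : expR m * (1 + (a - m)) <= expR a.
  have -> : expR a = expR m * expR (a - m) by rewrite -expRD; congr expR; ring.
  by rewrite ler_pM2l ?expR_gt0// expR_ge1Dx.
have hb : expR m * (1 + (b - m)) <= expR b.
  have -> : expR b = expR m * expR (b - m) by rewrite -expRD; congr expR; ring.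
  by rewrite ler_pM2l ?expR_gt0// expR_ge1Dx.
have x1' : 0 <= 1 - x by rewrite subr_ge0.
have h1 := ler_wpM2l x1' ha; have h2 := ler_wpM2l x0 hb.
apply: le_trans (lerD h1 h2); rewrite le_eqVlt; apply/orP; left; apply/eqP.
by rewrite /m; move: (expR _) => e; ring.
Qed.

Lemma powR_key (x u v w : R) : 0 <= x <= 1 -> u < 1 -> v < 1 ->
  w <= (1 - x) * u + x * v -> (1 - u) `^ (1 - x) * (1 - v) `^ x <= 1 - w.
Proof.
move=> hx u1 v1 hw.
have u0 : 0 < 1 - u by rewrite subr_gt0.
have v0 : 0 < 1 - v by rewrite subr_gt0.
rewrite /powR !gt_eqF// -expRD; apply: le_trans (amgm_expR _ _ hx) _.
by rewrite !lnK ?posrE//; move: hx; lra.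
Qed.

Lemma powR_le1 (a x : R) : 0 <= a <= 1 -> 0 <= x -> a `^ x <= 1.
Proof.
move=> /andP[a0 a1] x0; rewrite -(powRr0 1) powRr0.
have -> : 1 = 1 `^ x :> R by rewrite powR1.
by apply: ge0_ler_powR; rewrite ?nnegrE.
Qed.

Section Fixed.
Variable t : R.
Hypothesis t0 : 0 < t.
Local Notation p := (expR (- t)).

Definition pw (x : R) : R := expR (- (t * x)).

Lemma pwD (x y : R) : pw (x + y) = pw x * pw y.
Proof. by rewrite /pw mulrDr opprD expRD. Qed.

Lemma pw_nat (n : nat) : pw n%:R = p ^+ n.
Proof. by rewrite /pw -expRM_natl mulrN mulrC. Qed.

Lemma pw_gt0 x : 0 < pw x. Proof. exact: expR_gt0. Qed.

Lemma pw_lt1 x : 0 < x -> pw x < 1.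
Proof. by move=> x0; rewrite expR_lt1 oppr_lt0 mulr_gt0. Qed.

(* (p^x;p)_oo; [qr x] is the reciprocal of the q-Gamma function at x. *)
Definition qP (x : R) : R := complex.Re (Ep t (- (pw x)%:C)).

Lemma qP_prodE x n :
  \prod_(i < n) (1 + - (pw x)%:C * (p ^+ i)%:C) = (\prod_(i < n) (1 - pw (x + i%:R)))%:C :> C.
Proof.
rewrite rc_prod; apply: eq_bigr => i _.
by rewrite pwD pw_nat rcB rcM mulNr.
Qed.

Lemma qP_cvg x : \prod_(i < n) (1 - pw (x + i%:R)) @[n --> \oo] --> qP x.
Proof.
pose proof (Ep_cvg t0 (- (pw x)%:C)) as h; pose proof (cvgc_Re h) as h'.
apply: cvg_trans h'; apply: near_eq_cvg; apply: nearW => n.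
by rewrite qP_prodE.
Qed.

Lemma qPE x : Ep t (- (pw x)%:C) = (qP x)%:C.
Proof.
pose proof (Ep_cvg t0 (- (pw x)%:C)) as h.
pose proof (cvgc_real (@qP_cvg x)) as h'.
apply: (cvgc_uniq h); apply: near_cvgc h'; apply: nearW => n.
by rewrite qP_prodE.
Qed.

Local Opaque qP.

Lemma qP_rec x : qP x = (1 - pw x) * qP (x + 1).
Proof.
have e : - (pw x)%:C * p%:C = - (pw (x + 1))%:C :> C.
  by rewrite pwD {3}/pw mulr1 rcM mulNr.
have h := Ep_funE t0 (- (pw x)%:C); rewrite e in h.
have h1 : (qP x)%:C = (1 - (pw x)%:C) * (qP (x + 1))%:C :=
  eq_trans (esym (qPE x)) (eq_trans h (congr1 _ (qPE (x + 1)))).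
have h2 : (1 - (pw x)%:C) * (qP (x + 1))%:C = ((1 - pw x) * qP (x + 1))%:C :> C.
  by rewrite [RHS]rcM [in RHS]rcB.
exact: (@complexI R _ _ (eq_trans h1 h2)).
Qed.

Lemma qP_nat n : qP n.+1%:R = qinf t / qf t n.
Proof.
have h := Ep_qf t0 n; have h1 := qPE n.+1%:R; rewrite pw_nat in h1.
exact: (@complexI R _ _ (eq_trans (esym h1) h)).
Qed.

(** Convexity of z -> p^z and the weighted mean inequality give one step of the induction; the
    boundary factor on the right is what the partial products owe to each other and tends to 1. *)
Lemma qP_prod_le (x y : R) N : 0 <= x <= 1 -> 0 < y ->
  \prod_(i < N) (1 - pw (y + 1 + i%:R)) * (1 - pw y) `^ (1 - x) <=
  \prod_(i < N) (1 - pw (y + x + i%:R)) * (1 - pw (y + N%:R)) `^ (1 - x).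
Proof.
move=> hx y0; have /andP[x0 x1] := hx.
have pos z : 0 < z -> 0 < 1 - pw z by move=> z0; rewrite subr_gt0 pw_lt1.
elim: N => [|N IH]; first by rewrite !big_ord0 addr0.
rewrite !big_ord_recr /=; set a := \prod_(i < N) _ in IH *; set b := \prod_(i < N) _ in IH *.
have yN : 0 < y + N%:R by rewrite ltr_wpDr.
have e1 : y + 1 + N%:R = y + N.+1%:R by rewrite -natr1; ring.
have V0 : 0 < 1 - pw (y + N.+1%:R) by rewrite pos// ltr_wpDr.
rewrite e1 mulrAC; apply: (@le_trans _ _ (b * (1 - pw (y + N%:R)) `^ (1 - x) * (1 - pw (y + N.+1%:R)))).
  by rewrite ler_pM2r.
rewrite -!mulrA; apply: ler_wpM2l.
  by apply: prodr_ge0 => i _; rewrite ltW// pos// -addrA ltr_wpDr// addr_ge0.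
set V := 1 - pw (y + N.+1%:R) in V0 *.
have -> : (1 - pw (y + N%:R)) `^ (1 - x) * V =
    (1 - pw (y + N%:R)) `^ (1 - x) * V `^ x * V `^ (1 - x).
  rewrite -mulrA -powRD; first by rewrite (addrC x) subrK powRr1// ltW.
  by apply/implyP => _; rewrite gt_eqF.
apply: ler_wpM2r; first exact: powR_ge0.
apply: powR_key => //; first exact: pw_lt1.
  by apply: pw_lt1; rewrite ltr_wpDr.
have -> : y + N.+1%:R = y + N%:R + 1 by rewrite -natr1; ring.
have -> : pw (y + x + N%:R) = expR ((1 - x) * (- (t * (y + N%:R))) + x * (- (t * (y + N%:R + 1)))).
  by rewrite /pw; congr expR; ring.
exact: amgm_expR.
Qed.

(** The q-analogue of the Bohr-Mollerup inequality, expressing logarithmic convexity of the q-Gamma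
    function between consecutive integers. *)
Lemma qP_lower (x y : R) : 0 <= x <= 1 -> 0 < y ->
  qP (y + 1) * (1 - pw y) `^ (1 - x) <= qP (y + x).
Proof.
move=> hx y0; have /andP[x0 x1] := hx.
have h1 : \prod_(i < N) (1 - pw (y + 1 + i%:R)) * (1 - pw y) `^ (1 - x) @[N --> \oo] -->
    qP (y + 1) * (1 - pw y) `^ (1 - x).
  by apply: lim_M; [exact: qP_cvg | exact: cvg_cst].
apply: (ler_cvg_to h1 (@qP_cvg (y + x))); apply: nearW => N; apply: le_trans (qP_prod_le N hx y0) _.
apply: ler_piMr.
  by apply: prodr_ge0 => i _; rewrite ltW// subr_gt0 pw_lt1// -addrA ltr_wpDr// addr_ge0.
apply: powR_le1; last by rewrite subr_ge0.
by rewrite subr_ge0 ltW ?pw_lt1 ?ltr_wpDr//= gerBl ltW ?pw_gt0.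
Qed.

(** The lower bound based at y + x with exponent 1 - x, combined with the functional equation. *)
Lemma qP_upper (x y : R) : 0 <= x <= 1 -> 0 < y ->
  qP (y + x) <= (1 - pw (y + x)) `^ (1 - x) * qP (y + 1).
Proof.
move=> hx y0; have /andP[x0 x1] := hx.
have yx : 0 < y + x by rewrite ltr_wpDr.
have h := @qP_lower (1 - x) (y + x) _ yx.
have {h} : qP (y + x + 1) * (1 - pw (y + x)) `^ (1 - (1 - x)) <= qP (y + x + (1 - x)).
  by apply: h; rewrite subr_ge0 x1 gerBl.
have -> : 1 - (1 - x) = x by ring.
have -> : y + x + (1 - x) = y + 1 by ring.
have V0 : 0 < 1 - pw (y + x) by rewrite subr_gt0 pw_lt1.
move=> h; rewrite (qP_rec (y + x)); set V := 1 - pw (y + x) in V0 h *.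
have -> : V * qP (y + x + 1) = V `^ (1 - x) * (qP (y + x + 1) * V `^ x).
  rewrite mulrCA -powRD; first by rewrite subrK powRr1 ?ltW// mulrC.
  by apply/implyP => _; rewrite gt_eqF.
by rewrite ler_wpM2l ?powR_ge0.
Qed.

(** The q-number of x in base p; it tends to x as t -> 0. *)
Definition br (x : R) : R := (1 - pw x) / (1 - p).
Definition qr (x : R) : R := qP x / qinf t * (1 - p) `^ (x - 1).

Lemma p1_gt0 : 0 < 1 - p.
Proof. by rewrite subr_gt0 expR_lt1 oppr_lt0. Qed.

Lemma qr_rec x : qr x = br x * qr (x + 1).
Proof.
rewrite /qr qP_rec /br; have -> : x + 1 - 1 = (x - 1) + 1 by ring.
rewrite [in RHS]powRD; last by apply/implyP => _; rewrite gt_eqF ?p1_gt0.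
have P0 := p1_gt0; rewrite powRr1 ?(ltW P0)//.
move: (qP _) (_ `^ _) (pw x) (qinf_gt0 t0) P0 => a b c; move: (qinf t) (1 - p) => q P q0 P0.
by field; rewrite !gt_eqF.
Qed.

Lemma br_ge0 x : 0 <= x -> 0 <= br x.
Proof.
move=> x0; apply: divr_ge0; last exact/ltW/p1_gt0.
by rewrite subr_ge0 expR_le1 oppr_le0; apply: mulr_ge0 => //; exact: ltW.
Qed.

Lemma br_gt0 x : 0 < x -> 0 < br x.
Proof. by move=> x0; rewrite divr_gt0 ?p1_gt0// subr_gt0 pw_lt1. Qed.

Lemma qr_nat n : qr n.+1%:R = (\prod_(i < n) br i.+1%:R)^-1.
Proof.
elim: n => [|n IH].
  rewrite big_ord0 invr1 /qr subrr powRr0 mulr1 qP_nat /qf big_ord0 divr1.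
  by rewrite divff// gt_eqF// qinf_gt0.
have B0 : br n.+1%:R != 0 by rewrite gt_eqF// br_gt0.
have := qr_rec n.+1%:R; rewrite IH natr1 => h.
rewrite big_ord_recr /= invfM h mulrAC mulfV// mul1r.
by [].
Qed.

Lemma br_powR (y e : R) : 0 < y -> (1 - pw y) `^ e = br y `^ e * (1 - p) `^ e.
Proof.
move=> y0; have P0 := p1_gt0.
by rewrite -powRM ?br_ge0 ?(ltW y0) ?(ltW P0)// /br divfK// gt_eqF.
Qed.

Lemma qr_lower (x : R) (n : nat) : 0 <= x <= 1 -> (0 < n)%N ->
  qr (n%:R + 1) * br n%:R `^ (1 - x) <= qr (n%:R + x).
Proof.
move=> hx n0; have nR : 0 < n%:R :> R by rewrite ltr0n.
have h := qP_lower hx nR; have P0 := p1_gt0; have q0 := qinf_gt0 t0.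
rewrite br_powR// in h; rewrite /qr.
have -> : n%:R + x - 1 = (n%:R + 1 - 1) - (1 - x) by ring.
rewrite [in leRHS]powRB; last by apply/implyP => _; rewrite gt_eqF.
have e0 : 0 < (1 - p) `^ (1 - x) by rewrite powR_gt0.
have f0 : 0 < (1 - p) `^ (n%:R + 1 - 1) by rewrite powR_gt0.
move: h e0 f0; move: (qP (n%:R + 1)) (qP (n%:R + x)) => a b.
move: (br n%:R `^ (1 - x)) ((1 - p) `^ (1 - x)) ((1 - p) `^ (n%:R + 1 - 1)) (qinf t) q0 => f c e q q0 h c0 e0.
have -> : a / q * e * f = (a * (f * c)) * (e / q / c) by field; rewrite !gt_eqF.
have -> : b / q * (e / c) = b * (e / q / c) by field; rewrite !gt_eqF.
by apply: ler_wpM2r => //; rewrite !divr_ge0 ?ltW.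
Qed.

Lemma qr_upper (x : R) (n : nat) : 0 <= x <= 1 -> (0 < n)%N ->
  qr (n%:R + x) <= qr (n%:R + 1) * br (n%:R + x) `^ (1 - x).
Proof.
move=> hx n0; have nR : 0 < n%:R :> R by rewrite ltr0n.
have nx : 0 < n%:R + x by case/andP: hx => x0 _; rewrite ltr_wpDr.
have h := qP_upper hx nR; have P0 := p1_gt0; have q0 := qinf_gt0 t0.
rewrite br_powR// in h; rewrite /qr.
have -> : n%:R + x - 1 = (n%:R + 1 - 1) - (1 - x) by ring.
rewrite [in leLHS]powRB; last by apply/implyP => _; rewrite gt_eqF.
have e0 : 0 < (1 - p) `^ (1 - x) by rewrite powR_gt0.
have f0 : 0 < (1 - p) `^ (n%:R + 1 - 1) by rewrite powR_gt0.
move: h e0 f0; move: (qP (n%:R + x)) (qP (n%:R + 1)) => a b.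
move: (br (n%:R + x) `^ (1 - x)) ((1 - p) `^ (1 - x)) ((1 - p) `^ (n%:R + 1 - 1)) (qinf t) q0 => f c e q q0 h c0 e0.
have -> : b / q * e * f = (f * c * b) * (e / q / c) by field; rewrite !gt_eqF.
have -> : a / q * (e / c) = a * (e / q / c) by field; rewrite !gt_eqF.
by apply: ler_wpM2r => //; rewrite !divr_ge0 ?ltW.
Qed.

Lemma qr_prod (x : R) n : qr x = \prod_(i < n) br (x + i%:R) * qr (n%:R + x).
Proof.
elim: n => [|n IH]; first by rewrite big_ord0 mul1r add0r.
rewrite IH big_ord_recr /= -mulrA; congr (_ * _).
by rewrite qr_rec [n%:R + x]addrC -natr1 (addrC x) addrAC.
Qed.

End Fixed.

(** The limits as t -> 0 of the two bounds in [qr_bounds]. They are the classical bounds between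
    which 1/Gamma(x) lies for 0 < x <= 1. *)
Definition Lg (n : nat) (x : R) := \prod_(i < n) (x + i%:R) * (n%:R `^ (1 - x)) / n`!%:R.
Definition Ug (n : nat) (x : R) := \prod_(i < n) (x + i%:R) * ((n%:R + x) `^ (1 - x)) / n`!%:R.

Lemma near0_gt0 : \forall t \near (0 : R)^'+, 0 < t.
Proof. exact: nbhs_right_gt. Qed.

Lemma near0_lt (e : R) : 0 < e -> \forall t \near (0 : R)^'+, t < e.
Proof. by move=> e0; exact: nbhs_right_lt. Qed.

Lemma lim_id0 : t @[t --> (0 : R)^'+] --> (0 : R).
Proof. by apply: cvg_at_right_filter; exact: cvg_id. Qed.

Lemma pw_lim (y : R) : pw t y @[t --> 0^'+] --> (1 : R).
Proof.
have h : t * y @[t --> 0^'+] --> 0 * y.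
  by apply: lim_M; [exact: lim_id0 | exact: cvg_cst].
have h2 : - (t * y) @[t --> 0^'+] --> - (0 * y) by exact: cvgN.
by rewrite -(@expR0 R) -[in X in _ --> X]oppr0 -[in X in _ --> X](mul0r y); exact: lim_expR h2.
Qed.

Lemma oneBpw_lim (y : R) : (1 - pw t y) / t @[t --> 0^'+] --> y.
Proof.
have h : y * pw t y @[t --> 0^'+] --> y.
  by rewrite -[X in _ --> X]mulr1; apply: lim_Z; exact: pw_lim.
apply: (@squeeze_cvgr _ _ _ _ _ _ _ _ _ h (cvg_cst y)).
near=> t; have t0 : 0 < t by near: t; exact: near0_gt0.
rewrite ler_pdivlMr// ler_pdivrMr//; apply/andP; split.
  have := expR_ge1Dx (t * y); rewrite /pw expRN => h1.
  have e0 := expR_gt0 (t * y).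
  by rewrite mulrAC ler_pdivrMr// mulrBl mulVf ?gt_eqF//; lra.
by have := expR_ge1Dx (- (t * y)); rewrite -/(pw t y); lra.
Unshelve. all: by end_near.
Qed.

Lemma br_lim (y : R) : br t y @[t --> 0^'+] --> y.
Proof.
pose proof (lim_div (oner_neq0 R) (@oneBpw_lim y) (@oneBpw_lim 1)) as h.
rewrite divr1 in h; apply: lim_near h.
near=> t; have t0 : 0 < t by near: t; exact: near0_gt0.
have := p1_gt0 t0; rewrite /br {2}/pw mulr1 => h1.
by field; rewrite !gt_eqF.
Unshelve. all: by end_near.
Qed.

Lemma lim_powR (T : Type) (F : set_system T) {FF : ProperFilter F} (u : T -> R) (a e : R) :
  0 < a -> u t @[t --> F] --> a -> u t `^ e @[t --> F] --> a `^ e.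
Proof.
move=> a0 h.
have h1 : expR (e * ln (u t)) @[t --> F] --> expR (e * ln a).
  apply: lim_expR; apply: lim_Z.
  by apply: continuous_cvg h; exact: continuous_ln.
have -> : a `^ e = expR (e * ln a) by rewrite /powR gt_eqF.
apply: lim_near h1; near=> t; suff u0 : 0 < u t by rewrite /powR gt_eqF.
near: t; exact: (cvgr_gt a h).
Unshelve. all: by end_near.
Qed.

Lemma lim_prod (T : Type) (F : set_system T) (FF : ProperFilter F) n (u : nat -> T -> R) (l : nat -> R) :
  (forall i, u i t @[t --> F] --> l i) ->
  \prod_(i < n) u i t @[t --> F] --> \prod_(i < n) l i.
Proof.
move=> h; elim: n => [|n IH].
  rewrite big_ord0; apply: lim_near (cvg_cst (1 : R)).
  by apply: nearW => t; rewrite big_ord0.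
rewrite big_ord_recr /=; apply: lim_near (lim_M IH (h n)).
by apply: nearW => t; rewrite big_ord_recr.
Qed.

Lemma fact_prod n : (n`!)%:R = \prod_(i < n) (i.+1%:R : R).
Proof.
elim: n => [|n IH]; first by rewrite big_ord0.
by rewrite factS natrM IH big_ord_recr /= mulrC.
Qed.

Lemma qr_bounds (t x : R) n : 0 < t -> 0 < x <= 1 -> (0 < n)%N ->
  \prod_(i < n) br t (x + i%:R) * br t n%:R `^ (1 - x) / \prod_(i < n) br t i.+1%:R
    <= qr t x <=
  \prod_(i < n) br t (x + i%:R) * br t (n%:R + x) `^ (1 - x) / \prod_(i < n) br t i.+1%:R.
Proof.
move=> t0 /andP[x0 x1] n0; have hx : 0 <= x <= 1 by rewrite ltW.
have P0 : 0 <= \prod_(i < n) br t (x + i%:R).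
  by apply: prodr_ge0 => i _; apply: br_ge0 => //; rewrite addr_ge0 ?(ltW x0).
rewrite (qr_prod t0 x n) -!mulrA; apply/andP; split; apply: ler_wpM2l => //.
  by have := qr_lower t0 hx n0; rewrite natr1 qr_nat// mulrC.
by have := qr_upper t0 hx n0; rewrite natr1 qr_nat// mulrC.
Qed.

Lemma prod_br_lim (f : nat -> R) n :
  \prod_(i < n) br t (f i) @[t --> 0^'+] --> \prod_(i < n) f i.
Proof.
pose proof (@lim_prod R (0 : R)^'+ _ n (fun i t => br t (f i)) f (fun i => @br_lim (f i))) as h.
exact: h.
Qed.

Lemma qlow_lim (x : R) (n : nat) : (0 < n)%N ->
  \prod_(i < n) br t (x + i%:R) * br t n%:R `^ (1 - x) / \prod_(i < n) br t i.+1%:R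
   @[t --> 0^'+] --> Lg n x.
Proof.
move=> n0; have nR : 0 < n%:R :> R by rewrite ltr0n.
rewrite /Lg fact_prod; apply: lim_div; first by rewrite -fact_prod gt_eqF// ltr0n fact_gt0.
  pose proof (lim_powR (e := 1 - x) nR (@br_lim n%:R)) as h1.
  exact: (lim_M (@prod_br_lim (fun i => x + i%:R) n) h1).
exact: (@prod_br_lim (fun i => i.+1%:R) n).
Qed.

Lemma qupp_lim (x : R) (n : nat) : 0 < x -> (0 < n)%N ->
  \prod_(i < n) br t (x + i%:R) * br t (n%:R + x) `^ (1 - x) / \prod_(i < n) br t i.+1%:R
   @[t --> 0^'+] --> Ug n x.
Proof.
move=> x0 n0; have nR : 0 < n%:R :> R by rewrite ltr0n.
rewrite /Ug fact_prod; apply: lim_div; first by rewrite -fact_prod gt_eqF// ltr0n fact_gt0.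
  pose proof (lim_powR (e := 1 - x) (addr_gt0 nR x0) (@br_lim (n%:R + x))) as h1.
  exact: (lim_M (@prod_br_lim (fun i => x + i%:R) n) h1).
exact: (@prod_br_lim (fun i => i.+1%:R) n).
Qed.

Lemma Lg_le (x : R) m n : 0 < x <= 1 -> (0 < m)%N -> (0 < n)%N -> Lg m x <= Ug n x.
Proof.
move=> hx m0 n0; have /andP[x0 x1] := hx.
pose proof (lim_le (@qlow_lim x m m0) (@qupp_lim x n x0 n0)) as hl; apply: hl.
near=> t; have t0 : 0 < t by near: t; exact: near0_gt0.
have /andP[h _] := qr_bounds t0 hx m0; have /andP[_ h'] := qr_bounds t0 hx n0.
exact: le_trans h h'.
Unshelve. all: by end_near.
Qed.

Lemma Lg_ge0 (x : R) n : 0 < x -> 0 <= Lg n x.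
Proof.
move=> x0; rewrite /Lg !mulr_ge0 ?powR_ge0 ?invr_ge0//.
by apply: prodr_ge0 => i _; rewrite addr_ge0 ?(ltW x0).
Qed.

Lemma Ug_le (x : R) n : 0 < x <= 1 -> (0 < n)%N -> Ug n x <= Lg n x * (1 + x / n%:R).
Proof.
move=> /andP[x0 x1] n0; have nR : 0 < n%:R :> R by rewrite ltr0n.
have xn : 0 <= x / n%:R by rewrite divr_ge0 ?ltW.
have e : n%:R + x = n%:R * (1 + x / n%:R) by field; rewrite gt_eqF.
have n1 : 1 <= 1 + x / n%:R by rewrite lerDl.
have h : (n%:R + x) `^ (1 - x) <= n%:R `^ (1 - x) * (1 + x / n%:R).
  rewrite e powRM ?(ltW nR) ?(le_trans ler01 n1)//; apply: ler_wpM2l; first exact: powR_ge0.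
  rewrite -[leRHS]powRr1 ?(le_trans ler01 n1)//; apply: ler_powR => //.
  by rewrite gerBl ltW.
have P0 : 0 <= \prod_(i < n) (x + i%:R) by apply: prodr_ge0 => i _; rewrite addr_ge0 ?(ltW x0).
have F0 : 0 <= (n`!%:R : R)^-1 by rewrite invr_ge0.
rewrite /Ug /Lg.
have -> : \prod_(i < n) (x + i%:R) * n%:R `^ (1 - x) / n`!%:R * (1 + x / n%:R) =
  \prod_(i < n) (x + i%:R) * (n%:R `^ (1 - x) * (1 + x / n%:R)) / n`!%:R.
  by move: (\prod_(i < n) _) (_ `^ _) (x / _) (_^-1) => a b c d; ring.
by apply: ler_wpM2r => //; apply: ler_wpM2l.
Qed.

(** Every lower bound is at most every upper bound, by comparison at small t, and Ug n <= Lg n (1 +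
    x/n). One number therefore separates them, and it is the limit both of Gauss's sequence and of
    the reciprocal q-Gamma function. *)
Lemma gamma_base (x : R) : 0 < x <= 1 ->
  exists l : R, [/\ 0 < l, Lg n.+1 x @[n --> \oo] --> l & qr t x @[t --> 0^'+] --> l].
Proof.
move=> hx; have /andP[x0 x1] := hx.
pose A := range (fun m : nat => Lg m.+1 x); pose S := sup A.
have A0 : A !=set0 by exists (Lg 1 x); exists 0%N.
have Aub n : ubound A (Ug n.+1 x) by move=> _ [m _ <-]; exact: Lg_le.
have hA : has_sup A by split=> //; exists (Ug 1 x); exact: (Aub 0%N).
have SL n : Lg n.+1 x <= S by apply: sup_upper_bound => //; exists n.
have SU n : S <= Ug n.+1 x by apply: ge_sup.
have L1 : Lg 1 x = x.
  by rewrite /Lg big_ord_recl big_ord0 addr0 mulr1 powR1 mulr1 divr1.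
have S0 : 0 < S by apply: lt_le_trans (SL 0%N); rewrite L1.
have near_S n : S - S / n.+1%:R <= Lg n.+1 x /\ Ug n.+1 x <= S + S / n.+1%:R.
  have hU := Ug_le hx (ltn0Sn n); have h1 := SL n; have h2 := SU n.
  have n0 : 0 < (n.+1%:R : R)^-1 by rewrite invr_gt0.
  have hL : Lg n.+1 x * (x / n.+1%:R) <= S / n.+1%:R.
    have -> : Lg n.+1 x * (x / n.+1%:R) = Lg n.+1 x * x * (n.+1%:R)^-1 by ring.
    rewrite ler_pM2r//; apply: le_trans h1; apply: ler_piMr => //.
    exact: Lg_ge0.
  have aux (a b c d e : R) : a <= b -> d <= c + a -> c <= e -> e <= d ->
    e - b <= c /\ d <= e + b by move=> *; split; lra.
  by rewrite mulrDr mulr1 in hU; exact: aux hL hU h1 h2.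
have inv0 : S / n.+1%:R @[n --> \oo] --> (0 : R).
  by rewrite -(mulr0 S); apply: lim_Z; exact: cvg_harmonic.
exists S; split=> //.
  have h : S - S / n.+1%:R @[n --> \oo] --> S.
    by rewrite -[X in _ --> X]subr0; apply: cvgB; [exact: cvg_cst | exact: inv0].
  apply: (@squeeze_cvgr _ _ _ _ _ _ _ _ _ h (cvg_cst S)).
  by apply: nearW => n; have [-> _] := near_S n; rewrite SL.
apply/cvgrPdist_lt => e e0.
have e2 : 0 < e / 2 by rewrite divr_gt0.
have [n hn] : exists n : nat, S / n.+1%:R < e / 2.
  have [N _ hN] : \forall n \near \oo, S / n.+1%:R < e / 2 by exact: (cvgr_lt 0 inv0).
  by exists N; apply: hN => /=.
have [hL hU] := near_S n.
pose fl (t : R) := \prod_(i < n.+1) br t (x + i%:R) * br t n.+1%:R `^ (1 - x) / \prod_(i < n.+1) br t i.+1%:R.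
pose fu (t : R) := \prod_(i < n.+1) br t (x + i%:R) * br t (n.+1%:R + x) `^ (1 - x) / \prod_(i < n.+1) br t i.+1%:R.
have hfl : fl t @[t --> 0^'+] --> Lg n.+1 x by exact: qlow_lim.
have hfu : fu t @[t --> 0^'+] --> Ug n.+1 x by exact: qupp_lim.
have nl : \forall t \near (0 : R)^'+, Lg n.+1 x - e / 2 < fl t.
  by apply: (cvgr_gt _ hfl); rewrite gtrBl.
have nu : \forall t \near (0 : R)^'+, fu t < Ug n.+1 x + e / 2.
  by apply: (cvgr_lt _ hfu); rewrite ltrDl.
near=> t; have t0 : 0 < t by near: t; exact: near0_gt0.
have /andP[h1 h2] := qr_bounds t0 hx (ltn0Sn n).
have h3 : Lg n.+1 x - e / 2 < fl t by near: t.
have h4 : fu t < Ug n.+1 x + e / 2 by near: t.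
have aux (L U f g q b : R) : S - b <= L -> U <= S + b -> b < e / 2 -> L - e / 2 < f ->
    g < U + e / 2 -> f <= q -> q <= g -> `|S - q| < e.
  by move=> *; rewrite ltr_norml; apply/andP; split; lra.
exact: aux hL hU hn h3 h4 h1 h2.
Unshelve. all: by end_near.
Qed.

Definition agam (x : R) (n : nat) : R :=
  \prod_(j < n.+1) (x + j%:R) / (n`!%:R * n%:R `^ x).

Lemma agam_Lg (x : R) n : agam x n.+1 = Lg n.+1 x * (1 + x / n.+1%:R).
Proof.
rewrite /agam /Lg big_ord_recr /= powRB; last by apply/implyP.
rewrite powRr1//; have : (n.+1)`!%:R != 0 :> R by rewrite gt_eqF// ltr0n fact_gt0.
have : n.+1%:R `^ x != 0 by rewrite gt_eqF// powR_gt0.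
have : n.+1%:R != 0 :> R by [].
move: (n.+1%:R : R) (_ `^ _) (_`!%:R) (\prod_(i < n.+1) _) => m p f q m0 p0 f0.
by field; rewrite m0 p0 f0.
Qed.

Lemma harm_lim (c : R) : c / n.+1%:R @[n --> \oo] --> (0 : R).
Proof. by rewrite -(mulr0 c); apply: lim_Z; exact: cvg_harmonic. Qed.

Lemma agam_rec (x : R) n : x + 1 + n.+1%:R != 0 ->
  agam x n.+1 = x * agam (x + 1) n.+1 * (1 + (x + 1) / n.+1%:R)^-1.
Proof.
move=> h; rewrite /agam big_ord_recl [in RHS]big_ord_recr /= addr0.
rewrite (eq_bigr (fun i : 'I_n.+1 => x + 1 + i%:R)) => [|i _]; last first.
  by rewrite /bump /= -natr1; ring.
rewrite powRD; last by apply/implyP.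
rewrite powRr1//; have : (n.+1)`!%:R != 0 :> R by rewrite gt_eqF// ltr0n fact_gt0.
have : n.+1%:R `^ x != 0 by rewrite gt_eqF// powR_gt0.
have : n.+1%:R != 0 :> R by [].
move: h; move: (n.+1%:R : R) (_ `^ _) (_`!%:R) (\prod_(i < n.+1) _) => m p f q h m0 p0 f0.
have hm : m + (x + 1) != 0 by rewrite addrC.
by field; rewrite ?m0 ?p0 ?f0 ?hm ?h.
Qed.

(** The functional equations of Gauss's sequence and of [qr] agree in the limit and carry the common
    value from (0,1] to the left, one unit at a time. The arguments 1 - k j/(k+1) of the Wright
    series all lie there. *)
Lemma gamma_lim (N : nat) (x : R) : 0 < x + N%:R <= 1 ->
  exists l : R, [/\ (0 < x -> 0 < l), agam x n @[n --> \oo] --> l & qr t x @[t --> 0^'+] --> l].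
Proof.
elim: N x => [|N IH] x hx.
  rewrite addr0 in hx; have [l [l0 h1 h2]] := gamma_base hx.
  exists l; split=> //; rewrite -cvg_shiftS.
  have : Lg n.+1 x * (1 + x / n.+1%:R) @[n --> \oo] --> l * (1 + 0).
    by apply: lim_M h1 _; apply: lim_D; [exact: cvg_cst | exact: harm_lim].
  rewrite addr0 mulr1; apply: lim_near; apply: nearW => n.
  by rewrite agam_Lg.
have hx1 : 0 < x + 1 + N%:R <= 1 by move: hx; rewrite -natr1 (addrC N%:R) addrA.
have [l [l0 h1 h2]] := IH _ hx1; exists (x * l); split.
- by move=> x0; rewrite mulr_gt0// l0// addr_gt0.
- rewrite -cvg_shiftS; have {}h1 : agam (x + 1) n.+1 @[n --> \oo] --> l by rewrite cvg_shiftS.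
  have : x * agam (x + 1) n.+1 * (1 + (x + 1) / n.+1%:R)^-1 @[n --> \oo] --> x * l * (1 + 0)^-1.
    apply: lim_M; first exact: lim_Z.
    apply: lim_V; first by rewrite addr0 oner_eq0.
    by apply: lim_D; [exact: cvg_cst | exact: harm_lim].
  rewrite addr0 invr1 mulr1; apply: lim_near; near=> n; rewrite [RHS]agam_rec//.
  have hn : (x + 1) / n.+1%:R > -1.
    by near: n; apply: (cvgr_gt _ (harm_lim (x + 1))); rewrite oppr_lt0.
  by rewrite gt_eqF//; move: hn; rewrite ltr_pdivlMr// mulN1r; lra.
have : br t x * qr t (x + 1) @[t --> 0^'+] --> x * l by apply: lim_M h2; exact: br_lim.
apply: lim_near; near=> t; rewrite -qr_rec//.
Unshelve. all: by end_near.
Qed.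

Definition rgam (x : R) : R := lim (agam x n @[n --> \oo]).

Lemma le1_shift (x : R) : x <= 1 -> exists N : nat, 0 < x + N%:R <= 1.
Proof.
move=> x1; exists (absz (Num.floor (1 - x))).
have f0 : 0 <= Num.floor (1 - x) by rewrite Num.Theory.floor_ge0 subr_ge0.
rewrite natr_absz ger0_norm//.
have h1 := Num.Theory.floor_le (1 - x); have h2 := Num.Theory.floorD1_gt (1 - x).
by rewrite intrD in h2; apply/andP; split; lra.
Qed.

Lemma rgam_agam (x : R) : x <= 1 -> agam x n @[n --> \oo] --> rgam x.
Proof.
move=> /le1_shift[N hN]; have [l [_ h _]] := gamma_lim hN.
by rewrite /rgam (cvg_lim _ h).
Qed.

Lemma rgam_qr (x : R) : x <= 1 -> qr t x @[t --> 0^'+] --> rgam x.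
Proof.
move=> /le1_shift[N hN]; have [l [_ h h2]] := gamma_lim hN.
by rewrite /rgam (cvg_lim _ h).
Qed.

Lemma rgam_gt0 (x : R) : 0 < x <= 1 -> 0 < rgam x.
Proof.
move=> hx; have hN : 0 < x + 0%:R <= 1 by rewrite addr0.
have [l [l0 h h2]] := gamma_lim hN.
by rewrite /rgam (cvg_lim _ h)// l0//; case/andP: hx.
Qed.

End QGamma.

(** * Mean values over the circle of both sides of the identity *)

Section MainEstimate.
Variable R : realType.
Local Notation C := R[i].

Lemma muln_ny (c : nat) : (0 < c)%N -> (c * K.+1)%N @[K --> \oo] --> \oo.
Proof.
move=> c0 A [N _ hN]; exists N => // n /= Nn; apply: hN => /=.
by apply: leq_trans (leq_pmull _ c0); exact: leqW.
Qed.

Lemma sqr_1D_le (z : R) : 0 <= z -> 1 + z ^+ 2 <= (1 + z) ^+ 2.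
Proof. by move=> z0; rewrite sqrrD expr1n mul1r lerD2r lerDl mulrn_wge0. Qed.

Lemma qP_ge0 (t x : R) : 0 < t -> 0 <= x -> 0 <= qP t x.
Proof.
move=> t0 x0; pose proof (@qP_cvg R _ t0 x) as h; apply: cvgr_to_ge h _; apply: nearW => n.
apply: prodr_ge0 => i _; rewrite subr_ge0 /pw expR_le1 oppr_le0.
by apply: mulr_ge0; [exact: ltW | rewrite addr_ge0].
Qed.

Lemma nc_pw (t x : R) : nc (pw t x)%:C = pw t x.
Proof. by rewrite nc_pos// ltW// pw_gt0. Qed.

Lemma Lp_pw (t x : R) : 0 < t -> 0 < x -> Lp t (pw t x)%:C * (qP t x)%:C = 1.
Proof. by move=> t0 x0; rewrite -qPE// Lp_Ep// nc_pw pw_lt1. Qed.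

Lemma qP_gt0 (t x : R) : 0 < t -> 0 < x -> 0 < qP t x.
Proof.
move=> t0 x0; rewrite lt_neqAle qP_ge0 ?(ltW x0)// andbT eq_sym.
apply/eqP => h; have := Lp_pw t0 x0; rewrite h mulr0 => /eqP.
by rewrite eq_sym oner_eq0.
Qed.

Lemma Ep_sq_cvg (t x y : R) (c : nat) : 0 < t -> (0 < c)%N -> 0 < x ->
  \prod_(i < (c * K.+1)%N) (1 - pw t (x + i%:R)) ^+ 2 *
  \prod_(i < (c * K.+1)%N) phi y (pw t (x + i%:R)) @[K --> \oo] -->
  nc (Ep t ((pw t x)%:C * ei y)) ^+ 2.
Proof.
move=> t0 c0 x0; pose proof (cvgc_comp (muln_ny c0) (Ep_cvg t0 ((pw t x)%:C * ei y))) as h.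
pose proof (lim_sq (cvgc_nc h)) as h2; apply: lim_near h2; apply: nearW => K.
rewrite nc_prod -big_split -prodrXl /=; apply: eq_bigr => i _.
rewrite -phiE ?pw_lt1 ?ltr_wpDr// pwD (pw_nat t) rcM; congr (nc (1 + _) ^+ 2); ring.
Qed.

Variables (k : nat) (s : R).
Hypothesis k0 : (0 < k)%N.
Hypothesis s0 : 0 < s.
Local Notation t1 := (tlo k s).
Local Notation t2 := (thi k s).
Local Notation tA := (tpr k s).
Local Notation p1 := (expR (- t1)).
Local Notation p2 := (expR (- t2)).

Definition x2 : R := 1 - t1 / (2 * t2).

Lemma x2_itv : 0 < x2 < 1.
Proof.
have T1 := t10 k0 s0; have T2 := t20 k s0; have h := t1Dt2 k s.
have h2 : 0 < 2 * t2 by rewrite mulr_gt0.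
rewrite /x2 subr_gt0 ltr_pdivrMr// gtrBl divr_gt0// andbT mul1r.
by move: T1 h; move: (tlo k s) (thi k s) => a b a0 ->; move: s0 => b0; lra.
Qed.

Lemma pw_xn i : pw t1 (1 / 2 + i%:R) = xn k s i.
Proof. by rewrite /pw /xn addrC. Qed.

Lemma pw_xd i : pw t2 (x2 + i%:R) = xd k s i.
Proof.
rewrite /pw /xd /x2; congr (expR (- _)); have := t20 k s0; move: t1 t2 => a b b0.
by field; rewrite gt_eqF.
Qed.

(** Cross-multiplied and squared, so that it is a limit of inequalities between finite products:
    (k+1)K factors of the numerator against kK of the denominator, as the interlacing requires. *)
Lemma Bz_cross y : `|y| <= pi ->
  nc (Ep t1 ((pw t1 (1 / 2))%:C * ei y)) ^+ 2 * qP t2 x2 ^+ 2 <=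
  (1 + 4 * (pi - `|y|) ^+ 2 / t1 ^+ 2) * expR (5 * ((pi - `|y|) / tA + 1)) *
   (qP t1 (1 / 2) ^+ 2 * nc (Ep t2 ((pw t2 x2)%:C * ei y)) ^+ 2).
Proof.
move=> hy; have T1 := t10 k0 s0; have T2 := t20 k s0; have /andP[X0 X1] := x2_itv.
have h12 : 0 < 1 / 2 :> R by rewrite divr_gt0.
set G := _ * expR _.
pose proof (Ep_sq_cvg (y := y) T1 (ltn0Sn k) h12) as a1.
pose proof (Ep_sq_cvg (y := y) T2 k0 X0) as a2.
pose proof (lim_comp (muln_ny k0) (@qP_cvg R _ T2 x2)) as b2.
pose proof (lim_comp (muln_ny (ltn0Sn k)) (@qP_cvg R _ T1 (1 / 2))) as b1.
pose proof (lim_M a1 (lim_sq b2)) as l1.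
pose proof (@lim_Z _ _ _ _ _ _ G (lim_M (lim_sq b1) a2)) as l2.
pose proof (lim_le l1 l2) as hl; apply: hl; apply: nearW => K /=.
have hG := prod_phi_bound k0 s0 K hy; rewrite -/G in hG.
have hP := prod_phi_le k0 s0 y K.+1.
rewrite -!prodrXl; under eq_bigr do rewrite pw_xn.
under [X in _ * X * _ <= _]eq_bigr do rewrite pw_xn.
under [X in _ * _ * X <= _]eq_bigr do rewrite pw_xd.
under [X in _ <= G * (_ * (X * _))]eq_bigr do rewrite pw_xd.
under [X in _ <= G * (_ * (_ * X))]eq_bigr do rewrite pw_xd.
set a := \prod_(i < k.+1 * K.+1) (1 - _) ^+ 2; set b := \prod_(i < k.+1 * K.+1) _ in hP *.
set c := \prod_(i < k * K.+1) (1 - _) ^+ 2; set d := \prod_(i < k * K.+1) _ in hP *.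
have a0 : 0 <= a by apply: prodr_ge0 => i _; exact: sqr_ge0.
have c0 : 0 <= c by apply: prodr_ge0 => i _; exact: sqr_ge0.
have d0 : 0 <= d.
  apply: prodr_ge0 => i _; apply: le_trans (phi_ge1 _ _) => //.
  by case/andP: (xd_itv k0 s0 i).
have -> : a * b * c = a * c * b by ring.
have -> : G * (a * (c * d)) = a * c * (d * G) by ring.
apply: ler_wpM2l; first exact: mulr_ge0.
by apply: le_trans hP _; apply: ler_wpM2l.
Qed.

(* The value of [Bz] at the negative point of the circle |x| = e^{ks/2}. *)
Definition BX : R := qP t1 (1 / 2) / qP t2 x2.

(** Square root of [Bz_cross] with u = (pi - |y|)/tA: the exponential gives e^{5(u+1)/2}, and the
    factor 1 + (2(k+1)u)^2 costs one more e^u, hence 7/2 = 5/2 + 1. *)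
Lemma Bz_bound y : `|y| <= pi ->
  nc (Bz k s (cexp (- wy k s y))) <=
   BX * (2 * k.+1%:R * expR (5 / 2)) * expR (7 / 2 * ((pi - `|y|) / tA)).
Proof.
move=> hy; have T1 := t10 k0 s0; have T2 := t20 k s0; have TA := tA0 k0 s0.
have /andP[X0 X1] := x2_itv; have h12 : 0 < 1 / 2 :> R by rewrite divr_gt0.
have hy' : `|- y| <= pi by rewrite normrN.
have := Bz_cross hy'; rewrite normrN.
have ex : cexp (- wy k s y) = (expR (t1 / 2))%:C * ei (- y).
  rewrite -cexp_real -cexpD; congr cexp; apply/eqP.
  by rewrite eq_complex /= opprK addr0 add0r !eqxx.
have e1 : p1%:C * cexp (- wy k s y) = (pw t1 (1 / 2))%:C * ei (- y).
  by rewrite ex mulrA -rcM -expRD /pw; congr ((expR _)%:C * _); field.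
have e2 : p2%:C * cexp (- wy k s y) = (pw t2 x2)%:C * ei (- y).
  rewrite ex mulrA -rcM -expRD /pw; congr ((expR _)%:C * _).
  by rewrite /x2; move: t1 t2 T2 => a b b0; field; rewrite gt_eqF.
rewrite /Bz e1 e2.
set eN := Ep t1 _; set eD := Ep t2 _.
have L2 : Lp t2 (- ((pw t2 x2)%:C * ei (- y))) * eD = 1.
  have := Lp_Ep T2 (z := - ((pw t2 x2)%:C * ei (- y))); rewrite opprK; apply.
  by rewrite ncN ncM nc_ei mulr1 nc_pw pw_lt1.
have D0 : eD != 0.
  by apply/eqP => h; move/eqP: L2; rewrite h mulr0 eq_sym oner_eq0.
have -> : Lp t2 (- ((pw t2 x2)%:C * ei (- y))) = eD^-1.
  by rewrite -[LHS](mulfK D0) L2 div1r.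
rewrite ncM ncV ler_pdivrMr ?nc_gt0//.
have d0 : 0 < nc eD by rewrite nc_gt0.
set u := (pi - `|y|) / tA; have u0 : 0 <= u by apply: divr_ge0; [rewrite subr_ge0 | exact: ltW].
have q1 := qP_gt0 T1 h12; have q2 := qP_gt0 T2 X0.
have -> : 4 * (pi - `|y|) ^+ 2 / t1 ^+ 2 = (2 * k.+1%:R * u) ^+ 2.
  have kn : k%:R != 0 :> R by rewrite gt_eqF// ltr0n.
  have s1 : s != 0 by rewrite gt_eqF.
  have kn1 : k.+1%:R != 0 :> R by rewrite pnatr_eq0.
  rewrite /u /tpr /tlo; move: (pi - `|y|) (k.+1%:R : R) kn1 (k%:R : R) kn => D b b0 a a0.
  by field; rewrite ?a0 ?b0 ?s1.
have k1 : 1 <= k.+1%:R :> R by rewrite ler1n.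
set kk : R := k.+1%:R in k1 *.
have kk2 : 0 <= 2 * kk by apply: mulr_ge0 => //; exact: le_trans ler01 k1.
set E := 2 * kk * expR (5 / 2).
have hG : (1 + (2 * kk * u) ^+ 2) * expR (5 * (u + 1)) <= (E * expR (7 / 2 * u)) ^+ 2.
  have -> : expR (5 * (u + 1)) = (expR (5 / 2 * u) * expR (5 / 2)) ^+ 2.
    by rewrite -expRD -expRM_natl; congr expR; field.
  have -> : (E * expR (7 / 2 * u)) ^+ 2 =
      (2 * kk * expR u) ^+ 2 * (expR (5 / 2 * u) * expR (5 / 2)) ^+ 2.
    rewrite -exprMn /E; congr (_ ^+ 2).
    have -> : expR (7 / 2 * u) = expR u * expR (5 / 2 * u) by rewrite -expRD; congr expR; field.
    by move: (expR u) (expR _) (expR _) => a b c; ring.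
  apply: ler_wpM2r; first exact: sqr_ge0.
  apply: (@le_trans _ _ ((1 + 2 * kk * u) ^+ 2)).
    by apply: sqr_1D_le; exact: mulr_ge0.
  have h3 := expR_ge1Dx u.
  apply: lerXn2r; rewrite ?nnegrE.
  - by apply: addr_ge0 => //; exact: mulr_ge0.
  - by apply: mulr_ge0 => //; exact: expR_ge0.
  apply: (@le_trans _ _ (2 * kk * (1 + u))); last exact: ler_wpM2l.
  by rewrite mulrDr mulr1 lerD2r; apply: (le_trans k1); rewrite ler_peMl ?(le_trans ler01 k1) ?ler1n.
have E0' : 0 <= E by apply: mulr_ge0 => //; exact: expR_ge0.
move: hG E0'; clearbody E => hG E0' hc.
have hh : (nc eN * qP t2 x2) ^+ 2 <= (qP t1 (1 / 2) * E * expR (7 / 2 * u) * nc eD) ^+ 2.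
  rewrite exprMn; apply: le_trans hc _.
  have -> : (qP t1 (1 / 2) * E * expR (7 / 2 * u) * nc eD) ^+ 2 =
    (E * expR (7 / 2 * u)) ^+ 2 * (qP t1 (1 / 2) ^+ 2 * nc eD ^+ 2).
    by move: (qP _ _) (nc eD) (expR _) => a b d; ring.
  by apply: ler_wpM2r; rewrite // mulr_ge0 ?sqr_ge0.
have A0 : 0 <= nc eN * qP t2 x2 by apply: mulr_ge0; [exact: nc_ge0 | exact: ltW].
have B0 : 0 <= qP t1 (1 / 2) * E * expR (7 / 2 * u) * nc eD.
  by rewrite -!mulrA; do !apply: mulr_ge0; rewrite ?nc_ge0 ?expR_ge0 ?E0' ?(ltW q1).
have : nc eN * qP t2 x2 <= qP t1 (1 / 2) * E * expR (7 / 2 * u) * nc eD.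
  by move: hh; rewrite ler_pXn2r ?nnegrE.
rewrite -ler_pdivlMr// => h; apply: le_trans h _.
rewrite /BX le_eqVlt; apply/orP; left; apply/eqP.
by move: (qP t1 _) (qP t2 _) q2 (expR _) (nc eD) => a b b0 c d; field; rewrite gt_eqF.
Qed.

Variable m : nat.

(** The expansion of z^{-m} [Th tA] [Hz], with coefficient [cF] and exponent [dF] of z. Exponent
    zero forces the theta index to be i + j - m, which is the Gaussian centred at m in [gm]. *)
Definition dF (p : int * (nat * nat)) : int := p.2.1%:Z + p.2.2%:Z - p.1 - m%:Z.
Definition cF (p : int * (nat * nat)) : C :=
  (expR (- (tA / 2) * p.1%:~R ^+ 2))%:C *
  ((ecoef t2 p.2.1 * p2 ^+ p.2.1)%:C * ((lcoef t1 p.2.2)%:C * (-1) ^+ p.2.2)).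
Definition gF (y : R) (p : int * (nat * nat)) : C :=
  cexp (- (m%:R * wy k s y)) * (th tA (- wy k s y) p.1 *
   (pterm (ecoef t2) (p2%:C * cexp (wy k s y)) p.2.1 *
    pterm (lcoef t1) (- cexp (wy k s y)) p.2.2)).

Lemma gF_E y p : gF y p = cF p * cexp ((dF p)%:~R * wy k s y).
Proof.
case: p => a [i j]; rewrite /gF /cF /dF /= /pterm /th; set w := wy k s y.
have -> : (i%:Z + j%:Z - a - m%:Z)%:~R * w =
   i%:R * w + j%:R * w + a%:~R * - w + - (m%:R * w) :> C.
  by rewrite !intrD !intrN !mulrDl mulrN !mulNr -!pmulrn.
rewrite !cexpD !cexpM_nat -(cexp_real (- (tA / 2) * _)) [(p2%:C * _) ^+ i]exprMn (exprNn (cexp w)) [(ecoef t2 i * _)%:C]rcM (rcX p2).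
have -> : (- (tA / 2) * (a%:~R : R) ^+ 2)%:C = - (tA / 2)%:C * a%:~R ^+ 2 :> C.
  by rewrite [LHS]rcM (rcN (tA / 2)) (rcX (a%:~R)) -intC.
move: (cexp (- (m%:R * w))) (cexp _) (cexp (a%:~R * _)) (cexp w ^+ i) (cexp w ^+ j).
move: ((ecoef _ _)%:C) (p2%:C ^+ i) ((lcoef _ _)%:C) ((-1) ^+ j) => x1 x2' x3 x4 x5 x6 x7 x8 x9.
by ring.
Qed.

Lemma gF_abs y : exists K, abs_le (gF y) K.
Proof.
have T1 := t10 k0 s0; have T2 := t20 k s0; have TA := tA0 k0 s0.
have [K1 h1] := Ep_abs T2 (p2%:C * cexp (wy k s y)).
have z1 : nc (- cexp (wy k s y)) < 1 by rewrite ncN nc_cexp_wy expRt1.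
have [K2 h2] := Lp_abs T1 z1.
exists (nc (cexp (- (m%:R * wy k s y))) * (thbound tA (- wy k s y) * (K1 * K2))).
exact: abs_leZ (abs_le_prod (abs_le_th _ TA) (abs_le_prod h1 h2)).
Qed.

Definition Fy (y : R) : C :=
  cexp (- (m%:R * wy k s y)) * (Th tA (- wy k s y) * Hz k s (cexp (wy k s y))).

Lemma gF_sum y : is_sum (gF y) (Fy y).
Proof.
have T1 := t10 k0 s0; have T2 := t20 k s0; have TA := tA0 k0 s0.
have [K1 h1] := Ep_abs T2 (p2%:C * cexp (wy k s y)).
have z1 : nc (- cexp (wy k s y)) < 1 by rewrite ncN nc_cexp_wy expRt1.
have [K2 h2] := Lp_abs T1 z1.
apply: is_sumZ; apply: (is_sum_prod (abs_le_th _ TA) (abs_le_prod h1 h2)).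
  exact: ThP.
by apply: (is_sum_prod h1 h2); [exact: EpP | exact: LpP].
Qed.

Definition gm (p : nat * nat) : C :=
  (ecoef t2 p.1 * p2 ^+ p.1)%:C * ((lcoef t1 p.2)%:C * (-1) ^+ p.2) *
  (expR (- (tA / 2) * (p.1%:Z + p.2%:Z - m%:Z)%:~R ^+ 2))%:C.

(* Gm m = sum_n c_n e^{-(A/2)(n - m)^2}, with c_n expanded by Euler's two identities. *)
Definition Gm : C := csum gm.

Lemma cexp_wyD (d : int) y : cexp (d%:~R * wy k s y) = cexp (d%:~R * wy k s 0) * ei (d%:~R * y).
Proof.
rewrite /ei -cexpD; congr cexp.
have -> : wy k s y = wy k s 0 + (0 +i* y).
  by apply/eqP; rewrite eq_complex /= addr0 add0r !eqxx.
by rewrite mulrDr; congr (_ + _); rewrite intC ImiM.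
Qed.

Definition hF (p : nat * nat) : int * (nat * nat) := (p.1%:Z + p.2%:Z - m%:Z, p).

Lemma dF_hF p : dF (hF p) = 0.
Proof. by rewrite /dF /hF /=; ring. Qed.

Lemma gm_hF p : gm p = gF 0 (hF p).
Proof. by rewrite gF_E dF_hF mulr0z mul0r cexp0 mulr1 /gm /cF /hF /= mulrC. Qed.

Lemma gm_abs : exists K, abs_le gm K.
Proof.
have [K h] := gF_abs 0; exists K.
have inj : injective hF by move=> p q [].
apply: abs_leS (abs_le_reindex inj h) => p.
by rewrite gm_hF.
Qed.

Lemma cmean_Fy : cvgc \oo (fun L => cmean L Fy) Gm.
Proof.
have [K h] := gF_abs 0; have [K' h'] := gm_abs.
have -> : Gm = csum (fun p => if dF p == 0 then gF 0 p else 0).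
  apply/esym/csumE; apply: (@is_sum_extend _ _ _ hF snd) => [p|p|]; rewrite ?/hF//.
    case: (dF p =P 0) => [hp _|_]; last by rewrite eqxx.
    case: p hp => a [i j]; rewrite /dF /= => hp; congr (_, _).
    by apply/eqP; rewrite -subr_eq0 -hp; apply/eqP; ring.
  apply: eq_is_sum (csumP h') => p /=.
  by rewrite -/(hF p) dF_hF eqxx gm_hF.
apply: (cmean_lim h) => y; apply: eq_is_sum (gF_sum y) => p.
by rewrite !gF_E -mulrA cexp_wyD.
Qed.

(** The same for z^{-m} [Bz](1/z)/(1 + z): two Euler series in 1/z and a geometric series in -z. *)
Definition dG (p : (nat * nat) * nat) : int := p.2%:Z - p.1.1%:Z - p.1.2%:Z - m%:Z.
Definition gG (y : R) (p : (nat * nat) * nat) : C :=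
  cexp (- (m%:R * wy k s y)) *
  (pterm (ecoef t1) (p1%:C * cexp (- wy k s y)) p.1.1 *
   pterm (lcoef t2) (- (p2%:C * cexp (- wy k s y))) p.1.2 * (- cexp (wy k s y)) ^+ p.2).
Definition cG (p : (nat * nat) * nat) : C :=
  (ecoef t1 p.1.1 * p1 ^+ p.1.1)%:C * ((lcoef t2 p.1.2)%:C * (- p2%:C) ^+ p.1.2) *
  (-1) ^+ p.2.

Lemma gG_E y p : gG y p = cG p * cexp ((dG p)%:~R * wy k s y).
Proof.
case: p => [[i j] n]; rewrite /gG /cG /dG /= /pterm; set w := wy k s y.
have -> : (n%:Z - i%:Z - j%:Z - m%:Z)%:~R * w =
   n%:R * w + i%:R * - w + j%:R * - w + - (m%:R * w) :> C.
  by rewrite !intrD !intrN !mulrDl !mulrN !mulNr -!pmulrn.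
rewrite !cexpD !cexpM_nat -(mulNr p2%:C) [(p1%:C * _) ^+ i]exprMn [(- p2%:C * _) ^+ j]exprMn (exprNn (cexp w)) [(ecoef t1 i * _)%:C]rcM (rcX p1).
move: (cexp (- (m%:R * w))) (cexp _ ^+ i) (cexp _ ^+ j) (cexp w ^+ n).
move: ((ecoef _ _)%:C) (p1%:C ^+ i) ((lcoef _ _)%:C) ((-1) ^+ n) => x1 x2' x3 x4 x5 x6 x7 x8.
by move: ((- p2%:C) ^+ j) => x9; ring.
Qed.

Definition By (y : R) : C :=
  cexp (- (m%:R * wy k s y)) * (Bz k s (cexp (- wy k s y)) / (1 + cexp (wy k s y))).

Lemma nc_p2x y : nc (- (p2%:C * cexp (- wy k s y))) < 1.
Proof.
have T1 := t10 k0 s0; have h := t1Dt2 k s.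
have ew : complex.Re (- wy k s y) = t1 / 2 by rewrite ReN /= opprK.
rewrite ncN ncM (nc_pos (expR_ge0 _)) nc_cexp ew -expRD expR_lt1.
rewrite addrC subr_lt0; apply: (@lt_trans _ _ t1); last by rewrite h ltrDl.
by rewrite ltr_pdivrMr// ltr_pMr// ltr1n.
Qed.

Lemma gG_abs_sum y : (exists K, abs_le (gG y) K) /\ is_sum (gG y) (By y).
Proof.
have T1 := t10 k0 s0; have T2 := t20 k s0.
have [K1 h1] := Ep_abs T1 (p1%:C * cexp (- wy k s y)).
have [K2 h2] := Lp_abs T2 (nc_p2x y).
have z1 : nc (- cexp (wy k s y)) < 1 by rewrite ncN nc_cexp_wy expRt1.
have h3 : abs_le (fun n : nat => (- cexp (wy k s y)) ^+ n) (1 - nc (- cexp (wy k s y)))^-1.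
  apply: abs_le_nat => n; under eq_bigr do rewrite ncX.
  by apply: geo_sum_le; rewrite nc_ge0.
split.
  exists (nc (cexp (- (m%:R * wy k s y))) * (K1 * K2 * (1 - nc (- cexp (wy k s y)))^-1)).
  exact: abs_leZ (abs_le_prod (abs_le_prod h1 h2) h3).
apply: is_sumZ; apply: (is_sum_prod (abs_le_prod h1 h2) h3).
  by apply: (is_sum_prod h1 h2); [exact: EpP | exact: LpP (nc_p2x y)].
by have := is_sum_geo z1; rewrite opprK.
Qed.

Definition hG (p : nat * nat) : (nat * nat) * nat := (p, (p.1 + p.2 + m)%N).

Lemma dG_hG p : dG (hG p) = 0.
Proof. by rewrite /dG /hG /= !PoszD; ring. Qed.

Definition kap : R := qinf t1 / qinf t2.

Lemma kap_gt0 : 0 < kap.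
Proof. by apply: divr_gt0; apply: qinf_gt0; [exact: t10 | exact: t20]. Qed.

(** Exponent zero fixes the geometric index as i + j + m, so the remaining double series is (-1)^m
    times [Bz] at -1, that is (p;p)/(p';p'). *)
Lemma cmean_By : cvgc \oo (fun L => cmean L By) ((-1) ^+ m * kap%:C).
Proof.
have T1 := t10 k0 s0; have T2 := t20 k s0.
have [[K h] _] := gG_abs_sum 0.
have -> : (-1) ^+ m * kap%:C = csum (fun p => if dG p == 0 then gG 0 p else 0).
  apply/esym/csumE; apply: (@is_sum_extend _ _ _ hG fst) => [p|p|]; rewrite ?/hG//.
    case: (dG p =P 0) => [hp _|_]; last by rewrite eqxx.
    case: p hp => [[i j] n]; rewrite /dG /= => hp; congr (_, _); lia.
  have p21 : nc p2%:C < 1 by rewrite nc_pos ?expR_ge0// expR_lt1 oppr_lt0.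
  have [K1 h1] := Ep_abs T1 (- p1%:C); have [K2 h2] := Lp_abs T2 p21.
  have hl : Lp t2 p2%:C = ((qinf t2)^-1)%:C.
    have q0 := rc_neq0 (qinf_gt0 T2).
    by apply: (mulIf q0); rewrite -{1}qinfE// Lp_Ep// rcV mulVf.
  rewrite /kap rcM -hl -qinfE//.
  apply: eq_is_sum (is_sumZ _ (is_sum_prod h1 h2 (EpP T1 _) (LpP T2 p21))) => -[i j] /=.
  have := dG_hG (i, j); rewrite /hG /= => e.
  rewrite e eqxx gG_E e mulr0z mul0r cexp0 mulr1 /cG /pterm /= !exprD.
  rewrite (exprNn p2%:C) (exprNn p1%:C) [(ecoef t1 i * _)%:C]rcM (rcX p1).
  have hj : (-1) ^+ j * (-1) ^+ j = 1 :> C by rewrite -expr2 sqrr_sign.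
  move: ((-1) ^+ j) hj => x hx.
  move: ((-1) ^+ i) ((-1) ^+ m) ((ecoef _ _)%:C) ((lcoef _ _)%:C) (p1%:C ^+ i) (p2%:C ^+ j) => a b c d e' f.
  transitivity (a * b * c * d * e' * f * (x * x)); first by rewrite hx; ring.
  by ring.
apply: (cmean_lim h) => y; have [_ hy] := gG_abs_sum y; apply: eq_is_sum hy => p.
by rewrite !gG_E -mulrA cexp_wyD.
Qed.

End MainEstimate.

(** * Theta functions on the line Im w = pi, and the asymptotics of (p;p) *)

Section DualBoundary.
Variable R : realType.
Local Notation C := R[i].

Lemma abs_le_sq (m : int) : m != -1 -> `|m| <= m * m + m.
Proof. by move=> h; case: m h => n h; nia. Qed.

(** At Im w = pi the dual term of index m has modulus e^{-(2 pi^2/t)(m^2+m)}. The indices 0 and -1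
    both have modulus 1 and form the main term; for the others m^2 + m >= |m|. *)
Lemma dual_boundary (t a : R) : 0 < t <= 1 ->
  nc (Th (4 * pi ^+ 2 / t) (dw t (a +i* pi)) - (1 + ei (- (2 * pi * a / t)))) <=
    4 * expR (- (2 * pi ^+ 2 / t)).
Proof.
move=> /andP[t0 t1]; have p2 := pi_ge2 R; have hpi := pi_gt0 R.
have T0 : 0 < 4 * pi ^+ 2 / t by rewrite divr_gt0// mulr_gt0// exprn_gt0.
set T := 4 * pi ^+ 2 / t in T0 *; set w := dw t _.
pose d (n : int) : C := (n == 0)%:R + (n == -1)%:R * ei (- (2 * pi * a / t)).
have hd : is_sum d (1 + ei (- (2 * pi * a / t))).
  have h0 := @is_sum_fin R int (fset1 0) (fun n => (n == 0)%:R).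
  have h1 := @is_sum_fin R int (fset1 (-1)) (fun n => (n == -1)%:R * ei (- (2 * pi * a / t))).
  rewrite !big_seq_fset1 !eqxx mul1r in h0 h1.
  apply: is_sumD; first by apply: h0 => i; rewrite inE => /negPf ->.
  by apply: h1 => i; rewrite inE => /negPf ->; rewrite mul0r.
apply: is_sum_nc_le (is_sumB (ThP w T0) hd) _.
pose x : R := expR (- (2 * pi ^+ 2 / t)); rewrite -/x.
have x0 : 0 <= x by exact: expR_ge0.
have x12 : x <= 1 / 2.
  rewrite /x expRN div1r lef_pV2 ?posrE ?expR_gt0//.
  apply: le_trans (expR_ge1Dx _).
  have : 1 <= 2 * pi ^+ 2 / t by rewrite ler_pdivlMr// expr2; nra.
  lra.
have Rw : complex.Re w = - (2 * pi ^+ 2 / t).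
  by rewrite /w Re_dw /=; move: (@pi R) => p; ring.
have thm1 : th T w (-1) = ei (- (2 * pi * a / t)).
  rewrite /th /ei; congr cexp; rewrite /w /dw /T; apply/eqP; rewrite eq_complex /=.
  apply/andP; split; apply/eqP; move: (@pi R) => p; rewrite /= ?(mul0r, mulr0, subr0, add0r, addr0, oppr0); field; rewrite gt_eqF//.
have term (n : nat) (m : int) : absz m = n.+1 -> nc (th T w m - d m) <= x * x ^+ n.
  move=> hm; have m0 : m != 0 by rewrite -absz_eq0 hm.
  rewrite /d (negPf m0) add0r; have [->|m1] := eqVneq m (-1).
    by rewrite mul1r thm1 subrr nc0 mulr_ge0 ?exprn_ge0.
  rewrite mul0r subr0 nc_th Rw -exprS /x -expRM_natl ler_expR.
  have h : (n.+1%:R : R) <= (m * m + m)%:~R.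
    by rewrite -hm natr_absz intr_norm -intr_norm ler_int abs_le_sq.
  have -> : - (T / 2) * m%:~R ^+ 2 + m%:~R * - (2 * pi ^+ 2 / t) =
    - (2 * pi ^+ 2 / t) * (m * m + m)%:~R.
    by rewrite intrD intrM /T; move: (@pi R) (m%:~R : R) => p M; field; rewrite gt_eqF.
  rewrite mulNr mulrN lerN2 (mulrC (2 * pi ^+ 2 / t)); apply: ler_wpM2r => //.
  by rewrite divr_ge0 ?(ltW t0)// mulr_ge0 ?exprn_ge0 ?(ltW hpi).
have -> : 4 * x = 2 * x + 2 * x by ring.
have half (g : nat -> int) : (forall n, absz (g n) = n) -> forall A : {fset nat},
    \sum_(i <- A) nc (th T w (g i) - d (g i)) <= 2 * x.
  move=> hg; apply: fsum_nat_le => [i|n]; first exact: nc_ge0.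
  case: n => [|n]; first by rewrite big_ord0 mulr_ge0.
  rewrite big_ord_recl /=.
  have -> : g 0%N = 0 by apply/eqP; rewrite -absz_eq0 hg.
  rewrite th0 /d eqxx /= mul0r addr0 subrr nc0 add0r.
  apply: (@le_trans _ _ (\sum_(i < n) x * x ^+ i)).
    by apply: ler_sum => i _; apply: term; rewrite hg.
  rewrite -mulr_sumr mulrC; apply: ler_wpM2r => //.
  have x1 : 0 <= x < 1 by rewrite x0 /=; lra.
  apply: le_trans (geo_sum_le n x1) _.
  rewrite -[leRHS]invrK lef_pV2 ?posrE ?invr_gt0//; lra.
apply: fsum_int_le => [i|A|A]; first exact: nc_ge0.
  by apply: (half (fun n : nat => n%:Z)).
by apply: (half (fun n : nat => - n%:Z)) => n; rewrite abszN.
Qed.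

Lemma cos_pi3 : cos (pi / 3) = 1 / 2 :> R.
Proof.
have hpi := pi_gt0 R; set x : R := pi / 3.
have c0 : 0 < cos x by apply: cos_gt0_pihalf; rewrite /x; apply/andP; split; lra.
have e3 : cos (x + (x + x)) = -1 by rewrite (_ : x + (x + x) = pi) ?cospi// /x; field.
have e : cos (x + (x + x)) = 4 * cos x ^+ 3 - 3 * cos x.
  rewrite cosD cosD sinD.
  have -> : cos x * (cos x * cos x - sin x * sin x) - sin x * (sin x * cos x + cos x * sin x) =
    cos x ^+ 3 - 3 * cos x * sin x ^+ 2 by ring.
  by rewrite sin2cos2; ring.
rewrite e in e3.
have : (cos x + 1) * (2 * cos x - 1) ^+ 2 == 0.
  have -> : (cos x + 1) * (2 * cos x - 1) ^+ 2 = 4 * cos x ^+ 3 - 3 * cos x + 1 by ring.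
  by rewrite e3 addNr.
rewrite mulf_eq0 sqrf_eq0 gt_eqF ?addr_gt0//= subr_eq0 => /eqP h.
by move: h; move: (cos x) => c h; lra.
Qed.

Lemma nc_one_ei : nc (1 + ei (- (pi / 3)) : C) = Num.sqrt 3.
Proof.
have h := nc_1Dx 1 (- (pi / 3) : R); rewrite mul1r cosN cos_pi3 in h.
by rewrite -[LHS]ger0_norm ?nc_ge0// -sqrtr_sqr h; congr Num.sqrt; field.
Qed.

(** The factors 1 - p^i are sorted by the residue of i modulo 3, on finite products and then in the
    limit. *)
Lemma qinf_mod3 (t : R) : 0 < t ->
  qP (3 * t) (1 / 3) * qP (3 * t) (2 / 3) * qinf (3 * t) = qinf t.
Proof.
move=> t0; have T0 : 0 < 3 * t by rewrite mulr_gt0.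
pose proof (lim_M (lim_M (@qP_cvg R _ T0 (1 / 3)) (@qP_cvg R _ T0 (2 / 3))) (qf_cvg T0)) as h.
have h3 : (3 * K.+1)%N @[K --> \oo] --> \oo.
  by move=> A [N _ hN]; exists N => // n /= Nn; apply: hN => /=; lia.
have h4 : (K.+1)%N @[K --> \oo] --> \oo.
  by move=> A [N _ hN]; exists N => // n /= Nn; apply: hN => /=; lia.
pose proof (lim_comp h3 (qf_cvg t0)) as h2.
pose proof (lim_comp h4 h) as h'.
pose Fk (K : nat) := \prod_(i < K.+1) (1 - pw (3 * t) (1 / 3 + i%:R)) *
  \prod_(i < K.+1) (1 - pw (3 * t) (2 / 3 + i%:R)) * qf (3 * t) K.+1.
have {}h' : Fk K @[K --> \oo] --> qP (3 * t) (1 / 3) * qP (3 * t) (2 / 3) * qinf (3 * t) by exact: h'.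
suff h5 : Fk K @[K --> \oo] --> qinf t by exact: cvg_unique h' h5.
apply: lim_near h2; apply: nearW => K /=; rewrite /Fk.
move: K.+1 => n; elim: n => [|n IH]; first by rewrite muln0 /qf !big_ord0 !mulr1.
have -> : (3 * n.+1 = (3 * n).+3)%N by lia.
rewrite !qfS IH !big_ord_recr /=.
have e1 : pw (3 * t) (1 / 3 + n%:R) = expR (- t) ^+ (3 * n).+1.
  by rewrite /pw -expRM_natl -(addn1 (3 * n)%N) natrD natrM; congr expR; field.
have e2 : pw (3 * t) (2 / 3 + n%:R) = expR (- t) ^+ (3 * n).+2.
  by rewrite /pw -expRM_natl -(addn2 (3 * n)%N) natrD natrM; congr expR; field.
have e3 : expR (- (3 * t)) ^+ n.+1 = expR (- t) ^+ (3 * n).+3.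
  have -> : ((3 * n).+3 = 3 * n.+1)%N by lia.
  by rewrite -!expRM_natl natrM; congr expR; ring.
by rewrite e1 e2 e3; move: (\prod_(i < n) _) (\prod_(i < n) _) (qf _ _) => a b c; ring.
Qed.

(** Euler's pentagonal number theorem, from the triple product in base p^3. *)
Lemma qinf_theta (t : R) : 0 < t -> Th (3 * t) ((t / 2) +i* pi) = (qinf t)%:C.
Proof.
move=> t0; have T0 : 0 < 3 * t by rewrite mulr_gt0.
have W0 : - (3 * t) < complex.Re ((- t) +i* pi : C) by rewrite /=; lra.
have := jacobi T0 W0.
have -> : (- t) +i* pi + (3 * t / 2)%:C = (t / 2) +i* pi :> C.
  by apply/eqP; rewrite eq_complex /= addr0 eqxx andbT; apply/eqP; field.
have e1 : cexp ((- t) +i* pi : C) = - (expR (- t))%:C.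
  have -> : (- t) +i* pi = (- t)%:C + (0 +i* pi) :> C.
    by apply/eqP; rewrite eq_complex /= addr0 add0r !eqxx.
  by rewrite cexpD cexp_pi cexp_real mulrN1.
have E1 : Ep (3 * t) (cexp ((- t) +i* pi : C)) = (qP (3 * t) (1 / 3))%:C.
  rewrite e1 (_ : expR (- t) = pw (3 * t) (1 / 3)); first exact: qPE.
  by rewrite /pw; congr expR; field.
have E2 : Ep (3 * t) ((expR (- (3 * t)))%:C * cexp (- ((- t) +i* pi : C))) = (qP (3 * t) (2 / 3))%:C.
  rewrite cexpN e1 invrN mulrN -rcV -rcM -expRN -expRD.
  rewrite (_ : expR _ = pw (3 * t) (2 / 3)); first exact: qPE.
  by rewrite /pw; congr expR; field.
rewrite E1 E2 => ->; have <- := qinf_mod3 t0.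
move: (qP _ _) (qP _ _) (qinf _) => a b c; rewrite !rcM; ring.
Qed.

(** The leading behaviour of the modular transformation of the eta function. The dual pair tends to
    1 + e^{-i pi/3}, of modulus sqrt 3, which cancels the sqrt 3 coming from the parameter 3t. *)
Lemma qinf_asym :
  qinf t / (Num.sqrt (2 * pi / t) * expR (t / 24 - pi ^+ 2 / (6 * t))) @[t --> (0 : R)^'+] --> (1 : R).
Proof.
have hpi := pi_gt0 R.
pose D (t : R) := Th (4 * pi ^+ 2 / (3 * t)) (dw (3 * t) ((t / 2) +i* pi)).
have hD : cvgc (0 : R)^'+ D (1 + ei (- (pi / 3))).
  move=> e e0; have e4 : 0 < e / 4 by rewrite divr_gt0.
  have h : expR (- (2 * pi ^+ 2 / (3 * t))) @[t --> (0 : R)^'+] --> (0 : R).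
    apply: (@squeeze_cvgr _ _ _ _ _ _ _ _ _ (cvg_cst 0) (@lim_id0 R)).
    near=> t; have t0 : 0 < t by near: t; exact: near0_gt0.
    rewrite expR_ge0 /=; apply: (@le_trans _ _ (2 * pi ^+ 2 / (3 * t))^-1).
      rewrite expRN lef_pV2 ?posrE ?expR_gt0 ?divr_gt0 ?mulr_gt0 ?exprn_gt0//.
      by apply: le_trans (expR_ge1Dx _); rewrite lerDr.
    rewrite invf_div ler_pdivrMr ?mulr_gt0 ?exprn_gt0//.
    have p2 := pi_ge2 R; rewrite expr2.
    have : 3 <= 2 * (pi * pi : R) by nra.
    move: (2 * _) => z hz; rewrite mulrC; apply: ler_wpM2l => //; exact: ltW.
  near=> t; have t0 : 0 < t by near: t; exact: near0_gt0.
  have t1 : t < 1 / 3 by near: t; apply: near0_lt; rewrite divr_gt0.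
  have hb : 0 < 3 * t <= 1 by apply/andP; split; lra.
  have := dual_boundary (t / 2) hb.
  have -> : 2 * pi * (t / 2) / (3 * t) = pi / 3 :> R.
    by move: (@pi R) => p; field; rewrite gt_eqF.
  move=> h1; apply: le_lt_trans h1 _.
  have : expR (- (2 * pi ^+ 2 / (3 * t))) < e / 4 by near: t; exact: (cvgr_lt _ h).
  lra.
pose proof (cvgc_nc hD) as h3; rewrite nc_one_ei in h3.
have s3 : Num.sqrt 3 != 0 :> R by rewrite gt_eqF ?sqrtr_gt0.
pose proof (lim_M h3 (cvg_cst (Num.sqrt 3)^-1)) as h4; rewrite mulfV// in h4.
apply: lim_near h4; near=> t; have t0 : 0 < t by near: t; exact: near0_gt0.
have T0 : 0 < 3 * t by rewrite mulr_gt0.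
have hi : `|complex.Im ((t / 2) +i* pi : C)| <= pi by rewrite /= ger0_norm// ltW.
have := poisson T0 hi; rewrite qinf_theta// -/(dw (3 * t) _) -/(D t) => h.
have eR : complex.Re (((t / 2) +i* pi) ^+ 2 / (2 * (3 * t))%:C : C) = t / 24 - pi ^+ 2 / (6 * t).
  by rewrite -rcV mulrC ReZ expr2 /=; move: (@pi R) => p; field; rewrite gt_eqF.
have hq : qinf t = Num.sqrt (2 * pi / (3 * t)) * (expR (t / 24 - pi ^+ 2 / (6 * t)) * nc (D t)).
  have := congr1 (@nc R) h; rewrite [nc (_ * _)]ncM [nc (_ * D t)]ncM nc_cexp eR.
  by rewrite (nc_pos (sqrtr_ge0 _)) (nc_pos (ltW (qinf_gt0 t0))).
rewrite hq; have -> : Num.sqrt (2 * pi / (3 * t)) = Num.sqrt (2 * pi / t) / Num.sqrt 3.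
  have -> : 2 * pi / (3 * t) = (2 * pi / t) / 3 :> R by move: (@pi R) => p; field; rewrite gt_eqF.
  by rewrite sqrtrM ?sqrtrV// divr_ge0 ?mulr_ge0 ?ltW.
have : Num.sqrt (2 * pi / t) != 0 by rewrite gt_eqF ?sqrt_gt0_pi.
have := expR_gt0 (t / 24 - pi ^+ 2 / (6 * t)).
move: (expR _) (Num.sqrt _) (Num.sqrt 3) s3 (nc _) => E S S3 s3 N E0 S0.
by field; rewrite S0 s3 gt_eqF.
Unshelve. all: by end_near.
Qed.

End DualBoundary.

(** * The error of the main estimate *)

Section MainBound.
Variable R : realType.
Local Notation C := R[i].

Lemma cmeanB L (F G : R -> C) (c : C) :
  cmean L F - c * cmean L G = cmean L (fun y => F y - c * G y).
Proof. by rewrite /cmean sumrB -mulr_sumr; ring. Qed.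

Lemma geo_dist_sum (x : R) (L : nat) : 0 <= x < 1 ->
  \sum_(l < L.*2.+1) (x ^+ l + x ^+ (L.*2 - l)) <= 2 / (1 - x).
Proof.
move=> hx; rewrite big_split /= (reindex_inj rev_ord_inj) /=.
under eq_bigr => i _ do rewrite subSS.
have -> : 2 / (1 - x) = (1 - x)^-1 + (1 - x)^-1 by ring.
have e : \sum_(i < L.*2.+1) x ^+ (L.*2 - i) = \sum_(i < L.*2.+1) x ^+ i.
  rewrite (reindex_inj rev_ord_inj) /=; apply: eq_bigr => i _.
  by rewrite subSS subKn// -ltnS ltn_ord.
by rewrite e; apply: lerD; exact: geo_sum_le.
Qed.

Lemma yL_dist (L l : nat) : (l < L.*2.+1)%N ->
  pi - `|yL R L l| = pi * (2 * (minn l (L.*2 - l))%:R + 1) / (L.*2.+1)%:R.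
Proof.
move=> hl; have hpi := pi_gt0 R.
have N0 : (L.*2.+1)%:R != 0 :> R by [].
have e2 : (L.*2.+1)%:R = 2 * L%:R + 1 :> R by rewrite -natr1 -mul2n natrM.
rewrite /yL.
have [lL|lL] := leqP l L.
  have -> : minn l (L.*2 - l) = l by apply/minn_idPl; lia.
  have h : l%:R - L%:R <= 0 :> R by rewrite subr_le0 ler_nat.
  rewrite ler0_norm; last first.
    rewrite pmulr_lle0 ?invr_gt0// pmulr_rle0// mulr_gt0//.
  by move: N0; rewrite e2; move: (@pi R) (l%:R : R) (L%:R : R) => p a b h0; field.
have -> : minn l (L.*2 - l) = (L.*2 - l)%N by apply/minn_idPr; lia.
have h : 0 <= l%:R - L%:R :> R by rewrite subr_ge0 ler_nat ltnW.
rewrite ger0_norm; last by rewrite divr_ge0// mulr_ge0// mulr_ge0// ltW.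
rewrite natrB; last by lia.
have e3 : (L.*2)%:R = 2 * L%:R :> R by rewrite -mul2n natrM.
by move: N0; rewrite e3 e2; move: (@pi R) (l%:R : R) (L%:R : R) => p a b h0; field.
Qed.

Lemma w_identity (p n v : R) : 0 < p -> 0 < n -> 0 < v ->
  2 + 2 * n * v / p = 2 / (p / (n * v) / (1 + p / (n * v))).
Proof.
move=> p0 n0 v0; have nv : 0 < n * v by rewrite mulr_gt0.
have h1 : 1 + p / (n * v) != 0 by rewrite gt_eqF// addr_gt0// divr_gt0.
have hh : n * v + p != 0 by rewrite gt_eqF// addr_gt0.
by field; rewrite ?hh ?(gt_eqF p0) ?(gt_eqF n0) ?(gt_eqF v0).
Qed.

(** The sample points lie at distance pi(2n+1)/(2L+1) from the nearer of pi and -pi, so the sum is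
    at most two geometric series. As L grows only v remains: the window around the negative axis has
    width of order [tA]. *)
Lemma mean_exp (v : R) (L : nat) : 0 < v ->
  (L.*2.+1)%:R^-1 * (\sum_(l < L.*2.+1) expR (- ((pi - `|yL R L l|) / v / 2))) <=
  2 * (L.*2.+1)%:R^-1 + v.
Proof.
move=> v0; have hpi := pi_gt0 R; have p2 := pi_ge2 R.
set N : R := (L.*2.+1)%:R; have N0 : 0 < N by rewrite ltr0n.
set w := pi / (N * v); have w0 : 0 < w by rewrite divr_gt0// mulr_gt0.
set x := expR (- w); have hx : 0 <= x < 1 by rewrite expR_ge0 expR_lt1 oppr_lt0.
have hx2 : 2 / (1 - x) <= 2 + 2 * N * v / pi.
  have h1 : x <= (1 + w)^-1.
    by rewrite /x expRN lef_pV2 ?posrE ?expR_gt0 ?addr_gt0// expR_ge1Dx.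
  have h2 : w / (1 + w) <= 1 - x.
    have -> : w / (1 + w) = 1 - (1 + w)^-1 by field; rewrite gt_eqF// addr_gt0.
    by rewrite lerD2l lerN2.
  have -> : 2 + 2 * N * v / pi = 2 / (w / (1 + w)).
    exact: w_identity.
  have a0 : 0 < w / (1 + w) by rewrite divr_gt0// addr_gt0.
  by rewrite ler_pM2l// lef_pV2 ?posrE//; exact: lt_le_trans h2.
have hs : \sum_(l < L.*2.+1) expR (- ((pi - `|yL R L l|) / v / 2)) <= 2 / (1 - x).
  apply: le_trans (geo_dist_sum L hx); apply: ler_sum => l _.
  have hxn (n : nat) : pi * (2 * n%:R + 1) / N / v / 2 >= w * n%:R.
    have -> : pi * (2 * n%:R + 1) / N / v / 2 = w * n%:R + w / 2.
      rewrite /w; move: (@pi R) => p; field; rewrite !gt_eqF//.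
    by rewrite lerDl divr_ge0// ltW.
  have key (n : nat) : expR (- (pi * (2 * n%:R + 1) / N / v / 2)) <= x ^+ n.
    by rewrite /x -expRM_natl ler_expR mulrN lerN2 mulrC.
  rewrite yL_dist// -/N; apply: le_trans (key _) _.
  rewrite /minn; case: ifP => _; first by rewrite lerDl exprn_ge0//; case/andP: hx.
  by rewrite lerDr exprn_ge0//; case/andP: hx.
apply: (@le_trans _ _ (N^-1 * (2 + 2 * N * v / pi))).
  by rewrite ler_pM2l ?invr_gt0//; exact: le_trans hx2.
have -> : N^-1 * (2 + 2 * N * v / pi) = 2 * N^-1 + v * (2 / pi).
  by move: (@pi R) hpi => p p0; field; rewrite !gt_eqF.
by rewrite lerD2l ler_piMr ?(ltW v0)// ler_pdivrMr// mul1r.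
Qed.

Variables (k : nat) (s : R).
Hypothesis k0 : (0 < k)%N.
Hypothesis s0 : 0 < s.
Local Notation t1 := (tlo k s).
Local Notation t2 := (thi k s).
Local Notation tA := (tpr k s).
Hypothesis tA1 : tA <= 1.
Variable m : nat.

Definition Mb : R := kap k s * E0 k s * expR (m%:R * (t1 / 2)) * (28 * BX k s) *
  (2 * k.+1%:R * expR (5 / 2)) / (1 - expR (- (t1 / 2))).

Lemma r_lt1 : 0 < 1 - expR (- (t1 / 2)).
Proof. by rewrite subr_gt0 expRt1. Qed.

Lemma BX_gt0 : 0 < BX k s.
Proof.
have /andP[X0 _] := x2_itv k0 s0.
by apply: divr_gt0; apply: qP_gt0; rewrite ?t10 ?t20// divr_gt0.
Qed.

Local Opaque BX kap E0.

Lemma Mb_ge0 : 0 <= Mb.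
Proof.
have h1 := kap_gt0 k0 s0; have h2 := E0_gt0 k0 s0; have h3 := BX_gt0; have h4 := r_lt1.
have e1 := expR_ge0 (m%:R * (t1 / 2)); have e2 : 0 <= expR (5 / 2) :> R := expR_ge0 _.
apply: divr_ge0; last exact: ltW.
have h28 : 0 <= 28 * BX k s := mulr_ge0 (ler0n R 28) (ltW h3).
have hX : 0 <= 2 * k.+1%:R * expR (5 / 2) := mulr_ge0 (mulr_ge0 (ler0n R 2) (ler0n R _)) e2.
exact: mulr_ge0 (mulr_ge0 (mulr_ge0 (mulr_ge0 (ltW h1) (ltW h2)) e1) h28) hX.
Qed.

Lemma diff_aux (c n b z B X r e1 e2 e : R) : 0 <= c -> 0 <= n -> 0 <= b -> 0 < r -> r <= z ->
  0 <= B -> 0 <= X -> n <= 28 * e1 -> b <= B * X * e2 -> e1 * e2 <= e ->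
  c * (n * b / z) <= c * (28 * B) * X / r * e.
Proof.
move=> c0 n0 b0 r0 rz B0 X0 hn hb he; rewrite -!mulrA; apply: ler_wpM2l => //.
have z0 : 0 < z by exact: lt_le_trans rz.
have -> : 28 * (B * (X * (r^-1 * e))) = 28 * B * X * e / r by ring.
rewrite mulrA; apply: ler_pM; rewrite ?mulr_ge0 ?invr_ge0 ?(ltW z0)//; last by rewrite lef_pV2 ?posrE.
apply: le_trans (ler_pM n0 b0 hn hb) _.
have -> : 28 * e1 * (B * X * e2) = 28 * B * X * (e1 * e2) by ring.
by apply: ler_wpM2l => //; rewrite !mulr_ge0.
Qed.

(** This is where the decay of the dual error beats the growth of the slow factor: 2 pi >= 4 = 7/2 +
    1/2. *)
Lemma exp_half (v : R) : 0 <= v -> expR (- (2 * pi * v)) * expR (7 / 2 * v) <= expR (- (v / 2)).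
Proof.
move=> v0; have p2 := pi_ge2 R; rewrite -expRD ler_expR.
have : 2 * v <= pi * v by apply: ler_wpM2r.
by rewrite -mulrA; move: (pi * v) => z; lra.
Qed.

Lemma diff_bound y : `|y| <= pi ->
  nc (Fy k s m y - (kap k s * E0 k s)%:C * By k s m y) <= Mb * expR (- ((pi - `|y|) / tA / 2)).
Proof.
move=> hy; have TA := tA0 k0 s0; have p2 := pi_ge2 R.
have h1 := kap_gt0 k0 s0; have h2 := E0_gt0 k0 s0; have h3 := BX_gt0; have h4 := r_lt1.
have hd := dual_ratio k0 s0 tA1 hy; have hb := Bz_bound k0 s0 hy.
rewrite /Fy (circle_identity k0 s0 hy) -/(kap k s) /By.
set w := wy k s y; set Nf := NA k s y * N2 k s y / N1 k s y in hd *.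
set BB := Bz k s (cexp (- w)) in hb *.
have -> : cexp (- (m%:R * w)) * ((kap k s * E0 k s)%:C * Nf * (BB / (1 + cexp w))) -
  (kap k s * E0 k s)%:C * (cexp (- (m%:R * w)) * (BB / (1 + cexp w))) =
  (kap k s * E0 k s)%:C * cexp (- (m%:R * w)) * ((Nf - 1) * BB / (1 + cexp w)).
  by move: (cexp (- _)) (_%:C) (1 + cexp w)^-1 => a b c; ring.
rewrite [nc (_ * _)]ncM [nc ((kap k s * E0 k s)%:C * _)]ncM [nc (_ / _)]ncM.
rewrite [nc ((Nf - 1) * BB)]ncM ncV (nc_cexp (- _)) (nc_pos (mulr_ge0 (ltW h1) (ltW h2))).
have -> : complex.Re (- (m%:R * w)) = m%:R * (t1 / 2).
  by rewrite ReN -rc_nat ReZ /w /=; ring.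
have hz : 1 - expR (- (t1 / 2)) <= nc (1 + cexp w).
  by have := nc_le_B 1 (- cexp w); rewrite nc1 ncN opprK nc_cexp_wy.
have hz0 : 0 < nc (1 + cexp w) by exact: lt_le_trans hz.
set u := (pi - `|y|) / tA in hb *; have u0 : 0 <= u by apply: divr_ge0; [rewrite subr_ge0 | exact: ltW].
set X := 2 * k.+1%:R * expR (5 / 2) in hb.
have X0 : 0 <= X := mulr_ge0 (mulr_ge0 (ler0n R 2) (ler0n R _)) (expR_ge0 _).
rewrite /Mb -/X.
have he : expR (- (2 * pi * (pi - `|y|) / tA)) * expR (7 / 2 * u) <= expR (- (u / 2)).
  have -> : 2 * pi * (pi - `|y|) / tA = 2 * pi * u by rewrite /u mulrA.
  exact: exp_half.
exact: (diff_aux (mulr_ge0 (mulr_ge0 (ltW h1) (ltW h2)) (expR_ge0 _)) (nc_ge0 _) (nc_ge0 _)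
  h4 hz (ltW h3) X0 hd hb he).
Qed.

Lemma mean_est : nc (Gm k s m - (-1) ^+ m * (kap k s ^+ 2 * E0 k s)%:C) <= Mb * tA.
Proof.
have TA := tA0 k0 s0.
pose proof (cmean_Fy k0 s0 m) as hF; pose proof (cmean_By k0 s0 m) as hB.
pose proof (cvgc_nc (cvgcB hF (cvgcZ (kap k s * E0 k s)%:C hB))) as h.
have e : (kap k s * E0 k s)%:C * ((-1) ^+ m * (kap k s)%:C) =
   (-1) ^+ m * (kap k s ^+ 2 * E0 k s)%:C :> C.
  by rewrite expr2 !rcM; move: (_%:C) (_%:C) => a b; ring.
rewrite e in h.
have hl : Mb * (2 * (L.*2.+1)%:R^-1 + tA) @[L --> \oo] --> Mb * tA.
  have hN : (L.*2.+1)%:R^-1 @[L --> \oo] --> (0 : R) by exact: NL_inv.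
  pose proof (lim_D (@lim_Z _ _ _ _ _ _ 2 hN) (cvg_cst tA)) as h2.
  rewrite mulr0 add0r in h2; exact: (@lim_Z _ _ _ _ _ _ Mb h2).
pose proof (lim_le h hl) as hle; apply: hle; apply: nearW => L.
rewrite cmeanB; apply: le_trans (nc_cmean_le (m := fun y => Mb * expR (- ((pi - `|y|) / tA / 2))) _) _.
  by move=> l hl'; apply: diff_bound; exact: yL_bound.
rewrite -mulr_sumr mulrCA; apply: ler_wpM2l; first exact: Mb_ge0.
exact: mean_exp.
Qed.

(** The width [tA] of the window compensates |1 + z| >= 1 - e^{-ks/2}: their quotient is at most
    3(k+1), and 168 = 28 * 2 * 3. Relative to the main term, the error is [BX / kap] times e^{ksm/2}
    up to a constant. *)
Lemma main_estimate : nc (Gm k s m - (-1) ^+ m * (kap k s ^+ 2 * E0 k s)%:C) <=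
  168 * k.+1%:R ^+ 2 * expR (5 / 2) * (kap k s * E0 k s * BX k s * expR (m%:R * (t1 / 2))).
Proof.
apply: le_trans mean_est _; have TA := tA0 k0 s0; have T1 := t10 k0 s0.
have h1 := kap_gt0 k0 s0; have h2 := E0_gt0 k0 s0; have h3 := BX_gt0; have h4 := r_lt1.
have hr : tA / (1 - expR (- (t1 / 2))) <= 3 * k.+1%:R.
  rewrite ler_pdivrMr//.
  have e : tA = k.+1%:R * t1 by rewrite /tpr /tlo; ring.
  have k1 : 0 < k.+1%:R :> R by rewrite ltr0n.
  have T11 : t1 <= 1 by apply: le_trans tA1; exact: t1_le_tA.
  suff h : t1 <= 3 * (1 - expR (- (t1 / 2))).
    by rewrite e mulrAC (mulrC _ k.+1%:R) ler_pM2l.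
  have h5 : expR (- (t1 / 2)) <= (1 + t1 / 2)^-1.
    by rewrite expRN lef_pV2 ?posrE ?expR_gt0 ?addr_gt0 ?divr_gt0// expR_ge1Dx.
  have h6 : (1 + t1 / 2)^-1 <= 1 - t1 / 3.
    rewrite -div1r ler_pdivrMr; last by rewrite addr_gt0// divr_gt0.
    move: T1 T11; move: (tlo k s) => t T1 T11; nra.
  lra.
rewrite /Mb.
have -> : kap k s * E0 k s * expR (m%:R * (t1 / 2)) * (28 * BX k s) *
  (2 * k.+1%:R * expR (5 / 2)) / (1 - expR (- (t1 / 2))) * tA =
  56 * k.+1%:R * expR (5 / 2) * (kap k s * E0 k s * BX k s * expR (m%:R * (t1 / 2))) *
   (tA / (1 - expR (- (t1 / 2)))).
  by move: (expR (5 / 2)) (expR (m%:R * _)) (1 - expR _)^-1 => a b c; ring.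
have -> : 168 * k.+1%:R ^+ 2 * expR (5 / 2) * (kap k s * E0 k s * BX k s * expR (m%:R * (t1 / 2))) =
  56 * k.+1%:R * expR (5 / 2) * (kap k s * E0 k s * BX k s * expR (m%:R * (t1 / 2))) * (3 * k.+1%:R).
  by move: (expR (5 / 2)) (expR (m%:R * _)) => a b; ring.
apply: ler_wpM2l => //.
apply: mulr_ge0; first exact: mulr_ge0 (mulr_ge0 (ler0n R 56) (ler0n R _)) (expR_ge0 _).
exact: mulr_ge0 (mulr_ge0 (mulr_ge0 (ltW h1) (ltW h2)) (ltW h3)) (expR_ge0 _).
Qed.

End MainBound.

(** * The probability of a run-free sequence *)

Section GapProbability.
Variables (R : realType) (d : measure_display) (T : measurableType d).
Variable P : probability T R.
Variable E : nat -> set T.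
Variable k : nat.
Hypothesis k0 : (0 < k)%N.
Hypothesis indep : independent_events P [set n | (1 <= n)%N] E.

Lemma mE n : (0 < n)%N -> measurable (E n).
Proof. by case: indep => h _ n0; exact: h. Qed.

(* [runs L n r]: none of the windows of [k] consecutive indices ending in [n+1 .. n+L]
   is without success, when the [r] indices up to [n] are already known to fail. *)
Fixpoint runs (L n r : nat) : set T :=
  if L is L'.+1 then
    (E n.+1 `&` runs L' n.+1 0) `|`
    (~` E n.+1 `&` (if r.+1 == k then set0 else runs L' n.+1 r.+1))
  else setT.

Definition pr (A : set T) : R := fine (P A).

Lemma prE A : measurable A -> P A = (pr A)%:E.
Proof. by move=> mA; rewrite /pr fineK// fin_num_measure. Qed.

Lemma prT : pr setT = 1. Proof. by rewrite /pr probability_setT. Qed.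
Lemma pr0 : pr set0 = 0. Proof. by rewrite /pr measure0. Qed.

Lemma pr_split A B : measurable A -> measurable B -> pr A = pr (A `&` B) + pr (A `&` ~` B).
Proof.
move=> mA mB; apply: EFin_inj; rewrite EFinD -!prE//; last 2 first.
- by apply: measurableI => //; exact: measurableC.
- exact: measurableI.
by rewrite (measureDI P mA mB) setDE addeC.
Qed.

Lemma pr_U A B : measurable A -> measurable B -> A `&` B = set0 -> pr (A `|` B) = pr A + pr B.
Proof.
move=> mA mB h; apply: EFin_inj; rewrite EFinD -!prE//; last exact: measurableU.
by rewrite measureU.
Qed.

Definition bcap (s : seq nat) : set T := \bigcap_(i in [set` s]) E i.

Lemma bcap_nil : bcap [::] = setT.
Proof. by apply/seteqP; split=> // x _ i. Qed.

Lemma bcap_cons (n : nat) (s : seq nat) : bcap (n :: s) = E n `&` bcap s.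
Proof.
apply/seteqP; split=> [x h|x [h1 h2] i /=].
  by split=> [|i /= hi]; apply: h; rewrite /= inE ?eqxx ?hi ?orbT.
by rewrite inE => /orP[/eqP->//|]; exact: h2.
Qed.

Lemma m_bcap (s : seq nat) : (forall i, i \in s -> (0 < i)%N) -> measurable (bcap s).
Proof.
elim: s => [|n s IH] hs; first by rewrite bcap_nil.
rewrite bcap_cons; apply: measurableI.
  by apply: mE; apply: hs; rewrite inE eqxx.
by apply: IH => i hi; apply: hs; rewrite inE hi orbT.
Qed.

Lemma pr_bcap (s : seq nat) : uniq s -> (forall i, i \in s -> (0 < i)%N) ->
  pr (bcap s) = \prod_(i <- s) pr (E i).
Proof.
move=> us hs; apply: EFin_inj; rewrite -prE; last exact: m_bcap.
case: indep => _ -> //; rewrite -prodEFin big_seq [RHS]big_seq.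
by apply: eq_bigr => i hi; rewrite -prE//; apply: mE; exact: hs.
Qed.

(** Independence of [B] from the past [E 1], ..., [E n], expressed by the product rule on finite
    subfamilies. In this form it passes to intersections with the next event or its complement,
    without generated sigma-algebras. *)
Definition good (n : nat) (B : set T) : Prop :=
  measurable B /\ forall s : seq nat, uniq s -> (forall i, i \in s -> (0 < i <= n)%N) ->
   pr (bcap s `&` B) = \prod_(i <- s) pr (E i) * pr B.

Lemma goodT n : good n setT.
Proof.
split=> // s us hs; rewrite setIT prT mulr1 pr_bcap// => i hi.
by case/andP: (hs i hi).
Qed.

Lemma good0 n : good n set0.
Proof. by split=> // s us hs; rewrite setI0 pr0 mulr0. Qed.

Lemma pr_success n B : good n.+1 B -> pr (E n.+1 `&` B) = pr (E n.+1) * pr B.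
Proof.
move=> [mB h]; have := h [:: n.+1]; rewrite bcap_cons bcap_nil setIT big_seq1 => -> // i.
by rewrite inE => /eqP ->; rewrite leqnn.
Qed.

Lemma good_success n B : good n.+1 B -> good n (E n.+1 `&` B).
Proof.
move=> hB; have [mB h] := hB; split=> [|s us hs].
  by apply: measurableI => //; exact: mE.
rewrite pr_success// mulrA (mulrC _ (pr (E n.+1))) -(big_cons _ _ n.+1 s xpredT).
rewrite -h.
- by rewrite bcap_cons setIA (setIC (E _)) -!setIA.
- by rewrite /= us andbT; apply/negP => /hs /andP[_]; rewrite ltnn.
move=> i; rewrite inE => /orP[/eqP ->|/hs /andP[-> h2]]; first by rewrite leqnn.
exact: leqW.
Qed.

Lemma pr_failure n B : good n.+1 B -> pr (~` E n.+1 `&` B) = (1 - pr (E n.+1)) * pr B.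
Proof.
move=> hB; have [mB h] := hB; have := pr_split mB (mE (ltn0Sn n)).
rewrite (setIC B) pr_success// (setIC B) => e.
by apply/eqP; rewrite mulrBl mul1r eq_sym subr_eq addrC -e.
Qed.

Lemma good_failure n B : good n.+1 B -> good n (~` E n.+1 `&` B).
Proof.
move=> hB; have [mB h] := hB; have hs := good_success hB.
have [mS h2] := hs; split=> [|s us hs'].
  by apply: measurableI => //; apply: measurableC; exact: mE.
have mb : measurable (bcap s) by apply: m_bcap => i /hs' /andP[].
have := pr_split (measurableI _ _ mb mB) (mE (ltn0Sn n)).
have -> : bcap s `&` B `&` E n.+1 = bcap s `&` (E n.+1 `&` B) by rewrite -setIA (setIC B).
have -> : bcap s `&` B `&` ~` E n.+1 = bcap s `&` (~` E n.+1 `&` B) by rewrite -setIA (setIC B).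
rewrite h2// h//; last by move=> i /hs' /andP[-> /leqW].
rewrite pr_success// pr_failure//.
move: (pr (bcap _ `&` _)) (\prod_(i <- s) _) (pr (E _)) (pr B) => a b c e hh.
by rewrite mulrBl mul1r mulrBr hh; ring.
Qed.

Lemma good_U n A B : good n A -> good n B -> A `&` B = set0 -> good n (A `|` B).
Proof.
move=> [mA hA] [mB hB] h; split=> [|s us hs]; first exact: measurableU.
have mb : measurable (bcap s) by apply: m_bcap => i /hs /andP[].
rewrite setIUr !pr_U//; first by rewrite hA// hB// mulrDr.
- exact: measurableI.
- exact: measurableI.
by rewrite setIACA h setI0.
Qed.

Lemma disj_sf n A B : (E n.+1 `&` A) `&` (~` E n.+1 `&` B) = set0.
Proof. by rewrite setIACA setICr set0I. Qed.

Lemma good_runs L n r : good n (runs L n r).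
Proof.
elim: L n r => [|L IH] n r; first exact: goodT.
rewrite /=; apply: good_U; last exact: disj_sf.
  exact: good_success.
by apply: good_failure; case: ifP => _ //; exact: good0.
Qed.

Lemma m_runs L n r : measurable (runs L n r).
Proof. by case: (good_runs L n r). Qed.

Lemma pr_runsS L n r : pr (runs L.+1 n r) = pr (E n.+1) * pr (runs L n.+1 0) +
   (1 - pr (E n.+1)) * (if r.+1 == k then 0 else pr (runs L n.+1 r.+1)).
Proof.
rewrite /= pr_U; last exact: disj_sf.
- rewrite pr_success ?pr_failure//; last exact: good_runs.
    by case: ifP => _ //; rewrite pr0.
  by case: ifP => _; [exact: good0 | exact: good_runs].
- by apply: measurableI; [exact: mE | exact: m_runs].
apply: measurableI; first by apply: measurableC; exact: mE.
by case: ifP => _ //; exact: m_runs.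
Qed.

(* Membership in [runs L n r]: windows starting at [n + 1 - r] or later and ending by [n + L]. *)
Lemma runsP L n r x : (r < k)%N -> (r <= n)%N ->
  runs L n r x <-> forall j, (n - r <= j)%N -> (j + k <= n + L)%N ->
     exists i, [/\ (n < i)%N, (j < i)%N, (i <= j + k)%N & E i x].
Proof.
elim: L n r => [|L IH] n r rk rn; first by split=> // _ j h1 h2; exfalso; lia.
have IH0 := IH n.+1 0%N k0 (leq0n _).
split=> [[[h1 h2]|[h1 h2]] j j1 j2|h].
- have [jn|jn] := leqP j n; first by exists n.+1; split=> //; lia.
  have /IH0 h3 := h2; have [||i [i1 i2 i3 i4]] := h3 j; [lia | lia |].
  by exists i; split=> //; lia.
- move: h2; case: eqP => // rk' h2.
  have /(IH n.+1 r.+1) h3 := h2; have [||||i [i1 i2 i3 i4]] := h3 _ _ j; [lia | lia | lia | lia |].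
  by exists i; split=> //; lia.
have [hE|hE] := pselect (E n.+1 x).
  left; split=> //; apply/IH0 => j j1 j2.
  have [||i [i1 i2 i3 i4]] := h j; [lia | lia |].
  by exists i; split=> //; lia.
right; split=> //; case: eqP => [rk'|rk'].
  have [||i [i1 i2 i3 i4]] := h (n - r)%N; [lia | lia |].
  by apply: hE; have -> : n.+1 = i by lia.
apply/(IH n.+1 r.+1); [lia | lia | move=> j j1 j2].
have [||i [i1 i2 i3 i4]] := h j; [lia | lia |].
exists i; split=> //; rewrite ltn_neqAle i1 andbT; apply/eqP => e.
by apply: hE; rewrite e.
Qed.

Lemma no_gapE : no_gap k E = \bigcap_L runs L 0 0.
Proof.
apply/seteqP; split=> x h.
  move=> L _; apply/runsP => // j _ jk.
  have [|i /= hi Ei] := h j.+1; first by [].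
  by exists i; split=> //; lia.
move=> j /= j1; have /runsP h2 := h (j.-1 + k)%N I.
have [i [i1 i2 i3 i4]] := h2 k0 (leqnn 0) j.-1 (leq0n _) (leqnn _).
by exists i => //=; lia.
Qed.

Lemma runs_anti L M : (L <= M)%N -> runs M 0 0 `<=` runs L 0 0.
Proof.
move=> LM x /runsP h; apply/runsP => // j j1 j2.
have [i [i1 i2 i3 i4]] := h k0 (leqnn 0) j (leq0n _) (leq_trans j2 LM).
by exists i.
Qed.

Lemma pr_no_gap : pr (runs L 0 0) @[L --> \oo] --> pr (no_gap k E).
Proof.
have mI : measurable (\bigcap_L runs L 0 0) by apply: bigcap_measurable => [|i _]; [exists 0%N | exact: m_runs].
have h : P (runs L 0 0) @[L --> \oo] --> P (\bigcap_L runs L 0 0).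
  apply: nonincreasing_cvg_mu => //.
  - by rewrite -ge0_fin_numE// fin_num_measure// ; exact: m_runs.
  - by move=> L; exact: m_runs.
  - by move=> L M LM; apply/subsetPset; exact: runs_anti.
rewrite no_gapE; apply: fine_cvg; rewrite prE// in h; exact: h.
Qed.

End GapProbability.

(** * The recursion in the current run length and its unique solution *)

Section Recursion.
Variables (R : realType) (q : R) (k : nat).
Hypothesis q01 : 0 < q < 1.
Hypothesis k0 : (0 < k)%N.

(** The run length r = k is an absorbing state of value 0, tested before [L] so that the recursion
    needs no separate case for a completed run. *)
Fixpoint rv (L n r : nat) : R :=
  if r == k then 0 else
  if L is L'.+1 then (1 - q ^+ n.+1) * rv L' n.+1 0 + q ^+ n.+1 * rv L' n.+1 r.+1 else 1.

Lemma rvS L n r : r != k ->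
  rv L.+1 n r = (1 - q ^+ n.+1) * rv L n.+1 0 + q ^+ n.+1 * rv L n.+1 r.+1.
Proof. by move=> /negPf h /=; rewrite h. Qed.

Lemma rv_k L n : rv L n k = 0.
Proof. by case: L => [|L] /=; rewrite eqxx. Qed.

Lemma qX01 n : 0 <= q ^+ n.+1 <= 1.
Proof. by case/andP: q01 => h1 h2; rewrite exprn_ge0 ?exprn_ile1 ?(ltW h1) ?(ltW h2). Qed.

Lemma rv01 L n r : 0 <= rv L n r <= 1.
Proof.
elim: L n r => [|L IH] n r; first by rewrite /=; case: ifP => _; rewrite ?lexx ler01.
have [->|rk] := eqVneq r k; first by rewrite rv_k lexx ler01.
rewrite rvS//; have := qX01 n; have := IH n.+1 0%N; have := IH n.+1 r.+1.
move: (rv _ _ _) (rv _ _ _) (q ^+ _) => a b c /andP[a0 a1] /andP[b0 b1] /andP[c0 c1].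
apply/andP; split; nra.
Qed.

Lemma rv_anti L n r : rv L.+1 n r <= rv L n r.
Proof.
have [->|rk] := eqVneq r k; first by rewrite !rv_k.
elim: L n r rk => [|L IH] n r rk.
  by have /andP[_ h] := rv01 1 n r; rewrite [leRHS]/= (negPf rk).
have e1 := rvS L.+1 n rk; have e2 := rvS L n rk; have /andP[c0 c1] := qX01 n.
have h0 : rv L.+1 n.+1 0 <= rv L n.+1 0 by apply: IH; rewrite eq_sym -lt0n.
have h1 : rv L.+1 n.+1 r.+1 <= rv L n.+1 r.+1.
  by have [->|rk'] := eqVneq r.+1 k; [rewrite !rv_k | exact: IH].
by rewrite e1 e2; apply: lerD; apply: ler_wpM2l => //; rewrite subr_ge0.
Qed.

(** A union bound: some event after [n] fails with probability at most the sum of the q^i over i >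
    n. *)
Lemma rv_lower L n r : (r < k)%N -> 1 - q ^+ n.+1 / (1 - q) <= rv L n r.
Proof.
have /andP[q0 q1] := q01; have Q : 0 < 1 - q by rewrite subr_gt0.
elim: L n r => [|L IH] n r rk.
  have /negPf h : r != k by rewrite neq_ltn rk.
  by rewrite /= h gerBl divr_ge0 ?(ltW Q)// exprn_ge0 ?(ltW q0).
rewrite rvS; last by rewrite neq_ltn rk.
have /andP[c0 c1] := qX01 n; have h := IH n.+1 0%N k0; have /andP[a0 _] := rv01 L n.+1 r.+1.
have e : q ^+ n.+1 / (1 - q) = q ^+ n.+1 + q ^+ n.+2 / (1 - q).
  by rewrite [q ^+ n.+2]exprSr; move: (q ^+ n.+1) => c; field; rewrite gt_eqF.
have b0 : 0 <= q ^+ n.+2 / (1 - q) by rewrite divr_ge0 ?(ltW Q)// exprn_ge0 ?(ltW q0).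
rewrite e; move: h a0 b0 c0 c1; move: (rv _ _ _) (rv _ _ _) (q ^+ n.+1) (_ / _) => a b c e' h1 h2 h3 h4 h5.
nra.
Qed.

Definition rV (n r : nat) : R := lim (rv L n r @[L --> \oo]).

Lemma rV_cvg n r : rv L n r @[L --> \oo] --> rV n r.
Proof.
apply: nonincreasing_is_cvgn.
  by apply/nonincreasing_seqP => L; exact: rv_anti.
by exists 0 => _ [L _ <-]; case/andP: (rv01 L n r).
Qed.

Lemma rV_k n : rV n k = 0.
Proof.
have h := @rV_cvg n k.
suff h2 : rv L n k @[L --> \oo] --> (0 : R) by exact: cvg_unique h h2.
by apply: lim_near (cvg_cst (0 : R)); apply: nearW => L; rewrite rv_k.
Qed.

Lemma rV_rec n r : r != k -> rV n r = (1 - q ^+ n.+1) * rV n.+1 0 + q ^+ n.+1 * rV n.+1 r.+1.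
Proof.
move=> rk; have h : rv L.+1 n r @[L --> \oo] --> rV n r by rewrite (cvg_shiftS (fun L => rv L n r)); exact: rV_cvg.
suff h3 : rv L.+1 n r @[L --> \oo] --> (1 - q ^+ n.+1) * rV n.+1 0 + q ^+ n.+1 * rV n.+1 r.+1.
  by exact: cvg_unique h h3.
pose proof (lim_D (@lim_Z _ _ _ _ _ _ (1 - q ^+ n.+1) (@rV_cvg n.+1 0%N))
  (@lim_Z _ _ _ _ _ _ (q ^+ n.+1) (@rV_cvg n.+1 r.+1))) as h2.
by apply: lim_near h2; apply: nearW => L; rewrite rvS.
Qed.

(** Subtracting the recursions for run lengths i and i + 1 cancels the common term at run length 0,
    so the difference is pushed along until the run length reaches k, where the value is 0. This
    eliminates the run length. *)
Lemma rV_diff n i : (i < k)%N -> rV n.+1 0 - rV n 0 =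
  \prod_(j < i.+1) q ^+ (n + j).+1 * (rV (n + i).+1 i - rV (n + i).+1 i.+1).
Proof.
elim: i => [|i IH] ik.
  rewrite big_ord_recr big_ord0 /= mul1r addn0 (rV_rec n (r := 0)); last by rewrite eq_sym -lt0n.
  by ring.
rewrite IH ?(ltnW ik)// [in RHS]big_ord_recr /= -mulrA; congr (_ * _).
rewrite (rV_rec _ (r := i)) ?(rV_rec _ (r := i.+1)) ?neq_ltn ?ik ?(ltnW ik)//.
by rewrite addnS; ring.
Qed.

Lemma rV_fund n : rV n.+1 0 - rV n 0 =
  \prod_(j < k) q ^+ (n + j).+1 * ((1 - q ^+ (n + k).+1) * rV (n + k).+1 0).
Proof.
case: k k0 rV_k rV_diff rV_rec => // k' _ hk hd hr.
rewrite (hd n k')// hk subr0 hr ?neq_ltn ?ltnSn// hk mulr0 addr0 addnS.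
by [].
Qed.

Lemma rV_lim1 : rV n 0 @[n --> \oo] --> (1 : R).
Proof.
have /andP[q0 q1] := q01; have Q : 0 < 1 - q by rewrite subr_gt0.
have h : 1 - q ^+ n.+1 / (1 - q) @[n --> \oo] --> (1 : R).
  have hq : q ^+ n.+1 @[n --> \oo] --> (0 : R).
    by rewrite (cvg_shiftS (fun n => q ^+ n)); apply: cvg_expr; rewrite ger0_norm// ltW.
  pose proof (lim_D (cvg_cst (1 : R)) (@lim_Z _ _ _ _ _ _ (- (1 - q)^-1) hq)) as h.
  rewrite mulr0 addr0 in h; apply: lim_near h; apply: nearW => n.
  by rewrite mulNr mulrC.
apply: (@squeeze_cvgr _ _ _ _ _ _ _ _ _ h (cvg_cst (1 : R))); apply: nearW => n.
have hc := @rV_cvg n 0%N.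
apply/andP; split.
  by pose proof (lim_le (cvg_cst (1 - q ^+ n.+1 / (1 - q))) hc) as hh; apply: hh; apply: nearW => L; exact: rv_lower.
by pose proof (lim_le hc (cvg_cst (1 : R))) as hh; apply: hh; apply: nearW => L; case/andP: (rv01 L n 0).
Qed.

(** Uniqueness for the q-difference equation. The inequality is iterated from an index beyond which
    [d] is small; the accumulated factors 1 + q^j form a bounded product. *)
Lemma recursion_zero (d : nat -> R) (a : nat -> R) (K : nat) :
  (forall n, 0 <= a n <= q ^+ n) -> (forall n, 0 <= d n) ->
  (forall n, d n <= d n.+1 + a n * d (n + K).+1) -> d n @[n --> \oo] --> (0 : R) ->
  forall n, d n = 0.
Proof.
have /andP[q0 q1] := q01; have Q : 0 < 1 - q by rewrite subr_gt0.
move=> ha d0 hd hl n; apply/eqP; rewrite eq_le d0 andbT.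
apply/ler_addgt0Pr => e e0; rewrite add0r.
(* A bound for the product of all 1 + q^j, since the q^j sum to 1/(1-q). *)
set A : R := expR (1 - q)^-1; have A0 : 0 < A by exact: expR_gt0.
have [N _ hN] : \forall m \near \oo, d m < e / A by apply: (cvgr_lt _ hl); rewrite divr_gt0.
have claim (i m : nat) : (N <= m + i)%N -> d m <= e / A * \prod_(j < i) (1 + q ^+ (m + j)).
  elim: i m => [|i IH] m hm.
    by rewrite big_ord0 mulr1 ltW//; apply: hN => /=; rewrite addn0 in hm.
  have h1 : d m.+1 <= e / A * \prod_(j < i) (1 + q ^+ (m.+1 + j)) by apply: IH; lia.
  have h2 : d (m + K).+1 <= e / A * \prod_(j < i) (1 + q ^+ (m.+1 + j)).
    have : d (m + K).+1 <= e / A * \prod_(j < i) (1 + q ^+ ((m + K).+1 + j)) by apply: IH; lia.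
    move=> h; apply: le_trans h _; rewrite ler_wpM2l ?divr_ge0 ?(ltW e0) ?(ltW A0)//.
    apply: ler_prod => j _; rewrite addr_ge0 ?exprn_ge0 ?(ltW q0)//= lerD2l.
    by apply: ler_wiXn2l; rewrite ?(ltW q0) ?(ltW q1)//; lia.
  apply: le_trans (hd m) _; have /andP[a0 a1] := ha m.
  rewrite big_ord_recl addn0.
  have -> : \prod_(i0 < i) (1 + q ^+ (m + lift ord0 i0)) = \prod_(j < i) (1 + q ^+ (m.+1 + j)).
    by apply: eq_bigr => j _; rewrite lift0 addnS addSn.
  move: h1 h2; set B := e / A * _ => h1 h2.
  have B0 : 0 <= B by apply: le_trans (d0 m.+1) h1.
  have -> : e / A * ((1 + q ^+ m) * \prod_(j < i) (1 + q ^+ (m.+1 + j))) = B + q ^+ m * B.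
    by rewrite /B; move: (e / A) (\prod_(j < i) _) => x y; ring.
  apply: lerD => //; apply: ler_pM => //; exact: d0.
apply: le_trans (claim N n _) _; first by rewrite leq_addl.
rewrite -mulrA ler_piMr ?(ltW e0)// mulrC ler_pdivrMr// mul1r.
apply: (@le_trans _ _ (\prod_(j < N) expR (q ^+ j))).
  apply: ler_prod => j _; rewrite addr_ge0 ?exprn_ge0 ?(ltW q0)//=.
  apply: le_trans (expR_ge1Dx _); rewrite lerD2l.
  by apply: ler_wiXn2l; rewrite ?(ltW q0) ?(ltW q1)// leq_addl.
rewrite -expR_sum ler_expR; apply: geo_sum_le.
by rewrite (ltW q0) q1.
Qed.

End Recursion.

Section GapValue.
Variables (R : realType) (d : measure_display) (T : measurableType d).
Variable P : probability T R.
Variables (E : nat -> set T) (k : nat) (q : R).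
Hypothesis q01 : 0 < q < 1.
Hypothesis k0 : (0 < k)%N.
Hypothesis indep : independent_events P [set n | (1 <= n)%N] E.
Hypothesis PE : forall n, (1 <= n)%N -> P (E n) = (1 - q ^+ n)%:E.

Lemma pr_runs_rv L n r : r != k -> pr P (runs E k L n r) = rv q k L n r.
Proof.
elim: L n r => [|L IH] n r rk; first by rewrite /= (negPf rk) prT.
rewrite pr_runsS// rvS//.
have -> : pr P (E n.+1) = 1 - q ^+ n.+1 by rewrite /pr PE.
rewrite IH; last by rewrite eq_sym -lt0n.
congr (_ + _); rewrite subKr; congr (_ * _).
by case: eqP => [->|/eqP h]; [rewrite rv_k | rewrite IH].
Qed.

Lemma no_gap_rV : fine (P (no_gap k E)) = rV q k 0 0.
Proof.
have h := pr_no_gap k0 indep.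
suff h2 : pr P (runs E k L 0 0) @[L --> \oo] --> rV q k 0 0 by exact: cvg_unique h h2.
apply: lim_near (@rV_cvg R q k q01 k0 0%N 0%N); apply: nearW => L.
by rewrite pr_runs_rv// eq_sym -lt0n.
Qed.

End GapValue.

(** * The double series solves the same q-difference equation *)

Section SeriesSolution.
Variable R : realType.
Local Notation C := R[i].
Variables (k : nat) (s : R).
Hypothesis k0 : (0 < k)%N.
Hypothesis s0 : 0 < s.
Local Notation t1 := (tlo k s).
Local Notation t2 := (thi k s).
Local Notation tA := (tpr k s).
Local Notation q := (expR (- s)).

(** The terms of G(0). The extra factor q^{n(kj + (k+1)i)} in [fg] extends the series to all n; G(0)
    is the value at n = 0. *)
Definition ug (p : nat * nat) : R :=
  ecoef t2 p.1 * expR (- t2) ^+ p.1 * (lcoef t1 p.2 * (-1) ^+ p.2) *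
  expR (- (tA / 2) * (p.1 + p.2)%:R ^+ 2).
Definition eg (p : nat * nat) : nat := (k * p.2 + k.+1 * p.1)%N.
Definition fg (n : nat) (p : nat * nat) : R := ug p * (q ^+ n) ^+ eg p.

Lemma gm0E p : gm k s 0 p = (ug p)%:C.
Proof.
rewrite /gm /ug !rcM (rcX (-1)) rcN; congr (_ * (expR (_ * _ ^+ 2))%:C).
by rewrite subr0 -PoszD -pmulrn.
Qed.

Lemma q01 : 0 < q < 1.
Proof. by rewrite expR_gt0 expR_lt1 oppr_lt0. Qed.

Lemma qn01 n : 0 <= q ^+ n <= 1.
Proof. by case/andP: q01 => h1 h2; rewrite exprn_ge0 ?exprn_ile1 ?(ltW h1) ?(ltW h2). Qed.

Lemma ug_abs : exists K, abs_le (fun p => (ug p)%:C : C) K.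
Proof.
have [K h] := gm_abs k0 s0 0; exists K; apply: abs_leS h => p.
by rewrite gm0E.
Qed.

Lemma fg_abs n : exists K, abs_le (fun p => (fg n p)%:C : C) K.
Proof.
have [K h] := ug_abs; exists K; apply: abs_leS h => p.
rewrite !nc_real /fg normrM ler_piMr//.
have /andP[h1 h2] := qn01 n.
by rewrite ger0_norm ?exprn_ge0// exprn_ile1.
Qed.

Definition FG n : C := csum (fun p => (fg n p)%:C).

Lemma FGP n : is_sum (fun p => (fg n p)%:C) (FG n).
Proof. by have [K h] := fg_abs n; exact: csumP h. Qed.

Lemma FG0 : FG 0 = Gm k s 0.
Proof.
have [K h] := gm_abs k0 s0 0; apply: csumE; apply: eq_is_sum (csumP h) => p.
by rewrite gm0E /fg expr0 expr1n mulr1.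
Qed.

(** The factor p^j p'^i - 1 is split as -(1 - p^j) p'^i - (1 - p'^i). Each bracket cancels the last
    factor of one q-factorial, so that [fA] and [fB] become shifts of the series at n + k + 1. *)
Definition fA n (p : nat * nat) : R := - ((1 - expR (- t1) ^+ p.2) * expR (- t2) ^+ p.1) * fg n p.
Definition fB n (p : nat * nat) : R := - (1 - expR (- t2) ^+ p.1) * fg n p.

Lemma p1E : expR (- t1) = q ^+ k.
Proof. by rewrite -expRM_natl /tlo; congr expR; ring. Qed.
Lemma p2E : expR (- t2) = q ^+ k.+1.
Proof. by rewrite -expRM_natl /thi; congr expR; ring. Qed.

Lemma fgS n p : fg n.+1 p - fg n p = fA n p + fB n p.
Proof.
rewrite /fA /fB /fg p1E p2E -!exprM /eg.
have -> : (n.+1 * (k * p.2 + k.+1 * p.1) = n * (k * p.2 + k.+1 * p.1) + k * p.2 + k.+1 * p.1)%N by lia.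
by rewrite !exprD; move: (ug p) (q ^+ _) (q ^+ _) (q ^+ _) => a b c e; ring.
Qed.

Lemma qA (n : nat) : expR (- (tA / 2) * n.+1%:R ^+ 2) =
  expR (- (tA / 2) * n%:R ^+ 2) * (expR (- (tA / 2)) * q ^+ (k * k.+1 * n)).
Proof.
by rewrite -expRM_natl -!expRD -natr1 !natrM /tpr; congr expR; field.
Qed.

Lemma fA_shift n i j : fA n (i, j.+1) =
  (q ^+ n) ^+ k * expR (- (tA / 2)) * fg (n + k).+1 (i, j).
Proof.
have T1 := t10 k0 s0; rewrite /fA /fg /ug /eg /=.
have -> : lcoef t1 j.+1 = lcoef t1 j / (1 - expR (- t1) ^+ j.+1).
  by rewrite /lcoef qfS invfM.
have : 1 - expR (- t1) ^+ j.+1 != 0 by rewrite gt_eqF// subr_gt0 pX_lt1.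
rewrite addnS qA (exprS (-1)) p1E p2E -!exprM.
have -> : ((n + k).+1 * (k * j + k.+1 * i) =
  n * (k * j + k.+1 * i) + k.+1 * i + k * k.+1 * (i + j))%N by nia.
have -> : (n * (k * j.+1 + k.+1 * i) = n * (k * j + k.+1 * i) + n * k)%N by nia.
rewrite !exprD.
move: (q ^+ (k * j.+1)) (q ^+ (n * (_ + _))) (q ^+ (k * k.+1 * _)) (q ^+ (n * k)) (q ^+ (k.+1 * i)).
move: (ecoef t2 i) (lcoef t1 j) ((-1) ^+ j) (expR _) (expR _) => a b c e f x y z w v h.
by field.
Qed.

Lemma fB_shift n i j : fB n (i.+1, j) =
  - ((q ^+ n) ^+ k * expR (- (tA / 2)) * q ^+ (n + k).+1 * fg (n + k).+1 (i, j)).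
Proof.
have T2 := t20 k s0; rewrite /fB /fg /ug /eg /=.
have -> : ecoef t2 i.+1 = ecoef t2 i * expR (- t2) ^+ i / (1 - expR (- t2) ^+ i.+1).
  by rewrite /ecoef qfS invfM binS bin1 exprD mulrACA -!mulrA; congr (_ * _); rewrite mulrCA.
have : 1 - expR (- t2) ^+ i.+1 != 0 by rewrite gt_eqF// subr_gt0 pX_lt1.
rewrite addSn qA p2E -!exprM.
have -> : ((n + k).+1 * (k * j + k.+1 * i) =
  n * (k * j + k.+1 * i) + k.+1 * i + k * k.+1 * (i + j))%N by nia.
have -> : (n * (k * j + k.+1 * i.+1) = n * (k * j + k.+1 * i) + n * k + n)%N by nia.
have -> : ((n + k).+1 = n + k.+1)%N by lia.
have -> : (k.+1 * i.+1 = k.+1 * i + k.+1)%N by lia.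
rewrite !exprD.
move: (q ^+ (n * _)) (q ^+ (k * k.+1 * _)) (q ^+ (n * k)) (q ^+ (k.+1 * i)) (q ^+ n) (q ^+ k.+1).
move: (ecoef t2 i) (lcoef t1 j) ((-1) ^+ j) (expR _) (expR _) => a b c e f x y z w v u h.
by field.
Qed.

Lemma FG_fund n : FG n.+1 - FG n =
  ((q ^+ n) ^+ k * expR (- (tA / 2)) * (1 - q ^+ (n + k).+1))%:C * FG (n + k).+1.
Proof.
have hN := FGP (n + k).+1.
set c := (q ^+ n) ^+ k * expR (- (tA / 2)).
have hA : is_sum (fun p => (fA n p)%:C) (c%:C * FG (n + k).+1).
  apply: (@is_sum_extend _ _ _ (fun p => (p.1, p.2.+1)) (fun p => (p.1, p.2.-1))) => [[i j]//|[i [|j]]//= |].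
    by rewrite /fA /= expr0 subrr mul0r oppr0 mul0r eqxx.
  by apply: eq_is_sum (is_sumZ c%:C hN) => -[i j] /=; rewrite fA_shift -rcM.
have hB : is_sum (fun p => (fB n p)%:C) (- ((c * q ^+ (n + k).+1)%:C * FG (n + k).+1)).
  apply: (@is_sum_extend _ _ _ (fun p => (p.1.+1, p.2)) (fun p => (p.1.-1, p.2))) => [[i j]//|[[|i] j]//= |].
    by rewrite /fB /= expr0 subrr oppr0 mul0r eqxx.
  apply: eq_is_sum (is_sumN (is_sumZ (c * q ^+ (n + k).+1)%:C hN)) => -[i j] /=.
  by rewrite fB_shift -rcM -rcN.
have h1 := is_sumB (FGP n.+1) (FGP n); have h2 := is_sumD hA hB.
have h3 := is_sum_uniq (eq_is_sum _ h1) h2; rewrite h3; last first.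
  by move=> p /=; rewrite -rcB fgS rcD.
have -> : c * (1 - q ^+ (n + k).+1) = c - c * q ^+ (n + k).+1 by ring.
by rewrite rcB mulrBl.
Qed.

Lemma FG_lim : cvgc \oo FG 1.
Proof.
have [K h] := ug_abs; have K0 := abs_le_ge0 h.
pose dlt (p : nat * nat) : C := (p == (0, 0)%N)%:R.
have hd : is_sum dlt 1.
  have := @is_sum_fin R _ (fset1 (0, 0)%N) dlt; rewrite big_seq_fset1 /dlt eqxx; apply=> i.
  by rewrite inE => /negPf ->.
have b n : nc (FG n - 1) <= q ^+ n * K.
  apply: is_sum_nc_le (is_sumB (FGP n) hd) _.
  have h' := abs_leZ (q ^+ n)%:C h; have /andP[q0 q1] := qn01 n.
  rewrite (nc_pos q0) in h'; apply: abs_leS h' => -[i j].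
  rewrite /dlt /fg; have [e|ne] := eqVneq (i, j) (0, 0)%N.
    case: e => -> ->; have -> : ug (0, 0)%N = 1.
      have e0 : expR (- (tA / 2) * (0 + 0)%:R ^+ 2) = 1 by rewrite addn0 mulr0n expr0n mulr0 expR0.
      by rewrite /ug /fst /snd e0 ecoef0 lcoef0 !expr0 !mulr1.
    by rewrite /eg /= !muln0 expr0 mulr1 subrr nc0 nc_ge0.
  rewrite subr0 ncM !nc_real normrM mulrC (ger0_norm q0); apply: ler_wpM2r => //.
  rewrite ger0_norm ?exprn_ge0// -[leRHS]expr1; apply: ler_wiXn2l => //.
  move: ne; rewrite /eg /= xpair_eqE; move/negP; case: i => [|i]; case: j => [|j] // _; nia.
have hq : q ^+ n * K @[n --> \oo] --> 0 * K.
  apply: lim_M; last exact: cvg_cst.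
  exact: cvgn_expR.
rewrite mul0r in hq; apply/cvgcP.
apply: (@squeeze_cvgr _ _ _ _ _ _ _ _ _ (cvg_cst 0) hq); apply: nearW => n.
by rewrite nc_ge0 b.
Qed.

Lemma coef_fund n : \prod_(j < k) q ^+ (n + j).+1 = (q ^+ n) ^+ k * expR (- (tA / 2)).
Proof.
rewrite /tpr; move: k => m; elim: m => [|m IH].
  by rewrite big_ord0 expr0 !mul0r oppr0 expR0 mulr1.
have e : expR (- (m%:R * m.+1%:R * s / 2)) * q ^+ (n + m).+1 =
  q ^+ n * expR (- (m.+1%:R * m.+2%:R * s / 2)).
  by rewrite -!expRM_natl -!expRD -(natr1 m.+1) -(natr1 m) -(natr1 (n + m)%N) natrD; congr expR; field.
by rewrite big_ord_recr /= IH (exprSr (q ^+ n)) -[LHS]mulrA e mulrA.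
Qed.

(** Both sides satisfy the same equation and tend to 1, so [recursion_zero] applies to the modulus
    of their difference. *)
Lemma FG_rV n : FG n = (rV q k n 0)%:C.
Proof.
pose d n := nc (FG n - (rV q k n 0)%:C).
suff h : d n = 0 by apply/eqP; rewrite -subr_eq0 -nc_eq0 -/(d n) h.
pose a n := (q ^+ n) ^+ k * expR (- (tA / 2)) * (1 - q ^+ (n + k).+1).
apply: (recursion_zero q01 k0 (d := d) (a := a) (K := k)) => {n}.
- move=> n; have /andP[h1 h2] := qn01 n; have /andP[h3 h4] := qn01 (n + k).+1.
  have e1 : expR (- (tA / 2)) <= 1 by rewrite expR_le1 oppr_le0 divr_ge0// ltW// tA0.
  have e0 := expR_ge0 (- (tA / 2)).
  have x0 : 0 <= (q ^+ n) ^+ k by rewrite exprn_ge0.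
  have x1 : (q ^+ n) ^+ k <= q ^+ n by rewrite -[leRHS]expr1 ler_wiXn2l.
  rewrite /a; apply/andP; split; first by rewrite !mulr_ge0// subr_ge0.
  apply: le_trans x1; rewrite -mulrA ler_piMr// -[leRHS]mulr1.
  by apply: ler_pM => //; rewrite ?subr_ge0// gerBl.
- by move=> n; exact: nc_ge0.
- move=> n; have hf := FG_fund n; have hr := rV_fund q01 k0 n.
  rewrite coef_fund mulrA -/(a n) in hr; rewrite -/(a n) in hf.
  have e : FG n - (rV q k n 0)%:C = (FG n.+1 - (rV q k n.+1 0)%:C) -
     (a n)%:C * (FG (n + k).+1 - (rV q k (n + k).+1 0)%:C).
    have hr' : (rV q k n.+1 0)%:C - (rV q k n 0)%:C = (a n)%:C * (rV q k (n + k).+1 0)%:C :> C.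
      by rewrite -rcB hr rcM.
    rewrite mulrBr -hf -hr'; ring.
  rewrite /d e; apply: le_trans (ncD _ _) _; rewrite ncN ncM lerD2l nc_pos//.
  have /andP[h3 h4] := qn01 (n + k).+1.
  by rewrite /a !mulr_ge0 ?exprn_ge0 ?expR_ge0// subr_ge0.
pose proof (cvgc_nc (cvgcB FG_lim (cvgc_real (rV_lim1 q01 k0)))) as h.
by rewrite subrr nc0 in h.
Qed.

Lemma Gm0_rV : Gm k s 0 = (rV q k 0 0)%:C.
Proof. by rewrite -FG0 FG_rV. Qed.

End SeriesSolution.

Section PeriodicRatio.
Variable R : realType.

(** A partial sum S is at most its head plus S/2. Halving is only known over [K] steps, so an
    ordinary ratio test does not apply. *)
Lemma ratio_sum_le (u : nat -> R) (J K : nat) : (forall j, 0 <= u j) ->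
  (forall j, (J <= j)%N -> u (j + K)%N <= u j / 2) ->
  forall n, \sum_(j < n) u j <= 2 * \sum_(j < J + K) u j.
Proof.
move=> u0 hu n.
have mono a b : (a <= b)%N -> \sum_(j < a) u j <= \sum_(j < b) u j.
  move=> ab; rewrite -(subnKC ab) big_split_ord /= lerDl.
  by apply: sumr_ge0 => i _; exact: u0.
have h m : \sum_(j < J + K + m) u j <= \sum_(j < J + K) u j + (\sum_(j < J + K + m) u j) / 2.
  rewrite {1}big_split_ord /= lerD2l.
  apply: (@le_trans _ _ (\sum_(i < m) u (J + i)%N / 2)).
    apply: ler_sum => i _; have -> : (J + K + i = J + i + K)%N by lia.
    by apply: hu; rewrite leq_addr.
  rewrite -mulr_suml ler_pM2r ?invr_gt0//.
  apply: (@le_trans _ _ (\sum_(j < J + m) u j)); last by apply: mono; lia.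
  rewrite big_split_ord /= lerDr.
  by apply: sumr_ge0 => i _; exact: u0.
have := h n; have := mono n (J + K + n)%N (leq_addl _ _).
move: (\sum_(j < n) _) (\sum_(j < J + K + n) _) (\sum_(j < J + K) _) => a b c; lra.
Qed.

Definition mdom (U : R) (J K j : nat) : R := U * (2^-1) ^+ ((j - J) %/ K).

Lemma mdom_ge (u : nat -> R) (U : R) (J K : nat) : (0 < K)%N -> 0 <= U ->
  (forall j, (J <= j)%N -> u (j + K)%N <= u j / 2) ->
  (forall j, (j < J + K)%N -> u j <= U) -> forall j, u j <= mdom U J K j.
Proof.
move=> K0 U0 hu hU j; rewrite /mdom.
have [n hn] := ubnP j; elim: n j hn => // n IH j hn.
have [h|h] := ltnP j (J + K).
  by rewrite divn_small ?expr0 ?mulr1 ?hU//; lia.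
have e : j = (j - K + K)%N by lia.
have e2 : ((j - J) %/ K = ((j - K - J) %/ K).+1)%N.
  have -> : (j - J = (j - K - J) + K)%N by lia.
  by rewrite divnDr// divnn K0 addn1.
rewrite {1}e e2 exprSr mulrA; apply: le_trans (hu _ _) _; first by lia.
rewrite ler_pM2r ?invr_gt0//; apply: IH; lia.
Qed.

Lemma mdom_sum (U : R) (J K : nat) : (0 < K)%N -> 0 <= U ->
  forall n, \sum_(j < n) mdom U J K j <= 2 * \sum_(j < J + K) mdom U J K j.
Proof.
move=> K0 U0; apply: ratio_sum_le => j.
  by rewrite mulr_ge0// exprn_ge0// invr_ge0.
move=> jJ; rewrite /mdom.
have -> : ((j + K - J) %/ K = ((j - J) %/ K).+1)%N.
  have -> : (j + K - J = (j - J) + K)%N by lia.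
  by rewrite divnDr// divnn K0 addn1.
by rewrite exprSr mulrA.
Qed.

Lemma mdom_ge0 (U : R) (J K : nat) j : 0 <= U -> 0 <= mdom U J K j.
Proof. by move=> U0; rewrite mulr_ge0// exprn_ge0// invr_ge0. Qed.

Lemma prod_expR_arith (a b : R) n :
  \prod_(i < n) expR (a + b * i%:R) = expR (n%:R * a + b * (n%:R * (n%:R - 1) / 2)).
Proof.
elim: n => [|n IH]; first by rewrite big_ord0 !mul0r mulr0 addr0 expR0.
by rewrite big_ord_recr /= IH -expRD -(natr1 n); congr expR; field.
Qed.

Lemma sig_alg (a b c d Q F Z L Y : R) : a * b = c * d -> Q != 0 -> F != 0 -> Z != 0 -> L != 0 ->
  a / Q / (F * Z * L) * (b * Z * Y) = c / Q / F * Y * (d / L).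
Proof.
move=> h q f z l; transitivity (a * b / Q / F * Y / L); first by field; rewrite q f z l.
by rewrite h; field; rewrite q f l.
Qed.

Lemma dual_alg (a b c d e f X : R[i]) : a != 0 -> b != 0 ->
  a^-1 / b * (X * d * (a * (c * b * e * f))) = X * d * c * (e * f).
Proof. by move=> a0 b0; field; rewrite a0 b0. Qed.

Lemma gauss_nat_abs (a b : R) : 0 < a ->
  abs_le (fun n : nat => (expR (- a * (n%:R - b) ^+ 2))%:C : R[i]) (gbound a).
Proof.
move=> a0.
have h : abs_le (fun n : int => (expR (- a * (n%:~R - b) ^+ 2))%:C : R[i]) (gbound a).
  move=> A; apply: le_trans (gauss_fsum_le b a0 A); apply: ler_sum => i _.
  by rewrite nc_pos ?expR_ge0.
have inj : injective (Posz) by move=> x y [].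
by have := abs_le_reindex inj h; apply: abs_leS => n.
Qed.

End PeriodicRatio.

(** * Dual expansion of the shifted sums *)

Section ThetaExpansion.
Variable R : realType.
Local Notation C := R[i].
Variables (k : nat) (s : R) (m : nat).
Hypothesis k0 : (0 < k)%N.
Hypothesis s0 : 0 < s.
Local Notation t1 := (tlo k s).
Local Notation t2 := (thi k s).
Local Notation tA := (tpr k s).
Local Notation p1 := (expR (- t1)).
Local Notation p2 := (expR (- t2)).

Definition rho : R := k%:R / k.+1%:R.

Lemma t2rho : t2 * rho = t1.
Proof.
rewrite /rho /thi /tlo; have : k.+1%:R != 0 :> R by [].
by move: (k.+1%:R : R) => b b0; field.
Qed.

Definition sg (j : nat) : R := ecoef t1 j * (- p1) ^+ j / qinf t1 * qP t2 (1 - rho * j%:R).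

(* [Ep t1 (- p1 ^ (l + 1)) / qinf t1] is [lcoef t1 l], and vanishes for negative [l]. *)
Definition lint (l : int) : C := Ep t1 (- (expR (- (t1 * (l%:~R + 1))))%:C) / (qinf t1)%:C.

Lemma lint_nat (l : nat) : lint l = (lcoef t1 l)%:C.
Proof.
have T1 := t10 k0 s0; have q0 := rc_neq0 (qinf_gt0 T1).
have e : expR (- (t1 * ((l%:Z)%:~R + 1))) = p1 ^+ l.+1.
  by rewrite -expRM_natl -natr1 -pmulrn; congr expR; ring.
rewrite /lint e (Ep_qf T1) /lcoef; move: (qf _ _)^-1 (qinf _) q0 => a b b0.
by rewrite [(b * a)%:C]rcM mulrAC mulfV// mul1r.
Qed.

Lemma lint_neg (l : nat) : lint (- l.+1%:Z) = 0.
Proof.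
have T1 := t10 k0 s0.
have e : expR (- (t1 * ((- l.+1%:Z)%:~R + 1))) = p1 ^- l.
  by rewrite -exprVn -expRN -expRM_natl intrN -pmulrn -natr1; congr expR; ring.
by rewrite /lint e (Ep_root T1) mul0r.
Qed.

(** The sign (-1)^n at an integer index, as an exponential that will merge with the theta terms. *)
Definition es (n : int) : C := cexp (n%:~R * (0 +i* pi)).

Lemma es_nat (n : nat) : es n%:Z = (-1) ^+ n.
Proof. by rewrite /es -pmulrn cexpM_nat cexp_pi. Qed.

Lemma esD (a b : int) : es (a + b) = es a * es b.
Proof. by rewrite /es intrD mulrDl cexpD. Qed.

Lemma esN (n : nat) : es (- n%:Z) = (-1) ^+ n.
Proof.
have h : es (- n%:Z) * es n%:Z = 1 by rewrite -esD addNr /es mulr0z mul0r cexp0.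
have h2 : (-1) ^+ n * es n%:Z = 1 by rewrite es_nat -expr2 sqrr_sign.
have e0 : es n%:Z != 0 by exact: cexp_neq0.
by apply: (mulIf e0); rewrite h h2.
Qed.

(** The double series of G(m) indexed by i and the total n = i + l; negative l are allowed because
    [lint] vanishes there. *)
Definition Fi (p : nat * int) : C :=
  (ecoef t2 p.1 * p2 ^+ p.1)%:C * (es (p.2 - p.1%:Z) * lint (p.2 - p.1%:Z)) *
  (expR (- (tA / 2) * (p.2 - m%:Z)%:~R ^+ 2))%:C.

Lemma Fi_sum : is_sum Fi (Gm k s m).
Proof.
have [K h] := gm_abs k0 s0 m.
apply: (@is_sum_extend _ _ _ (fun p : nat * nat => (p.1, p.1%:Z + p.2%:Z))
  (fun p : nat * int => (p.1, `|p.2 - p.1%:Z|%N))) => [[i l]|[i n]|] /=.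
- by congr (_, _); rewrite addrC addKr; lia.
- case e : (n - i%:Z) => [l|l] hn; first by congr (_, _); lia.
  exfalso; move/eqP: hn; apply; rewrite /Fi /= e NegzE.
  by rewrite lint_neg mulr0 mulr0 mul0r.
apply: eq_is_sum (csumP h) => -[i l] /=.
have e : i%:Z + l%:Z - i%:Z = l%:Z by lia.
by rewrite /Fi /gm /= e lint_nat es_nat (mulrC (lcoef _ _)%:C).
Qed.

Section FixedIndex.
Variable n : int.

Definition Ai (p : nat * nat) : C :=
  (ecoef t2 p.1 * (- p2) ^+ p.1)%:C *
  (ecoef t1 p.2 * (- p1) ^+ p.2 / qinf t1 * expR (- (t1 * p.2%:R * (n%:~R - p.1%:R))))%:C.

Lemma Ai_inner i : is_sum (fun j => Ai (i, j))
  ((ecoef t2 i * (- p2) ^+ i)%:C * lint (n - i%:Z)).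
Proof.
have T1 := t10 k0 s0.
set z : C := - (expR (- (t1 * ((n - i%:Z)%:~R + 1))))%:C.
have -> : lint (n - i%:Z) = ((qinf t1)^-1)%:C * Ep t1 z by rewrite /lint -/z mulrC rcV.
rewrite mulrA; apply: eq_is_sum (is_sumZ _ (EpP T1 z)) => j; rewrite /pterm /z /Ai /=.
have -> : (- (expR (- (t1 * ((n - i%:Z)%:~R + 1))))%:C) ^+ j =
  ((- p1) ^+ j * expR (- (t1 * j%:R * (n%:~R - i%:R))))%:C :> C.
  rewrite -rcN -rcX (exprNn (expR (- (t1 * (_ + 1))))) (exprNn p1) -mulrA -!expRM_natl -expRD; congr ((_ * expR _)%:C).
  by rewrite intrD intrN -pmulrn; ring.
rewrite -!rcM; congr (_%:C).
by move: (expR _) (_ ^+ j) (_ ^+ i) (ecoef _ _) (ecoef _ _) (qinf t1)^-1 => a b c d e f; ring.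
Qed.

Lemma Ai_outer j : is_sum (fun i => Ai (i, j)) (sg j * expR (- (t1 * j%:R * n%:~R)))%:C.
Proof.
have T2 := t20 k s0; rewrite /sg.
have e := qPE T2 (1 - rho * j%:R).
set c := ecoef t1 j * _ / _.
have -> : (c * qP t2 (1 - rho * j%:R) * expR (- (t1 * j%:R * n%:~R)))%:C =
  (c * expR (- (t1 * j%:R * n%:~R)))%:C * Ep t2 (- (pw t2 (1 - rho * j%:R))%:C) :> C.
  by rewrite e -rcM; congr (_%:C); ring.
apply: eq_is_sum (is_sumZ _ (EpP T2 _)) => i; rewrite /pterm /Ai /=.
have -> : (- (pw t2 (1 - rho * j%:R))%:C) ^+ i =
   ((- p2) ^+ i * expR (t1 * j%:R * i%:R))%:C :> C.
  rewrite -rcN -rcX (exprNn (pw t2 _)) (exprNn p2) -mulrA -!expRM_natl -expRD; congr ((_ * expR _)%:C).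
  by rewrite -t2rho; ring.
rewrite -!rcM; congr (_%:C); rewrite -/c.
have -> : expR (- (t1 * j%:R * (n%:~R - i%:R))) =
   expR (- (t1 * j%:R * n%:~R)) * expR (t1 * j%:R * i%:R).
  by rewrite -expRD; congr expR; ring.
by move: (expR _) (expR _) (_ ^+ i) (ecoef _ _) => a b e' f; ring.
Qed.

Lemma p_bin (t : R) (i : nat) : expR (- t) ^+ 'C(i, 2) = expR (- (t * (i%:R * (i%:R - 1) / 2))).
Proof. by rewrite -expRM_natl -bin2R; congr expR; field. Qed.

Lemma ecoef_le (t : R) (i : nat) : 0 < t -> 0 <= ecoef t i <= (qlow t)^-1 * expR (- t) ^+ 'C(i, 2).
Proof.
move=> t0; have q0 := qf_gt0 t0 i; have ql : 0 < qlow t by exact: expR_gt0.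
rewrite /ecoef divr_ge0 ?exprn_ge0 ?expR_ge0 ?(ltW q0)//= mulrC.
apply: ler_wpM2r; first by rewrite exprn_ge0 ?expR_ge0.
by rewrite lef_pV2 ?posrE// qf_ge.
Qed.

Lemma norm_signed (e p : R) (i : nat) : 0 <= e -> 0 <= p -> `|e * (- p) ^+ i| = e * p ^+ i.
Proof. by move=> e0 p0; rewrite normrM normrX normrN !ger0_norm. Qed.

(** The exponent contains the growing cross term t1 i j, but t2 = t1 + s makes the form definite: t2
    i^2 - 2 t1 i j + t1 j^2 = s i^2 + t1 (i - j)^2. [N] and [B] complete these two squares. *)
Lemma Ai_abs : exists K, abs_le Ai K.
Proof.
have T1 := t10 k0 s0; have T2 := t20 k s0; have Q1 := qinf_gt0 T1.
have l1 : 0 < qlow t1 by exact: expR_gt0.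
have l2 : 0 < qlow t2 by exact: expR_gt0.
pose c0 : R := (qlow t2)^-1 * ((qlow t1)^-1 / qinf t1).
have c00 : 0 <= c0 by rewrite !mulr_ge0 ?invr_ge0 ?(ltW l1) ?(ltW l2) ?(ltW Q1).
pose N : R := n%:~R + 2^-1.
pose B : R := - (k.+1%:R / 2 + k%:R * N).
pose c1 : R := expR (t1 / 2 * N ^+ 2 + s / 2 * B ^+ 2).
have bnd i j : nc (Ai (i, j)) <= c0 * c1 *
   (expR (- (s / 2) * (i%:R - B) ^+ 2) * expR (- (t1 / 2) * (j%:R - (i%:R - N)) ^+ 2)).
  have /andP[a1 a2] := ecoef_le i T2; have /andP[b1 b2] := ecoef_le j T1.
  have -> : nc (Ai (i, j)) = ecoef t2 i * p2 ^+ i *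
     (ecoef t1 j * p1 ^+ j / qinf t1 * expR (- (t1 * j%:R * (n%:~R - i%:R)))).
    rewrite /Ai /= ncM !nc_real norm_signed ?expR_ge0//; congr (_ * _).
    have iQ : 0 <= (qinf t1)^-1 by rewrite invr_ge0 ltW.
    rewrite -(mulrA (ecoef t1 j * (- p1) ^+ j)) -(mulrA (ecoef t1 j * p1 ^+ j)).
    rewrite normrM norm_signed ?expR_ge0//; congr (_ * _).
    by rewrite ger0_norm// mulr_ge0// expR_ge0.
  have e : expR (- t2) ^+ 'C(i, 2) * p2 ^+ i *
    (expR (- t1) ^+ 'C(j, 2) * p1 ^+ j * expR (- (t1 * j%:R * (n%:~R - i%:R)))) =
    c1 * (expR (- (s / 2) * (i%:R - B) ^+ 2) * expR (- (t1 / 2) * (j%:R - (i%:R - N)) ^+ 2)).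
    rewrite !p_bin -!expRM_natl -!expRD; congr expR.
    by rewrite /B /N /tlo /thi -(natr1 k); field.
  rewrite -(mulrA c0 c1) -e.
  have x1 : 0 <= p2 ^+ i by rewrite exprn_ge0 ?expR_ge0.
  have x2 : 0 <= p1 ^+ j by rewrite exprn_ge0 ?expR_ge0.
  have x3 := expR_ge0 (- (t1 * j%:R * (n%:~R - i%:R))).
  have iQ : 0 <= (qinf t1)^-1 by rewrite invr_ge0 ltW.
  have h : ecoef t2 i * ecoef t1 j <= (qlow t2)^-1 * expR (- t2) ^+ 'C(i, 2) *
      ((qlow t1)^-1 * expR (- t1) ^+ 'C(j, 2)) by apply: ler_pM.
  have h2 := ler_wpM2r (mulr_ge0 (mulr_ge0 (mulr_ge0 x1 x2) x3) iQ) h.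
  move: h2; rewrite /c0.
  move: (ecoef t2 i) (ecoef t1 j) (p2 ^+ i) (p1 ^+ j) (expR (- (t1 * _ * _))) (qinf t1)^-1 => e1 e2 f1 f2 f3 f4.
  move: (qlow t2)^-1 (qlow t1)^-1 (p2 ^+ _) (p1 ^+ _) => g1 g2 g3 g4 h2.
  rewrite [leLHS](_ : _ = e1 * e2 * (f1 * f2 * f3 * f4)); last by ring.
  rewrite [leRHS](_ : _ = g1 * g3 * (g2 * g4) * (f1 * f2 * f3 * f4)); last by ring.
  exact: h2.
have s2 : 0 < s / 2 by rewrite divr_gt0.
have t12 : 0 < t1 / 2 by rewrite divr_gt0.
have c10 : 0 <= c1 by exact: expR_ge0.
have G0 : 0 <= gbound (t1 / 2) := abs_le_ge0 (gauss_nat_abs 0 t12).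
exists (c0 * c1 * gbound (t1 / 2) * gbound (s / 2)).
apply: (@abs_le_pair _ _ _ _ (fun i => c0 * c1 * gbound (t1 / 2) * expR (- (s / 2) * (i%:R - B) ^+ 2))).
  move=> i A; apply: le_trans (ler_sum _ (fun j _ => bnd i j)) _.
  rewrite -mulr_sumr -(mulrA (c0 * c1)); apply: ler_wpM2l; first exact: mulr_ge0.
  rewrite -mulr_sumr mulrC; apply: ler_wpM2r; first exact: expR_ge0.
  have := gauss_nat_abs (i%:R - N) t12 A.
  by under eq_bigr do rewrite nc_pos ?expR_ge0//.
move=> A; rewrite -mulr_sumr; apply: ler_wpM2l; first exact: mulr_ge0 (mulr_ge0 c00 c10) G0.
have := gauss_nat_abs B s2 A.
by under eq_bigr do rewrite nc_pos ?expR_ge0//.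
Qed.

(** Expanding [lint] and summing over i first produces [Ep t2] at -p'^{1 - rho j}, a q-analogue of
    1/Gamma(1 - rho j): the origin of the Wright coefficients. *)
Lemma Ai_eq (l : C) : is_sum (fun j => (sg j * expR (- (t1 * j%:R * n%:~R)))%:C) l ->
  is_sum (fun i => (ecoef t2 i * (- p2) ^+ i)%:C * lint (n - i%:Z)) l.
Proof.
move=> h; have [K hK] := Ai_abs; have hs := csumP hK.
have h1 := fubini hs Ai_inner; have h2 := fubini_r hs Ai_outer.
by rewrite (is_sum_uniq h h2).
Qed.

Lemma Ai_ex : is_sum (fun j => (sg j * expR (- (t1 * j%:R * n%:~R)))%:C) (csum Ai).
Proof. by have [K hK] := Ai_abs; exact: fubini_r (csumP hK) Ai_outer. Qed.

End FixedIndex.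

Definition gau (n : int) : C := (expR (- (tA / 2) * (n - m%:Z)%:~R ^+ 2))%:C.

Lemma Fi_fiber n : is_sum (fun i => Fi (i, n)) (es n * gau n * csum (Ai n)).
Proof.
apply: eq_is_sum (is_sumZ (es n * gau n) (Ai_eq (Ai_ex n))) => i; rewrite /Fi /= -/(gau n).
have -> : (ecoef t2 i * (- p2) ^+ i)%:C = (ecoef t2 i * p2 ^+ i)%:C * (-1) ^+ i :> C.
  by rewrite (exprNn p2) mulrCA mulrC [LHS]rcM; congr (_ * _); rewrite rcX rcN.
rewrite esD esN.
by move: (es n) (gau n) ((-1) ^+ i) (lint _) ((_ * _)%:C) => a b c d e; ring.
Qed.

Definition wj (j : nat) : C := (- (t1 * j%:R)) +i* pi.

Definition Bf (p : nat * int) : C :=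
  es p.2 * gau p.2 * (sg p.1 * expR (- (t1 * p.1%:R * p.2%:~R)))%:C.

Lemma Bf_th j n : Bf (j, n) =
  (-1) ^+ m * (sg j * expR (- (t1 * j%:R * m%:R)))%:C * th tA (wj j) (n - m%:Z).
Proof.
rewrite /Bf /gau /th /=; set u := n - m%:Z; have -> : n = u + m%:Z by rewrite /u subrK.
have -> : - (tA / 2)%:C * u%:~R ^+ 2 + u%:~R * wj j =
  (- (tA / 2) * u%:~R ^+ 2 - t1 * j%:R * u%:~R)%:C + u%:~R * (0 +i* pi) :> C.
  have -> : wj j = (- (t1 * j%:R))%:C + (0 +i* pi).
    by apply/eqP; rewrite eq_complex /= addr0 add0r !eqxx.
  rewrite mulrDr addrA; congr (_ + _).
  rewrite !(intC R u) -rcX -rcN -!rcM -rcD; congr (_%:C); ring.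
rewrite cexpD cexp_real esD es_nat -/(es u).
have -> : sg j * expR (- (t1 * j%:R * (u + m%:Z)%:~R)) =
  sg j * expR (- (t1 * j%:R * m%:R)) * expR (- (t1 * j%:R * u%:~R)).
  have -> : expR (- (t1 * j%:R * (u + m%:Z)%:~R)) =
    expR (- (t1 * j%:R * m%:R)) * expR (- (t1 * j%:R * u%:~R)).
    by rewrite -expRD; congr expR; rewrite intrD -pmulrn; ring.
  by rewrite mulrA.
rewrite (expRD (- (tA / 2) * _)) !rcM.
move: (es u) ((-1) ^+ m) => a b; move: ((expR _)%:C) ((expR _)%:C) ((expR _)%:C) ((sg j)%:C) => c d e f.
by ring.
Qed.

(** The coefficient after Poisson summation in n; the last factor is the real part of w^2/(2 tA) at
    w = [wj j] that depends on j. *)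
Definition sig (j : nat) : R := sg j * expR (- (t1 * j%:R * m%:R)) * expR ((t1 * j%:R) ^+ 2 / (2 * tA)).

Lemma Bf_inner j : abs_le (fun n => Bf (j, n)) (`|sig j| * gbound (tA / 2)) /\
  is_sum (fun n => Bf (j, n)) ((-1) ^+ m * (sg j * expR (- (t1 * j%:R * m%:R)))%:C * Th tA (wj j)).
Proof.
have TA := tA0 k0 s0; set c := (-1) ^+ m * _.
have inj : injective (fun n : int => n - m%:Z) by exact: addIr.
split.
  have h := abs_leZ c (abs_le_reindex inj (abs_le_th (wj j) TA)).
  apply: abs_leS (le_abs_le _ h) => [n|]; first by rewrite Bf_th.
  rewrite /c ncM ncX ncN nc1 expr1n mul1r nc_real /thbound /= sqrrN mulrA /sig.
  by rewrite [X in _ <= X * _]normrM (ger0_norm (expR_ge0 (_ / _))).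
have h := is_sum_reindex (addrK (- m%:Z)) (addrNK (- m%:Z)) (ThP (wj j) TA).
by apply: eq_is_sum (is_sumZ c h) => n; rewrite Bf_th.
Qed.

Definition ee (j : nat) : R := - (t1 * (j%:R * (j%:R - 1) / 2)) - t1 * j%:R - t1 * j%:R * m%:R +
  (t1 * j%:R) ^+ 2 / (2 * tA).

Lemma sig_abs j : `|sig j| = expR (ee j) / qinf t1 / qf t1 j * `|qP t2 (1 - rho * j%:R)|.
Proof.
have T1 := t10 k0 s0; have Q1 := qinf_gt0 T1; have F1 := qf_gt0 T1 j.
have /andP[b1 _] := ecoef_le j T1.
have iQ : 0 <= (qinf t1)^-1 by rewrite invr_ge0 ltW.
set e1 := expR (- (t1 * j%:R * m%:R)); set e2 := expR ((t1 * j%:R) ^+ 2 / (2 * tA)).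
have -> : sig j = ecoef t1 j * (- p1) ^+ j * ((qinf t1)^-1 * e1 * e2) * qP t2 (1 - rho * j%:R).
  by rewrite /sig /sg -/e1 -/e2; move: (_^-1) (_ ^+ j) (ecoef _ _) (qP _ _) => a b c d; ring.
have c0 : 0 <= (qinf t1)^-1 * e1 * e2.
  exact: mulr_ge0 (mulr_ge0 iQ (expR_ge0 _)) (expR_ge0 _).
rewrite normrM [ `|ecoef t1 j * _ * _|]normrM norm_signed ?expR_ge0// (ger0_norm c0).
rewrite /ecoef p_bin -expRM_natl.
have -> : expR (ee j) = expR (- (t1 * (j%:R * (j%:R - 1) / 2))) * expR (j%:R * - t1) *
  expR (- (t1 * j%:R * m%:R)) * expR ((t1 * j%:R) ^+ 2 / (2 * tA)).
  by rewrite -!expRD; congr expR; rewrite /ee; ring.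
rewrite -/e1 -/e2; move: `|_| e1 e2 (expR _) (expR _) (qinf t1)^-1 (qf t1 j)^-1 c0 => a b c d e f g _.
by ring.
Qed.

Lemma qP_shift n x : qP t2 (x - n%:R) = \prod_(i < n) (1 - pw t2 (x - i.+1%:R)) * qP t2 x.
Proof.
have T2 := t20 k s0; elim: n => [|n IH]; first by rewrite big_ord0 mul1r subr0.
rewrite (qP_rec T2) big_ord_recr /= (mulrC (\prod_(i < n) _)) -mulrA; congr (_ * _).
by rewrite -IH; congr qP; rewrite -natr1; ring.
Qed.

(** As rho (k+1) = k, a step of k + 1 in j moves the argument of [qP t2] by the integer k. The
    functional equation makes the ratio explicit, and the k new factors are absorbed by the growth
    of [qf t1]. *)
Lemma sig_ratio j : `|sig (j + k.+1)%N| <=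
  `|sig j| * (expR (- (tA * m.+1%:R)) / (1 - p1 ^+ (j + k.+1))).
Proof.
have T1 := t10 k0 s0; have T2 := t20 k s0; have TA := tA0 k0 s0.
have Q1 := qinf_gt0 T1; have F1 := qf_gt0 T1 j.
rewrite !sig_abs.
have -> : 1 - rho * (j + k.+1)%:R = 1 - rho * j%:R - k%:R.
  rewrite natrD /rho; have : k.+1%:R != 0 :> R by [].
  by move: (k.+1%:R : R) => b b0; field.
rewrite qP_shift normrM normr_prod.
set x := 1 - rho * j%:R; set Y := `|qP t2 x|.
have eX i : pw t2 (x - i.+1%:R) = expR (t1 * j%:R + t2 * i%:R).
  by rewrite /pw /x -t2rho -(natr1 i); congr expR; ring.
have hp : \prod_(i < k) `|1 - pw t2 (x - i.+1%:R)| <=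
  \prod_(i < k) (expR (t1 * j%:R + t2 * i%:R) * (1 - p1 ^+ (j + i).+1)).
  apply: ler_prod => i _; rewrite normr_ge0 /= eX.
  have u0 : 0 <= t1 * j%:R + t2 * i%:R by rewrite addr_ge0// mulr_ge0// ltW.
  rewrite ler0_norm; last by rewrite subr_le0 -[leLHS]expR0 ler_expR.
  rewrite mulrBr mulr1 opprB lerD2l lerN2 -expRM_natl -expRD expR_le1.
  have : (i : nat)%:R <= k%:R :> R by rewrite ler_nat ltnW.
  rewrite -(natr1 (j + i)%N) natrD /tlo /thi -(natr1 k) => ik.
  have : s * (i%:R : R) <= s * k%:R by rewrite ler_pM2l.
  by lra.
have ePX : \prod_(i < k) expR (t1 * j%:R + t2 * i%:R) = expR (k%:R * t1 * j%:R + t2 * (k%:R * (k%:R - 1) / 2)).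
  by rewrite prod_expR_arith mulrA.
have eqf : qf t1 (j + k.+1) = qf t1 j * \prod_(i < k) (1 - p1 ^+ (j + i).+1) * (1 - p1 ^+ (j + k.+1)).
  by rewrite addnS qfS /qf big_split_ord.
have P0 : 0 < \prod_(i < k) (1 - p1 ^+ (j + i).+1).
  by apply: prodr_gt0 => i _; rewrite subr_gt0 pX_lt1.
have L0 : 0 < 1 - p1 ^+ (j + k.+1) by rewrite addnS subr_gt0 pX_lt1.
have een : expR (ee (j + k.+1)) * expR (k%:R * t1 * j%:R + t2 * (k%:R * (k%:R - 1) / 2)) =
  expR (ee j) * expR (- (tA * m.+1%:R)).
  rewrite -!expRD; congr expR; rewrite /ee natrD /tlo /thi /tpr -(natr1 m).
  have k1 : k.+1%:R != 0 :> R by [].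
  have kk : k%:R != 0 :> R by rewrite gt_eqF// ltr0n.
  have s1 : s != 0 by rewrite gt_eqF.
  rewrite -(natr1 k) in k1 *; move: (k%:R : R) kk k1 => a a0 a1.
  by field; rewrite ?a0 ?a1 ?s1.
rewrite big_split /= ePX in hp.
rewrite eqf; have Y0 : 0 <= Y by exact: normr_ge0.
move: hp een; move: (\prod_(i < k) `|_|) => Z hp een.
apply: (@le_trans _ _ (expR (ee (j + k.+1)) / qinf t1 / (qf t1 j * \prod_(i < k) (1 - p1 ^+ (j + i).+1) *
   (1 - p1 ^+ (j + k.+1))) * ((expR (k%:R * t1 * j%:R + t2 * (k%:R * (k%:R - 1) / 2)) *
   \prod_(i < k) (1 - p1 ^+ (j + i).+1)) * Y))).
  apply: ler_wpM2l; last by apply: ler_wpM2r.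
  apply: divr_ge0; first by rewrite divr_ge0 ?expR_ge0// ltW.
  by apply: mulr_ge0; [apply: mulr_ge0; exact: ltW | exact: ltW].
rewrite le_eqVlt; apply/orP; left; apply/eqP.
by apply: sig_alg => //; rewrite gt_eqF.
Qed.

Variable J : nat.
Hypothesis hJ : 2 * expR (- (tA * m.+1%:R)) <= 1 - p1 ^+ J.

Lemma sig_half j : (J <= j)%N -> `|sig (j + k.+1)%N| <= `|sig j| / 2.
Proof.
move=> jJ; have T1 := t10 k0 s0; apply: le_trans (sig_ratio j) _; apply: ler_wpM2l => //.
have L0 : 0 < 1 - p1 ^+ (j + k.+1) by rewrite addnS subr_gt0 pX_lt1.
have h : p1 ^+ (j + k.+1) <= p1 ^+ J.
  apply: ler_wiXn2l; rewrite ?expR_ge0 ?expR_le1 ?oppr_le0 ?(ltW T1)//.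
  exact: leq_trans jJ (leq_addr _ _).
rewrite ler_pdivrMr//; move: hJ h; move: (expR (- (tA * _))) (p1 ^+ _) (p1 ^+ J) => a b c h1 h2; lra.
Qed.

Lemma sig_sum : abs_le (fun j => (sig j)%:C : C) (2 * \sum_(j < J + k.+1) `|sig j|).
Proof.
apply: abs_le_nat => n; under eq_bigr do rewrite nc_real.
by apply: (ratio_sum_le (u := fun j => `|sig j|)) => // j jJ; exact: sig_half.
Qed.

(** The summations are exchanged in two stages: in i and j at each fixed n, by Gaussian bounds, and
    then in j and n, by the halving of [sig]. *)
Lemma Gm_theta : is_sum (fun j => (sg j * expR (- (t1 * j%:R * m%:R)))%:C * Th tA (wj j))
  ((-1) ^+ m * Gm k s m).
Proof.
have TA := tA0 k0 s0; have t12 : 0 < tA / 2 by rewrite divr_gt0.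
have G0 : 0 <= gbound (tA / 2) := abs_le_ge0 (gauss_nat_abs 0 t12).
have hab : abs_le Bf (2 * (\sum_(j < J + k.+1) `|sig j|) * gbound (tA / 2)).
  apply: (@abs_le_pair _ _ _ _ (fun j => `|sig j| * gbound (tA / 2))).
    by move=> j; case: (Bf_inner j).
  move=> A; rewrite -mulr_suml; apply: ler_wpM2r => //.
  by have := sig_sum A; under eq_bigr do rewrite nc_real.
have hs := csumP hab; have h1 := fubini hs (fun j => (Bf_inner j).2).
have h2 := @fubini_r _ _ _ _ _ (fun n => es n * gau n * csum (Ai n)) hs.
have {}h2 : is_sum (fun n => es n * gau n * csum (Ai n)) (csum Bf).
  by apply: h2 => n; apply: eq_is_sum (is_sumZ (es n * gau n) (Ai_ex n)) => j; rewrite /Bf.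
have h3 := fubini_r Fi_sum Fi_fiber.
have e := is_sum_uniq h2 h3; rewrite e in h1.
apply: eq_is_sum (is_sumZ ((-1) ^+ m) h1) => j.
by rewrite !mulrA -expr2 sqrr_sign mul1r.
Qed.

(** The part of the Poisson factor common to all j: the imaginary part pi of [wj j] contributes
    e^{-pi^2/(2 tA)}. *)
Definition S0 : R := Num.sqrt (2 * pi / tA) * expR (- (pi ^+ 2 / (2 * tA))).
Definition Dj (j : nat) : C := Th (4 * pi ^+ 2 / tA) (dw tA (wj j)).

Lemma Gm_dual : is_sum (fun j => (sig j)%:C * (ei (- (pi * j%:R / k.+1%:R)) * Dj j))
  ((S0^-1)%:C * ((-1) ^+ m * Gm k s m)).
Proof.
have TA := tA0 k0 s0; have hpi := pi_gt0 R.
have S00 : 0 < S0 by rewrite mulr_gt0 ?expR_gt0 ?sqrt_gt0_pi.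
apply: eq_is_sum (is_sumZ (S0^-1)%:C Gm_theta) => j.
have hw : `|complex.Im (wj j)| <= pi by rewrite /= ger0_norm// ltW.
rewrite (poisson TA hw) -/(dw tA (wj j)) -/(Dj j).
have -> : wj j ^+ 2 / (2 * tA)%:C =
   ((t1 * j%:R) ^+ 2 / (2 * tA) - pi ^+ 2 / (2 * tA))%:C + (0 +i* (- (pi * j%:R / k.+1%:R))).
  rewrite -rcV mulrC; apply/eqP; rewrite eq_complex expr2 /=.
  have k1 : k.+1%:R != 0 :> R by [].
  have kk : k%:R != 0 :> R by rewrite gt_eqF// ltr0n.
  have s1 : s != 0 by rewrite gt_eqF.
  rewrite /tpr /tlo; move: (@pi R) (k%:R : R) (k.+1%:R : R) kk k1 => p a b a0 b0.
  apply/andP; split; apply/eqP; field; by rewrite ?a0 ?b0 ?s1.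
rewrite cexpD cexp_real -/(ei _) expRD /sig /S0 invfM !rcM.
have n1 : (Num.sqrt (2 * pi / tA))%:C != 0 :> C by rewrite rc_neq0// sqrt_gt0_pi.
have n2 : (expR (- (pi ^+ 2 / (2 * tA))))%:C != 0 :> C by rewrite rc_neq0// expR_gt0.
rewrite !rcV; move: n1 n2; move: ((Num.sqrt _)%:C) ((expR (- (pi ^+ 2 / _)))%:C) => a b a0 b0.
exact: dual_alg.
Qed.

End ThetaExpansion.

(** * The limit s -> 0 *)

Section SmallS.
Variable R : realType.
Local Notation C := R[i].

Lemma scale_right (c : R) : 0 < c -> (c * s) @[s --> (0 : R)^'+] --> (0 : R)^'+.
Proof.
move=> c0 A [e /= e0 he]; exists (e / c); first by rewrite /= divr_gt0.
move=> s /= hs s0; apply: he => /=; last exact: mulr_gt0.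
rewrite sub0r normrN normrM (gtr0_norm c0) mulrC -ltr_pdivlMr//.
by move: hs; rewrite sub0r normrN.
Qed.

Variable k : nat.
Hypothesis k0 : (0 < k)%N.
Local Notation rh := (k%:R / k.+1%:R : R).

Lemma kneq0 : k%:R != 0 :> R. Proof. by rewrite gt_eqF// ltr0n. Qed.
Lemma k1neq0 : k.+1%:R != 0 :> R. Proof. by []. Qed.

Lemma rh01 : 0 < rh < 1.
Proof. by rewrite divr_gt0 ?ltr0n//= ltr_pdivrMr// mul1r ltr_nat. Qed.

Lemma rhE : rh = 1 - (k.+1%:R)^-1.
Proof. by rewrite -(natr1 k); field; rewrite natr1. Qed.

Lemma tlo_right : tlo k s @[s --> (0 : R)^'+] --> (0 : R)^'+.
Proof. by apply: scale_right; rewrite ltr0n. Qed.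
Lemma thi_right : thi k s @[s --> (0 : R)^'+] --> (0 : R)^'+.
Proof. by apply: scale_right; rewrite ltr0n. Qed.

Lemma tpr_lim : tpr k s @[s --> (0 : R)^'+] --> (0 : R).
Proof.
rewrite -[X in _ --> X](mulr0 (k%:R * k.+1%:R)); apply: lim_Z; exact: lim_id0.
Qed.

Lemma near_tpr1 : \forall s \near (0 : R)^'+, tpr k s <= 1.
Proof.
near=> s; rewrite ltW//; near: s; apply: (cvgr_lt _ tpr_lim); exact: ltr01.
Unshelve. all: by end_near.
Qed.

Lemma pw_const (c s : R) : expR (- (c * s)) = pw s c.
Proof. by rewrite /pw mulrC. Qed.

(* (c s^{-1/(k+1)}) e^{-ksm}, the quantity kept near a fixed value below *)
Definition cst : R := k.+1%:R `^ rh / k%:R.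
Definition yy (s : R) (m : nat) : R := cst * s `^ (- (k.+1%:R)^-1) * expR (- (tlo k s * m%:R)).
Definition corr (s : R) : R := ((1 - pw s k.+1%:R) / s / k.+1%:R) `^ rh.

Lemma cst_gt0 : 0 < cst.
Proof. by rewrite divr_gt0 ?powR_gt0 ?ltr0n. Qed.

Lemma corr_lim : corr s @[s --> (0 : R)^'+] --> (1 : R).
Proof.
pose proof (@oneBpw_lim R k.+1%:R) as h.
pose proof (lim_M h (cvg_cst ((k.+1%:R)^-1 : R))) as h2; rewrite mulfV ?k1neq0// in h2.
by pose proof (lim_powR (e := rh) ltr01 h2) as h3; rewrite powR1 in h3; exact: h3.
Qed.

(** This factor enters the j-th term with power j. The part k s is consumed by the factors 1 - p^i
    of the q-factorial, [corr] tends to 1, and [yy] is what becomes x. *)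
Lemma fac_num (s : R) (m : nat) : 0 < s ->
  (1 - expR (- thi k s)) `^ rh * expR (- (tlo k s * m%:R)) = yy s m * corr s * (k%:R * s).
Proof.
move=> s0; rewrite /thi pw_const.
have k1 : 0 < k.+1%:R :> R by rewrite ltr0n.
have Q0 : 0 < 1 - pw s k.+1%:R by rewrite subr_gt0 pw_lt1.
have e : 1 - pw s k.+1%:R = ((1 - pw s k.+1%:R) / s / k.+1%:R) * (k.+1%:R * s).
  by field; rewrite !gt_eqF.
rewrite {1}e powRM; last 2 first.
- by rewrite !divr_ge0// ltW.
- by rewrite mulr_ge0// ltW.
rewrite powRM ?(ltW k1) ?(ltW s0)// -/(corr s) /yy /cst.
have -> : s `^ rh = s * s `^ (- (k.+1%:R)^-1).
  by rewrite rhE powRD ?powRr1 ?(ltW s0)//; apply/implyP => _; rewrite gt_eqF.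
have aux (a b c d f : R) : f != 0 -> a * (b * (s * c)) * d = b / f * c * d * a * (f * s).
  by move=> f0; field.
exact: aux kneq0.
Qed.

Lemma yy_pow (s : R) (m : nat) : 0 < s ->
  expR (- (tpr k s * m%:R)) = (yy s m / cst) ^+ k.+1 * s.
Proof.
move=> s0; have c0 := cst_gt0.
have -> : yy s m / cst = s `^ (- (k.+1%:R)^-1) * expR (- (tlo k s * m%:R)).
  by rewrite /yy; field; rewrite gt_eqF.
rewrite exprMn -expRM_natl -powR_mulrn ?powR_ge0// -powRrM mulNr mulVf ?k1neq0//.
rewrite powR_inv1 ?(ltW s0)//; set E := expR (k.+1%:R * _).
have -> : s^-1 * E * s = E by field; rewrite gt_eqF.
rewrite /E; congr expR.
by rewrite /tpr /tlo; ring.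
Qed.

Lemma fac_lim_aux (i : nat) : (k%:R * s) / (1 - expR (- tlo k s) ^+ i.+1) @[s --> (0 : R)^'+] --> ((i.+1%:R)^-1 : R).
Proof.
pose proof (@oneBpw_lim R (k%:R * i.+1%:R)) as h.
have h0 : k%:R * i.+1%:R != 0 :> R by rewrite mulf_neq0 ?kneq0.
pose proof (@lim_Z _ _ _ _ _ _ k%:R (lim_V h0 h)) as h2.
have e : k%:R * (k%:R * i.+1%:R)^-1 = (i.+1%:R)^-1 :> R.
  by have := kneq0; move: (i.+1%:R : R) (k%:R : R) (oner_neq0 R) => a b _ b0; rewrite invfM mulrA mulfV// mul1r.
rewrite e in h2; apply: lim_near h2; near=> s.
have s0 : 0 < s by near: s; exact: near0_gt0.
have -> : expR (- tlo k s) ^+ i.+1 = pw s (k%:R * i.+1%:R).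
  by rewrite -expRM_natl /pw /tlo; congr expR; ring.
by rewrite invf_div mulrA.
Unshelve. all: by end_near.
Qed.

Lemma qr_lo_lim (x : R) : x <= 1 -> qr (tlo k s) x @[s --> (0 : R)^'+] --> rgam x.
Proof. by move=> x1; exact: (lim_comp tlo_right (rgam_qr x1)). Qed.

Lemma qr_hi_lim (x : R) : x <= 1 -> qr (thi k s) x @[s --> (0 : R)^'+] --> rgam x.
Proof. by move=> x1; exact: (lim_comp thi_right (rgam_qr x1)). Qed.

Lemma qP_qr (t x : R) : 0 < t -> qP t x / qinf t = qr t x * (1 - expR (- t)) `^ (1 - x).
Proof.
move=> t0; have P0 := p1_gt0 t0; rewrite /qr -mulrA -powRD; last by apply/implyP => _; rewrite gt_eqF.
by rewrite (_ : x - 1 + (1 - x) = 0) ?powRr0 ?mulr1//; ring.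
Qed.

Lemma yy_gt0 (s : R) m : 0 < s -> 0 < yy s m.
Proof.
move=> s0; apply: mulr_gt0; last exact: expR_gt0.
by apply: mulr_gt0; [exact: cst_gt0 | exact: powR_gt0].
Qed.

Lemma corr_gt0 (s : R) : 0 < s -> 0 < corr s.
Proof. by move=> s0; rewrite powR_gt0// !divr_gt0 ?ltr0n// subr_gt0 pw_lt1. Qed.

Lemma powR_half_sq (a r : R) : (a `^ (r / 2)) ^+ 2 = a `^ r.
Proof.
rewrite -powR_mulrn ?powR_ge0// -powRrM (_ : r / 2 * 2%:R = r)//.
by rewrite divfK.
Qed.

Local Opaque yy corr.

Lemma BX_alg (B r1 u r2 v E P W y c K f : R) : B = r1 * u / (r2 * v) -> r2 != 0 -> v != 0 ->
  u ^+ 2 = P -> v ^+ 2 = W -> E ^+ 2 = f^-1 -> W = y * c * K / f ->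
  y != 0 -> c != 0 -> K != 0 -> f != 0 ->
  (B * E) ^+ 2 = (r1 / r2) ^+ 2 * (y^-1 * c^-1 * (P / K)).
Proof.
move=> -> r20 v0 hu hv hE hW y0 c0 K0 f0.
transitivity (r1 ^+ 2 * u ^+ 2 / (r2 ^+ 2 * v ^+ 2) * E ^+ 2).
  by field; rewrite r20 v0.
by rewrite hu hv hE hW; field; rewrite y0 c0 K0 f0 r20.
Qed.

(* The error ratio of the main estimate, squared. *)
Lemma BX_sq (s : R) (m : nat) : 0 < s ->
  (BX k s / kap k s * expR (m%:R * (tlo k s / 2))) ^+ 2 =
  (qr (tlo k s) (1 / 2) / qr (thi k s) (1 - rh / 2)) ^+ 2 *
  ((yy s m)^-1 * (corr s)^-1 * ((1 - expR (- tlo k s)) / (k%:R * s))).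
Proof.
move=> s0; have T1 := t10 k0 s0; have T2 := t20 k s0.
have P1 := p1_gt0 T1; have P2 := p1_gt0 T2; have Q1 := qinf_gt0 T1; have Q2 := qinf_gt0 T2.
have /andP[X0 X1] := x2_itv k0 s0.
have ex : x2 k s = 1 - rh / 2.
  rewrite /x2 /tlo /thi; have := kneq0; have := k1neq0; move: (k.+1%:R : R) (k%:R : R) => a b a0 b0.
  by field; rewrite a0 gt_eqF.
have h1 := qP_qr (1 / 2) T1; have h2 := qP_qr (x2 k s) T2.
have qp1 : 0 < qP (tlo k s) (1 / 2) by apply: qP_gt0 => //; rewrite divr_gt0.
have qp2 := qP_gt0 T2 X0.
have e : BX k s / kap k s = (qP (tlo k s) (1 / 2) / qinf (tlo k s)) / (qP (thi k s) (x2 k s) / qinf (thi k s)).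
  rewrite /BX /kap; move: (qP _ _) (qP _ _) (qinf _) (qinf _) qp2 Q1 Q2 => a b c d b0 c0 d0.
  by field; rewrite !gt_eqF.
have q2 : qr (thi k s) (x2 k s) != 0.
  apply/eqP => h; have := @eq_ind R _ (fun z => is_true (0 < z)) (divr_gt0 qp2 Q2) _ h2.
  by rewrite h mul0r ltxx.
have e2 : 1 - x2 k s = rh / 2 by rewrite ex; ring.
have e3 : 1 - 1 / 2 = 2^-1 :> R by field.
rewrite e3 in h1; rewrite e2 in h2; rewrite ex in h2 q2 e.
have hB : BX k s / kap k s = qr (tlo k s) (1 / 2) * (1 - expR (- tlo k s)) `^ 2^-1 /
    (qr (thi k s) (1 - rh / 2) * (1 - expR (- thi k s)) `^ (rh / 2)).
  exact: (etrans e (f_equal2 (fun u v : R => u / v) h1 h2)).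
move: hB q2; move: (BX k s / kap k s) (qr (tlo k s) _) (qr (thi k s) _) => B r1 r2 hB q2.
have hf := fac_num m s0.
have Y0 := yy_gt0 m s0; have C0 := corr_gt0 s0.
have hks : 0 < k%:R * s := t10 k0 s0.
have E0 : 0 < expR (- (tlo k s * m%:R)) by exact: expR_gt0.
have hv0 : (1 - expR (- thi k s)) `^ (rh / 2) != 0 := lt0r_neq0 (powR_gt0 _ P2).
have hu : ((1 - expR (- tlo k s)) `^ 2^-1) ^+ 2 = 1 - expR (- tlo k s).
  by rewrite (powR12_sqrt (ltW P1)) (sqr_sqrtr (ltW P1)).
have hv : ((1 - expR (- thi k s)) `^ (rh / 2)) ^+ 2 = (1 - expR (- thi k s)) `^ rh.
  exact: powR_half_sq.
have hE : expR (m%:R * (tlo k s / 2)) ^+ 2 = (expR (- (tlo k s * m%:R)))^-1.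
  by rewrite -expRN -expRM_natl; congr expR; field.
have hW : (1 - expR (- thi k s)) `^ rh = yy s m * corr s * (k%:R * s) / expR (- (tlo k s * m%:R)).
  by rewrite -hf (mulfK (lt0r_neq0 E0)).
move: hB hv0 hu hv hE hW; move: (_ `^ 2^-1) (_ `^ (rh / 2)) (_ `^ rh) (expR (m%:R * _)) => u v W E.
move: E0 Y0 C0 hks; move: (expR (- (tlo k s * m%:R))) (yy s m) (corr s) (k%:R * s) => f y c K f0 y0 c0 K0.
move=> hB hv0 hu hv hE hW.
exact: (BX_alg hB q2 hv0 hu hv hE hW (lt0r_neq0 y0) (lt0r_neq0 c0) (lt0r_neq0 K0) (lt0r_neq0 f0)).
Qed.

Lemma BX_lim (mm : R -> nat) (l : R) : (yy s (mm s))^-1 @[s --> (0 : R)^'+] --> l ->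
  (BX k s / kap k s * expR ((mm s)%:R * (tlo k s / 2))) ^+ 2 @[s --> (0 : R)^'+] -->
  (rgam (1 / 2) / rgam (1 - rh / 2)) ^+ 2 * l.
Proof.
move=> hl; have /andP[r0 r1] := rh01.
have x2 : 0 < 1 - rh / 2 <= 1.
  by move: r0 r1; move: (k%:R / k.+1%:R : R) => r r0 r1; apply/andP; split; lra.
have g2 := rgam_gt0 x2; have /andP[_ x21] := x2.
have h12 : 1 / 2 <= 1 :> R by lra.
have g2n : rgam (1 - rh / 2) != 0 by rewrite gt_eqF.
pose proof (lim_sq (lim_div g2n (qr_lo_lim h12) (qr_hi_lim x21))) as a1.
pose proof (lim_V (oner_neq0 R) corr_lim) as a2.
have one_ne : (1%:R : R)^-1 != 0 by rewrite invr1 oner_eq0.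
pose proof (lim_V one_ne (@fac_lim_aux 0%N)) as a3.
pose proof (lim_M a1 (lim_M (lim_M hl a2) a3)) as a4.
rewrite !invr1 !mulr1 in a4; apply: lim_near a4; near=> s.
have s0 : 0 < s by near: s; exact: near0_gt0.
by rewrite BX_sq// expr1 invf_div.
Unshelve. all: by end_near.
Qed.

Local Transparent yy corr.

Lemma powR_neg_inv (s : R) : 0 < s -> (yy s 0)^-1 = cst^-1 * s `^ ((k.+1%:R)^-1).
Proof.
move=> s0; have c0 := cst_gt0; rewrite /yy mulr0 oppr0 expR0 mulr1 powRN.
have : s `^ ((k.+1%:R)^-1) != 0 by rewrite gt_eqF// powR_gt0.
by move: (_ `^ _) => a a0; field; rewrite a0 gt_eqF.
Qed.

Lemma yy0_lim : (yy s 0)^-1 @[s --> (0 : R)^'+] --> (0 : R).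
Proof.
have k1 : 0 < (k.+1%:R : R)^-1 by rewrite invr_gt0.
pose proof (@lim_Z _ _ _ _ _ _ cst^-1 (powR_cvg0 k1)) as h; rewrite mulr0 in h.
apply: lim_near h; near=> s.
by rewrite powR_neg_inv//; near: s; exact: near0_gt0.
Unshelve. all: by end_near.
Qed.

Variable x : R.
Hypothesis x0 : 0 < x.

(** The integer part of the solution m of [yy] = x; rounding changes [yy] by a factor at most
    e^{ks}. *)
Definition msel (s : R) : nat := Num.truncn (ln ((yy s 0) / x) / tlo k s).

Lemma yy_msel : yy s (msel s) @[s --> (0 : R)^'+] --> x.
Proof.
have up : x * expR (tlo k s) @[s --> (0 : R)^'+] --> x.
  pose proof (@lim_Z _ _ _ _ _ _ x (@pw_lim R (- k%:R))) as h; rewrite mulr1 in h.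
  apply: lim_near h; apply: nearW => s; rewrite /pw /tlo; congr (_ * expR _); ring.
apply: (@squeeze_cvgr _ _ _ _ _ _ _ _ _ (cvg_cst x) up).
near=> s; have s0 : 0 < s by near: s; exact: near0_gt0.
have T1 := t10 k0 s0.
have Y0 := yy_gt0 0 s0.
have hL : (yy s 0)^-1 < x^-1 by near: s; apply: (cvgr_lt _ yy0_lim); rewrite invr_gt0.
set L := yy s 0 / x; have L0 : 0 < L by rewrite divr_gt0.
have L1 : 1 <= L.
  rewrite /L ler_pdivlMr// mul1r ltW//; move: hL; rewrite ltf_pV2 ?posrE//.
have lnL : 0 <= ln L / tlo k s by rewrite divr_ge0 ?ln_ge0// ltW.
have /andP[h1 h2] := truncn_itv lnL.
rewrite -/(msel s) in h1 h2.
rewrite ler_pdivlMr// mulrC in h1; rewrite ltr_pdivrMr// -natr1 mulrC in h2.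
have e : yy s (msel s) = x * expR (ln L - tlo k s * (msel s)%:R).
  rewrite expRD (lnK L0) /L /yy mulr0 oppr0 expR0 mulr1.
  by move: (expR _) (_ `^ _) => a b; field; rewrite gt_eqF.
rewrite e; apply/andP; split.
  by rewrite ler_peMr ?(ltW x0)// -[leLHS]expR0 ler_expR subr_ge0.
by rewrite ler_pM2l// ler_expR; move: h2; rewrite mulrDr mulr1; lra.
Unshelve. all: by end_near.
Qed.

End SmallS.

Section WrightLimit.
Variable R : realType.
Local Notation C := R[i].
Variable k : nat.
Hypothesis k0 : (0 < k)%N.
Local Notation rh := (k%:R / k.+1%:R : R).
Variable x : R.
Hypothesis x0 : 0 < x.
Local Notation ms := (msel k x).

(** The factor [kap] exchanges the normalisation (p;p) in [sig] for (p';p'), the one under which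
    [qP t2] is a reciprocal q-Gamma function. *)
Definition us (s : R) (j : nat) : R := kap k s * sig k s (ms s) j.
Definition xprod (j : nat) : R := \prod_(i < j) (x * (i.+1%:R)^-1).
Definition aj (j : nat) : R := (-1) ^+ j * xprod j * rgam (1 - rh * j%:R).

Lemma rhj_le1 (j : nat) : 1 - rh * j%:R <= 1.
Proof. by rewrite gerBl mulr_ge0// divr_ge0. Qed.

Lemma prod_const_div (c : R) (u : nat -> R) j :
  \prod_(i < j) (c / u i) = c ^+ j / \prod_(i < j) u i.
Proof.
elim: j => [|j IH]; first by rewrite !big_ord0 expr0 divr1.
by rewrite !big_ord_recr /= IH exprSr invfM mulrACA.
Qed.

Lemma us_alg (Q1 Q2 c F g g' P q A e E : R) : Q1 != 0 -> Q2 != 0 -> F != 0 -> P / Q2 = q * A ->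
  Q1 / Q2 * (c / F * (g * g') / Q1 * P * e * E) = g * (c * g') * E * q * (A * e / F).
Proof.
move=> h1 h2 h3 /(canRL (divfK h2)) ->; field; by rewrite h1 h2 h3.
Qed.

Lemma us_E (s : R) (j : nat) : 0 < s -> us s j =
  (-1) ^+ j * pw s (k%:R * ('C(j, 2) + j)%:R) * pw s (- (k%:R * j%:R ^+ 2 / (2 * k.+1%:R))) *
  qr (thi k s) (1 - rh * j%:R) *
  \prod_(i < j) (yy k s (ms s) * corr k s * ((k%:R * s) / (1 - expR (- tlo k s) ^+ i.+1))).
Proof.
move=> s0; have T1 := t10 k0 s0; have T2 := t20 k s0.
have Q1 := lt0r_neq0 (qinf_gt0 T1); have Q2 := lt0r_neq0 (qinf_gt0 T2).
have F1 := lt0r_neq0 (qf_gt0 T1 j).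
have h := qP_qr (1 - rh * j%:R) T2.
have e1 : 1 - (1 - rh * j%:R) = rh * j%:R by ring.
rewrite e1 powRrM powR_mulrn ?powR_ge0// in h.
have -> : \prod_(i < j) (yy k s (ms s) * corr k s * ((k%:R * s) / (1 - expR (- tlo k s) ^+ i.+1))) =
  ((1 - expR (- thi k s)) `^ rh) ^+ j * expR (- (tlo k s * j%:R * (ms s)%:R)) / qf (tlo k s) j.
  have -> : expR (- (tlo k s * j%:R * (ms s)%:R)) = expR (- (tlo k s * (ms s)%:R)) ^+ j.
    by rewrite -expRM_natl; congr expR; ring.
  rewrite -exprMn (fac_num k0 (ms s) s0) -(prod_const_div _ (fun i => 1 - expR (- tlo k s) ^+ i.+1)).
  by apply: eq_bigr => i _; rewrite mulrA.
have ep : expR (- tlo k s) ^+ 'C(j, 2) * expR (- tlo k s) ^+ j = pw s (k%:R * ('C(j, 2) + j)%:R).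
  by rewrite -exprD -expRM_natl /pw /tlo; congr expR; ring.
have eE : expR ((tlo k s * j%:R) ^+ 2 / (2 * tpr k s)) = pw s (- (k%:R * j%:R ^+ 2 / (2 * k.+1%:R))).
  rewrite /pw /tlo /tpr; congr expR; have := kneq0 R k0; have := k1neq0 R k.
  move: (k%:R : R) (k.+1%:R : R) (lt0r_neq0 s0) => a b s1 b0 a0.
  by field; rewrite a0 b0 s1.
rewrite -ep -eE /us /kap /sig /sg /rho /ecoef (exprNn (expR (- tlo k s))).
exact: (@us_alg (qinf (tlo k s)) (qinf (thi k s)) (expR (- tlo k s) ^+ 'C(j, 2)) (qf (tlo k s) j)
  ((-1) ^+ j) (expR (- tlo k s) ^+ j) (qP (thi k s) (1 - rh * j%:R)) (qr (thi k s) (1 - rh * j%:R))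
  (((1 - expR (- thi k s)) `^ rh) ^+ j) (expR (- (tlo k s * j%:R * (ms s)%:R)))
  (expR ((tlo k s * j%:R) ^+ 2 / (2 * tpr k s))) Q1 Q2 F1 h).
Qed.

Lemma prod_fac_lim (j : nat) :
  \prod_(i < j) (yy k s (ms s) * corr k s * ((k%:R * s) / (1 - expR (- tlo k s) ^+ i.+1)))
   @[s --> (0 : R)^'+] --> xprod j.
Proof.
pose proof (@lim_prod R R (0 : R)^'+ _ j
  (fun i s => yy k s (ms s) * corr k s * ((k%:R * s) / (1 - expR (- tlo k s) ^+ i.+1)))
  (fun i => x * (i.+1%:R)^-1)) as h.
apply: h => i; pose proof (lim_M (lim_M (@yy_msel R k k0 x x0) (@corr_lim R k)) (@fac_lim_aux R k k0 i)) as h2.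
by rewrite mulr1 in h2.
Qed.

Lemma us_lim (j : nat) : us s j @[s --> (0 : R)^'+] --> aj j.
Proof.
pose proof (lim_M (lim_M (lim_M (@lim_Z _ _ _ _ _ _ ((-1) ^+ j) (@pw_lim R (k%:R * ('C(j, 2) + j)%:R)))
  (@pw_lim R (- (k%:R * j%:R ^+ 2 / (2 * k.+1%:R))))) (qr_hi_lim k (rhj_le1 j)))
  (@prod_fac_lim j)) as h.
have -> : aj j = (-1) ^+ j * 1 * 1 * rgam (1 - rh * j%:R) * xprod j by rewrite /aj; ring.
apply: lim_near h; near=> s; have s0 : 0 < s by near: s; exact: near0_gt0.
by rewrite (us_E j s0).
Unshelve. all: by end_near.
Qed.

(** One J works for all small s because both sides are of order s: the left is about 2 (x/cst)^{k+1}
    s by [yy_pow], the right about k J s. *)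
Lemma near_hJ : exists J : nat, \forall s \near (0 : R)^'+,
  2 * expR (- (tpr k s * (ms s).+1%:R)) <= 1 - expR (- tlo k s) ^+ J.
Proof.
have c0 := cst_gt0 R k0; have kk : 0 < k%:R :> R by rewrite ltr0n.
pose L : R := (x / cst R k) ^+ k.+1.
have L0 : 0 <= 2 * L / k%:R by apply: divr_ge0;
  [apply: mulr_ge0 => //; apply: exprn_ge0; exact: divr_ge0 (ltW x0) (ltW c0) | exact: ltW].
exists (Num.truncn (2 * L / k%:R)).+1; set J := (Num.truncn _).+1.
have hJ : 2 * L < k%:R * J%:R.
  have /andP[_] := truncn_itv L0; rewrite -/J.
  by rewrite (ltr_pdivrMr _ _ kk) [_ * k%:R]mulrC.
have a1 : (yy k s (ms s) / cst R k) ^+ k.+1 @[s --> (0 : R)^'+] --> L.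
  have h : \prod_(i < k.+1) (yy k s (ms s) / cst R k) @[s --> (0 : R)^'+] --> \prod_(i < k.+1) (x / cst R k).
    pose proof (@lim_prod R R (0 : R)^'+ _ k.+1 (fun _ s => yy k s (ms s) / cst R k) (fun _ => x / cst R k)) as h.
    by apply: h => i; apply: lim_M; [exact: yy_msel | exact: cvg_cst].
  rewrite prodr_const card_ord in h; apply: lim_near h; apply: nearW => s.
  by rewrite prodr_const card_ord.
have a2 : pw s (k%:R * k.+1%:R) @[s --> (0 : R)^'+] --> (1 : R) by exact: pw_lim.
pose proof (@lim_Z _ _ _ _ _ _ 2 (lim_M a1 a2)) as a3; rewrite mulr1 in a3.
pose proof (@oneBpw_lim R (k%:R * J%:R)) as a4.
pose proof (lim_D a4 (cvgN a3)) as a5.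
have d0 : 0 < k%:R * J%:R - 2 * L by rewrite subr_gt0.
pose proof (cvgr_gt _ a5 _ d0) as a6.
near=> s; have s0 : 0 < s by near: s; exact: near0_gt0.
have h6 : 0 < (1 - pw s (k%:R * J%:R)) / s - 2 * ((yy k s (ms s) / cst R k) ^+ k.+1 * pw s (k%:R * k.+1%:R)).
  by near: s; exact: a6.
have -> : expR (- tlo k s) ^+ J = pw s (k%:R * J%:R).
  by rewrite -expRM_natl /pw /tlo; congr expR; ring.
have -> : expR (- (tpr k s * (ms s).+1%:R)) = (yy k s (ms s) / cst R k) ^+ k.+1 * pw s (k%:R * k.+1%:R) * s.
  rewrite [RHS]mulrAC -(yy_pow k0 (ms s) s0) /pw -expRD -(natr1 (ms s)) /tpr; congr expR; ring.
move: h6; rewrite subr_gt0 ltr_pdivlMr// => h6; rewrite ltW//.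
by rewrite mulrA.
Unshelve. all: by end_near.
Qed.

Lemma us_near (n : nat) : \forall s \near (0 : R)^'+, forall j, (j < n)%N -> `|us s j| <= `|aj j| + 1.
Proof.
elim: n => [|n IH]; first by apply: nearW => s j.
have h : `|us s n| @[s --> (0 : R)^'+] --> `|aj n| by apply: cvg_norm; exact: us_lim.
have l1 : `|aj n| < `|aj n| + 1 by rewrite ltrDl.
pose proof (cvgr_lt _ h _ l1) as h2.
near=> s.
have h3 : `|us s n| < `|aj n| + 1 by near: s; exact: h2.
have h4 : forall j, (j < n)%N -> `|us s j| <= `|aj j| + 1 by near: s; exact: IH.
move=> j; rewrite ltnS leq_eqVlt => /orP[/eqP->|jn]; [exact: ltW | exact: h4].
Unshelve. all: by end_near.
Qed.

Lemma us_dom : exists U J, 0 <= U /\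
  \forall s \near (0 : R)^'+, [/\ forall j, `|us s j| <= mdom U J k.+1 j &
    2 * expR (- (tpr k s * (ms s).+1%:R)) <= 1 - expR (- tlo k s) ^+ J].
Proof.
have [J hJ] := near_hJ; pose U : R := \sum_(j < J + k.+1) (`|aj j| + 1).
have U0 : 0 <= U by apply: sumr_ge0 => i _; rewrite addr_ge0.
exists U, J; split=> //; near=> s; have s0 : 0 < s by near: s; exact: near0_gt0.
have h : 2 * expR (- (tpr k s * (ms s).+1%:R)) <= 1 - expR (- tlo k s) ^+ J by near: s.
have hn : forall j, (j < J + k.+1)%N -> `|us s j| <= `|aj j| + 1 by near: s; exact: us_near.
have K0 := kap_gt0 k0 s0; split=> //.
apply: (mdom_ge (u := fun j => `|us s j|)) => // j jJ.
  have uE i : `|us s i| = kap k s * `|sig k s (ms s) i| by rewrite /us normrM (gtr0_norm K0).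
  rewrite !uE -mulrA; apply: ler_wpM2l; first exact: ltW.
  exact: (sig_half k0 s0 h).
apply: le_trans (hn j jJ) _; rewrite /U (bigD1 (Ordinal jJ)) //= lerDl.
by apply: sumr_ge0 => i _; rewrite addr_ge0.
Unshelve. all: by end_near.
Qed.

Definition vs (s : R) (j : nat) : C := ei (- (pi * j%:R / k.+1%:R)) * Dj k s j.

(** With a = pi j/(k+1), the two boundary terms of the dual theta give e^{-ia}(1 + e^{2ia}) = 2 cos
    a. *)
Lemma vs_close (s : R) j : 0 < s -> tpr k s <= 1 ->
  nc (vs s j - (2 * cos (pi * j%:R / k.+1%:R))%:C) <= 4 * tpr k s.
Proof.
move=> s0 A1; have TA := tA0 k0 s0; have hA : 0 < tpr k s <= 1 by rewrite TA.
have hpi := pi_gt0 R; have p2 := pi_ge2 R.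
have h := dual_boundary (- (tlo k s * j%:R)) hA.
have ea : - (2 * pi * - (tlo k s * j%:R) / tpr k s) = 2 * (pi * j%:R / k.+1%:R).
  rewrite /tlo /tpr; have := kneq0 R k0; have := k1neq0 R k.
  move: (@pi R) (k%:R : R) (k.+1%:R : R) (lt0r_neq0 s0) => p a b s1 b0 a0.
  by field; rewrite a0 b0 s1.
rewrite ea in h; set a := pi * j%:R / k.+1%:R in h *.
have -> : vs s j - (2 * cos a)%:C = ei (- a) * (Dj k s j - (1 + ei (2 * a))).
  rewrite /vs -/a mulrBr; congr (_ - _).
  have -> : 2 * a = a + a by ring.
  rewrite mulrDr mulr1 eiD mulrA -eiD addNr ei0 mul1r !eiE cosN sinN.
  by apply/eqP; rewrite eq_complex /= addNr !eqxx andbT; apply/eqP; ring.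
rewrite ncM nc_ei mul1r; apply: le_trans h _; rewrite ler_pM2l//.
have T0 : 0 < 2 * pi ^+ 2 / tpr k s by rewrite divr_gt0// mulr_gt0// exprn_gt0.
apply: (@le_trans _ _ (2 * pi ^+ 2 / tpr k s)^-1).
  rewrite expRN lef_pV2 ?posrE ?expR_gt0//.
  by apply: le_trans (expR_ge1Dx _); rewrite lerDr.
rewrite invf_div ler_pdivrMr ?mulr_gt0 ?exprn_gt0// ler_peMr ?(ltW TA)//.
by rewrite expr2; nra.
Qed.

Lemma vs_bound (s : R) j : 0 < s -> tpr k s <= 1 -> nc (vs s j) <= 6.
Proof.
move=> s0 A1; have h := vs_close j s0 A1.
have h2 := nc_le_B (vs s j) (2 * cos (pi * j%:R / k.+1%:R))%:C.
have h3 : nc ((2 * cos (pi * j%:R / k.+1%:R) : R)%:C) <= 2.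
  rewrite nc_real normrM ger0_norm// ler_piMr//.
  by rewrite ler_norml cos_geN1 cos_le1.
lra.
Qed.

Lemma vs_lim j : cvgc (0 : R)^'+ (fun s => vs s j) (2 * cos (pi * j%:R / k.+1%:R))%:C.
Proof.
apply/cvgcP.
have h4 : 4 * tpr k s @[s --> (0 : R)^'+] --> (0 : R).
  by rewrite -[X in _ --> X](mulr0 4); apply: lim_Z; exact: tpr_lim.
apply: (@squeeze_cvgr _ _ _ _ _ _ _ _ _ (cvg_cst 0) h4); near=> s.
have s0 : 0 < s by near: s; exact: near0_gt0.
have A1 : tpr k s <= 1 by near: s; exact: near_tpr1.
by rewrite nc_ge0 vs_close.
Unshelve. all: by end_near.
Qed.

Definition gj (j : nat) : C := (aj j)%:C * (2 * cos (pi * j%:R / k.+1%:R))%:C.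

Lemma aj_dom : exists U J, 0 <= U /\ forall j, `|aj j| <= mdom U J k.+1 j.
Proof.
have [U [J [U0 h]]] := us_dom; exists U, J; split=> // j.
pose proof (lim_le (cvg_norm (@us_lim j)) (cvg_cst (mdom U J k.+1 j))) as hl; apply: hl.
by apply: filterS h => s [].
Qed.

Lemma aj_abs (v : nat -> C) (B : R) : 0 <= B -> (forall j, nc (v j) <= B) ->
  exists K, abs_le (fun j => (aj j)%:C * v j) K.
Proof.
move=> B0 hv; have [U [J [U0 h]]] := aj_dom.
exists (B * (2 * \sum_(j < J + k.+1) mdom U J k.+1 j)); apply: abs_le_nat => n.
apply: le_trans (_ : \sum_(i < n) B * mdom U J k.+1 i <= _).
  apply: ler_sum => i _; rewrite ncM nc_real mulrC.
  by apply: ler_pM => //; exact: nc_ge0.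
by rewrite -mulr_sumr; apply: ler_wpM2l => //; exact: mdom_sum.
Qed.

Lemma gj_sum : is_sum gj (csum gj).
Proof.
have [||K hK] := @aj_abs (fun j => (2 * cos (pi * j%:R / k.+1%:R))%:C) 2 => //.
  move=> j; rewrite nc_real normrM ger0_norm// ler_piMr//.
  by rewrite ler_norml cos_geN1 cos_le1.
exact: csumP hK.
Qed.

(** Domination is uniform in s: the first J + k + 1 terms are bounded by their limits plus 1, and
    beyond them the terms halve every k + 1 steps. *)
Lemma Gm_limit : cvgc (0 : R)^'+
  (fun s => (kap k s / S0 k s)%:C * ((-1) ^+ ms s * Gm k s (ms s))) (csum gj).
Proof.
have [U [J [U0 h]]] := us_dom.
have hm : forall A : {fset nat}, \sum_(i <- A) 6 * mdom U J k.+1 i <=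
   6 * (2 * \sum_(j < J + k.+1) mdom U J k.+1 j).
  apply: fsum_nat_le => [i|n]; first by rewrite mulr_ge0// mdom_ge0.
  by rewrite -mulr_sumr; apply: ler_wpM2l => //; exact: mdom_sum.
apply: (tannery (f := fun s j => (us s j)%:C * vs s j) _ hm _ _ _ gj_sum).
- near=> s; have s0 : 0 < s by near: s; exact: near0_gt0.
  have A1 : tpr k s <= 1 by near: s; exact: near_tpr1.
  have [hu _] : [/\ forall j, `|us s j| <= mdom U J k.+1 j &
    2 * expR (- (tpr k s * (ms s).+1%:R)) <= 1 - expR (- tlo k s) ^+ J] by near: s.
  move=> j; rewrite ncM nc_real mulrC; apply: ler_pM => //; first exact: nc_ge0.
  exact: vs_bound.
- by move=> j; apply: cvgcM; [exact: cvgc_real (@us_lim j) | exact: vs_lim].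
near=> s; have s0 : 0 < s by near: s; exact: near0_gt0.
have [_ hJ] : [/\ forall j, `|us s j| <= mdom U J k.+1 j &
    2 * expR (- (tpr k s * (ms s).+1%:R)) <= 1 - expR (- tlo k s) ^+ J] by near: s.
rewrite [(_ / _)%:C]rcM -mulrA.
apply: eq_is_sum (is_sumZ (kap k s)%:C (Gm_dual k0 s0 hJ)) => j.
by rewrite /us /vs [(kap k s * _)%:C]rcM mulrA.
Unshelve. all: by end_near.
Qed.

End WrightLimit.

(** * The constants of the main term *)

Section KapAsym.
Variable R : realType.
Variable k : nat.
Hypothesis k0 : (0 < k)%N.

Definition qinf_ratio (t : R) : R :=
  qinf t / (Num.sqrt (2 * pi / t) * expR (t / 24 - pi ^+ 2 / (6 * t))).
Definition Qr (s : R) : R := qinf_ratio (tlo k s) / qinf_ratio (thi k s).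

Lemma Qr_lim : Qr s @[s --> (0 : R)^'+] --> (1 : R).
Proof.
have h1 : qinf_ratio (tlo k s) @[s --> (0 : R)^'+] --> (1 : R).
  exact: (lim_comp (@tlo_right R k k0) (@qinf_asym R)).
have h2 : qinf_ratio (thi k s) @[s --> (0 : R)^'+] --> (1 : R).
  exact: (lim_comp (@thi_right R k) (@qinf_asym R)).
by pose proof (lim_div (oner_neq0 R) h1 h2) as h; rewrite divr1 in h.
Qed.

Lemma kap_alg (q1 q2 a1 a2 e1 e2 E : R) : q2 != 0 -> a1 != 0 -> a2 != 0 -> e2 != 0 -> E != 0 ->
  e1 = E * e2 -> q1 / q2 = (q1 / (a1 * e1)) / (q2 / (a2 * e2)) * (a1 / a2) * E.
Proof. by move=> h1 h2 h3 h4 h5 ->; field; rewrite h1 h2 h3 h4 h5. Qed.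

Lemma kap2_alg (Q u r1 r2 E F : R) : u != 0 -> r1 != 0 -> r2 != 0 ->
  (Q * ((u / r1) / (u / r2)) * E) ^+ 2 * (u / (r1 * r2) * (u / r2) / (u / r1) * F) =
  Q ^+ 2 * (u / r1 ^+ 2 * (E ^+ 2 * F)).
Proof. by move=> h1 h2 h3; field; rewrite h1 h2 h3. Qed.

Lemma kap3_alg (Q u r1 r2 E F A G : R) : u != 0 -> r1 != 0 -> r2 != 0 -> A != 0 -> G != 0 ->
  E ^+ 3 * F = G ->
  (Q * ((u / r1) / (u / r2)) * E) ^+ 3 * (A * (u / r2) / (u / r1) * F) / (A * G) =
  Q ^+ 3 * (r2 ^+ 2 / r1 ^+ 2).
Proof.
move=> h1 h2 h3 h4 h5 hG.
have -> : (Q * ((u / r1) / (u / r2)) * E) ^+ 3 * (A * (u / r2) / (u / r1) * F) / (A * G) =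
  Q ^+ 3 * (r2 ^+ 2 / r1 ^+ 2) * ((E ^+ 3 * F) / G) by field; rewrite h1 h2 h3 h4 h5.
by rewrite hG divff ?mulr1.
Qed.

Lemma sqrt_scale (c s : R) : 0 < c -> 0 < s ->
  Num.sqrt (2 * pi / (c * s)) = Num.sqrt (2 * pi / s) / Num.sqrt c.
Proof.
move=> c0 s0; have -> : 2 * pi / (c * s) = 2 * pi / s * c^-1 by rewrite invfM mulrA mulrAC.
rewrite sqrtrM ?sqrtrV ?(ltW c0)//.
by rewrite divr_ge0 ?mulr_ge0 ?pi_ge0 ?(ltW s0).
Qed.

Definition kexp (s : R) : R := expR (- (s / 24) - pi ^+ 2 / (6 * tpr k s)).

Lemma kapE (s : R) : 0 < s -> kap k s = Qr s * ((Num.sqrt (2 * pi / s) / Num.sqrt k%:R) /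
  (Num.sqrt (2 * pi / s) / Num.sqrt k.+1%:R)) * kexp s.
Proof.
move=> s0; have T1 := t10 k0 s0; have T2 := t20 k s0.
have kk : 0 < k%:R :> R by rewrite ltr0n.
have kk1 : 0 < k.+1%:R :> R by rewrite ltr0n.
rewrite -(sqrt_scale kk s0) -(sqrt_scale kk1 s0).
have sq t : 0 < t -> Num.sqrt (2 * pi / t) != 0 :> R.
  by move=> t0; rewrite gt_eqF// sqrtr_gt0 divr_gt0// mulr_gt0// pi_gt0.
apply: kap_alg; rewrite ?sq ?gt_eqF ?expR_gt0 ?qinf_gt0//.
rewrite /kexp -expRD; congr expR; rewrite /tpr /tlo /thi.
move: (kneq0 R k0) (k1neq0 R k) (lt0r_neq0 s0).
have -> : k.+1%:R = k%:R + 1 :> R by rewrite -natr1.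
by move: (@pi R) (k%:R : R) => p a a0 b0 s1; field; rewrite a0 b0 s1.
Qed.

Lemma sqrtA (s : R) : 0 < s -> Num.sqrt (2 * pi / tpr k s) =
  Num.sqrt (2 * pi / s) / (Num.sqrt k%:R * Num.sqrt k.+1%:R).
Proof.
move=> s0; rewrite -sqrtrM//; apply: sqrt_scale => //.
by rewrite mulr_gt0 ?ltr0n.
Qed.

Lemma sqrt_neq0s (c : R) : 0 < c -> Num.sqrt c != 0.
Proof. by move=> c0; rewrite gt_eqF ?sqrtr_gt0. Qed.

(** The exponents add up to -s/12 + s/8 = s/24 and -pi^2/(3A); the square roots combine to sqrt(2
    pi/s)/k. *)
Lemma kap2E (s : R) : 0 < s -> kap k s ^+ 2 * E0 k s = Qr s ^+ 2 * (Num.sqrt (2 * pi / s) / k%:R *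
  expR (- (pi ^+ 2 / (3 * k%:R * k.+1%:R * s)) + s / 24)).
Proof.
move=> s0; have kk : 0 < k%:R :> R by rewrite ltr0n.
have kk1 : 0 < k.+1%:R :> R by rewrite ltr0n.
have u0 : 0 < 2 * pi / s by rewrite divr_gt0// mulr_gt0// pi_gt0.
rewrite (kapE s0) /E0 (sqrtA s0) (_ : tlo k s = k%:R * s)// (_ : thi k s = k.+1%:R * s)//.
rewrite (sqrt_scale kk s0) (sqrt_scale kk1 s0).
rewrite (kap2_alg (Qr s) (kexp s) (expR (s / 8)) (sqrt_neq0s u0) (sqrt_neq0s kk) (sqrt_neq0s kk1)).
rewrite sqr_sqrtr ?(ltW kk)//; congr (_ * (_ * _)).
rewrite /kexp -expRM_natl -expRD; congr expR; rewrite /tpr.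
move: (kneq0 R k0) (k1neq0 R k) (lt0r_neq0 s0).
by move: (@pi R) (k%:R : R) (k.+1%:R : R) => p a b a0 b0 s1; field; rewrite a0 b0 s1.
Qed.

(** Here the exponentials cancel exactly, -3s/24 + s/8 = 0 and 3 pi^2/(6A) = pi^2/(2A), so the
    rescaled main term has the finite limit (k+1)/k. *)
Lemma kap3E (s : R) : 0 < s -> kap k s ^+ 3 * E0 k s / S0 k s = Qr s ^+ 3 * (k.+1%:R / k%:R).
Proof.
move=> s0; have kk : 0 < k%:R :> R by rewrite ltr0n.
have kk1 : 0 < k.+1%:R :> R by rewrite ltr0n.
have u0 : 0 < 2 * pi / s by rewrite divr_gt0// mulr_gt0// pi_gt0.
have uA : 0 < 2 * pi / tpr k s by rewrite divr_gt0 ?(tA0 k0 s0)// mulr_gt0// pi_gt0.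
rewrite (kapE s0) /E0 /S0 (_ : tlo k s = k%:R * s)// (_ : thi k s = k.+1%:R * s)//.
rewrite (sqrt_scale kk s0) (sqrt_scale kk1 s0).
have hG : kexp s ^+ 3 * expR (s / 8) = expR (- (pi ^+ 2 / (2 * tpr k s))).
  rewrite /kexp -expRM_natl -expRD; congr expR.
  by move: (tpr k s) (lt0r_neq0 (tA0 k0 s0)) (@pi R) => a a0 p; field; rewrite a0.
rewrite (kap3_alg (Qr s) (sqrt_neq0s u0) (sqrt_neq0s kk) (sqrt_neq0s kk1) (sqrt_neq0s uA)
  (lt0r_neq0 (expR_gt0 _)) hG).
by rewrite !sqr_sqrtr ?(ltW kk) ?(ltW kk1).
Qed.

End KapAsym.

(** * The Wright function *)

Section Wright.
Variable R : realType.
Local Notation C := R[i].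

Lemma limn_cvgc (u : nat -> C) (l : C) : cvgc \oo u l -> limn (u : nat -> C^o) = l.
Proof.
move=> h; apply: cvg_lim; first exact: norm_hausdorff.
apply/cvgrPdist_lt => -[a b]; rewrite ltcE /= => /andP[/eqP b0 a0].
apply: filterS (h a a0) => n hn; rewrite ncB in hn.
have -> : a +i* b = a%:C by rewrite b0.
by have -> : `|l - u n| = (nc (l - u n))%:C by []; rewrite ltcR.
Qed.

Lemma rGamma_real (x : R) : x <= 1 -> rGamma x%:C = (rgam x)%:C.
Proof.
move=> x1; apply: limn_cvgc; apply: near_cvgc (cvgc_real (rgam_agam x1)).
near=> n; have n0 : (0 < n)%N by near: n; exact: nbhs_infty_gt.
rewrite /agam rcM rcV rcM rc_nat rc_prod big_mkord -rcM cexp_real /powR.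
rewrite pnatr_eq0 gtn_eqF//; congr (_ / _).
by apply: eq_bigr => i _; rewrite rcD rc_nat.
Unshelve. all: by end_near.
Qed.

Variable k : nat.
Hypothesis k0 : (0 < k)%N.
Local Notation rh := (k%:R / k.+1%:R : R).
Local Notation w := (cexp (0 +i* (pi * k%:R / k.+1%:R : R))).

Definition Wre (x : R) : R := complex.Re (wright rh 1 (x%:C * w)).

(** As -e^{i pi k/(k+1)} = e^{-i pi/(k+1)}, the signs of [aj] turn the powers of the Wright argument
    into the cosines of [gj]. *)
Lemma sign_w : -1 * w = cexp (0 +i* (- (pi / k.+1%:R : R))).
Proof.
have -> : -1 = (-1)^-1 :> C by rewrite invrN1.
rewrite -cexp_pi -cexpN -cexpD; congr cexp; apply/eqP; rewrite eq_complex /=.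
rewrite oppr0 addr0 eqxx /=; apply/eqP; have := k1neq0 R k.
have -> : k.+1%:R = k%:R + 1 :> R by rewrite -natr1.
by move: (@pi R) (k%:R : R) => p a a0; field.
Qed.

Lemma Re_sign_w j : complex.Re ((-1) ^+ j * w ^+ j) = cos (pi * j%:R / k.+1%:R).
Proof.
rewrite -exprMn sign_w -cexpM_nat -rc_nat.
have -> : (j%:R)%:C * (0 +i* (- (pi / k.+1%:R))) = 0 +i* (- (pi * j%:R / k.+1%:R)) :> C.
  apply/eqP; rewrite eq_complex /= !mulr0 !mul0r subrr addr0 eqxx /=.
  by apply/eqP; ring.
by rewrite cexp_i /= cosN.
Qed.

Variable x : R.
Hypothesis x0 : 0 < x.

Lemma wright_term j : (x%:C * w) ^+ j / j`!%:R * rGamma (1 - (rh * j%:R)%:C) =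
  (aj k x j)%:C * ((-1) ^+ j * w ^+ j).
Proof.
have e1 : (1 : C) - (rh * j%:R)%:C = (1 - rh * j%:R)%:C by rewrite rcB.
have e2 : xprod x j = x ^+ j / j`!%:R.
  by rewrite fact_prod; exact: (prod_const_div x (fun i => i.+1%:R) j).
rewrite e1 rGamma_real ?rhj_le1// exprMn /aj e2 !rcM rcV rc_nat !rcX rcN (_ : 1%:C = 1 :> C)//.
have s2 : (-1) ^+ j * (-1) ^+ j = 1 :> C by rewrite -exprD addnn -mul2n exprM sqrrN !expr1n.
move: ((-1 : C) ^+ j) s2 (x%:C ^+ j) (w ^+ j) (j`!%:R^-1 : C) (rgam (1 - rh * j%:R))%:C.
move=> e s2 a b c d; rewrite -[LHS]mul1r -s2; ring.
Qed.

Lemma csum_gj : csum (gj k x) = (2 * Wre x)%:C.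
Proof.
pose f j := (aj k x j)%:C * ((-1) ^+ j * w ^+ j) : C.
have [|j|K hK] := @aj_abs R k k0 x x0 (fun j => (-1) ^+ j * w ^+ j) 1 => //.
  by rewrite ncM !ncX ncN nc1 nc_cexp /= expR0 !expr1n mulr1.
have hf := is_sum_nat (csumP hK).
have hW : wright rh 1 (x%:C * w) = csum f.
  apply: limn_cvgc; apply: near_cvgc hf; apply: nearW => n.
  by rewrite /series /= big_mkord; apply: eq_bigr => i _; rewrite wright_term.
have hg := is_sum_nat (gj_sum k0 x0).
have h2 : cvgc \oo (fun n => (2 * complex.Re (\sum_(i < n) f i))%:C) (2 * complex.Re (csum f))%:C.
  by apply: cvgc_real; apply: lim_Z; exact: cvgc_Re hf.
apply: (cvgc_uniq hg); rewrite /Wre hW; apply: near_cvgc h2; apply: nearW => n.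
rewrite Re_sum mulr_sumr rc_sum; apply: eq_bigr => i _.
by rewrite ReZ Re_sign_w /gj -rcM; congr (_%:C); ring.
Qed.

Local Notation ms := (msel k x).
Local Notation KK := (168 * k.+1%:R ^+ 2 * expR (5 / 2) : R).
Local Notation rc := ((rgam (1 / 2) / rgam (1 - rh / 2)) ^+ 2 : R).

Lemma est_alg (K E S B e M D : R) : 0 < K -> 0 < S -> 0 <= D -> 0 <= E ->
  D <= M * (K * E * B * e) -> (K / S * D) <= M * (K ^+ 3 * E / S) * (B / K * e).
Proof.
move=> hK hS hD hE h; apply: le_trans (ler_wpM2l (ltW (divr_gt0 hK hS)) h) _.
rewrite le_eqVlt; apply/orP; left; apply/eqP; field.
by rewrite !gt_eqF.
Qed.

Lemma sign_alg (e a b : C) : e * e = 1 -> e * a - b = e * (a - e * b).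
Proof. by move=> h; rewrite mulrBr mulrA h mul1r. Qed.

Lemma sq_mono (a b c : R) : 0 <= a -> a <= b * c -> a * a <= b * b * c ^+ 2.
Proof.
move=> a0 h; have -> : b * b * c ^+ 2 = (b * c) * (b * c) by ring.
exact: ler_pM.
Qed.

Lemma S0_gt0 (s : R) : 0 < s -> 0 < S0 k s.
Proof.
move=> s0; rewrite mulr_gt0 ?expR_gt0// sqrtr_gt0 divr_gt0 ?(tA0 k0 s0)//.
by rewrite mulr_gt0// pi_gt0.
Qed.

Lemma scaled_est (s : R) m : 0 < s -> tpr k s <= 1 ->
  nc ((kap k s / S0 k s)%:C * ((-1) ^+ m * Gm k s m) - (kap k s ^+ 3 * E0 k s / S0 k s)%:C) <=
  KK * (kap k s ^+ 3 * E0 k s / S0 k s) * (BX k s / kap k s * expR (m%:R * (tlo k s / 2))).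
Proof.
move=> s0 A1; have K0 := kap_gt0 k0 s0; have E00 := E0_gt0 k0 s0; have SS := S0_gt0 s0.
have -> : (kap k s ^+ 3 * E0 k s / S0 k s)%:C =
   (kap k s / S0 k s)%:C * (kap k s ^+ 2 * E0 k s)%:C :> C by rewrite -rcM; congr (_%:C); ring.
rewrite -mulrBr ncM nc_real (gtr0_norm (divr_gt0 K0 SS)).
have -> : (-1) ^+ m * Gm k s m - (kap k s ^+ 2 * E0 k s)%:C =
  (-1) ^+ m * (Gm k s m - (-1) ^+ m * (kap k s ^+ 2 * E0 k s)%:C).
  by apply: sign_alg; rewrite -exprD addnn -mul2n exprM sqrrN !expr1n.
rewrite ncM ncX ncN nc1 expr1n mul1r.
exact: est_alg K0 SS (nc_ge0 _) (ltW E00) (main_estimate k0 s0 A1 m).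
Qed.

(** Limit of [scaled_est] with m = [msel] at fixed x. The right side is a constant times 1/x with
    the constant independent of x, so x may afterwards tend to infinity. *)
Lemma Wre_bound :
  (2 * Wre x - k.+1%:R / k%:R) ^+ 2 <= (KK * (k.+1%:R / k%:R)) ^+ 2 * rc * x^-1.
Proof.
have c1 : Qr k s ^+ 3 * (k.+1%:R / k%:R) @[s --> (0 : R)^'+] --> (k.+1%:R / k%:R : R).
  pose proof (lim_M (lim_M (@Qr_lim R k k0) (lim_M (@Qr_lim R k k0) (@Qr_lim R k k0)))
    (cvg_cst (k.+1%:R / k%:R : R))) as h; rewrite !mul1r in h.
  apply: lim_near h; apply: nearW => s; rewrite !exprS expr0 mulr1; by [].
pose proof (@Gm_limit R k k0 x x0) as h1; rewrite csum_gj in h1.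
pose proof (cvgc_nc (cvgcB h1 (cvgc_real c1))) as h2.
rewrite -rcB nc_real in h2; pose proof (lim_M h2 h2) as h3.
have yl : (yy k s (ms s))^-1 @[s --> (0 : R)^'+] --> x^-1.
  exact: (lim_V (lt0r_neq0 x0) (@yy_msel R k k0 x x0)).
pose proof (@BX_lim R k k0 ms x^-1 yl) as h4.
pose proof (lim_M (lim_M (@lim_Z _ _ _ _ _ _ KK c1) (@lim_Z _ _ _ _ _ _ KK c1)) h4) as h5.
have -> : (2 * Wre x - k.+1%:R / k%:R) ^+ 2 =
  `|2 * Wre x - k.+1%:R / k%:R| * `|2 * Wre x - k.+1%:R / k%:R|.
  by rewrite -expr2 real_normK ?num_real.
have -> : (KK * (k.+1%:R / k%:R)) ^+ 2 * rc * x^-1 =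
  KK * (k.+1%:R / k%:R) * (KK * (k.+1%:R / k%:R)) * (rc * x^-1).
  by rewrite -!mulrA.
pose proof (lim_le h3 h5) as hl; apply: hl; near=> s.
have s0 : 0 < s by near: s; exact: near0_gt0.
have A1 : tpr k s <= 1 by near: s; exact: (@near_tpr1 R k).
have he := scaled_est (ms s) s0 A1; rewrite (kap3E k0 s0) in he.
exact: sq_mono (nc_ge0 _) he.
Unshelve. all: by end_near.
Qed.

End Wright.

(** * Assembling the asymptotic formula *)

Section Conclusion.
Variable R : realType.
Variable k : nat.
Hypothesis k0 : (0 < k)%N.

Lemma lim_sq0 (T : Type) (F : set_system T) {FF : ProperFilter F} (u v : T -> R) :
  v t @[t --> F] --> (0 : R) -> (\forall t \near F, u t ^+ 2 <= v t) -> u t @[t --> F] --> (0 : R).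
Proof.
move=> h hu; apply/cvgr0Pnorm_lt => e e0.
pose proof (cvgr_lt _ h _ (exprn_gt0 2 e0)) as h2.
near=> t; have a1 : u t ^+ 2 <= v t by near: t; exact: hu.
have a2 : v t < e ^+ 2 by near: t; exact: h2.
have a3 := le_lt_trans a1 a2; rewrite -real_normK ?num_real// in a3.
by rewrite -(@ltr_pXn2r _ 2)// nnegrE// ltW.
Unshelve. all: by end_near.
Qed.

(** [Wre_bound] is now used at x = [yy s 0], which tends to infinity as s -> 0 and is the modulus of
    the Wright argument in the theorem. *)
Lemma Wre_lim : 2 * Wre k (yy k s 0) @[s --> (0 : R)^'+] --> (k.+1%:R / k%:R : R).
Proof.
pose M : R := (168 * k.+1%:R ^+ 2 * expR (5 / 2) * (k.+1%:R / k%:R)) ^+ 2 *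
  (rgam (1 / 2) / rgam (1 - (k%:R / k.+1%:R) / 2)) ^+ 2.
have h : M * (yy k s 0)^-1 @[s --> (0 : R)^'+] --> (0 : R).
  by rewrite -[X in _ --> X](mulr0 M); apply: lim_Z; exact: (@yy0_lim R k k0).
have h2 : 2 * Wre k (yy k s 0) - k.+1%:R / k%:R @[s --> (0 : R)^'+] --> (0 : R).
  apply: (lim_sq0 h); near=> s; apply: Wre_bound => //.
  by apply: yy_gt0 => //; near: s; exact: near0_gt0.
pose proof (lim_D h2 (cvg_cst (k.+1%:R / k%:R : R))) as h3; rewrite add0r in h3.
by apply: lim_near h3; apply: nearW => s; rewrite subrK.
Unshelve. all: by end_near.
Qed.

Lemma Gm0_alg (a b c e m : R) : a != 0 -> m * (a * b * c * e) = m * (c / a * e) * (a ^+ 2 * b).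
Proof. by move=> a0; field. Qed.

Lemma Gm0_lim : complex.Re (Gm k s 0) / (kap k s ^+ 2 * E0 k s) @[s --> (0 : R)^'+] --> (1 : R).
Proof.
pose M : R := 168 * k.+1%:R ^+ 2 * expR (5 / 2).
pose proof (@BX_lim R k k0 (fun=> 0%N) 0 (@yy0_lim R k k0)) as h.
pose proof (@lim_Z _ _ _ _ _ _ (M ^+ 2) h) as h1; rewrite !mulr0 in h1.
have h2 : complex.Re (Gm k s 0) / (kap k s ^+ 2 * E0 k s) - 1 @[s --> (0 : R)^'+] --> (0 : R).
  apply: (lim_sq0 h1); near=> s.
  have s0 : 0 < s by near: s; exact: near0_gt0.
  have A1 : tpr k s <= 1 by near: s; exact: (@near_tpr1 R k).
  have K0 := kap_gt0 k0 s0; have E00 := E0_gt0 k0 s0.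
  have D0 : 0 < kap k s ^+ 2 * E0 k s by rewrite mulr_gt0 ?exprn_gt0.
  have he := main_estimate k0 s0 A1 0; rewrite expr0 mul1r -/M in he.
  have hr := le_trans (normRe _) he; rewrite ReB /= in hr.
  rewrite -exprMn -real_normK ?num_real//; apply: lerXn2r; rewrite ?nnegrE//.
    have hB := BX_gt0 k0 s0.
    apply: mulr_ge0; last exact: mulr_ge0 (divr_ge0 (ltW hB) (ltW K0)) (expR_ge0 _).
    exact: mulr_ge0 (mulr_ge0 (ler0n _ _) (exprn_ge0 _ (ler0n _ _))) (expR_ge0 _).
  have -> : complex.Re (Gm k s 0) / (kap k s ^+ 2 * E0 k s) - 1 =
    (complex.Re (Gm k s 0) - kap k s ^+ 2 * E0 k s) / (kap k s ^+ 2 * E0 k s).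
    by rewrite mulrBl divff// lt0r_neq0.
  rewrite normrM normfV (gtr0_norm D0) ler_pdivrMr//; apply: le_trans hr _.
  by rewrite (Gm0_alg _ _ _ _ (lt0r_neq0 K0)).
pose proof (lim_D h2 (cvg_cst (1 : R))) as h3; rewrite add0r in h3.
by apply: lim_near h3; apply: nearW => s; rewrite subrK.
Unshelve. all: by end_near.
Qed.

Lemma final_alg (V Q u a b X W : R) : u != 0 -> X != 0 -> a != 0 -> b != 0 ->
  V * (Q * (u / a * X)) / (2 / b * u * X * W) = V * Q * (b / a) / (2 * W).
Proof.
(* If W = 0 both sides are 0, division by zero being 0. *)
move=> h1 h2 h3 h4; have [->|w0] := eqVneq W 0; first by rewrite !mulr0 invr0 !mulr0.
by field; rewrite h1 h2 h3 h4 w0.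
Qed.

Lemma Gm0_asym : complex.Re (Gm k s 0) / (2 / k.+1%:R * Num.sqrt (2 * pi / s)
       * expR (- (pi ^+ 2 / (3 * k%:R * k.+1%:R * s)) + s / 24) * Wre k (yy k s 0))
  @[s --> (0 : R)^'+] --> (1 : R).
Proof.
have c0 : (k.+1%:R / k%:R : R) != 0.
  by rewrite mulf_neq0 ?invr_eq0 ?(kneq0 R k0) ?(k1neq0 R k).
pose proof (lim_M Gm0_lim (lim_M (@Qr_lim R k k0) (@Qr_lim R k k0))) as h1.
pose proof (lim_div c0 (lim_M h1 (cvg_cst (k.+1%:R / k%:R : R))) Wre_lim) as h2.
rewrite !mul1r divff// in h2; apply: lim_near h2; near=> s.
have s0 : 0 < s by near: s; exact: near0_gt0.
have K0 := kap_gt0 k0 s0; have E00 := E0_gt0 k0 s0.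
have D0 : kap k s ^+ 2 * E0 k s != 0 by rewrite lt0r_neq0// mulr_gt0 ?exprn_gt0.
have e1 : complex.Re (Gm k s 0) = complex.Re (Gm k s 0) / (kap k s ^+ 2 * E0 k s) *
   (Qr k s ^+ 2 * (Num.sqrt (2 * pi / s) / k%:R *
     expR (- (pi ^+ 2 / (3 * k%:R * k.+1%:R * s)) + s / 24))).
  by rewrite -(kap2E k0 s0) divfK.
have u0 : 0 < 2 * pi / s by rewrite divr_gt0// mulr_gt0// pi_gt0.
by rewrite [in RHS]e1 (final_alg _ _ _ (sqrt_neq0s u0) (lt0r_neq0 (expR_gt0 _)) (kneq0 R k0) (k1neq0 R k)).
Unshelve. all: by end_near.
Qed.

End Conclusion.

Theorem mainTheorem2 (R : realType)
    (d : R -> measure_display) (T : forall s : R, measurableType (d s))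
    (P : forall s : R, probability (T s) R)
    (C : forall s : R, nat -> set (T s))
    (C_indep : forall s : R, 0 < s < 1 ->
       independent_events (P s) [set n | (1 <= n)%N] (C s))
    (P_C : forall s : R, 0 < s < 1 -> forall n : nat, (1 <= n)%N ->
       P s (C s n) = (1 - expR (- (n%:R * s)))%:E)
    (g : nat -> R -> R)
    (g_def : forall (k : nat) (s : R), 0 < s < 1 ->
       g k (expR (- s)) = fine (P s (no_gap k (C s))))
    (k : nat) (k_ge2 : (2 <= k)%N) :
  asymp 0^'+
    (fun s : R => g k (expR (- s)))
    (fun s : R =>
       2 / k.+1%:R * Num.sqrt (2 * pi / s)
       * expR (- (pi ^+ 2 / (3 * k%:R * k.+1%:R * s)) + s / 24)
       * complex.Re (wright (k%:R / k.+1%:R) 1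
           (((k.+1%:R `^ (k%:R / k.+1%:R)) / k%:R)%:C
            * cexp (0 +i* (pi * k%:R / k.+1%:R))
            * (s `^ (- (k.+1%:R)^-1))%:C))).

Proof.
have k0 : (0 < k)%N by exact: ltn_trans k_ge2.
rewrite /asymp; apply: lim_near (@Gm0_asym R k k0); near=> s.
have s0 : 0 < s by near: s; exact: near0_gt0.
have s1 : s < 1 by near: s; exact: (near0_lt ltr01).
have hs : 0 < s < 1 by rewrite s0.
have -> : g k (expR (- s)) = complex.Re (Gm k s 0).
  rewrite (g_def k s hs) (Gm0_rV k0 s0) /=.
  apply: (no_gap_rV (q01 s0) k0 (C_indep s hs)) => n n1.
  by rewrite (P_C s hs n n1) -expRM_natl mulrN.
rewrite /Wre /yy /cst mulr0 oppr0 expR0 mulr1.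
(* The two arguments of [wright] differ only in the order of the real factors around the
   exponential. *)
set z1 := (X in wright _ _ X); set z2 := (X in _ = _ / (_ * complex.Re (wright _ _ X))).
suff -> : z1 = z2 by [].
by rewrite /z1 /z2 rcM mulrAC.
Unshelve. all: by end_near.
Qed.
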